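(* Let $\lambda_1,\lambda_2$ be the two small eigenvalues of the Bloch operator $B(\varepsilon,\omega,\sigma)$ described in the context, and let $\omega\in(-\frac14,\frac14)$. Setting $\sigma=:2\varepsilon\hat\sigma$ and $\lambda_j=:\varepsilon^2\hat\lambda_j$, one has, for $|\hat\sigma|\ll1$ (and $\varepsilon>0$ small), the expansions $$\hat\lambda_1(\hat\sigma)=-\frac43(1-16\omega^2)-\frac{32(1+16\omega^2)}{3(1-16\omega^2)}\hat\sigma^2+\mathcal{O}(|\hat\sigma|^3+\varepsilon(1+\hat\sigma)),$$ $$\hat\lambda_2(\hat\sigma)=-\frac{32(1-48\omega^2)}{3(1-16\omega^2)}\hat\sigma^2+\mathcal{O}(|\hat\sigma|^3+\varepsilon\hat\sigma^2),$$ agreeing to lowest order with the corresponding expansions of the eigenvalues $\hat\lambda^{GL}_1,\hat\lambda^{GL}_2$ of the linearized Ginzburg–Landau matrix $$\begin{pmatrix}-\frac43(1-16\omega^2)-\frac{32}{3}\hat\sigma^2&\frac{64}{3}i\omega\hat\sigma\\-\frac{64}{3}i\omega\hat\sigma&-\frac{32}{3}\hat\sigma^2\end{pmatrix},$$ namely $\hat\lambda_1^{GL}(\hat\sigma)=-\frac43(1-16\omega^2)-\frac{32(1+16\omega^2)}{3(1-16\omega^2)}\hat\sigma^2+\mathcal{O}(|\hat\sigma|^3)$ and $\hat\lambda^{GL}_2(\hat\sigma)=-\frac{32(1-48\omega^2)}{3(1-16\omega^2)}\hat\sigma^2+\mathcal{O}(|\hat\sigma|^3)$. Moreover, for every $C>0$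 and every $\omega$ in the interior $(-\frac14,\frac14)$ of $I_E$, the eigenvalues $\lambda_j$ are real for $|\hat\sigma|\le C$ and all sufficiently small $\varepsilon>0$.
   Context: Profile equation (from the Brusselator model $\partial_tu_1=4\partial_x^2u_1+2-(\beta+1)u_1+u_1^2u_2$, $\partial_tu_2=16\partial_x^2u_2+\beta u_1-u_1^2u_2$ after shifting the equilibrium $(2,\beta/2)$ to $0$, writing $\beta=4+b$, and setting $\xi=kx$): $0=k^2D\partial_\xi^2\tilde u+f(\tilde u)$ with $D=\mathrm{diag}(4,16)$ and $$f(\tilde u)=\begin{pmatrix}(b+3)\tilde u_1+4\tilde u_2+(\frac b2+2)\tilde u_1^2+4\tilde u_1\tilde u_2+\tilde u_1^2\tilde u_2\\-(b+4)\tilde u_1-4\tilde u_2-(\frac b2+2)\tilde u_1^2-4\tilde u_1\tilde u_2-\tilde u_1^2\tilde u_2\end{pmatrix}.$$ Set $b=\varepsilon^2$, $k=k(\varepsilon,\omega)=\frac{2\varepsilon\omega+\sqrt{4\varepsilon^2\omega^2+1}}{2}$. There is $\varepsilon_0>0$ such that for $\varepsilon\in[0,\varepsilon_0)$, $\omega\in I_E=[-\frac14,\frac14]$, $\tilde u_{\varepsilon,\omega}\in H^2_{per}([0,2\pi],\mathbb{R}^2)$ denotes the unique small $2\pi$-periodic solution of the profile equation that is even in $\xi$ with first component positive at $\xi=0$ (with $\tilde u_{\varepsilon,\omega}\equiv0$ if $\varepsilon=0$ or $\omega=\pm\frac14$); $\tilde u_{\varepsilon,\omega}=\sqrt{\frac23(1-16\omega^2)}\cos\xi\,(2,-1)^T\varepsilon+\mathcal{O}(\varepsilon^2)$.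 The Bloch operator is $B(\varepsilon,\omega,\sigma)V=k^2(\varepsilon,\omega)D(\partial_\xi+i\sigma)^2V+df(\tilde u_{\varepsilon,\omega})V$ from $H^2_{per}[0,2\pi]$ to $L^2_{per}[0,2\pi]$ ($\mathbb{C}^2$-valued), where, with $\tilde u=\tilde u_{\varepsilon,\omega}$, $$df(\tilde u)=\begin{pmatrix}\varepsilon^2+3&4\\-(\varepsilon^2+4)&-4\end{pmatrix}+\begin{pmatrix}p&q\\-p&-q\end{pmatrix},\quad p=(\varepsilon^2+4)\tilde u_1+4\tilde u_2+2\tilde u_1\tilde u_2,\quad q=4\tilde u_1+\tilde u_1^2.$$ For $\varepsilon,\sigma$ small, $\mathrm{Sp}(B(\varepsilon,\omega,\sigma))=S\cup\{\lambda_1,\lambda_2\}$ with $\Re\lambda<-\delta$ on $S$ for some fixed $\delta>0$, and $\lambda_1,\lambda_2$ (counted with multiplicity) tending to $0$ as $(\varepsilon,\sigma)\to(0,0)$. The associated Ginzburg–Landau equation is $\partial_{\hat t}A=\frac{32}{3}\partial_{\hat x}^2A+\frac23A-|A|^2A$; the displayed matrix is the Fourier symbol (frequency $\hat\sigma$) of its linearization about $A_\omega(\hat x)=\sqrt{\frac23(1-16\omega^2)}\,e^{i\omega\hat x}$ in the coordinates $A=A_\omega+e^{i\omega\hat x}(b_r-ib_i)$. *)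

(* Defs.v *)
From HB Require Import structures.
From mathcomp Require Import all_boot all_order all_algebra.
From mathcomp Require Import all_classical all_reals all_analysis.
From mathcomp Require Export complex.

Set Implicit Arguments.
Unset Strict Implicit.
Unset Printing Implicit Defensive.

Import Order.TTheory GRing.Theory Num.Theory.
Import numFieldNormedType.Exports.

Local Open Scope classical_set_scope.
Local Open Scope complex_scope.
Local Open Scope ring_scope.

Definition col2 (T : Type) (a b : T) : 'cV[T]_2 :=
  \col_i (if i == 0 then a else b).

Definition mx2 (T : Type) (a b c d : T) : 'M[T]_2 :=
  \matrix_(i, j) (if i == 0 then if j == 0 then a else b
                  else if j == 0 then c else d).

Section FunctionSpaces.
Context {R : realType}.
Local Notation mu := (@lebesgue_measure R).
Local Notation I := (`[0, pi *+ 2]%classic : set R).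

(* Functions are given on the whole line; for L^2 only their values on
   [0, 2 pi] matter, and equality in L^2 is equality almost everywhere there. *)

Definition L2_per (g : R -> R) : Prop := g \_ I \in Lfun mu 2%:E.

(* g is in H^2_per with first derivative g1 and second weak derivative g2:
   g is periodic and C^1, and g1 is a primitive of the L^2 function g2 (the
   periodicity of g1 follows from that of g). *)
Definition H2_derivs (g g1 g2 : R -> R) : Prop :=
  [/\ periodic g (pi *+ 2),
      forall x : R, is_derive x 1 g (g1 x),
      L2_per g2 &
      forall x, 0 <= x <= pi *+ 2 -> g1 x = g1 0 + \int[mu]_(t in `[0, x]) g2 t].

Definition C2fun := R -> 'cV[R[i]]_2.

Definition ReC (V : C2fun) (j : 'I_2) : R -> R := fun x => complex.Re (V x j 0).
Definition ImC (V : C2fun) (j : 'I_2) : R -> R := fun x => complex.Im (V x j 0).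

Definition toC2 (u : R -> 'cV[R]_2) : C2fun :=
  fun x => map_mx (real_complex R) (u x).

Definition L2_perC2 (V : C2fun) : Prop :=
  forall j, L2_per (ReC V j) /\ L2_per (ImC V j).

Definition H2_derivsC2 (V V1 V2 : C2fun) : Prop :=
  forall j, H2_derivs (ReC V j) (ReC V1 j) (ReC V2 j) /\
            H2_derivs (ImC V j) (ImC V1 j) (ImC V2 j).

Definition L2norm (V : C2fun) : R :=
  Num.sqrt (\int[mu]_(x in I) (\sum_j (ReC V j x ^+ 2 + ImC V j x ^+ 2))).

Definition H2norm_le (V : C2fun) (c : R) : Prop :=
  exists V1 V2, H2_derivsC2 V V1 V2 /\
    Num.sqrt (L2norm V ^+ 2 + L2norm V1 ^+ 2 + L2norm V2 ^+ 2) <= c.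

(* Unbounded operators on L^2_per([0, 2 pi], C^2) are given by their graphs:
   [A V F] reads "V is in the domain and A V = F in L^2".  In particular
   [A V (fun x => z *: V x + F x)] reads "(A - z) V = F". *)
Definition in_resolvent (A : C2fun -> C2fun -> Prop) (z : R[i]) : Prop :=
  (forall F, L2_perC2 F -> exists V, A V (fun x => z *: V x + F x)) /\
  exists c : R, forall V F, L2_perC2 F -> A V (fun x => z *: V x + F x) ->
    L2norm V <= c * L2norm F.

Definition in_spectrum (A : C2fun -> C2fun -> Prop) (z : R[i]) : Prop :=
  ~ in_resolvent A z.

Fixpoint in_ker_pow (A : C2fun -> C2fun -> Prop) (z : R[i]) (n : nat)
    (V : C2fun) : Prop :=
  if n is n'.+1 then
    exists W, in_ker_pow A z n' W /\ A V (fun x => z *: V x + W x)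
  else forall x, V x = 0.

Definition gen_eigenvector (A : C2fun -> C2fun -> Prop) (z : R[i])
    (V : C2fun) : Prop := exists n, in_ker_pow A z n V.

(* The generalized eigenspace of A at z has dimension m: unique coordinates
   express that v is both spanning and linearly independent. *)
Definition alg_mult (A : C2fun -> C2fun -> Prop) (z : R[i]) (m : nat) : Prop :=
  exists v : 'I_m -> C2fun,
    (forall i, gen_eigenvector A z (v i)) /\
    forall V, gen_eigenvector A z V ->
      exists! c : 'rV[R[i]]_m, forall x, V x = \sum_i c 0 i *: v i x.

(* Sp(A) = S u {l1, l2}, where Re < - d on S and l1, l2 are counted with
   algebraic multiplicity. *)
Definition spectral_pair (A : C2fun -> C2fun -> Prop) (d : R) (l1 l2 : R[i])
    : Prop :=
  (forall z, in_spectrum A z -> [\/ z = l1, z = l2 | complex.Re z < - d]) /\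
  (forall z, z \in [:: l1; l2] -> alg_mult A z (count_mem z [:: l1; l2])).

End FunctionSpaces.

Section Brusselator.
Context {R : realType}.
Implicit Types (b e w s : R).
Local Notation mu := (@lebesgue_measure R).
Local Notation I := (`[0, pi *+ 2]%classic : set R).

Definition Dmx : 'M[R]_2 := mx2 4 0 0 16.

Definition reaction b (u : 'cV[R]_2) : 'cV[R]_2 :=
  let u1 := u 0 0 in let u2 := u 1 0 in
  col2 ((b + 3) * u1 + 4 * u2 + (b / 2 + 2) * u1 ^+ 2 + 4 * u1 * u2
        + u1 ^+ 2 * u2)
       (- (b + 4) * u1 - 4 * u2 - (b / 2 + 2) * u1 ^+ 2 - 4 * u1 * u2
        - u1 ^+ 2 * u2).

Definition dreaction e (u : 'cV[R]_2) : 'M[R]_2 :=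
  let u1 := u 0 0 in let u2 := u 1 0 in
  let p := (e ^+ 2 + 4) * u1 + 4 * u2 + 2 * u1 * u2 in
  let q := 4 * u1 + u1 ^+ 2 in
  mx2 (e ^+ 2 + 3) 4 (- (e ^+ 2 + 4)) (- 4) + mx2 p q (- p) (- q).

Definition wavenumber e w : R :=
  (2 * e * w + Num.sqrt (4 * e ^+ 2 * w ^+ 2 + 1)) / 2.

Definition profile_solution e w (u : R -> 'cV[R]_2) : Prop :=
  exists u1 u2 : R -> 'cV[R]_2,
    H2_derivsC2 (toC2 u) (toC2 u1) (toC2 u2) /\
    {ae mu, forall x, I x ->
       wavenumber e w ^+ 2 *: (Dmx *m u2 x) + reaction (e ^+ 2) (u x) = 0}.

Definition even_positive (u : R -> 'cV[R]_2) : Prop :=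
  (forall x, u (- x) = u x) /\ 0 < u 0 0 0.

Definition leading_profile e w : R -> 'cV[R]_2 :=
  fun x => (e * Num.sqrt (2 / 3 * (1 - 16 * w ^+ 2)) * cos x) *: col2 2 (- 1).

(* ut e w is the small profile for e in [0, e0) and w in [-1/4, 1/4].  The
   constants eta and C, like e0, do not depend on e and w. *)
Record profile_family (e0 : R) (ut : R -> R -> R -> 'cV[R]_2) : Prop := {
  profile_e0 : 0 < e0;
  profile_solves : forall e w, 0 <= e < e0 -> `|w| <= 4^-1 ->
    profile_solution e w (ut e w);
  profile_even_positive : forall e w, 0 < e < e0 -> `|w| < 4^-1 ->
    even_positive (ut e w);
  profile_trivial : forall e w, 0 <= e < e0 -> `|w| <= 4^-1 ->
    e = 0 \/ `|w| = 4^-1 -> forall x, ut e w x = 0;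
  profile_unique : exists2 eta : R, 0 < eta &
    forall e w, 0 < e < e0 -> `|w| < 4^-1 ->
      H2norm_le (toC2 (ut e w)) eta /\
      forall v, profile_solution e w v -> even_positive v ->
        H2norm_le (toC2 v) eta -> forall x, v x = ut e w x;
  profile_expansion : exists C : R,
    forall e w, 0 <= e < e0 -> `|w| <= 4^-1 ->
      H2norm_le (toC2 (fun x => ut e w x - leading_profile e w x)) (C * e ^+ 2)
}.

Definition bloch e w s (u : R -> 'cV[R]_2) (V F : @C2fun R) : Prop :=
  exists V1 V2, H2_derivsC2 V V1 V2 /\
    {ae mu, forall x, I x ->
       F x = (wavenumber e w ^+ 2)%:C *:
               (map_mx (real_complex R) Dmx *m
                  (V2 x + (2 * (s *i)) *: V1 x + (s *i) ^+ 2 *: V x))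
             + map_mx (real_complex R) (dreaction e (u x)) *m V x}.

(* The description of the two small eigenvalues for a fixed w, as functions of
   (e, s); which of the two comes first may vary with (e, s). *)
Definition small_eigenvalues (e0 : R) (ut : R -> R -> R -> 'cV[R]_2) (w d : R)
    (lam1 lam2 : R -> R -> R[i]) : Prop :=
  (exists2 r : R, 0 < r & forall e s, 0 <= e < e0 -> e < r -> `|s| < r ->
     spectral_pair (bloch e w s (ut e w)) d (lam1 e s) (lam2 e s)) /\
  (forall eta : R, 0 < eta ->
     exists2 r : R, 0 < r & forall e s, 0 <= e < e0 -> e < r -> `|s| < r ->
       `|lam1 e s| < eta%:C /\ `|lam2 e s| < eta%:C).

Definition GLmx w s : 'M[R[i]]_2 :=
  mx2 (- (4 / 3) * (1 - 16 * w ^+ 2) - 32 / 3 * s ^+ 2)%:C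
      ((64 / 3 * w * s) *i)
      (- ((64 / 3 * w * s) *i))
      (- (32 / 3) * s ^+ 2)%:C.

Definition expansion1 w s : R :=
  - (4 / 3) * (1 - 16 * w ^+ 2)
  - 32 * (1 + 16 * w ^+ 2) / (3 * (1 - 16 * w ^+ 2)) * s ^+ 2.

Definition expansion2 w s : R :=
  - (32 * (1 - 48 * w ^+ 2) / (3 * (1 - 16 * w ^+ 2))) * s ^+ 2.

End Brusselator.

(* Main.v *)
Require Import Defs.
From HB Require Import structures.
From mathcomp Require Import all_boot all_order all_algebra.
From mathcomp Require Import all_classical all_reals all_analysis.
From mathcomp Require Import measurable_realfun.
From mathcomp Require Import ring lra.

(** At a small periodic profile [u] of amplitude [e] the Bloch operator is a
    perturbation of the critical operator [(v1'' + 3 v1 + 4 v2, 4 v2'' - 4 v1 - 4 v2)],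
    whose kernel consists of the multiples of [(2, -1)] by the cosine and the
    sine.  Two small eigenvalues emerge from this kernel, and the proof is a
    Lyapunov-Schmidt reduction by hand.

    Weak solutions of the profile and eigenvalue equations are smooth
    ([ode_smooth]), so everything takes place in the algebra of smooth periodic
    functions.  The critical operator is invertible off its kernel
    ([hyperbolic_bound]), which bounds an eigenvector by its two critical
    coordinates ([hypnorm_estimate]).  The quadratic part of the reaction vanishes
    on the kernel, since its terms contain the slaved combination [v1 + 2 v2]
    ([excessE]); therefore the solvability conditions for these coordinates
    ([bloch_cos], [bloch_sin]) are, at order [e ^+ 2] and up to errors of order
    [e ^+ 3], the linearized Ginzburg-Landau equation.

    For the two eigenvalues together this determines the trace and the determinant
    of a two by two matrix ([pair_trace], [pair_det]).  The Ginzburg-Landau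
    eigenvalues [gl1] and [gl2] are apart for [w] in the open interval, so
    each eigenvalue of the Bloch operator is [e ^+ 2] times one of them up to
    [e ^+ 3] ([pair_near_gl]).  Since the profile is real and even, conjugation
    followed by reflection preserves the spectrum; two eigenvalues close to
    distinct real numbers are then real ([small_real]).

    The error [e * s ^+ 2] in the second expansion is finer, because it vanishes
    with [s].  The eigenvector is split into an even and an odd part, which only
    interact through the Floquet terms, with a factor [s] each.  Subtracting from
    the odd part a multiple of the derivative of the profile, a null vector of the
    linearization by translation invariance, leaves an odd function without
    critical part.  The solvability conditions for the two parts ([sharp_even],
    [sharp_odd]) then have errors that are proportional to [s ^+ 2] or to the
    eigenvalue itself, and eliminating the even part yields
    [sharp_expansion]. *)

Set Implicit Arguments.
Unset Strict Implicit.
Unset Printing Implicit Defensive.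

Import Order.TTheory GRing.Theory Num.Theory.
Import numFieldNormedType.Exports.

Local Open Scope complex_scope.
Local Open Scope ring_scope.

(** * Smooth periodic functions *)

Section SmoothPeriodic.
Context {R : realType}.
Local Notation C := R[i].
Implicit Types f g h : R -> C.

Definition cderiv f g := forall x : R,
  is_derive x 1 (@complex.Re R \o f) (complex.Re (g x)) /\
  is_derive x 1 (@complex.Im R \o f) (complex.Im (g x)).

Definition ccontinuous f :=
  continuous (@complex.Re R \o f) /\ continuous (@complex.Im R \o f).

Lemma ccontinuousD f g : ccontinuous f -> ccontinuous g -> ccontinuous (f \+ g).
Proof.
move=> [f1 f2] [g1 g2]; split=> x.
  have -> : @complex.Re R \o (f \+ g) = (@complex.Re R \o f) \+ (@complex.Re R \o g).
    by apply: funext => t /=; case: (f t) (g t) => ? ? [].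
  by apply: (@cvgD _ _ _ _ _ (complex.Re (R:=R) \o f)); [exact: f1 | exact: g1].
have -> : @complex.Im R \o (f \+ g) = (@complex.Im R \o f) \+ (@complex.Im R \o g).
  by apply: funext => t /=; case: (f t) (g t) => ? ? [].
by apply: (@cvgD _ _ _ _ _ (complex.Im (R:=R) \o f)); [exact: f2 | exact: g2].
Qed.

Lemma ccontinuousM f g : ccontinuous f -> ccontinuous g -> ccontinuous (f \* g).
Proof.
move=> [f1 f2] [g1 g2]; split=> x.
  have -> : @complex.Re R \o (f \* g) =
      ((@complex.Re R \o f) \* (@complex.Re R \o g)) \-
      ((@complex.Im R \o f) \* (@complex.Im R \o g)).
    by apply: funext => t /=; case: (f t) (g t) => ? ? [].
  by apply: (@cvgB _ _ _ _ _ ((@complex.Re R \o f) \* (@complex.Re R \o g)));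
    apply: cvgM; [exact: f1 | exact: g1 | exact: f2 | exact: g2].
have -> : @complex.Im R \o (f \* g) =
    ((@complex.Re R \o f) \* (@complex.Im R \o g)) \+
    ((@complex.Im R \o f) \* (@complex.Re R \o g)).
  by apply: funext => t /=; case: (f t) (g t) => ? ? [] ? ? /=.
by apply: (@cvgD _ _ _ _ _ ((@complex.Re R \o f) \* (@complex.Im R \o g)));
  apply: cvgM; [exact: f1 | exact: g2 | exact: f2 | exact: g1].
Qed.

Lemma cderiv_cst (c : C) : cderiv (fun=> c) (fun=> 0).
Proof. by move=> x; split; exact: is_derive_cst. Qed.

Lemma cderivD f g f' g' :
  cderiv f f' -> cderiv g g' -> cderiv (f \+ g) (f' \+ g').
Proof.
move=> Hf Hg x; have [f1 f2] := Hf x; have [g1 g2] := Hg x; split.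
  have -> : @complex.Re R \o (f \+ g) = (@complex.Re R \o f) + (@complex.Re R \o g).
    by apply: funext => t /=; rewrite fctE /=; case: (f t) (g t) => ? ? [].
  by apply: is_derive_eq => /=; case: (f' x) (g' x) => ? ? [].
have -> : @complex.Im R \o (f \+ g) = (@complex.Im R \o f) + (@complex.Im R \o g).
  by apply: funext => t /=; rewrite fctE /=; case: (f t) (g t) => ? ? [].
by apply: is_derive_eq => /=; case: (f' x) (g' x) => ? ? [].
Qed.

Lemma cderivM f g f' g' :
  cderiv f f' -> cderiv g g' -> cderiv (f \* g) ((f' \* g) \+ (f \* g')).
Proof.
move=> Hf Hg x; have [f1 f2] := Hf x; have [g1 g2] := Hg x; split.
  have -> : @complex.Re R \o (f \* g) =
      ((@complex.Re R \o f) * (@complex.Re R \o g)) -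
      ((@complex.Im R \o f) * (@complex.Im R \o g)).
    by apply: funext => t /=; rewrite !fctE /=; case: (f t) (g t) => ? ? [].
  apply: (is_derive_eq (is_deriveB (is_deriveM f1 g1) (is_deriveM f2 g2))).
  rewrite /GRing.scale /=.
  case: (f x) (g x) (f' x) (g' x) => ? ? [] ? ? [] ? ? [] ? ? /=; ring.
have -> : @complex.Im R \o (f \* g) =
    ((@complex.Re R \o f) * (@complex.Im R \o g)) +
    ((@complex.Im R \o f) * (@complex.Re R \o g)).
  by apply: funext => t /=; rewrite !fctE /=; case: (f t) (g t) => ? ? [].
apply: (is_derive_eq (is_deriveD (is_deriveM f1 g2) (is_deriveM f2 g1))).
rewrite /GRing.scale /=.
case: (f x) (g x) (f' x) (g' x) => ? ? [] ? ? [] ? ? [] ? ? /=; ring.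
Qed.

Lemma cderiv_uniq f g h : cderiv f g -> cderiv f h -> g = h.
Proof.
move=> fg fh; apply: funext => x; have [a b] := fg x; have [c e] := fh x.
have := @derive_val _ _ _ _ _ _ _ a; rewrite (@derive_val _ _ _ _ _ _ _ c).
have := @derive_val _ _ _ _ _ _ _ b; rewrite (@derive_val _ _ _ _ _ _ _ e).
by case: (g x) (h x) => ? ? [] ? ? /= -> ->.
Qed.

Lemma cderiv_continuous f g : cderiv f g -> ccontinuous f.
Proof.
by move=> fg; split=> x; have [a b] := fg x;
  apply/differentiable_continuous/derivable1_diffP.
Qed.

Fixpoint Ck (n : nat) f : Prop :=
  if n is n'.+1 then exists2 g, cderiv f g & Ck n' g else ccontinuous f.

Lemma CkS n f : Ck n.+1 f -> Ck n f.
Proof.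
elim: n f => [f [g fg _]|n IH f [g fg Hg]]; first exact: cderiv_continuous fg.
by exists g => //; exact: IH.
Qed.

Lemma Ck_cst n (c : C) : Ck n (fun=> c).
Proof.
elim: n c => [c|n IH c]; last by exists (fun=> 0); [exact: cderiv_cst|].
by split=> x; exact: cst_continuous.
Qed.

Lemma CkD n f g : Ck n f -> Ck n g -> Ck n (f \+ g).
Proof.
elim: n f g => [|n IH] f g; first exact: ccontinuousD.
by move=> [f' Df Hf] [g' Dg Hg]; exists (f' \+ g');
  [exact: cderivD | exact: IH].
Qed.

Lemma CkM n f g : Ck n f -> Ck n g -> Ck n (f \* g).
Proof.
elim: n f g => [|n IH] f g; first exact: ccontinuousM.
move=> Hf Hg; have Hf' := CkS Hf; have Hg' := CkS Hg.
case: Hf Hg => [f' Df Hf] [g' Dg Hg].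
by exists ((f' \* g) \+ (f \* g')); [exact: cderivM | apply: CkD; exact: IH].
Qed.

Definition smooth_periodic : {pred R -> C} :=
  fun f => `[< periodic f (pi *+ 2) /\ forall n, Ck n f >].

Lemma smooth_periodic_subring : subring_closed smooth_periodic.
Proof.
have sM f g : f \in smooth_periodic -> g \in smooth_periodic ->
    f * g \in smooth_periodic.
  move=> /asboolP[pf sf] /asboolP[pg sg]; apply/asboolP; split=> [x|n].
    by rewrite /GRing.mul/= pf pg.
  exact: CkM.
have s1 (c : C) : (fun=> c) \in smooth_periodic.
  by apply/asboolP; split=> // n; exact: Ck_cst.
split=> [|f g sf|]; [exact: s1 | | exact: sM].
move=> /(sM _ _ (s1 (-1)))/asboolP[pg sg].
move: sf => /asboolP[pf sf]; apply/asboolP.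
have -> : f - g = f \+ (fun=> -1) * g.
  by apply: funext => x; rewrite /GRing.mul/= mulN1r.
by split=> [x|n]; [rewrite /= pf pg | exact: CkD].
Qed.
HB.instance Definition _ := GRing.isSubringClosed.Build (R -> C) smooth_periodic
  smooth_periodic_subring.

End SmoothPeriodic.

(** A bundled algebra, so that identities between smooth periodic functions are
    identities of a commutative ring. *)
Record sfun {R : realType} := SFun {
  sval_ :> R -> R[i]; sfunP : sval_ \in @smooth_periodic R }.
Arguments sfun : clear implicits.
HB.instance Definition _ (R : realType) := [isSub for @sval_ R].
HB.instance Definition _ (R : realType) := gen_eqMixin (sfun R).
HB.instance Definition _ (R : realType) := gen_choiceMixin (sfun R).
HB.instance Definition _ (R : realType) := [SubChoice_isSubComNzRing of sfun R by <:].

(** * Real periodic functions *)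

Section RealPeriodic.
Context {R : realType}.
Local Notation mu := (@lebesgue_measure R).
Local Notation tpi := (pi *+ 2 : R).
Implicit Types (f g G : R -> R).

Lemma tpi_gt0 : 0 < tpi.
Proof. by rewrite pmulrn_lgt0 // pi_gt0. Qed.

Lemma is_derive_continuous f g : (forall x : R, is_derive x 1 f (g x)) -> continuous f.
Proof. by move=> fg x; apply/differentiable_continuous/derivable1_diffP. Qed.

Lemma is_derive_compD (f : R -> R) (x k c : R) :
  is_derive (x + k) 1 f c -> is_derive x 1 (f \o shift k) c.
Proof.
move=> h; rewrite -[c]mulr1.
by apply: is_derive1_comp; exact: (is_derive_shift x 1 k).
Qed.

Lemma continuous_integrable_itv g (a b : R) : continuous g ->
  mu.-integrable `[a, b] (EFin \o g).
Proof.
move=> cg; apply: continuous_compact_integrable; first exact: segment_compact.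
exact: continuous_subspaceT.
Qed.

Lemma is_derive_integral g (a x : R) : continuous g -> a < x ->
  is_derive x 1 (fun y => \int[mu]_(t in `[a, y]) g t) (g x).
Proof.
move=> cg ax.
have x1 : x < x + 1 by rewrite ltrDl.
have [d e] := continuous_FTC1_closed x1 (continuous_integrable_itv a (x + 1) cg)
  ax (cg x).
by apply: DeriveDef; [exact: d | rewrite -derive1E; exact: e].
Qed.

Lemma integral_FTC2 g G (a b : R) : a <= b -> continuous g ->
  (forall x : R, a <= x <= b -> is_derive x 1 G (g x)) ->
  \int[mu]_(t in `[a, b]) g t = G b - G a.
Proof.
rewrite le_eqVlt => /orP[/eqP <- _ _|ab cg dG].
  by rewrite subrr set_itv1 Rintegral_set1.
have cG x : a <= x <= b -> {for x, continuous G}.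
  by move=> /dG h; apply/differentiable_continuous/derivable1_diffP.
rewrite /Rintegral (continuous_FTC2 (F := G)) //.
- exact: continuous_subspaceT.
- split.
  + by move=> x; rewrite in_itv/= => /andP[p q]; have /dG[] : a <= x <= b by rewrite !ltW.
  + by apply: cvg_at_right_filter; apply: cG; rewrite lexx ltW.
  + by apply: cvg_at_left_filter; apply: cG; rewrite lexx ltW.
- move=> x; rewrite in_itv/= => /andP[p q]; rewrite derive1E.
  have /dG h : a <= x <= b by rewrite !ltW.
  by rewrite derive_val.
Qed.

Lemma is_derive_MVT f g (a b : R) : a <= b ->
  (forall x : R, a <= x <= b -> is_derive x 1 f (g x)) ->
  exists2 c, a <= c <= b & f b - f a = g c * (b - a).
Proof.
move=> ab fg; have [||c] := @MVT_segment _ f g a b ab.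
- by move=> x; rewrite in_itv/= => /andP[p q]; apply: fg; rewrite !ltW.
- apply: derivable_within_continuous => x; rewrite in_itv/= => xab.
  by have [] := fg x xab.
- by rewrite in_itv/= => cab e; exists c.
Qed.

Lemma periodic_reduce (T : zmodType) (x : R) :
  exists2 t, 0 <= t <= tpi &
  forall f : R -> T, periodic f tpi -> f x = f t.
Proof.
have p0 := tpi_gt0; pose m := Num.floor (x / tpi).
exists (x - tpi *~ m).
  have /andP[l u] := floor_itv (x / tpi); rewrite -/m in l u.
  move: l u; rewrite ler_pdivlMr// ltr_pdivrMr// intrD mulrDl mul1r !mulrzl.
  by move=> l u; rewrite subr_ge0 l /= lerBlDl ltW.
move=> f pf; case: m => n.
  by rewrite -{1}(subrK (tpi *+ n) x) periodicn.
by rewrite NegzE mulrNz opprK (periodicn pf).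
Qed.

Lemma periodic_is_derive f g : periodic f tpi ->
  (forall x : R, is_derive x 1 f (g x)) -> periodic g tpi.
Proof.
move=> pf fg x.
have := @derive_val _ _ _ _ _ _ _ (fg x) ; have e : f = f \o shift tpi.
  by apply: funext => y /=; rewrite pf.
by rewrite [in 'D_1 f x]e (@derive_val _ _ _ _ _ _ _ (is_derive_compD (fg _))).
Qed.

Definition mean g : R := (\int[mu]_(t in `[0, tpi]) g t) / tpi.

Lemma mean_FTC2 g G : continuous g ->
  (forall x : R, 0 <= x <= tpi -> is_derive x 1 G (g x)) ->
  mean g = (G tpi - G 0) / tpi.
Proof. by move=> cg dG; rewrite /mean (integral_FTC2 _ cg dG) // ltW // tpi_gt0. Qed.

Lemma primitive_ex (a : R) g : continuous g ->
  exists G : R -> R, forall x : R, a < x -> is_derive x 1 G (g x).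
Proof. move=> cg; exists (fun y => \int[mu]_(t in `[a, y]) g t) => x.
exact: is_derive_integral. Qed.

Lemma primitive0_ex g : continuous g ->
  exists G : R -> R, forall x : R, 0 <= x <= tpi -> is_derive x 1 G (g x).
Proof.
move=> /(primitive_ex (-1))[G dG]; exists G => x /andP[x0 _]; apply: dG.
exact: lt_le_trans x0.
Qed.

Lemma mean_MVT g : continuous g -> exists2 t, 0 <= t <= tpi & mean g = g t.
Proof.
move=> cg; have [G dG] := primitive0_ex cg.
have [c ct e] := is_derive_MVT (ltW tpi_gt0) dG.
exists c => //; rewrite (mean_FTC2 cg dG) e subr0 mulfK //.
by rewrite gt_eqF // tpi_gt0.
Qed.

Lemma meanD f g : continuous f -> continuous g ->
  mean (f \+ g) = mean f + mean g.
Proof.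
move=> cf cg; have [F dF] := primitive0_ex cf; have [G dG] := primitive0_ex cg.
have cfg : continuous (f \+ g).
  by move=> x; apply: cvgD; [exact: cf | exact: cg].
have dFG x : 0 <= x <= tpi -> is_derive x 1 (F + G) ((f \+ g) x).
  by move=> x0; exact: is_deriveD (dF x x0) (dG x x0).
rewrite (mean_FTC2 cf dF) (mean_FTC2 cg dG) (mean_FTC2 cfg dFG) !fctE; ring.
Qed.

Lemma meanZ (c : R) g : continuous g -> mean (fun x => c * g x) = c * mean g.
Proof.
move=> cg; have [G dG] := primitive0_ex cg.
have ccg : continuous (fun x => c * g x).
  by move=> x; apply: cvgMr; exact: cg.
have dcG x : 0 <= x <= tpi -> is_derive x 1 (c *: G) (c * g x).
  by move=> x0; exact: is_deriveZ (dG x x0).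
rewrite (mean_FTC2 cg dG) (mean_FTC2 ccg dcG) !fctE /GRing.scale /=; ring.
Qed.

Lemma mean_derive f g : periodic f tpi -> continuous g ->
  (forall x : R, is_derive x 1 f (g x)) -> mean g = 0.
Proof.
move=> pf cg fg; rewrite (mean_FTC2 cg (fun x _ => fg x)).
by rewrite -{1}[tpi]add0r pf subrr mul0r.
Qed.

Lemma continuous_reflect g : continuous g -> continuous (fun x => g (- x)).
Proof.
by move=> cg x; apply: continuous_comp; [exact: opp_continuous | exact: cg].
Qed.

Lemma mean_reflect g : periodic g tpi -> continuous g ->
  mean (fun x => g (- x)) = mean g.
Proof.
move=> pg cg; have [G dG] := primitive_ex (- (tpi + 1)) cg.
have p0 := tpi_gt0.
have dG' x : - tpi <= x -> is_derive x 1 G (g x).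
  by move=> h; apply: dG; apply: lt_le_trans h; rewrite ltrN2 ltrDl.
have dG0 x : 0 <= x <= tpi -> is_derive x 1 G (g x).
  by move=> /andP[x0 _]; apply: dG'; apply: le_trans x0; rewrite oppr_le0 ltW.
have cgN := continuous_reflect cg.
have dGN x : 0 <= x <= tpi -> is_derive x 1 (- (G \o -%R)) (g (- x)).
  move=> /andP[x0 x1]; have h : is_derive (- x) 1 G (g (- x)).
    by apply: dG'; rewrite lerN2.
  have h2 : is_derive x 1 (G \o -%R) (g (- x) * (-1)).
    exact: (is_derive1_comp h (is_deriveNid x 1)).
  by have := is_deriveN h2; rewrite mulrN1 opprK.
rewrite (mean_FTC2 cg dG0) (mean_FTC2 cgN dGN) !fctE /= oppr0 opprK; congr (_ / _).
have dd x : - tpi <= x <= 0 ->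
    is_derive x 1 ((G \o shift tpi) - G) ((fun=> 0) x).
  move=> /andP[l u]; have h : is_derive (x + tpi) 1 G (g (x + tpi)).
    apply: dG'; apply: le_trans (_ : 0 <= _); first by rewrite oppr_le0 ltW.
    by rewrite -lerBlDr sub0r.
  by have := is_deriveB (is_derive_compD h) (dG' _ l); rewrite pg subrr.
have le0 : - tpi <= 0 by rewrite oppr_le0 ltW.
have [c _] := is_derive_MVT le0 dd.
rewrite !fctE /= mul0r add0r addNr => /eqP; rewrite subr_eq0 => /eqP ->.
by rewrite addrC.
Qed.

(** A function of mean zero vanishes somewhere, and the bound on its derivative
    controls its oscillation over a period. *)
Lemma periodic_poincare f g (K : R) : periodic f tpi -> (forall x : R, is_derive x 1 f (g x)) ->
  (forall x : R, `|g x| <= K) -> mean f = 0 -> forall x : R, `|f x| <= tpi * K.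
Proof.
move=> pf fg gK f0 x; have cf := is_derive_continuous fg.
have [t /andP[t0 t1] e] := periodic_reduce R x; rewrite (e f pf).
have [r /andP[r0 r1]] := mean_MVT cf; rewrite f0 => fr.
have main (a b : R) : 0 <= a -> b <= tpi -> a <= b -> `|f b - f a| <= tpi * K.
  move=> a0 b1 ab; have [c _ ->] := is_derive_MVT ab (fun x _ => fg x).
  rewrite [tpi * K]mulrC normrM ler_pM //.
  by rewrite ger0_norm ?subr_ge0 // lerBlDr (le_trans b1) // lerDl.
have [tr|/ltW tr] := leP t r; last by have := main r t r0 t1 tr; rewrite -fr subr0.
by have := main t r t0 r1 tr; rewrite -fr sub0r normrN.
Qed.

Lemma periodic_bounded f : periodic f tpi -> continuous f ->
  exists K : R, forall x : R, `|f x| <= K.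
Proof.
move=> pf cf.
have [|||c _ H] := @compact_EVT_max _ R (fun x => `|f x|) `[0, tpi]%classic.
- by exists 0; rewrite /= in_itv/= lexx ltW // tpi_gt0.
- exact: segment_compact.
- apply: continuous_subspaceT => x; apply: continuous_comp; first exact: cf.
  exact: norm_continuous.
exists `|f c| => x; have [t t01 e] := periodic_reduce R x; rewrite (e f pf).
by apply: H; rewrite inE /= in_itv.
Qed.

End RealPeriodic.

(** * The calculus of smooth periodic functions *)

HB.lock Definition cabs (R : realType) (z : R[i]) : R := complex.Re `|z|.
Canonical cabs_unlockable := Unlockable cabs.unlock.

Section ComplexModulus.
Context {R : realType}.
Implicit Types z : R[i].

Lemma cabsE z : `|z| = (cabs z)%:C.
Proof. by rewrite unlock normc_def. Qed.

Lemma cabs_ge0 z : 0 <= cabs z.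
Proof. by rewrite -lecR -cabsE normr_ge0. Qed.

Lemma cabsD z1 z2 : cabs (z1 + z2) <= cabs z1 + cabs z2.
Proof. by rewrite -lecR rmorphD /= -!cabsE ler_normD. Qed.

Lemma cabsM z1 z2 : cabs (z1 * z2) = cabs z1 * cabs z2.
Proof. by apply: complexI; rewrite rmorphM /= -!cabsE normrM. Qed.

Lemma cabsN z : cabs (- z) = cabs z.
Proof. by rewrite unlock normrN. Qed.

Lemma cabsB z1 z2 : cabs (z1 - z2) <= cabs z1 + cabs z2.
Proof. by rewrite -[cabs z2]cabsN cabsD. Qed.

Lemma cabs0 : cabs (0 : R[i]) = 0.
Proof. by apply: complexI; rewrite -cabsE normr0. Qed.

Lemma cabs_eq0 z : cabs z = 0 -> z = 0.
Proof. by move=> h; apply/eqP; rewrite -normr_eq0 cabsE h. Qed.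

Lemma cabsr (x : R) : cabs x%:C = `|x|.
Proof. by rewrite unlock normc_def /= expr0n addr0 sqrtr_sqr. Qed.

Lemma cabs_Re z : `|complex.Re z| <= cabs z.
Proof. by rewrite -lecR -cabsE normc_ge_Re. Qed.

Lemma cabs_Im z : `|complex.Im z| <= cabs z.
Proof.
rewrite unlock normc_def /= -sqrtr_sqr ler_sqrt ?addr_ge0 ?sqr_ge0 //.
by rewrite lerDr sqr_ge0.
Qed.

Lemma cabs_ReIm z : cabs z <= `|complex.Re z| + `|complex.Im z|.
Proof.
rewrite unlock normc_def /= -[leRHS]ger0_norm ?addr_ge0 // -sqrtr_sqr.
rewrite ler_sqrt ?sqr_ge0 // sqrrD !real_normK ?num_real //.
have := mulr_ge0 (normr_ge0 (complex.Re z)) (normr_ge0 (complex.Im z)).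
by move: (_ * _) => p; lra.
Qed.

Lemma cabsJ z : cabs z^* = cabs z.
Proof. by rewrite unlock normcJ. Qed.

Lemma cabsi : cabs ('i : R[i]) = 1.
Proof. by rewrite unlock normc_def /= expr0n expr1n add0r sqrtr1. Qed.

End ComplexModulus.

Section Operations.
Context {R : realType}.
Local Notation tpi := (pi *+ 2 : R).
Implicit Types (f g : sfun R) (c : R[i]).

Lemma sfun_inj f g : f =1 g -> f = g.
Proof. by move=> h; apply/val_inj/funext. Qed.

Lemma sfun_periodic f : periodic f tpi.
Proof. by have /asboolP[] := sfunP f. Qed.

Lemma sfun_Ck f n : Ck n f.
Proof. by have /asboolP[] := sfunP f. Qed.

Lemma sfun_continuous f : ccontinuous f.
Proof. exact: (sfun_Ck f 0). Qed.

Lemma sfunD f g x : (f + g) x = f x + g x. Proof. by []. Qed.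
Lemma sfunN f x : (- f) x = - f x. Proof. by []. Qed.
Lemma sfunM f g x : (f * g) x = f x * g x. Proof. by []. Qed.

Lemma cderiv_periodic (h h' : R -> R[i]) : periodic h tpi -> cderiv h h' ->
  periodic h' tpi.
Proof.
move=> ph dh x.
have pr : periodic (@complex.Re R \o h) tpi by move=> y /=; rewrite ph.
have pi : periodic (@complex.Im R \o h) tpi by move=> y /=; rewrite ph.
have := periodic_is_derive pr (fun x => (dh x).1) x.
have := periodic_is_derive pi (fun x => (dh x).2) x.
by case: (h' x) (h' (x + _)) => ? ? [] ? ? /= -> ->.
Qed.

Lemma sder_ex f : exists g : sfun R, cderiv f g.
Proof.
have [f' df _] := sfun_Ck f 1.
suff sf' : f' \in smooth_periodic by exists (SFun sf').
apply/asboolP; split; first exact: cderiv_periodic (sfun_periodic f) df.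
by move=> n; have [g dg] := sfun_Ck f n.+1; rewrite (cderiv_uniq df dg).
Qed.

Definition sder f : sfun R := projT1 (cid (sder_ex f)).

Lemma sderP f : cderiv f (sder f).
Proof. by rewrite /sder; case: cid. Qed.

Lemma sder_eq f g : cderiv f g -> sder f = g.
Proof. by move=> fg; apply/val_inj/(cderiv_uniq (sderP f) fg). Qed.

Lemma scst_subproof c : (fun=> c) \in @smooth_periodic R.
Proof. by apply/asboolP; split=> // n; exact: Ck_cst. Qed.
Definition scst c : sfun R := SFun (scst_subproof c).

Lemma scst_is_additive : additive scst.
Proof. by move=> a b; apply: sfun_inj. Qed.
Lemma scst_is_multiplicative : multiplicative scst.
Proof. by split=> [a b|]; apply: sfun_inj. Qed.
HB.instance Definition _ := GRing.isAdditive.Build R[i] (sfun R) scst scst_is_additive.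
HB.instance Definition _ := GRing.isMultiplicative.Build R[i] (sfun R) scst
  scst_is_multiplicative.

Lemma scst_nat n : scst (n%:R : R[i]) = n%:R.
Proof. exact: rmorph_nat. Qed.

Lemma sderD f g : sder (f + g) = sder f + sder g.
Proof. by apply: sder_eq; exact: cderivD (sderP f) (sderP g). Qed.

Lemma sderM f g : sder (f * g) = sder f * g + f * sder g.
Proof. by apply: sder_eq; exact: cderivM (sderP f) (sderP g). Qed.

Lemma sder_cst c : sder (scst c) = 0.
Proof. by apply: sder_eq; exact: cderiv_cst. Qed.

Lemma sderZ c f : sder (scst c * f) = scst c * sder f.
Proof. by rewrite sderM sder_cst mul0r add0r. Qed.

Lemma sderN f : sder (- f) = - sder f.
Proof. by rewrite -mulN1r -[-1](rmorphN1 scst) sderZ rmorphN1 mulN1r. Qed.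

Lemma Ck_cos_sin n :
  Ck n (fun x : R => (cos x)%:C) /\ Ck n (fun x : R => (sin x)%:C).
Proof.
have dc : cderiv (fun x : R => (cos x)%:C) (fun x => - (sin x)%:C).
  move=> x; split; first exact: is_derive_cos.
  by rewrite /= oppr0; exact: is_derive_cst.
have ds : cderiv (fun x : R => (sin x)%:C) (fun x => (cos x)%:C).
  by move=> x; split; [exact: is_derive_sin|exact: is_derive_cst].
elim: n => [|n [IHc IHs]].
  by split; [exact: cderiv_continuous dc | exact: cderiv_continuous ds].
split; [exists (fun x => - (sin x)%:C) | exists (fun x => (cos x)%:C)] => //.
have -> : (fun x : R => - (sin x)%:C) = (fun=> (-1)) \* (fun x : R => (sin x)%:C).
  by apply: funext => x /=; rewrite mulN1r.
by apply: CkM => //; exact: Ck_cst.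
Qed.

Lemma scos_subproof : (fun x : R => (cos x)%:C) \in smooth_periodic.
Proof.
by apply/asboolP; split=> [x|n]; [rewrite cosD2pi|have [] := Ck_cos_sin n].
Qed.
Lemma ssin_subproof : (fun x : R => (sin x)%:C) \in smooth_periodic.
Proof.
by apply/asboolP; split=> [x|n]; [rewrite sinD2pi|have [] := Ck_cos_sin n].
Qed.
Definition scos : sfun R := SFun scos_subproof.
Definition ssin : sfun R := SFun ssin_subproof.

Lemma sder_cos : sder scos = - ssin.
Proof.
apply: sder_eq => x; split; first exact: is_derive_cos.
by rewrite /= oppr0; exact: is_derive_cst.
Qed.

Lemma sder_sin : sder ssin = scos.
Proof.
by apply: sder_eq => x; split; [exact: is_derive_sin|exact: is_derive_cst].
Qed.

Lemma scos2sin2 : scos ^+ 2 + ssin ^+ 2 = 1.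
Proof.
apply: sfun_inj => x; rewrite sfunD !expr2 !sfunM /= -!rmorphM -rmorphD -!expr2.
by rewrite cos2Dsin2.
Qed.

Definition savg f : R[i] :=
  mean (@complex.Re R \o f) +i* mean (@complex.Im R \o f).

Lemma savgD f g : savg (f + g) = savg f + savg g.
Proof.
have [fr fi] := sfun_continuous f; have [gr gi] := sfun_continuous g.
rewrite /savg.
have -> : @complex.Re R \o (f + g) = (@complex.Re R \o f) \+ (@complex.Re R \o g).
  by apply: funext => x /=; rewrite fctE; case: (f x) (g x) => ? ? [].
have -> : @complex.Im R \o (f + g) = (@complex.Im R \o f) \+ (@complex.Im R \o g).
  by apply: funext => x /=; rewrite fctE; case: (f x) (g x) => ? ? [].
by rewrite !meanD.
Qed.

Lemma savgZ c f : savg (scst c * f) = c * savg f.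
Proof.
have [fr fi] := sfun_continuous f; rewrite /savg.
have cZ (k : R) (h : R -> R) : continuous h -> continuous (fun x => k * h x).
  by move=> ch x; apply: cvgMr; exact: ch.
have -> : @complex.Re R \o (scst c * f) =
    (fun x => complex.Re c * complex.Re (f x)) \+
    (fun x => (- complex.Im c) * complex.Im (f x)).
  by apply: funext => x /=; rewrite fctE; case: c (f x) => ? ? [] ? ? /=; rewrite mulNr.
have -> : @complex.Im R \o (scst c * f) =
    (fun x => complex.Re c * complex.Im (f x)) \+
    (fun x => complex.Im c * complex.Re (f x)).
  by apply: funext => x /=; rewrite fctE; case: c (f x) => ? ? [] ? ? /=.
rewrite !meanD ?(meanZ _ fr) ?(meanZ _ fi);
  [|exact: cZ fi|exact: cZ fr|exact: cZ fr|exact: cZ fi].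
by case: c => a b /=; rewrite mulNr.
Qed.

Lemma savgN f : savg (- f) = - savg f.
Proof. by rewrite -mulN1r -[-1](rmorphN1 scst) savgZ mulN1r. Qed.

Lemma savgB f g : savg (f - g) = savg f - savg g.
Proof. by rewrite savgD savgN. Qed.

Lemma savg_der f : savg (sder f) = 0.
Proof.
have [fr fi] := sfun_continuous (sder f); rewrite /savg.
have pr : periodic (@complex.Re R \o f) tpi by move=> y /=; rewrite sfun_periodic.
have pi : periodic (@complex.Im R \o f) tpi by move=> y /=; rewrite sfun_periodic.
rewrite (mean_derive pr fr (fun x => (sderP f x).1)).
by rewrite (mean_derive pi fi (fun x => (sderP f x).2)).
Qed.

Lemma savg_cst c : savg (scst c) = c.
Proof.
have cc (k : R) : continuous (fun _ : R => k) by move=> x; exact: cst_continuous.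
rewrite /savg; have [t _ ->] := mean_MVT (cc (complex.Re c)).
by have [u _ ->] := mean_MVT (cc (complex.Im c)); case: c.
Qed.

Lemma savg1 : savg 1 = 1.
Proof. by rewrite -[1](rmorph1 scst) savg_cst. Qed.

Definition snorm f : R := sup (range (fun x => cabs (f x))).

Lemma snorm_has_ubound f : has_ubound (range (fun x => cabs (f x))).
Proof.
have [fr fi] := sfun_continuous f.
have [|K1 h1] := periodic_bounded _ fr; first by move=> x /=; rewrite sfun_periodic.
have [|K2 h2] := periodic_bounded _ fi; first by move=> x /=; rewrite sfun_periodic.
exists (K1 + K2) => _ [x _ <-]; apply: le_trans (cabs_ReIm _) _.
by apply: lerD; [exact: h1 | exact: h2].
Qed.

Lemma snorm_ub f x : cabs (f x) <= snorm f.
Proof.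
by apply: (ub_le_sup (snorm_has_ubound f)); exists x.
Qed.

Lemma snorm_le f (K : R) : (forall x, cabs (f x) <= K) -> snorm f <= K.
Proof.
move=> h; apply: ge_sup; first by exists (cabs (f 0)), 0.
by move=> _ [x _ <-].
Qed.

Lemma snorm_ge0 f : 0 <= snorm f.
Proof. exact: le_trans (cabs_ge0 (f 0)) (snorm_ub f 0). Qed.

Lemma snorm_eq0 f : snorm f = 0 -> f = 0.
Proof.
move=> h; apply: sfun_inj => x; apply: cabs_eq0; apply/eqP.
by rewrite eq_le cabs_ge0 -h snorm_ub.
Qed.

Lemma snormD f g : snorm (f + g) <= snorm f + snorm g.
Proof.
by apply: snorm_le => x; rewrite sfunD (le_trans (cabsD _ _)) // lerD ?snorm_ub.
Qed.

Lemma snormM f g : snorm (f * g) <= snorm f * snorm g.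
Proof.
by apply: snorm_le => x; rewrite sfunM cabsM ler_pM ?cabs_ge0 ?snorm_ub.
Qed.

Lemma snorm_cst c : snorm (scst c) = cabs c.
Proof.
by apply/eqP; rewrite eq_le (snorm_ub (scst c) 0) snorm_le.
Qed.

Lemma snormN f : snorm (- f) = snorm f.
Proof.
by congr sup; apply: eq_imagel => x _ /=; rewrite fctE cabsN.
Qed.

Lemma snorm_cos : snorm scos <= 1.
Proof. by apply: snorm_le => x; rewrite cabsr ler_norml cos_geN1 cos_le1. Qed.

Lemma snorm_sin : snorm ssin <= 1.
Proof. by apply: snorm_le => x; rewrite cabsr ler_norml sin_geN1 sin_le1. Qed.

Lemma cabs_savg f : cabs (savg f) <= 2 * snorm f.
Proof.
have [fr fi] := sfun_continuous f; rewrite /savg.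
have [t _ ->] := mean_MVT fr; have [u _ ->] := mean_MVT fi.
apply: le_trans (cabs_ReIm _) _; rewrite mulr2n mulrDl mul1r lerD //=.
  exact: le_trans (cabs_Re _) (snorm_ub _ _).
exact: le_trans (cabs_Im _) (snorm_ub _ _).
Qed.

Lemma spoincare f : savg f = 0 -> snorm f <= 4 * pi * snorm (sder f).
Proof.
move=> [r0 i0]; apply: snorm_le => x; apply: le_trans (cabs_ReIm _) _.
have [dr di] := (fun x => (sderP f x).1, fun x => (sderP f x).2).
have pr : periodic (@complex.Re R \o f) tpi by move=> y /=; rewrite sfun_periodic.
have pi : periodic (@complex.Im R \o f) tpi by move=> y /=; rewrite sfun_periodic.
have br y : `|complex.Re (sder f y)| <= snorm (sder f).
  exact: le_trans (cabs_Re _) (snorm_ub _ _).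
have bi y : `|complex.Im (sder f y)| <= snorm (sder f).
  exact: le_trans (cabs_Im _) (snorm_ub _ _).
have h1 := periodic_poincare pr dr br r0 x.
have h2 := periodic_poincare pi di bi i0 x.
apply: le_trans (lerD h1 h2) _; rewrite le_eqVlt; apply/orP; left; apply/eqP; ring.
Qed.

Lemma reflect_Ck n (h : R -> R[i]) : Ck n h -> Ck n (fun x => h (- x)).
Proof.
elim: n h => [|n IH] h.
  by move=> [hr hi]; split; [exact: continuous_reflect hr|exact: continuous_reflect hi].
move=> [h' dh /IH ch]; exists ((fun=> -1) \* (fun x => h' (- x))).
  move=> x; have [dr di] := dh (- x); split.
    apply: is_derive_eq (is_derive1_comp dr (is_deriveNid x 1)) _ => /=.
    by case: (h' (- x)) => ? ?; simpc.
  apply: is_derive_eq (is_derive1_comp di (is_deriveNid x 1)) _ => /=.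
  by case: (h' (- x)) => ? ?; simpc.
by apply: CkM => //; exact: Ck_cst.
Qed.

Lemma sreflect_subproof f : (fun x => f (- x)) \in smooth_periodic.
Proof.
apply/asboolP; split=> [x|n]; last exact/reflect_Ck/sfun_Ck.
by rewrite opprD -[LHS]sfun_periodic subrK.
Qed.
Definition sreflect f : sfun R := SFun (sreflect_subproof f).

Lemma sreflect_is_additive : additive sreflect.
Proof. by move=> a b; apply: sfun_inj. Qed.
Lemma sreflect_is_multiplicative : multiplicative sreflect.
Proof. by split=> [a b|]; apply: sfun_inj. Qed.
HB.instance Definition _ :=
  GRing.isAdditive.Build (sfun R) (sfun R) sreflect sreflect_is_additive.
HB.instance Definition _ :=
  GRing.isMultiplicative.Build (sfun R) (sfun R) sreflect sreflect_is_multiplicative.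

Lemma sreflectK : involutive sreflect.
Proof. by move=> f; apply: sfun_inj => x /=; rewrite opprK. Qed.

Lemma sreflect_cst c : sreflect (scst c) = scst c.
Proof. exact: sfun_inj. Qed.

Lemma sreflect_cos : sreflect scos = scos.
Proof. by apply: sfun_inj => x /=; rewrite cosN. Qed.

Lemma sreflect_sin : sreflect ssin = - ssin.
Proof. by apply: sfun_inj => x /=; rewrite sinN rmorphN. Qed.

Lemma sder_reflect f : sder (sreflect f) = - sreflect (sder f).
Proof.
apply: sder_eq => x; have [dr di] := sderP f (- x); split.
  apply: is_derive_eq (is_derive1_comp dr (is_deriveNid x 1)) _ => /=.
  by rewrite fctE /=; case: (sder f (- x)) => ? ? /=; rewrite mulrN1.
apply: is_derive_eq (is_derive1_comp di (is_deriveNid x 1)) _ => /=.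
by rewrite fctE /=; case: (sder f (- x)) => ? ? /=; rewrite mulrN1.
Qed.

Lemma savg_reflect f : savg (sreflect f) = savg f.
Proof.
have [fr fi] := sfun_continuous f; rewrite /savg.
have pr : periodic (@complex.Re R \o f) tpi by move=> y /=; rewrite sfun_periodic.
have pi : periodic (@complex.Im R \o f) tpi by move=> y /=; rewrite sfun_periodic.
by rewrite (mean_reflect pr fr : mean (_ \o sreflect f) = _)
  (mean_reflect pi fi : mean (_ \o sreflect f) = _).
Qed.

Lemma snorm_reflect f : snorm (sreflect f) <= snorm f.
Proof. by apply: snorm_le => x; exact: (snorm_ub f (- x)). Qed.

Lemma cderiv_conj (h h' : R -> R[i]) :
  cderiv h h' -> cderiv (fun x => (h x)^*) (fun x => (h' x)^*).
Proof.
move=> dh x; have [dr di] := dh x; split.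
  have -> : @complex.Re R \o (fun x => (h x)^*) = @complex.Re R \o h.
    by apply: funext => y /=; case: (h y).
  by apply: is_derive_eq dr _; case: (h' x).
have -> : @complex.Im R \o (fun x => (h x)^*) = - (@complex.Im R \o h).
  by apply: funext => y /=; rewrite fctE /=; case: (h y).
by apply: is_derive_eq (is_deriveN di) _; case: (h' x).
Qed.

Lemma conj_Ck n (h : R -> R[i]) : Ck n h -> Ck n (fun x => (h x)^*).
Proof.
elim: n h => [|n IH] h.
  move=> [hr hi]; split.
    by have -> : @complex.Re R \o (fun x => (h x)^*) = @complex.Re R \o h
      by apply: funext => y /=; case: (h y).
  have -> : @complex.Im R \o (fun x => (h x)^*) = - (@complex.Im R \o h).
    by apply: funext => y /=; rewrite fctE /=; case: (h y).
  by move=> x; apply: cvgN; exact: hi.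
by move=> [h' dh /IH ch]; exists (fun x => (h' x)^*) => //; exact: cderiv_conj.
Qed.

Lemma sconj_subproof f : (fun x => (f x)^*) \in smooth_periodic.
Proof.
apply/asboolP; split=> [x|n]; last exact/conj_Ck/sfun_Ck.
by rewrite sfun_periodic.
Qed.
Definition sconj f : sfun R := SFun (sconj_subproof f).

Lemma sconj_is_additive : additive sconj.
Proof. by move=> a b; apply: sfun_inj => x; exact: rmorphB. Qed.
Lemma sconj_is_multiplicative : multiplicative sconj.
Proof.
by split=> [a b|]; apply: sfun_inj => x; [exact: rmorphM|exact: rmorph1].
Qed.
HB.instance Definition _ :=
  GRing.isAdditive.Build (sfun R) (sfun R) sconj sconj_is_additive.
HB.instance Definition _ :=
  GRing.isMultiplicative.Build (sfun R) (sfun R) sconj sconj_is_multiplicative.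

Lemma sder_conj f : sder (sconj f) = sconj (sder f).
Proof. by apply: sder_eq; exact: cderiv_conj (sderP f). Qed.

End Operations.

(** Everything the spectral argument uses about smooth 2 pi-periodic functions:
    a commutative algebra with a derivation, a mean value that annihilates
    derivatives, a submultiplicative norm for which functions of mean zero are
    bounded by their derivative, the cosine and the sine, and the reflection
    at 0. *)
Record calculus (R : realType) := Calculus {
  pfun : comNzRingType;
  con : {rmorphism R[i] -> pfun};
  der : pfun -> pfun;
  avg : pfun -> R[i];
  nm : pfun -> R;
  pcos : pfun;
  psin : pfun;
  refl : {rmorphism pfun -> pfun};
  derD : forall f g, der (f + g) = der f + der g;
  derM : forall f g, der (f * g) = der f * g + f * der g;
  der_con : forall c, der (con c) = 0;
  avgD : forall f g, avg (f + g) = avg f + avg g;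
  avgZ : forall c f, avg (con c * f) = c * avg f;
  avg_der : forall f, avg (der f) = 0;
  avg1 : avg 1 = 1;
  nm_eq0 : forall f, nm f = 0 -> f = 0;
  nmD : forall f g, nm (f + g) <= nm f + nm g;
  nmM : forall f g, nm (f * g) <= nm f * nm g;
  nm_con : forall c, nm (con c) = cabs c;
  nm_ge0 : forall f, 0 <= nm f;
  cabs_avg : forall f, cabs (avg f) <= 2 * nm f;
  poincare : forall f, avg f = 0 -> nm f <= 4 * pi * nm (der f);
  der_cos : der pcos = - psin;
  der_sin : der psin = pcos;
  pythagoras : pcos ^+ 2 + psin ^+ 2 = 1;
  nm_cos : nm pcos <= 1;
  nm_sin : nm psin <= 1;
  reflK : involutive refl;
  refl_con : forall c, refl (con c) = con c;
  refl_cos : refl pcos = pcos;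
  refl_sin : refl psin = - psin;
  der_refl : forall f, der (refl f) = - refl (der f);
  avg_refl : forall f, avg (refl f) = avg f;
  nm_refl : forall f, nm (refl f) <= nm f
}.
Arguments con {R P} : rename.
Arguments der {R P} : rename.
Arguments avg {R P} : rename.
Arguments nm {R P} : rename.
Arguments pcos {R P} : rename.
Arguments psin {R P} : rename.
Arguments refl {R P} : rename.

Definition sfun_calculus (R : realType) : calculus R := Calculus
  (@sderD R) (@sderM R) (@sder_cst R) (@savgD R) (@savgZ R) (@savg_der R)
  (@savg1 R) (@snorm_eq0 R) (@snormD R) (@snormM R) (@snorm_cst R)
  (@snorm_ge0 R) (@cabs_savg R) (@spoincare R) (@sder_cos R) (@sder_sin R)
  (@scos2sin2 R) (@snorm_cos R) (@snorm_sin R) (@sreflectK R) (@sreflect_cst R)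
  (@sreflect_cos R) (@sreflect_sin R) (@sder_reflect R) (@savg_reflect R)
  (@snorm_reflect R).

(** * The critical operator *)

(* Linear arithmetic where norms are generalized first: [lra] would otherwise
   compare the functions under them up to conversion. *)
Ltac norm_lra :=
  clear;
  repeat match goal with
  | |- context [@nm ?R ?P ?f] => generalize (@nm R P f)
  | |- context [@cabs ?R ?z] => generalize (@cabs R z)
  end; intros; lra.

Section Resolvent.
Context {R : realType} {P : calculus R}.
Implicit Types (f g v : pfun P) (c : R[i]).
Local Notation "c %:S" := (@con R P c) (at level 2, format "c %:S").
Local Notation Cs := (@pcos R P).
Local Notation Sn := (@psin R P).

Lemma con_nat n : (n%:R : R[i])%:S = n%:R.
Proof. exact: rmorph_nat. Qed.

Lemma derZ c f : der (c%:S * f) = c%:S * der f.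
Proof. by rewrite derM der_con mul0r add0r. Qed.

Lemma derN f : der (- f) = - der f.
Proof. by rewrite -mulN1r -(rmorphN1 con) derZ rmorphN1 mulN1r. Qed.

Lemma derB f g : der (f - g) = der f - der g.
Proof. by rewrite derD derN. Qed.

Lemma der_nat n f : der (n%:R * f) = n%:R * der f.
Proof. by rewrite -con_nat derZ. Qed.

Lemma avgN f : avg (- f) = - avg f.
Proof. by rewrite -mulN1r -(rmorphN1 con) avgZ mulN1r. Qed.

Lemma avgB f g : avg (f - g) = avg f - avg g.
Proof. by rewrite avgD avgN. Qed.

Lemma avg0 : avg (0 : pfun P) = 0.
Proof. by rewrite -(subrr 0) avgB subrr. Qed.

Lemma avg_nat n f : avg (n%:R * f) = n%:R * avg f.
Proof. by rewrite -con_nat avgZ. Qed.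

Lemma avg_parts f g : avg (der f * g) = - avg (f * der g).
Proof. by apply/eqP; rewrite -addr_eq0 -avgD -derM avg_der. Qed.

Lemma nmZ c f : nm (c%:S * f) <= cabs c * nm f.
Proof. by rewrite -(nm_con P) nmM. Qed.

Lemma nmN f : nm (- f) = nm f.
Proof.
have le (h : pfun P) : nm (- h) <= nm h.
  rewrite -mulN1r -(rmorphN1 con); apply: le_trans (nmZ _ _) _.
  by rewrite -(rmorphN1 (real_complex R)) cabsr normrN1 mul1r.
by apply/eqP; rewrite eq_le le -{1}[f]opprK le.
Qed.

Lemma nmB f g : nm (f - g) <= nm f + nm g.
Proof. by rewrite -[nm g]nmN nmD. Qed.

Lemma derX f n : der (f ^+ n.+1) = n.+1%:R * f ^+ n * der f.
Proof.
elim: n => [|n IH]; first by rewrite expr1 expr0 !mul1r.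
by rewrite exprS derM IH !exprS; ring.
Qed.

Lemma avg_cos_sin : avg (Cs * Sn) = 0.
Proof.
have h := avg_der (Sn ^+ 2).
rewrite derX der_sin expr1 in h.
have : avg ((2 : R[i])%:S * (Cs * Sn)) = 0.
  by rewrite -h; congr avg; ring.
by rewrite avgZ => /eqP; rewrite mulf_eq0 pnatr_eq0 /= => /eqP.
Qed.

Lemma avg_cos2 : avg (Cs ^+ 2) = 1 / 2.
Proof.
have h := avg_der (Cs * Sn); rewrite derM der_cos der_sin in h.
have : avg ((2 : R[i])%:S * Cs ^+ 2 - 1) = 0.
  by rewrite -h -pythagoras; congr avg; ring.
rewrite avgB avgZ avg1 => /eqP; rewrite subr_eq0 => /eqP h2.
have two0 : (2 : R[i]) != 0 by rewrite pnatr_eq0.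
by apply: (mulfI two0); rewrite h2 mulrC divfK.
Qed.

Lemma avg_sin2 : avg (Sn ^+ 2) = 1 / 2.
Proof.
have -> : Sn ^+ 2 = 1 - Cs ^+ 2 by rewrite -pythagoras; ring.
by rewrite avgB avg1 avg_cos2; field.
Qed.

Definition coefc v : R[i] := avg (v * Cs).
Definition coefs v : R[i] := avg (v * Sn).

Definition cosin (a b : R[i]) : pfun P := a%:S * Cs + b%:S * Sn.

Lemma der_cosin a b : der (cosin a b) = cosin b (- a).
Proof. by rewrite derD !derZ der_cos der_sin /cosin rmorphN; ring. Qed.

Lemma nm_cosin a b : nm (cosin a b) <= cabs a + cabs b.
Proof.
apply: le_trans (nmD _ _) _; apply: lerD; apply: le_trans (nmZ _ _) _.
  by rewrite ler_piMr ?cabs_ge0 ?nm_cos.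
by rewrite ler_piMr ?cabs_ge0 ?nm_sin.
Qed.

Lemma coefc_cosin a b : coefc (cosin a b) = a / 2.
Proof.
rewrite /coefc; have -> : cosin a b * Cs = a%:S * Cs ^+ 2 + b%:S * (Cs * Sn).
  by rewrite /cosin; ring.
by rewrite avgD !avgZ avg_cos2 avg_cos_sin mulr0 addr0 mul1r.
Qed.

Lemma coefs_cosin a b : coefs (cosin a b) = b / 2.
Proof.
rewrite /coefs; have -> : cosin a b * Sn = a%:S * (Cs * Sn) + b%:S * Sn ^+ 2.
  by rewrite /cosin; ring.
by rewrite avgD !avgZ avg_sin2 avg_cos_sin mulr0 add0r mul1r.
Qed.

Lemma coefcD f g : coefc (f + g) = coefc f + coefc g.
Proof. by rewrite /coefc mulrDl avgD. Qed.
Lemma coefsD f g : coefs (f + g) = coefs f + coefs g.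
Proof. by rewrite /coefs mulrDl avgD. Qed.
Lemma coefcN f : coefc (- f) = - coefc f.
Proof. by rewrite /coefc mulNr avgN. Qed.
Lemma coefsN f : coefs (- f) = - coefs f.
Proof. by rewrite /coefs mulNr avgN. Qed.
Lemma coefcB f g : coefc (f - g) = coefc f - coefc g.
Proof. by rewrite coefcD coefcN. Qed.
Lemma coefsB f g : coefs (f - g) = coefs f - coefs g.
Proof. by rewrite coefsD coefsN. Qed.
Lemma coefcZ c f : coefc (c%:S * f) = c * coefc f.
Proof. by rewrite /coefc -mulrA avgZ. Qed.
Lemma coefsZ c f : coefs (c%:S * f) = c * coefs f.
Proof. by rewrite /coefs -mulrA avgZ. Qed.
Lemma coefc_der f : coefc (der f) = coefs f.
Proof. by rewrite /coefc avg_parts der_cos mulrN avgN opprK. Qed.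
Lemma coefs_der f : coefs (der f) = - coefc f.
Proof. by rewrite /coefs avg_parts der_sin. Qed.

Lemma cabs_coefc f : cabs (coefc f) <= 2 * nm f.
Proof.
apply: le_trans (cabs_avg _) _; rewrite ler_pM2l //.
by apply: le_trans (nmM _ _) _; rewrite ler_piMr ?nm_ge0 ?nm_cos.
Qed.
Lemma cabs_coefs f : cabs (coefs f) <= 2 * nm f.
Proof.
apply: le_trans (cabs_avg _) _; rewrite ler_pM2l //.
by apply: le_trans (nmM _ _) _; rewrite ler_piMr ?nm_ge0 ?nm_sin.
Qed.

(** With [E = Cs - j Sn], which solves [E' = - j E], the function
    [(f' + j f) E] has derivative [g E]; its mean is a combination of the critical
    coefficients of [f], hence zero, and the Poincare inequality applies. *)
Lemma helmholtz_rotated (j : R[i]) f g : j ^+ 2 = -1 -> cabs j = 1 ->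
  der (der f) + f = g -> coefc f = 0 -> coefs f = 0 ->
  nm (der f + j%:S * f) <= 16 * pi * nm g.
Proof.
move=> j2 j1 fg fc fs.
have jS : (j%:S) ^+ 2 = -1 by rewrite -rmorphXn j2 rmorphN1.
pose E : pfun P := Cs - j%:S * Sn; pose E' : pfun P := Cs + j%:S * Sn.
have EE : E * E' = 1.
  by rewrite -pythagoras /E /E' -subr_sqr exprMn jS mulN1r opprK.
have dE : der E = - j%:S * E.
  rewrite /E derB derZ der_cos der_sin.
  by ring: jS.
have dE' : der E' = j%:S * E'.
  rewrite /E' derD derZ der_cos der_sin.
  by ring: jS.
set z := der f + _; have zE : avg (z * E) = 0.
  rewrite mulrDl avgD avg_parts dE -avgN -avgD.
  have -> : - (f * (- j%:S * E)) + j%:S * f * E =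
    (2 * j)%:S * (f * Cs) + (2 * j * - j)%:S * (f * Sn).
    by rewrite /E; ring.
  by rewrite avgD !avgZ -/(coefc f) -/(coefs f) fc fs !mulr0 addr0.
have dz : der (z * E) = g * E.
  rewrite derM dE /z derD derZ -fg.
  have -> : (der f + j%:S * f) * (- j%:S * E) =
    - (j%:S * der f + (j%:S) ^+ 2 * f) * E by ring.
  by rewrite jS; ring.
have nE : nm E <= 2 /\ nm E' <= 2.
  have h : nm (j%:S * Sn) <= 1.
    by apply: le_trans (nmZ _ _) _; rewrite j1 mul1r nm_sin.
  split; [apply: le_trans (nmB _ _) _ | apply: le_trans (nmD _ _) _];
  by rewrite -[2]/(1 + 1) lerD ?nm_cos.
have := poincare zE; rewrite dz => h1.
have {}h1 : nm (z * E) <= 4 * pi * (nm g * 2).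
  apply: le_trans h1 _; rewrite ler_pM2l ?mulr_gt0 ?pi_gt0 //.
  apply: le_trans (nmM _ _) _; rewrite ler_pM ?nm_ge0 //.
  by case: nE.
have -> : z = (z * E) * E' by rewrite -mulrA EE mulr1.
apply: le_trans (nmM _ _) _.
have -> : 16 * pi * nm g = 4 * pi * (nm g * 2) * 2 by ring.
by rewrite ler_pM ?nm_ge0 //; case: nE.
Qed.

(** Off the critical modes [f'' + f = g] is solved with a bound: [f] and [f']
    are combinations of the rotated functions for [j] and [- j]. *)
Lemma helmholtz_bound f g : der (der f) + f = g ->
  coefc f = 0 -> coefs f = 0 ->
  nm f <= 16 * pi * nm g /\ nm (der f) <= 16 * pi * nm g.
Proof.
move=> fg fc fs.
have i2 : ('i : R[i]) ^+ 2 = -1 by exact: sqr_i.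
have h1 := helmholtz_rotated i2 cabsi fg fc fs.
have h2 : nm (der f + (- 'i)%:S * f) <= 16 * pi * nm g.
  by apply: helmholtz_rotated; rewrite // ?sqrrN // cabsN cabsi.
set a := der f + _ in h1; set b := der f + _ in h2.
have two0 : (2 : R[i]) != 0 by rewrite pnatr_eq0.
have half : cabs (1 / 2 : R[i]) = 1 / 2.
  have -> : (1 / 2 : R[i]) = (1 / 2 : R)%:C by rewrite rmorphM fmorphV rmorph1 rmorph_nat.
  by rewrite cabsr ger0_norm // divr_ge0.
have i0 : ('i : R[i]) != 0 by rewrite -normr_gt0 cabsE cabsi ltr01.
have ef : f = (- 'i / 2)%:S * (a - b).
  rewrite /a /b rmorphN.
  have -> : der f + 'i%:S * f - (der f + - 'i%:S * f) = (2 * 'i)%:S * f by ring.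
  rewrite mulrA -rmorphM.
  have -> : - 'i / 2 * (2 * 'i) = 1 :> R[i].
    have -> : - 'i / 2 * (2 * 'i) = - ('i ^+ 2) :> R[i] by field.
    by rewrite i2 opprK.
  by rewrite rmorph1 mul1r.
have ed : der f = (1 / 2)%:S * (a + b).
  rewrite /a /b rmorphN.
  have -> : der f + 'i%:S * f + (der f + - 'i%:S * f) = 2%:S * der f by ring.
  by rewrite mulrA -rmorphM divfK // rmorph1 mul1r.
have ni : cabs (- 'i / 2 : R[i]) = 1 / 2.
  have -> : - 'i / 2 = - 'i * (1 / 2) :> R[i] by field.
  by rewrite cabsM cabsN cabsi mul1r half.
split; [rewrite ef | rewrite ed]; apply: le_trans (nmZ _ _) _.
  by rewrite ni; move: (nmB a b) h1 h2; norm_lra.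
by rewrite half; move: (nmD a b) h1 h2; norm_lra.
Qed.

Definition nm2 f : R := nm f + nm (der f) + nm (der (der f)).

Lemma nm2_ge0 f : 0 <= nm2 f.
Proof. by rewrite !addr_ge0 ?nm_ge0. Qed.

Lemma nm2D f g : nm2 (f + g) <= nm2 f + nm2 g.
Proof.
rewrite /nm2 !derD; have := nmD f g; have := nmD (der f) (der g).
by have := nmD (der (der f)) (der (der g)); norm_lra.
Qed.

Lemma nm2Z c f : nm2 (c%:S * f) <= cabs c * nm2 f.
Proof.
rewrite /nm2 !derZ !mulrDr; have := nmZ c f; have := nmZ c (der f).
have := nmZ c (der (der f)).
by move: (cabs c * _) (cabs c * _) (cabs c * _); norm_lra.
Qed.

Lemma nm2_cosin a b : nm2 (cosin a b) <= 3 * (cabs a + cabs b).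
Proof.
rewrite /nm2 !der_cosin; have := nm_cosin a b.
have := nm_cosin b (- a); have := nm_cosin (- a) (- b).
by rewrite !cabsN; norm_lra.
Qed.

Definition critical c s : pfun P * pfun P :=
  (cosin (2 * c) (2 * s), cosin (- c) (- s)).

Definition hyp1 (V : pfun P * pfun P) : pfun P :=
  V.1 - cosin (2 * coefc V.1) (2 * coefs V.1).
Definition hyp2 (V : pfun P * pfun P) : pfun P :=
  V.2 + cosin (coefc V.1) (coefs V.1).
(** The norm of what is left of a pair after removing its projection onto the
    critical kernel. *)
Definition hypnorm V : R := nm2 (hyp1 V) + nm2 (hyp2 V).

(** The critical operator is invertible off its kernel, spanned by [Cs] and [Sn]
    times [(2, -1)]: [y = v1 + 2 v2] solves [y'' + y = R1 + R2 / 2] and [v1]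
    solves [v1'' + v1 = R1 - 2 y], two equations for [helmholtz_bound]. *)
Lemma hyperbolic_bound : exists2 K : R, 0 <= K & forall v1 v2 R1 R2 : pfun P,
  der (der v1) + 3 * v1 + 4 * v2 = R1 ->
  4 * der (der v2) - 4 * v1 - 4 * v2 = R2 ->
  hypnorm (v1, v2) <= K * (nm R1 + nm R2).
Proof.
pose k : R := 16 * pi; have k0 : 0 <= k by rewrite mulr_ge0 ?pi_ge0.
pose Y1 := k + 4; pose A1 := k * (1 + 2 * Y1).
have Y0 : 0 <= Y1 by rewrite addr_ge0.
have A0 : 0 <= A1 by rewrite mulr_ge0 // addr_ge0 // mulr_ge0.
exists (6 * A1 + 7 * Y1 + 3); first by move: Y0 A0; norm_lra.
move=> v1 v2 R1 R2 e1 e2; set r := nm R1 + nm R2.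
have r1 : nm R1 <= r by rewrite lerDl nm_ge0.
have r0 : 0 <= r by rewrite addr_ge0 ?nm_ge0.
have hS : (1 / 2 : R[i])%:S * 2 = 1.
  by rewrite -(con_nat 2) -rmorphM divfK ?rmorph1 // pnatr_eq0.
have half f : nm ((1 / 2 : R[i])%:S * f) <= nm f.
  apply: le_trans (nmZ _ _) _; rewrite ler_piMl ?nm_ge0 //.
  have -> : (1 / 2 : R[i]) = (1 / 2 : R)%:C.
    by rewrite rmorphM fmorphV rmorph1 rmorph_nat.
  by rewrite cabsr ger0_norm; clear; lra.
pose y := v1 + 2 * v2; pose g := R1 + (1 / 2)%:S * R2.
have ey : der (der y) + y = g.
  rewrite /y /g -e1 -e2 !derD.
  have -> : der (der (2 * v2)) = 2 * der (der v2).
    by rewrite -(con_nat 2) !derZ.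
  rewrite [X in X = _](_ : _ = der (der v1) + 3 * v1 + 4 * v2 +
    1 * (2 * der (der v2) - 2 * v1 - 2 * v2)); last ring.
  by rewrite -hS; ring.
have ng : nm g <= r.
  by apply: le_trans (nmD _ _) _; rewrite lerD2l half.
have yc : 2 * coefc y = coefc R1.
  rewrite -e1 /y -(con_nat 2) -(con_nat 3) -(con_nat 4).
  by rewrite !(coefcD, coefcZ, coefc_der, coefs_der); ring.
have ys : 2 * coefs y = coefs R1.
  rewrite -e1 /y -(con_nat 2) -(con_nat 3) -(con_nat 4).
  by rewrite !(coefsD, coefsZ, coefc_der, coefs_der); ring.
pose w := cosin (coefc R1) (coefs R1).
have dw : der (der w) = - w.
  by rewrite !der_cosin /w /cosin !rmorphN; ring.
have nw : nm w <= 4 * nm R1 /\ nm (der w) <= 4 * nm R1.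
  have a := cabs_coefc R1; have b := cabs_coefs R1.
  split; first by move: a b (nm_cosin (coefc R1) (coefs R1)); rewrite -/w; norm_lra.
  rewrite der_cosin.
  by move: a b (nm_cosin (coefs R1) (- coefc R1)); rewrite cabsN; norm_lra.
have two0 : (2 : R[i]) != 0 by rewrite pnatr_eq0.
have [|||n0 n1] := @helmholtz_bound (y - w) g.
- by rewrite !derB dw -ey; ring.
- by rewrite coefcD coefcN coefc_cosin -yc; field.
- by rewrite coefsD coefsN coefs_cosin -ys; field.
have ky : k * nm g <= k * r by rewrite ler_wpM2l.
have ny : nm y <= Y1 * r.
  have -> : y = (y - w) + w by rewrite subrK.
  have := nmD (y - w) w; have : Y1 * r = k * r + 4 * r by rewrite mulrDl.
  by case: nw; move: n0 ky r1; rewrite -/k; norm_lra.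
have ny' : nm (der y) <= Y1 * r.
  have -> : y = (y - w) + w by rewrite subrK.
  rewrite derD.
  have := nmD (der (y - w)) (der w).
  have : Y1 * r = k * r + 4 * r by rewrite mulrDl.
  by case: nw; move: n1 ky r1; rewrite -/k; norm_lra.
have ny'' : nm (der (der y)) <= r + Y1 * r.
  have -> : der (der y) = g - y by rewrite -ey addrK.
  by move: (nmB g y) ng ny; norm_lra.
pose h1 := hyp1 (v1, v2); pose h2 := hyp2 (v1, v2).
have eh1 : der (der h1) + h1 = R1 - 2 * y.
  rewrite /h1 /hyp1 /y -e1 /= !derB !der_cosin /cosin !rmorphN; ring.
have n2y : nm (2 * y) <= 2 * (Y1 * r).
  rewrite mulr2n mulrDl mul1r mulrDl mul1r.
  by apply: le_trans (nmD _ _) _; exact: lerD.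
have [||m0 m1] := @helmholtz_bound h1 _ eh1.
- by rewrite /h1 /hyp1 coefcD coefcN coefc_cosin /=; field.
- by rewrite /h1 /hyp1 coefsD coefsN coefs_cosin /=; field.
have kz : k * nm (R1 - 2 * y) <= A1 * r.
  rewrite /A1 -mulrA ler_wpM2l //; have := nmB R1 (2 * y).
  by move: r1 n2y; norm_lra.
rewrite -/k in m0 m1; move: m0 m1 => /le_trans/(_ kz) m0 /le_trans/(_ kz) m1.
have m2 : nm (der (der h1)) <= r + 2 * (Y1 * r) + A1 * r.
  have -> : der (der h1) = R1 - 2 * y - h1 by rewrite -eh1 addrK.
  by move: (nmB (R1 - 2 * y) h1) (nmB R1 (2 * y)) m0 r1 n2y; norm_lra.
have eh2 : h2 = (1 / 2)%:S * (y - h1).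
  have -> : y - h1 = 2 * h2.
    by rewrite /h1 /h2 /hyp1 /hyp2 /y /= /cosin !rmorphM rmorph_nat; ring.
  by rewrite mulrA hS mul1r.
have p0 : nm h2 <= Y1 * r + A1 * r.
  by rewrite eh2; move: (half (y - h1)) (nmB y h1) ny m0; norm_lra.
have p1 : nm (der h2) <= Y1 * r + A1 * r.
  rewrite eh2 derZ (derB y); have := half (der y - der h1).
  by move: (nmB (der y) (der h1)) ny' m1; norm_lra.
have p2 : nm (der (der h2)) <= 2 * r + 3 * (Y1 * r) + A1 * r.
  rewrite eh2 !derZ (derB y) (derB (der y)).
  have := half (der (der y) - der (der h1)).
  by move: (nmB (der (der y)) (der (der h1))) ny'' m2; norm_lra.
have -> : (6 * A1 + 7 * Y1 + 3) * r = 6 * (A1 * r) + 7 * (Y1 * r) + 3 * r by ring.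
rewrite /hypnorm /nm2 -/h1 -/h2.
by move: m0 m1 m2 p0 p1 p2 r0; norm_lra.
Qed.
End Resolvent.

(** * Uniform asymptotic estimates *)

Section BigO.
Context {R : realType} {P : calculus R} {T : Type} (mag : T -> R).
Implicit Types (f g h : T -> R) (F H : T -> pfun P) (z : T -> R[i]).

(** The constants depend on the family alone: the members [t] of the family are
    all the data of the problem, and [mag t] measures their distance to the
    bifurcation point. *)
Definition isO f g := exists K d : R,
  [/\ 0 <= K, 0 < d & forall t, mag t < d -> f t <= K * g t].

Lemma isO_le f g (K : R) : 0 <= K -> (forall t, f t <= K * g t) -> isO f g.
Proof. by move=> K0 h; exists K, 1; split. Qed.

Lemma isO_le_small f g (K : R) : 0 <= K ->
  (forall t, mag t < 1 -> f t <= K * g t) -> isO f g.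
Proof. by move=> K0 h; exists K, 1; split. Qed.

Lemma isO_refl f : isO f f.
Proof. by apply: (@isO_le _ _ 1) => // t; rewrite mul1r. Qed.

Lemma isO_trans f g h : isO f g -> isO g h -> isO f h.
Proof.
move=> [K [d [K0 d0 fg]]] [L [c [L0 c0 gh]]].
exists (K * L), (Num.min d c); split; rewrite ?mulr_ge0 ?lt_min ?d0 //.
move=> t; rewrite lt_min => /andP[td tc]; apply: le_trans (fg _ td) _.
by rewrite -mulrA ler_wpM2l // gh.
Qed.

Lemma isO_leq (K : R) f g h : isO f g -> 0 <= K -> (forall t, g t <= K * h t) ->
  isO f h.
Proof. by move=> fg K0 gh; apply: isO_trans fg (isO_le K0 gh). Qed.

Lemma isO_mono f g h : isO f g -> (forall t, g t <= h t) -> isO f h.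
Proof.
by move=> fg gh; apply: isO_trans fg (@isO_le _ _ 1 _ _) => // t; rewrite mul1r.
Qed.

Lemma isOD f g h : isO f h -> isO g h -> isO (fun t => f t + g t) h.
Proof.
move=> [K [d [K0 d0 fg]]] [L [c [L0 c0 gh]]].
exists (K + L), (Num.min d c); split; rewrite ?addr_ge0 ?lt_min ?d0 //.
move=> t; rewrite lt_min => /andP[td tc].
by rewrite mulrDl lerD ?fg ?gh.
Qed.

Lemma isOM f g f' g' : (forall t, 0 <= f t) -> (forall t, 0 <= f' t) ->
  isO f g -> isO f' g' -> isO (fun t => f t * f' t) (fun t => g t * g' t).
Proof.
move=> f0 f'0 [K [d [K0 d0 fg]]] [L [c [L0 c0 gh]]].
exists (K * L), (Num.min d c); split; rewrite ?mulr_ge0 ?lt_min ?d0 //.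
move=> t; rewrite lt_min => /andP[td tc].
by rewrite mulrACA ler_pM ?fg ?gh.
Qed.

Lemma isO_pw f g h : (forall t, f t <= g t) -> isO g h -> isO f h.
Proof.
move=> fg gh; apply: isO_trans gh; apply: (@isO_le _ _ 1) => // t.
by rewrite mul1r.
Qed.

Lemma isO_eq f g h : (forall t, f t = g t) -> isO g h -> isO f h.
Proof. by move=> fg; apply: isO_pw => t; rewrite fg. Qed.

(** Once [K * mag t] is less than a half, the term with [f] on the right is
    absorbed by the left hand side. *)
Lemma isO_absorb f g : (forall t, 0 <= f t) ->
  isO f (fun t => g t + mag t * f t) -> isO f g.
Proof.
move=> f0 [K [d [K0 d0 h]]]; have K1 : 0 < 2 * K + 1 by rewrite ltr_wpDl ?mulr_ge0.
exists (2 * K), (Num.min d (2 * K + 1)^-1); split; rewrite ?mulr_ge0 ?lt_min ?d0 ?invr_gt0 //.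
move=> t; rewrite lt_min => /andP[td tc]; have := h t td.
rewrite -[X in _ < X]mul1r ltr_pdivlMr // in tc.
have : K * (mag t * f t) * 2 <= f t.
  have [m0|m0] := leP (mag t) 0.
    apply: le_trans (f0 t); rewrite mulrAC mulr_ge0_le0 ?mulr_ge0 //.
    by rewrite mulr_le0_ge0.
  have -> : K * (mag t * f t) * 2 = (mag t * (2 * K)) * f t by ring.
  rewrite ler_piMl //; apply: le_trans (ltW tc).
  by rewrite ler_wpM2l ?lerDl // ltW.
rewrite (mulrDr K) -(mulrA 2 K); move: (K * g t) (K * (mag t * f t)) => a b.
by lra.
Qed.

Lemma isO_nmD F H g : isO (fun t => nm (F t)) g -> isO (fun t => nm (H t)) g ->
  isO (fun t => nm (F t + H t)) g.
Proof. by move=> a b; apply: isO_pw (isOD a b) => t; exact: nmD. Qed.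

Lemma isO_nmN F g : isO (fun t => nm (F t)) g -> isO (fun t => nm (- F t)) g.
Proof. by apply: isO_pw => t; rewrite nmN. Qed.

Lemma isO_nmB F H g : isO (fun t => nm (F t)) g -> isO (fun t => nm (H t)) g ->
  isO (fun t => nm (F t - H t)) g.
Proof. by move=> a b; apply: isO_nmD => //; exact: isO_nmN. Qed.

Lemma isO_nmM F H g h : isO (fun t => nm (F t)) g -> isO (fun t => nm (H t)) h ->
  isO (fun t => nm (F t * H t)) (fun t => g t * h t).
Proof.
move=> a b; apply: (@isO_pw _ (fun t => nm (F t) * nm (H t))).
  by move=> t; exact: nmM.
by apply: isOM => // t; exact: nm_ge0.
Qed.

Lemma isO_nmZ z H g h : isO (fun t => cabs (z t)) g ->
  isO (fun t => nm (H t)) h ->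
  isO (fun t => nm (con (z t) * H t)) (fun t => g t * h t).
Proof. by move=> a b; apply: isO_nmM b; apply: isO_pw a => t; rewrite nm_con. Qed.

Lemma isO_nm_nat n F g : isO (fun t => nm (F t)) g ->
  isO (fun t => nm (n%:R * F t)) g.
Proof.
move=> [K [d [K0 d0 h]]]; exists (n%:R * K), d; split; rewrite ?mulr_ge0 // => t td.
rewrite -con_nat; apply: le_trans (nmZ _ _) _.
rewrite -(rmorph_nat (real_complex R)) cabsr ger0_norm // -mulrA.
by rewrite ler_wpM2l // h.
Qed.

Lemma isO_cabsD z1 z2 g : isO (fun t => cabs (z1 t)) g ->
  isO (fun t => cabs (z2 t)) g -> isO (fun t => cabs (z1 t + z2 t)) g.
Proof. by move=> a b; apply: isO_pw (isOD a b) => t; exact: cabsD. Qed.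

Lemma isO_cabsN z g : isO (fun t => cabs (z t)) g ->
  isO (fun t => cabs (- z t)) g.
Proof. by apply: isO_pw => t; rewrite cabsN. Qed.

Lemma isO_cabsB z1 z2 g : isO (fun t => cabs (z1 t)) g ->
  isO (fun t => cabs (z2 t)) g -> isO (fun t => cabs (z1 t - z2 t)) g.
Proof. by move=> a b; apply: isO_cabsD => //; exact: isO_cabsN. Qed.

Lemma isO_cabsM z1 z2 g h : isO (fun t => cabs (z1 t)) g ->
  isO (fun t => cabs (z2 t)) h ->
  isO (fun t => cabs (z1 t * z2 t)) (fun t => g t * h t).
Proof.
move=> a b; apply: (@isO_pw _ (fun t => cabs (z1 t) * cabs (z2 t))).
  by move=> t; rewrite cabsM.
by apply: isOM => // t; exact: cabs_ge0.
Qed.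

Lemma isO_cabsZ (c : R[i]) z g : isO (fun t => cabs (z t)) g ->
  isO (fun t => cabs (c * z t)) g.
Proof.
move=> [K [d [K0 d0 h]]]; exists (cabs c * K), d; split=> //.
  by rewrite mulr_ge0 ?cabs_ge0.
by move=> t td; rewrite cabsM -mulrA ler_wpM2l ?cabs_ge0 // h.
Qed.

Lemma isO_cabs_nat n z g : isO (fun t => cabs (n.+1%:R * z t)) g ->
  isO (fun t => cabs (z t)) g.
Proof.
apply: isO_pw => t; rewrite cabsM -(rmorph_nat (real_complex R)) cabsr ger0_norm //.
by rewrite ler_peMl ?cabs_ge0 // ler1n.
Qed.

Lemma isO_avg F g : isO (fun t => nm (F t)) g ->
  isO (fun t => cabs (avg (F t))) g.
Proof.
move=> [K [d [K0 d0 h]]]; exists (2 * K), d; split; rewrite ?mulr_ge0 // => t td.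
by apply: le_trans (cabs_avg _) _; rewrite -mulrA ler_wpM2l // h.
Qed.

Lemma isO_nm1 F H g : (forall t, nm (H t) <= 1) -> isO (fun t => nm (F t)) g ->
  isO (fun t => nm (F t * H t)) g.
Proof.
move=> H1; apply: isO_pw => t; apply: le_trans (nmM _ _) _.
by rewrite ler_piMr ?nm_ge0.
Qed.

End BigO.

(** * The linearization about a profile *)

Ltac norm2_lra :=
  repeat match goal with
  | |- context [@nm2 ?R ?P ?f] => generalize (@nm2 R P f)
  | |- context [@nm ?R ?P ?f] => generalize (@nm R P f)
  | |- context [@cabs ?R ?z] => generalize (@cabs R z)
  end; intros; lra.

Section LinearizedOperator.
Context {R : realType} {P : calculus R}.
Implicit Types (e k : R) (u v : pfun P).
Local Notation "x %:f" := (@con R P (real_complex R x)) (at level 2, format "x %:f").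
Local Notation "c %:S" := (@con R P c) (at level 2, format "c %:S").

Definition potential e u1 u2 v1 v2 : pfun P :=
  ((e ^+ 2 + 4)%:f * u1 + 4 * u2 + 2 * u1 * u2) * v1 + (4 * u1 + u1 ^+ 2) * v2.

Definition linop1 e k u1 u2 v1 v2 : pfun P :=
  (1 + k)%:f * der (der v1) + (e ^+ 2 + 3)%:f * v1 + 4 * v2
  + potential e u1 u2 v1 v2.

Definition linop2 e k u1 u2 v1 v2 : pfun P :=
  4 * (1 + k)%:f * der (der v2) - (e ^+ 2 + 4)%:f * v1 - 4 * v2
  - potential e u1 u2 v1 v2.

(** [k] is the detuning: the squared wavenumber is [(1 + k) / 4]. *)
Definition floquet k (sg : R) v : pfun P :=
  (1 + k)%:f * (2 * (('i * sg%:C)%:S * der v) - (sg ^+ 2)%:f * v).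

Definition bloch1 e k sg u1 u2 v1 v2 : pfun P :=
  linop1 e k u1 u2 v1 v2 + floquet k sg v1.

Definition bloch2 e k sg u1 u2 v1 v2 : pfun P :=
  linop2 e k u1 u2 v1 v2 + 4 * floquet k sg v2.

Definition nonlinearity e u1 u2 : pfun P :=
  (e ^+ 2 / 2 + 2)%:f * u1 ^+ 2 + 4 * u1 * u2 + u1 ^+ 2 * u2.

Definition is_profile e k u1 u2 :=
  (1 + k)%:f * der (der u1) + (e ^+ 2 + 3)%:f * u1 + 4 * u2
    + nonlinearity e u1 u2 = 0 /\
  4 * (1 + k)%:f * der (der u2) - (e ^+ 2 + 4)%:f * u1 - 4 * u2
    - nonlinearity e u1 u2 = 0.

(** Everything of order [e ^+ 2] or smaller that the linearization adds to the
    critical operator, apart from the detuning [k] of the wavenumber. *)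
Definition excess e u1 u2 v1 v2 : pfun P :=
  (e ^+ 2)%:f * v1 + potential e u1 u2 v1 v2.

(** Vanishes on the critical kernel, so that it is of higher order than [v1] and
    [v2] on approximate eigenvectors, and on the profile. *)
Definition slaved v1 v2 : pfun P := v1 + 2 * v2.

(** The quadratic part of the reaction only contains products with a slaved
    factor: this cancellation makes [excess] small on critical modes. *)
Lemma excessE e u1 u2 v1 v2 : excess e u1 u2 v1 v2 =
  (e ^+ 2)%:f * v1
  + 2 * (u1 * slaved v1 v2) + 2 * (v1 * slaved u1 u2)
  + (e ^+ 2)%:f * (u1 * v1) + (2 * (u1 * u2 * v1) + u1 ^+ 2 * v2).
Proof. by rewrite /excess /potential /slaved; ring. Qed.

Lemma linop1_critical e k u1 u2 v1 v2 :
  der (der v1) + 3 * v1 + 4 * v2 =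
  linop1 e k u1 u2 v1 v2 - k%:f * der (der v1) - excess e u1 u2 v1 v2.
Proof. by rewrite /linop1 /excess; ring. Qed.

Lemma linop2_critical e k u1 u2 v1 v2 :
  4 * der (der v2) - 4 * v1 - 4 * v2 =
  linop2 e k u1 u2 v1 v2 - 4 * (k%:f * der (der v2)) + excess e u1 u2 v1 v2.
Proof. by rewrite /linop2 /excess; ring. Qed.

Lemma slaved_hyp v1 v2 : slaved v1 v2 = hyp1 (v1, v2) + 2 * hyp2 (v1, v2).
Proof. by rewrite /slaved /hyp1 /hyp2 /cosin !rmorphM rmorph_nat /=; ring. Qed.

Definition critnorm v : R := cabs (coefc v) + cabs (coefs v).

Lemma critnorm_ge0 v : 0 <= critnorm v.
Proof. by rewrite addr_ge0 ?cabs_ge0. Qed.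

Lemma hypnorm_ge0 V : 0 <= hypnorm (P := P) V.
Proof. by rewrite addr_ge0 ?nm2_ge0. Qed.

Lemma cabs2 (c : R[i]) : cabs (2 * c) = 2 * cabs c.
Proof. by rewrite cabsM -(rmorph_nat (real_complex R)) cabsr ger0_norm. Qed.

Lemma nm2N v : nm2 (- v) = nm2 v.
Proof. by rewrite /nm2 !derN !nmN. Qed.

Lemma nm2_comp1 v1 v2 : nm2 v1 <= 6 * critnorm v1 + hypnorm (v1, v2).
Proof.
have -> : nm2 v1 =
    nm2 (cosin (2 * coefc v1) (2 * coefs v1) + hyp1 (v1, v2)).
  by rewrite /hyp1 /= addrC subrK.
apply: le_trans (nm2D _ _) _.
have := nm2_cosin (P := P) (2 * coefc v1) (2 * coefs v1).
rewrite !cabs2 /critnorm /hypnorm => h.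
have := nm2_ge0 (hyp2 (v1, v2)); move: h.
by norm2_lra.
Qed.

Lemma nm2_comp2 v1 v2 : nm2 v2 <= 6 * critnorm v1 + hypnorm (v1, v2).
Proof.
have -> : nm2 v2 =
    nm2 (hyp2 (v1, v2) - cosin (coefc v1) (coefs v1)).
  by rewrite /hyp2 /= addrK.
apply: le_trans (nm2D _ _) _; rewrite nm2N.
have := nm2_cosin (P := P) (coefc v1) (coefs v1); rewrite /critnorm /hypnorm.
have := nm2_ge0 (hyp1 (v1, v2)); have := cabs_ge0 (coefc v1).
have := cabs_ge0 (coefs v1).
by norm2_lra.
Qed.

Lemma nm2_slaved v1 v2 : nm2 (slaved v1 v2) <= 2 * hypnorm (v1, v2).
Proof.
rewrite slaved_hyp /hypnorm; have := nm2D (hyp1 (v1, v2)) (2 * hyp2 (v1, v2)).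
have := nm2Z 2 (hyp2 (v1, v2)); rewrite con_nat.
rewrite -(rmorph_nat (real_complex R)) cabsr ger0_norm //.
have := nm2_ge0 (hyp1 (v1, v2)).
by norm2_lra.
Qed.

Lemma nm_nm2 v : nm v <= nm2 v.
Proof. by rewrite /nm2 -addrA lerDl addr_ge0 ?nm_ge0. Qed.
Lemma nm_der_nm2 v : nm (der v) <= nm2 v.
Proof. by rewrite /nm2 addrAC lerDr addr_ge0 ?nm_ge0. Qed.
Lemma nm_der2_nm2 v : nm (der (der v)) <= nm2 v.
Proof. by rewrite /nm2 lerDr addr_ge0 ?nm_ge0. Qed.

(** The two solvability conditions on the critical mode: the first component
    fixes the critical mode of the slaved combination, and the left kernel
    [(2, 1)] of the critical symbol yields the bifurcation equation. *)
Lemma coefc_slaved e k u1 u2 v1 v2 :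
  2 * coefc (slaved v1 v2) = coefc (linop1 e k u1 u2 v1 v2)
    + k%:C * coefc v1 - coefc (excess e u1 u2 v1 v2).
Proof.
have := congr1 coefc (linop1_critical e k u1 u2 v1 v2).
rewrite -(con_nat 3) -(con_nat 4) /slaved -(con_nat 2).
rewrite !(coefcD, coefcZ, coefcN, coefc_der, coefs_der) => h.
by transitivity (- coefc v1 + 3 * coefc v1 + 4 * coefc v2); [ring | rewrite h; ring].
Qed.

Lemma coefs_slaved e k u1 u2 v1 v2 :
  2 * coefs (slaved v1 v2) = coefs (linop1 e k u1 u2 v1 v2)
    + k%:C * coefs v1 - coefs (excess e u1 u2 v1 v2).
Proof.
have := congr1 coefs (linop1_critical e k u1 u2 v1 v2).
rewrite -(con_nat 3) -(con_nat 4) /slaved -(con_nat 2).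
rewrite !(coefsD, coefsZ, coefsN, coefc_der, coefs_der) => h.
by transitivity (- coefs v1 + 3 * coefs v1 + 4 * coefs v2); [ring | rewrite h; ring].
Qed.

Definition forcing e k u1 u2 v1 v2 : pfun P :=
  2 * linop1 e k u1 u2 v1 v2 + linop2 e k u1 u2 v1 v2.

Lemma slaved_eq e k u1 u2 v1 v2 :
  2 * (der (der (slaved v1 v2)) + slaved v1 v2) =
  forcing e k u1 u2 v1 v2 - 2 * (k%:f * der (der (slaved v1 v2)))
    - excess e u1 u2 v1 v2.
Proof.
rewrite /forcing /linop1 /linop2 /excess /slaved !derD !der_nat.
by rewrite !(rmorphD, rmorph1, rmorph_nat); ring.
Qed.

Lemma coefc_solvability e k u1 u2 v1 v2 :
  coefc (forcing e k u1 u2 v1 v2) + 2 * (k%:C * coefc (slaved v1 v2))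
    - coefc (excess e u1 u2 v1 v2) = 0.
Proof.
have := congr1 coefc (slaved_eq e k u1 u2 v1 v2); rewrite -(con_nat 2).
move: (forcing _ _ _ _ _ _) (excess _ _ _ _ _) (slaved _ _) => F E y.
rewrite !(coefcD, coefcZ, coefcN, coefc_der, coefs_der) => h.
by transitivity (2 * (- coefc y + coefc y)); [rewrite h; ring | ring].
Qed.

Lemma coefs_solvability e k u1 u2 v1 v2 :
  coefs (forcing e k u1 u2 v1 v2) + 2 * (k%:C * coefs (slaved v1 v2))
    - coefs (excess e u1 u2 v1 v2) = 0.
Proof.
have := congr1 coefs (slaved_eq e k u1 u2 v1 v2); rewrite -(con_nat 2).
move: (forcing _ _ _ _ _ _) (excess _ _ _ _ _) (slaved _ _) => F E y.
rewrite !(coefsD, coefsZ, coefsN, coefc_der, coefs_der) => h.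
by transitivity (2 * (- coefs y + coefs y)); [rewrite h; ring | ring].
Qed.

Local Notation Cs := (@pcos R P).
Local Notation Sn := (@psin R P).

Lemma avg_der2 (f w : pfun P) : avg (der (der f) * w) = avg (f * der (der w)).
Proof. by rewrite avg_parts avg_parts opprK. Qed.

Lemma der2_cos2 : der (der (Cs ^+ 2)) = 2 - 4 * Cs ^+ 2.
Proof.
rewrite derX der_cos expr1 -mulrA der_nat derM derN der_cos der_sin.
have -> : - Sn * - Sn = Sn ^+ 2 by ring.
have -> : Sn ^+ 2 = 1 - Cs ^+ 2 by rewrite -pythagoras; ring.
by ring.
Qed.

Lemma der2_cos_sin : der (der (Cs * Sn)) = - (4 * (Cs * Sn)).
Proof. by rewrite derM der_cos der_sin derD !derM derN der_cos der_sin; ring. Qed.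

(** The harmonics 0 and 2 of a solution of [y'' + y = r]. *)
Lemma helmholtz_cos2 (y r : pfun P) : 2 * (der (der y) + y) = r ->
  6 * avg (y * Cs ^+ 2) = 2 * avg r - avg (r * Cs ^+ 2).
Proof.
move=> <-; rewrite -!mulrA !avg_nat (mulrDl (der (der y))) !avgD avg_der2 der2_cos2.
rewrite (mulrBr y) avgB [y * 2]mulrC [y * (4 * _)]mulrCA !avg_nat avg_der; ring.
Qed.

Lemma helmholtz_cos_sin (y r : pfun P) : 2 * (der (der y) + y) = r ->
  6 * avg (y * (Cs * Sn)) = - avg (r * (Cs * Sn)).
Proof.
move=> <-; rewrite -!mulrA !avg_nat (mulrDl (der (der y))) !avgD avg_der2 der2_cos_sin.
by rewrite mulrN avgN [y * (4 * _)]mulrCA !avg_nat; ring.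
Qed.

Lemma avg_cos3_sin : avg (Cs ^+ 3 * Sn) = 0.
Proof.
have := avg_der (Cs ^+ 4); rewrite derX der_cos.
have -> : 4%:R * Cs ^+ 3 * - Sn = (- 4)%:S * (Cs ^+ 3 * Sn).
  by rewrite rmorphN con_nat; ring.
by rewrite avgZ => /eqP; rewrite mulf_eq0 oppr_eq0 pnatr_eq0 /= => /eqP.
Qed.

Lemma avg_cos4 : avg (Cs ^+ 4) = 3 / 8.
Proof.
have := avg_der (Cs ^+ 3 * Sn); rewrite derM derX der_cos der_sin.
have -> : 3%:R * Cs ^+ 2 * - Sn * Sn + Cs ^+ 3 * Cs =
    4%:S * Cs ^+ 4 + (- 3)%:S * Cs ^+ 2.
  have -> : 3%:R * Cs ^+ 2 * - Sn * Sn + Cs ^+ 3 * Cs =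
     - 3 * Cs ^+ 2 * Sn ^+ 2 + Cs ^+ 4 by ring.
  have -> : Sn ^+ 2 = 1 - Cs ^+ 2 by rewrite -pythagoras; ring.
  by rewrite rmorphN !con_nat; ring.
rewrite avgD !avgZ avg_cos2 => h.
have four0 : (4 : R[i]) != 0 by rewrite pnatr_eq0.
by apply: (mulfI four0); rewrite -[LHS]subr0 -h; field.
Qed.

Lemma avg_cos2_sin2 : avg (Cs ^+ 2 * Sn ^+ 2) = 1 / 8.
Proof.
have -> : Cs ^+ 2 * Sn ^+ 2 = Cs ^+ 2 - Cs ^+ 4.
  have -> : Sn ^+ 2 = 1 - Cs ^+ 2 by rewrite -pythagoras; ring.
  by ring.
by rewrite avgB avg_cos2 avg_cos4; field.
Qed.

(** Expansion of the critical projections of the excess: the quadratic terms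
    vanish on the kernel vector [(2, -1)], so that only the harmonics 0 and 2
    and the cubic resonance remain, up to the remainder [excess_rest]. *)
Definition excess_rest e a u1 u2 v1 v2 : pfun P :=
  let w := u1 - (2 * a)%:f * Cs in let z := u2 + a%:f * Cs in
  let h1 := hyp1 (v1, v2) in let h2 := hyp2 (v1, v2) in
  2 * (w * slaved v1 v2) + 2 * (h1 * slaved u1 u2) + (e ^+ 2)%:f * (u1 * v1)
  + (2 * ((2 * (a%:f * Cs * z) - a%:f * Cs * w + w * z) * v1)
     - 4 * (a%:f * Cs * (a%:f * Cs) * h1) + (4 * (a%:f * Cs * w) + w * w) * v2
     + 4 * (a%:f * Cs * (a%:f * Cs) * h2)).

Lemma excess_expand e a u1 u2 v1 v2 : excess e u1 u2 v1 v2 =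
  (e ^+ 2)%:f * v1 + (4 * a)%:f * (Cs * slaved v1 v2)
  + 4 * (cosin (coefc v1) (coefs v1) * slaved u1 u2)
  - (12 * a ^+ 2)%:f * (Cs ^+ 2 * cosin (coefc v1) (coefs v1))
  + excess_rest e a u1 u2 v1 v2.
Proof.
rewrite /excess /potential /excess_rest /hyp1 /hyp2 /slaved /cosin /=.
by rewrite !(rmorphM, rmorphXn, rmorphD, rmorph_nat); ring.
Qed.

Lemma coefc_excess e a u1 u2 v1 v2 : coefc (excess e u1 u2 v1 v2)
    - (e ^+ 2 - 9 / 2 * a ^+ 2)%:C * coefc v1 =
  (4 * a)%:C * avg (slaved v1 v2 * Cs ^+ 2)
  + 4 * (coefc v1 * avg (slaved u1 u2 * Cs ^+ 2)
         + coefs v1 * avg (slaved u1 u2 * (Cs * Sn)))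
  + avg (excess_rest e a u1 u2 v1 v2 * Cs).
Proof.
rewrite (excess_expand e a); set rest := excess_rest _ _ _ _ _ _.
set y := slaved v1 v2; set yu := slaved u1 u2.
set c := coefc v1; set s := coefs v1.
have -> : coefc ((e ^+ 2)%:f * v1 + (4 * a)%:f * (Cs * y)
    + 4 * (cosin c s * yu) - (12 * a ^+ 2)%:f * (Cs ^+ 2 * cosin c s) + rest) =
  avg ((e ^+ 2)%:f * (v1 * Cs) + (4 * a)%:f * (y * Cs ^+ 2)
    + 4 * (c%:S * (yu * Cs ^+ 2) + s%:S * (yu * (Cs * Sn)))
    - (12 * a ^+ 2)%:f * (c%:S * Cs ^+ 4 + s%:S * (Cs ^+ 3 * Sn)) + rest * Cs).
  by rewrite /coefc /cosin; congr avg; ring.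
rewrite !(avgD, avgN, avgZ, avg_nat) avg_cos4 avg_cos3_sin -/(coefc v1) -/c.
by rewrite !(rmorphM, rmorphXn, rmorphB, rmorph_nat, fmorphV); field.
Qed.

Lemma coefs_excess e a u1 u2 v1 v2 : coefs (excess e u1 u2 v1 v2)
    - (e ^+ 2 - 3 / 2 * a ^+ 2)%:C * coefs v1 =
  (4 * a)%:C * avg (slaved v1 v2 * (Cs * Sn))
  + 4 * (coefc v1 * avg (slaved u1 u2 * (Cs * Sn))
         + coefs v1 * (avg (slaved u1 u2) - avg (slaved u1 u2 * Cs ^+ 2)))
  + avg (excess_rest e a u1 u2 v1 v2 * Sn).
Proof.
rewrite (excess_expand e a); set rest := excess_rest _ _ _ _ _ _.
set y := slaved v1 v2; set yu := slaved u1 u2.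
set c := coefc v1; set s := coefs v1.
have -> : coefs ((e ^+ 2)%:f * v1 + (4 * a)%:f * (Cs * y)
    + 4 * (cosin c s * yu) - (12 * a ^+ 2)%:f * (Cs ^+ 2 * cosin c s) + rest) =
  avg ((e ^+ 2)%:f * (v1 * Sn) + (4 * a)%:f * (y * (Cs * Sn))
    + 4 * (c%:S * (yu * (Cs * Sn)) + s%:S * (yu - yu * Cs ^+ 2))
    - (12 * a ^+ 2)%:f * (c%:S * (Cs ^+ 3 * Sn) + s%:S * (Cs ^+ 2 * Sn ^+ 2))
    + rest * Sn).
  have -> : yu - yu * Cs ^+ 2 = yu * Sn ^+ 2 by rewrite -{1}[yu]mulr1 -pythagoras; ring.
  by rewrite /coefs /cosin; congr avg; ring.
rewrite !(avgD, avgN, avgZ, avg_nat) avg_cos2_sin2 avg_cos3_sin -/(coefs v1) -/s.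
by rewrite !(rmorphM, rmorphXn, rmorphB, rmorph_nat, fmorphV); field.
Qed.

Lemma profile_slaved_eq e k u1 u2 : is_profile e k u1 u2 ->
  2 * (der (der (slaved u1 u2)) + slaved u1 u2) =
  - (2 * (k%:f * der (der (slaved u1 u2))) + (e ^+ 2)%:f * u1
     + (2 * (u1 * slaved u1 u2) + (e ^+ 2 / 2)%:f * (u1 * u1) + u1 * u1 * u2)).
Proof.
move=> [p1 p2]; apply/eqP; rewrite -subr_eq0 opprK; apply/eqP.
rewrite -[RHS]addr0 -[X in _ = X + _](mulr0 2) -[X in _ = _ * X + _]p1 -p2.
rewrite /nonlinearity /slaved !derD !der_nat.
by rewrite !(rmorphD, rmorph1, rmorph_nat); ring.
Qed.

Lemma rmorph_reduced (x y z : R) :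
  (x ^+ 2 + 4 * y ^+ 2 - z)%:C = x%:C ^+ 2 + 4 * y%:C ^+ 2 - z%:C :> R[i].
Proof.
by rewrite !(rmorphB, rmorphD, rmorphM, rmorphXn, rmorph_nat).
Qed.

Lemma rmorph_floquet (x y : R) :
  (1 + x)%:C * (y ^+ 2)%:C = (1 + x%:C) * y%:C ^+ 2 :> R[i].
Proof. by rewrite !(rmorphD, rmorph1, rmorphXn). Qed.

(** The elimination of the slaved coordinates from the solvability condition, as
    an identity in a commutative ring with a square root [I] of [-1]. *)
Lemma reduced_identity (K : comNzRingType) (I l s d c z yc ys E A : K) :
  I ^+ 2 = -1 ->
  A - 2 * ((1 + l) * (2 * (I * s * ys) - s ^+ 2 * yc)) + 2 * (l * yc) - E = 0 ->
  A + (l ^+ 2 + 4 * s ^+ 2 - d) * c - 4 * I * l * s * z =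
  (E - d * c) + 2 * (I * s) * (2 * ys - l * z - 2 * (I * s) * c)
  - l * (2 * yc - l * c + 2 * (I * s) * z) + 2 * (2 * (I * s) * l) * ys
  - 2 * ((1 + l) * s ^+ 2) * yc.
Proof.
move=> i2 /eqP; rewrite subr_eq0 => /eqP hE.
have -> : 2 * (I * s) * (2 * ys - l * z - 2 * (I * s) * c) =
  2 * (I * s) * (2 * ys - l * z) - 4 * (I ^+ 2) * s ^+ 2 * c by ring.
by rewrite i2 -hE; ring.
Qed.

End LinearizedOperator.

Section Family.
Context {R : realType} {P : calculus R} {T : Type}.
Local Notation "x %:f" := (@con R P (real_complex R x)) (at level 2, format "x %:f").
Local Notation Cs := (@pcos R P).
Local Notation Sn := (@psin R P).

(** Families of exact profiles of small amplitude [2 * a], uniformly close to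
    their leading part. *)
Record profiles (mag e k a : T -> R) (u1 u2 : T -> pfun P) : Prop := {
  prof_e : forall t, 0 < e t <= 1;
  prof_mag : forall t, e t <= mag t;
  prof_k : isO mag (fun t => `|k t|) e;
  prof_a : isO mag (fun t => `|a t|) e;
  prof_u1 : isO mag (fun t => nm (u1 t - (2 * a t)%:f * Cs)) (fun t => e t ^+ 2);
  prof_u2 : isO mag (fun t => nm (u2 t + (a t)%:f * Cs)) (fun t => e t ^+ 2);
  prof_eq : forall t, is_profile (e t) (k t) (u1 t) (u2 t)
}.

Variables (mag e k a : T -> R) (u1 u2 : T -> pfun P).
Hypothesis prof : profiles mag e k a u1 u2.
Local Notation "f \isO g" := (isO mag f g) (at level 70).

Let e0 t : 0 < e t. Proof. by have /andP[] := prof_e prof t. Qed.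
Let e0' t : 0 <= e t. Proof. exact: ltW. Qed.
Let e1 t : e t <= 1. Proof. by have /andP[] := prof_e prof t. Qed.
Let e2 t : 0 <= e t ^+ 2. Proof. exact: sqr_ge0. Qed.
Let e21 t : e t ^+ 2 <= e t.
Proof. by rewrite expr2 ler_piMr ?e0' ?e1. Qed.
Let e32 t : e t ^+ 3 <= e t ^+ 2.
Proof. by rewrite exprS ler_piMl ?e2 ?e1. Qed.

Let e3 t : 0 <= e t ^+ 3. Proof. by rewrite exprn_ge0. Qed.

Lemma isO_cos (z : T -> R[i]) g :
  (fun t => cabs (z t)) \isO g -> (fun t => nm (con (z t) * Cs)) \isO g.
Proof.
by move=> h; apply: isO_nm1 => [t|]; [exact: nm_cos|apply: isO_pw h => t; rewrite nm_con].
Qed.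

Let Ocabs (f : T -> R) g : (fun t => `|f t|) \isO g ->
  (fun t => cabs (f t)%:C) \isO g.
Proof. by apply: isO_pw => t; rewrite cabsr. Qed.

Let Ocabs_pos (f : T -> R) : (forall t, 0 <= f t) ->
  (fun t => cabs (f t)%:C) \isO f.
Proof. by move=> f0; apply: isO_pw (isO_refl _ f) => t; rewrite cabsr ger0_norm. Qed.

Lemma profile_size1 : (fun t => nm (u1 t)) \isO e.
Proof.
apply: (@isO_pw _ _ _ _
    (fun t => nm ((u1 t - (2 * a t)%:f * Cs) + 2 * ((a t)%:f * Cs)))).
  by move=> t; rewrite rmorphM rmorphM !rmorph_nat mulrA subrK.
apply: isO_nmD; first exact: isO_mono (prof_u1 prof) e21.
by apply: isO_nm_nat; apply: isO_cos; apply: Ocabs; exact: prof_a prof.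
Qed.

Lemma profile_size2 : (fun t => nm (u2 t)) \isO e.
Proof.
apply: (@isO_pw _ _ _ _ (fun t => nm ((u2 t + (a t)%:f * Cs) - (a t)%:f * Cs))).
  by move=> t; rewrite addrK.
apply: isO_nmB; first exact: isO_mono (prof_u2 prof) e21.
by apply: isO_cos; apply: Ocabs; exact: prof_a prof.
Qed.

Lemma profile_slaved : (fun t => nm (slaved (u1 t) (u2 t))) \isO (fun t => e t ^+ 2).
Proof.
apply: (@isO_pw _ _ _ _ (fun t => nm ((u1 t - (2 * a t)%:f * Cs)
   + 2 * (u2 t + (a t)%:f * Cs)))).
  move=> t; rewrite /slaved le_eqVlt; apply/orP; left; apply/eqP; congr nm.
  by rewrite rmorphM rmorphM !rmorph_nat; ring.
by apply: isO_nmD; [exact: prof_u1 prof | apply: isO_nm_nat; exact: prof_u2 prof].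
Qed.

Section Linear.
Variables (v1 v2 : T -> pfun P).
Local Notation G1 t := (linop1 (e t) (k t) (u1 t) (u2 t) (v1 t) (v2 t)).
Local Notation G2 t := (linop2 (e t) (k t) (u1 t) (u2 t) (v1 t) (v2 t)).
Local Notation E t := (excess (e t) (u1 t) (u2 t) (v1 t) (v2 t)).
Local Notation y t := (slaved (v1 t) (v2 t)).
Local Notation yu t := (slaved (u1 t) (u2 t)).
Local Notation X t := (critnorm (v1 t)).
Local Notation N t := (hypnorm (v1 t, v2 t)).
Local Notation g t := (nm (G1 t) + nm (G2 t)).

Let X0 t : 0 <= X t. Proof. exact: critnorm_ge0. Qed.
Let N0 t : 0 <= N t. Proof. exact: hypnorm_ge0. Qed.
Let g0 t : 0 <= g t. Proof. by rewrite addr_ge0 ?nm_ge0. Qed.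
Let XN0 t : 0 <= X t + N t. Proof. by rewrite addr_ge0. Qed.

Lemma isO_comp1 : (fun t => nm2 (v1 t)) \isO (fun t => X t + N t).
Proof.
apply: (@isO_le _ _ _ _ _ 6) => // t; have := nm2_comp1 (v1 t) (v2 t).
by move: (N0 t); move: (X t) (N t); norm2_lra.
Qed.

Lemma isO_comp2 : (fun t => nm2 (v2 t)) \isO (fun t => X t + N t).
Proof.
apply: (@isO_le _ _ _ _ _ 6) => // t; have := nm2_comp2 (v1 t) (v2 t).
by move: (N0 t); move: (X t) (N t); norm2_lra.
Qed.

Lemma isO_slaved : (fun t => nm2 (y t)) \isO (fun t => N t).
Proof. by apply: (@isO_le _ _ _ _ _ 2) => // t; exact: nm2_slaved. Qed.

Let Ov1 := isO_pw (fun t => nm_nm2 (v1 t)) isO_comp1.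
Let Ov2 := isO_pw (fun t => nm_nm2 (v2 t)) isO_comp2.
Let Oy := isO_pw (fun t => nm_nm2 (y t)) isO_slaved.
Let Oddv1 := isO_pw (fun t => nm_der2_nm2 (v1 t)) isO_comp1.
Let Oddv2 := isO_pw (fun t => nm_der2_nm2 (v2 t)) isO_comp2.
Let Oddy := isO_pw (fun t => nm_der2_nm2 (y t)) isO_slaved.

Let Ov1yu : (fun t => nm (v1 t * yu t)) \isO (fun t => e t ^+ 2 * (X t + N t)).
Proof.
apply: isO_mono (isO_nmM Ov1 profile_slaved) _ => t.
by rewrite mulrC.
Qed.
Let Oeuv : (fun t => nm ((e t ^+ 2)%:f * (u1 t * v1 t)))
  \isO (fun t => e t ^+ 3 * (X t + N t)).
Proof.
apply: isO_mono (isO_nmZ (Ocabs_pos e2) (isO_nmM profile_size1 Ov1)) _ => t.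
by rewrite mulrA -exprSr.
Qed.

Lemma excess_crude :
  (fun t => nm (E t)) \isO (fun t => e t ^+ 2 * (X t + N t) + e t * N t).
Proof.
have h (f : T -> R) : f \isO (fun t => e t ^+ 2 * (X t + N t)) ->
    f \isO (fun t => e t ^+ 2 * (X t + N t) + e t * N t).
  by move=> hf; apply: isO_mono hf _ => t; rewrite lerDl mulr_ge0.
apply: (@isO_pw _ _ _ _ (fun t => nm (
  (e t ^+ 2)%:f * v1 t
  + 2 * (u1 t * y t) + 2 * (v1 t * yu t)
  + (e t ^+ 2)%:f * (u1 t * v1 t) + (2 * (u1 t * u2 t * v1 t) + u1 t ^+ 2 * v2 t)))).
  by move=> t; rewrite excessE.
apply: isO_nmD; first apply: isO_nmD; first apply: isO_nmD; first apply: isO_nmD.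
- by apply: h; exact: (isO_nmZ (Ocabs_pos e2) Ov1).
- apply: isO_nm_nat; apply: isO_mono (isO_nmM profile_size1 Oy) _ => t.
  by rewrite lerDr mulr_ge0.
- by apply: h; exact: isO_nm_nat.
- apply: h; apply: isO_mono Oeuv _ => t; exact: ler_wpM2r.
- apply: h; apply: isO_nmD.
    apply: isO_nm_nat.
    exact: (isO_nmM (isO_nmM profile_size1 profile_size2) Ov1).
  exact: (isO_nmM (isO_nmM profile_size1 profile_size1) Ov2).
Qed.

(** The non-critical part of a solution is slaved to the critical modes and to
    the forcing: this inverts the critical operator and absorbs the rest. *)
Lemma hypnorm_estimate : (fun t => N t) \isO (fun t => e t * X t + g t).
Proof.
have [K K0 HK] := @hyperbolic_bound R P.
apply: isO_absorb => //.
apply: (@isO_trans _ _ _ _ (fun t => e t * (X t + N t) + g t)); last first.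
  apply: (@isO_le _ _ _ _ _ 1) => // t; rewrite mul1r mulrDr addrAC lerD2l.
  by rewrite ler_wpM2r // (prof_mag prof).
have OE : (fun t => nm (E t)) \isO (fun t => e t * (X t + N t) + g t).
  apply: (isO_leq (K := 2) excess_crude) => // t.
  have := ler_wpM2r (XN0 t) (e21 t); have := g0 t.
  have := ler_wpM2l (e0' t) (_ : N t <= X t + N t); rewrite lerDr => /(_ (X0 t)).
  by move: (e t ^+ 2 * _) (e t * _) (e t * _) (g t); move=> *; lra.
have OkD (f : T -> pfun P) : (fun t => nm (f t)) \isO (fun t => X t + N t) ->
    (fun t => nm ((k t)%:f * f t)) \isO (fun t => e t * (X t + N t) + g t).
  move=> hf; apply: isO_mono (isO_nmZ (Ocabs (prof_k prof)) hf) _ => t.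
  by rewrite lerDl.
have OG1 : (fun t => nm (G1 t)) \isO (fun t => e t * (X t + N t) + g t).
  apply: (@isO_le _ _ _ _ _ 1) => // t; rewrite mul1r addrCA lerDl addr_ge0 //.
    by rewrite mulr_ge0.
  exact: nm_ge0.
have OG2 : (fun t => nm (G2 t)) \isO (fun t => e t * (X t + N t) + g t).
  apply: (@isO_le _ _ _ _ _ 1) => // t; rewrite mul1r addrA lerDr addr_ge0 //.
    by rewrite mulr_ge0.
  exact: nm_ge0.
apply: (@isO_trans _ _ _ _ (fun t =>
    nm (G1 t - (k t)%:f * der (der (v1 t)) - E t)
    + nm (G2 t - 4 * ((k t)%:f * der (der (v2 t))) + E t))).
  apply: (@isO_le _ _ _ _ _ K) => // t; apply: HK.
    exact: linop1_critical.
  exact: linop2_critical.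
apply: isOD.
  by apply: isO_nmB => //; apply: isO_nmB => //; exact: OkD Oddv1.
apply: isO_nmD => //; apply: isO_nmB => //; apply: isO_nm_nat; exact: OkD Oddv2.
Qed.

(** * Third order terms of the linearization *)

Lemma excess_bound : (fun t => nm (E t)) \isO (fun t => e t ^+ 2 * X t + e t * g t).
Proof.
have h := isOM e0' N0 (isO_refl mag e) hypnorm_estimate.
apply: isO_trans excess_crude _.
apply: (@isO_pw _ _ _ _ (fun t => e t ^+ 2 * X t + (e t * N t + e t * N t))).
  by move=> t; rewrite mulrDr -addrA !lerD // ler_wpM2r.
apply: isOD.
  by apply: isO_mono (isO_refl mag _) _ => t; rewrite lerDl mulr_ge0.
have h' : (fun t => e t * N t) \isO (fun t => e t ^+ 2 * X t + e t * g t).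
  by apply: isO_mono h _ => t; rewrite mulrDr expr2 -!mulrA.
exact: isOD.
Qed.

Local Notation F t := (forcing (e t) (k t) (u1 t) (u2 t) (v1 t) (v2 t)).
Local Notation m t := (cabs (avg (F t)) + cabs (avg (F t * Cs ^+ 2))
  + cabs (avg (F t * (Cs * Sn)))).

Let m0 t : 0 <= m t. Proof. by rewrite !addr_ge0 ?cabs_ge0. Qed.

Let ON : (fun t => e t * N t) \isO (fun t => e t ^+ 2 * X t + e t * g t).
Proof.
apply: isO_mono (isOM e0' N0 (isO_refl mag e) hypnorm_estimate) _ => t.
by rewrite mulrDr expr2 -!mulrA.
Qed.

Let Oparts (w : pfun P) : nm w <= 1 ->
  (fun t => cabs (avg (F t * w))) \isO (fun t => m t + (e t ^+ 2 * X t + e t * g t)) ->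
  (fun t => cabs (avg ((F t - 2 * ((k t)%:f * der (der (y t))) - E t) * w)))
    \isO (fun t => m t + (e t ^+ 2 * X t + e t * g t)).
Proof.
move=> w1 hw; have mono (f : T -> R) : f \isO (fun t => e t ^+ 2 * X t + e t * g t) ->
    f \isO (fun t => m t + (e t ^+ 2 * X t + e t * g t)).
  by move=> hf; apply: isO_mono hf _ => t; rewrite lerDr.
apply: (@isO_pw _ _ _ _ (fun t => cabs (avg (F t * w)
    - avg (2 * ((k t)%:f * der (der (y t))) * w) - avg (E t * w)))).
  by move=> t; rewrite !mulrBl !avgB.
apply: isO_cabsB; first apply: isO_cabsB => //.
  apply: mono; apply: isO_avg; apply: (isO_nm1 (H := fun=> w)) => //.
  apply: isO_nm_nat; apply: isO_trans ON.
  exact: (isO_nmZ (Ocabs (prof_k prof)) Oddy).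
apply: mono; apply: isO_avg; apply: (isO_nm1 (H := fun=> w)) => //.
exact: excess_bound.
Qed.

Let nmcos2 : nm (Cs ^+ 2) <= 1.
Proof.
rewrite expr2; apply: le_trans (nmM _ _) _.
by apply: mulr_ile1; rewrite ?nm_ge0 ?nm_cos.
Qed.

Let nmcossin : nm (Cs * Sn) <= 1.
Proof.
apply: le_trans (nmM _ _) _.
by apply: mulr_ile1; rewrite ?nm_ge0 ?nm_cos ?nm_sin.
Qed.

Let nm_1 : nm (1 : pfun P) <= 1.
Proof. by rewrite -(rmorph1 con) nm_con -(rmorph1 (real_complex R)) cabsr normr1. Qed.

(** The harmonics 0 and 2 of the slaved combination are not critical: they are
    determined by the forcing [F] through [slaved_eq]. *)
Lemma slaved_moments :
  (fun t => cabs (avg (y t * Cs ^+ 2)))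
    \isO (fun t => m t + (e t ^+ 2 * X t + e t * g t)) /\
  (fun t => cabs (avg (y t * (Cs * Sn))))
    \isO (fun t => m t + (e t ^+ 2 * X t + e t * g t)).
Proof.
have mm (f : T -> R) : (forall t, f t <= m t) ->
    f \isO (fun t => m t + (e t ^+ 2 * X t + e t * g t)).
  move=> fm; apply: (@isO_le _ _ _ _ _ 1) => // t; rewrite mul1r.
  by apply: le_trans (fm t) _; rewrite lerDl addr_ge0 ?mulr_ge0.
have c0 z : 0 <= cabs (z : R[i]) := cabs_ge0 z.
have eq t := slaved_eq (e t) (k t) (u1 t) (u2 t) (v1 t) (v2 t).
split; apply: (isO_cabs_nat (n := 5)).
  apply: (isO_eq (fun t => congr1 (@cabs R) (helmholtz_cos2 (eq t)))).
  apply: isO_cabsB.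
    apply: isO_cabsZ.
    apply: (isO_eq (g := fun t => cabs (avg ((F t - 2 * ((k t)%:f * der (der (y t)))
      - E t) * 1)))).
      by move=> t; rewrite mulr1.
    by apply: Oparts => //; apply: mm => t; rewrite mulr1 -addrA lerDl addr_ge0.
  by apply: Oparts => //; apply: mm => t; rewrite addrAC lerDr addr_ge0.
apply: (isO_eq (fun t => congr1 (@cabs R) (helmholtz_cos_sin (eq t)))).
apply: isO_cabsN.
by apply: Oparts => //; apply: mm => t; rewrite lerDr addr_ge0.
Qed.

Let Ow := prof_u1 prof.
Let Oz := prof_u2 prof.
Let Oa := Ocabs (prof_a prof).
Let OaC : (fun t => nm ((a t)%:f * Cs)) \isO e.
Proof. by apply: isO_cos; exact: Oa. Qed.

Lemma excess_rest_bound :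
  (fun t => nm (excess_rest (e t) (a t) (u1 t) (u2 t) (v1 t) (v2 t)))
  \isO (fun t => e t ^+ 3 * X t + e t ^+ 2 * g t).
Proof.
have key : (fun t => e t ^+ 2 * N t) \isO (fun t => e t ^+ 3 * X t + e t ^+ 2 * g t).
  apply: isO_mono (isOM e2 N0 (isO_refl mag _) hypnorm_estimate) _ => t.
  by rewrite mulrDr mulrA -exprSr.
have red (f : T -> R) : f \isO (fun t => e t ^+ 3 * (X t + N t)) ->
    f \isO (fun t => e t ^+ 3 * X t + e t ^+ 2 * g t).
  move=> hf; apply: isO_trans hf _; apply: (@isO_pw _ _ _ _
    (fun t => e t ^+ 3 * X t + e t ^+ 2 * N t)).
    by move=> t; rewrite mulrDr lerD2l ler_wpM2r.
  apply: isOD key; apply: isO_mono (isO_refl mag _) _ => t.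
  by rewrite lerDl mulr_ge0.
have e4 t : e t ^+ 2 * e t ^+ 2 <= e t ^+ 3.
  by rewrite -exprD -[(2 + 2)%N]/4%N exprS ler_piMl ?e1 ?e3.
have h1 : (fun t => nm (hyp1 (v1 t, v2 t))) \isO (fun t => N t).
  apply: (@isO_le _ _ _ _ _ 1) => // t; rewrite mul1r.
  by apply: le_trans (nm_nm2 _) _; rewrite lerDl nm2_ge0.
have h2 : (fun t => nm (hyp2 (v1 t, v2 t))) \isO (fun t => N t).
  apply: (@isO_le _ _ _ _ _ 1) => // t; rewrite mul1r.
  by apply: le_trans (nm_nm2 _) _; rewrite lerDr nm2_ge0.
rewrite /excess_rest.
apply: isO_nmD; first apply: isO_nmD; first apply: isO_nmD.
- apply: isO_nm_nat; apply: isO_trans key.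
  exact: (isO_nmM Ow Oy).
- apply: isO_nm_nat; apply: isO_trans key.
  by apply: isO_mono (isO_nmM h1 profile_slaved) _ => t; rewrite mulrC.
- by apply: red.
have Oaw : (fun t => nm ((a t)%:f * Cs * (u1 t - (2 * a t)%:f * Cs)))
    \isO (fun t => e t ^+ 3).
  by apply: isO_mono (isO_nmM OaC Ow) _ => t; rewrite -exprS.
have Oaz : (fun t => nm ((a t)%:f * Cs * (u2 t + (a t)%:f * Cs)))
    \isO (fun t => e t ^+ 3).
  by apply: isO_mono (isO_nmM OaC Oz) _ => t; rewrite -exprS.
apply: isO_nmD; first apply: isO_nmD; first apply: isO_nmB.
- apply: isO_nm_nat; apply: red; apply: isO_nmM Ov1.
  apply: isO_nmD; first by apply: isO_nmB; [exact: isO_nm_nat|].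
  exact: isO_mono (isO_nmM Ow Oz) e4.
- apply: isO_nm_nat; apply: isO_trans key.
  exact: (isO_nmM (isO_nmM OaC OaC) h1).
- apply: red; apply: isO_nmM Ov2; apply: isO_nmD; first exact: isO_nm_nat.
  exact: isO_mono (isO_nmM Ow Ow) e4.
- apply: isO_nm_nat; apply: isO_trans key.
  exact: (isO_nmM (isO_nmM OaC OaC) h2).
Qed.

(** The order [e ^+ 3] of the harmonics 0 and 2 of the profile: the quadratic
    part of the reaction vanishes on the critical kernel. *)
Lemma profile_moments :
  [/\ (fun t => cabs (avg (yu t))) \isO (fun t => e t ^+ 3),
      (fun t => cabs (avg (yu t * Cs ^+ 2))) \isO (fun t => e t ^+ 3) &
      (fun t => cabs (avg (yu t * (Cs * Sn)))) \isO (fun t => e t ^+ 3)].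
Proof.
have eq t := profile_slaved_eq (prof_eq prof t).
pose rest t := (e t ^+ 2)%:f * u1 t
  + (2 * (u1 t * yu t) + (e t ^+ 2 / 2)%:f * (u1 t * u1 t) + u1 t * u1 t * u2 t).
have Orest : (fun t => nm (rest t)) \isO (fun t => e t ^+ 3).
  have exp3 t : e t ^+ 2 * e t <= e t ^+ 3 by rewrite -exprSr.
  apply: isO_nmD.
    exact: isO_mono (isO_nmZ (Ocabs_pos e2) profile_size1) exp3.
  apply: isO_nmD; first apply: isO_nmD.
  - apply: isO_nm_nat; apply: isO_mono (isO_nmM profile_size1 profile_slaved) _.
    by move=> t; rewrite -exprS.
  - have h : (fun t => cabs (e t ^+ 2 / 2)%:C) \isO (fun t => e t ^+ 2).
      apply: Ocabs; apply: (@isO_le _ _ _ _ _ 1) => // t; rewrite mul1r.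
      by rewrite ger0_norm ?divr_ge0 //; have := e2 t; lra.
    apply: isO_mono (isO_nmZ h (isO_nmM profile_size1 profile_size1)) _ => t.
    by rewrite mulrA -!exprSr exprSr ler_piMr ?e1.
  - by apply: isO_mono (isO_nmM (isO_nmM profile_size1 profile_size1)
      profile_size2) _ => t; rewrite -expr2 -exprSr.
have parts (w : pfun P) (K : R) : nm w <= 1 -> nm (der (der w)) <= K ->
    (fun t => cabs (avg (- (2 * ((k t)%:f * der (der (yu t))) + (e t ^+ 2)%:f * u1 t
     + (2 * (u1 t * yu t) + (e t ^+ 2 / 2)%:f * (u1 t * u1 t) + u1 t * u1 t * u2 t)) * w)))
    \isO (fun t => e t ^+ 3).
  move=> w1 wK; apply: (isO_eq (g := fun t => cabs (- (2 * ((k t)%:C *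
      avg (yu t * der (der w))) + avg (rest t * w))))).
    move=> t; congr cabs; rewrite -avg_der2 -avgZ -avg_nat -avgD -avgN; congr avg.
    by rewrite /rest; ring.
  apply: isO_cabsN; apply: isO_cabsD; last first.
    by apply: isO_avg; exact: (isO_nm1 (H := fun=> w)).
  apply: isO_cabsZ.
  have h : (fun t => cabs (avg (yu t * der (der w)))) \isO (fun t => e t ^+ 2).
    apply: isO_avg; apply: (isO_leq (K := K) (isO_nmM profile_slaved
      (isO_refl mag (fun=> nm (der (der w)))))).
      exact: le_trans (nm_ge0 _) wK.
    by move=> t; rewrite mulrC ler_wpM2r.
  by apply: isO_mono (isO_cabsM (Ocabs (prof_k prof)) h) _ => t; rewrite -exprS.
have d1 : nm (der (der (1 : pfun P))) <= nm (der (der (1 : pfun P))) by [].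
have dc : nm (der (der (Cs ^+ 2))) <= nm (der (der (Cs ^+ 2))) by [].
have ds : nm (der (der (Cs * Sn))) <= nm (der (der (Cs * Sn))) by [].
split.
- apply: (isO_cabs_nat (n := 1)).
  apply: (isO_eq _ (parts 1 _ nm_1 d1)) => t; congr cabs.
  by rewrite mulr1 -eq avg_nat avgD avg_der add0r.
- apply: (isO_cabs_nat (n := 5)).
  apply: (isO_eq (fun t => congr1 (@cabs R) (helmholtz_cos2 (eq t)))).
  apply: isO_cabsB; last exact: parts dc.
  apply: isO_cabsZ; apply: (isO_eq _ (parts 1 _ nm_1 d1)) => t.
  by rewrite mulr1.
- apply: (isO_cabs_nat (n := 5)).
  apply: (isO_eq (fun t => congr1 (@cabs R) (helmholtz_cos_sin (eq t)))).
  by apply: isO_cabsN; exact: parts ds.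
Qed.

Let gauge t := e t ^+ 3 * X t + e t ^+ 2 * g t + e t * m t.

Let Ogauge_rest f : f \isO (fun t => e t ^+ 3 * X t + e t ^+ 2 * g t) -> f \isO gauge.
Proof. by move=> hf; apply: isO_mono hf _ => t; rewrite lerDl mulr_ge0. Qed.

Let Omoment (z : T -> R[i]) :
  (fun t => cabs (z t)) \isO (fun t => m t + (e t ^+ 2 * X t + e t * g t)) ->
  (fun t => cabs ((4 * a t)%:C * z t)) \isO gauge.
Proof.
move=> hz; have h4 : (fun t => cabs (4 * a t)%:C) \isO e.
  apply: isO_trans (prof_a prof); apply: (@isO_le _ _ _ _ _ 4) => // t.
  by rewrite cabsr normrM ger0_norm.
apply: isO_mono (isO_cabsM h4 hz) _ => t; rewrite /gauge le_eqVlt.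
by apply/orP; left; apply/eqP; ring.
Qed.

Let Ocritical (z1 z2 : T -> R[i]) :
  (fun t => cabs (z1 t)) \isO (fun t => e t ^+ 3) ->
  (fun t => cabs (z2 t)) \isO (fun t => e t ^+ 3) ->
  (fun t => cabs (4 * (coefc (v1 t) * z1 t + coefs (v1 t) * z2 t))) \isO gauge.
Proof.
move=> h1 h2; apply: isO_cabsZ.
have h (z z' : T -> R[i]) : (forall t, cabs (z t) <= X t) ->
    (fun t => cabs (z' t)) \isO (fun t => e t ^+ 3) ->
    (fun t => cabs (z t * z' t)) \isO gauge.
  move=> zX hz'; apply: Ogauge_rest.
  apply: isO_mono (isO_cabsM (isO_pw zX (isO_refl _ _)) hz') _ => t.
  by rewrite mulrC lerDl mulr_ge0.
by apply: isO_cabsD; apply: h => // t; rewrite ?lerDl ?lerDr cabs_ge0.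
Qed.

Let nm1_avg (H : T -> pfun P) (w : pfun P) f : nm w <= 1 ->
  (fun t => nm (H t)) \isO f -> (fun t => cabs (avg (H t * w))) \isO f.
Proof. by move=> w1 hH; apply: isO_avg; exact: (isO_nm1 (H := fun=> w)). Qed.

(** The constants [9 / 2] here and [3 / 2] in [excess_sin] are 12 times the means
    of [Cs ^+ 4] and of [Cs ^+ 2 * Sn ^+ 2].  They differ because a phase shift of
    the pattern costs nothing, whereas a change of its amplitude does. *)
Lemma excess_cos : (fun t => cabs (coefc (E t)
    - (e t ^+ 2 - 9 / 2 * a t ^+ 2)%:C * coefc (v1 t))) \isO gauge.
Proof.
have [s1 s2] := slaved_moments; have [p0 p1 p2] := profile_moments.
apply: (isO_eq (fun t => congr1 (@cabs R) (coefc_excess _ _ _ _ _ _))).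
apply: isO_cabsD; first by apply: isO_cabsD; [exact: Omoment | exact: Ocritical].
by apply: Ogauge_rest; apply: nm1_avg excess_rest_bound; exact: nm_cos.
Qed.

Lemma excess_sin : (fun t => cabs (coefs (E t)
    - (e t ^+ 2 - 3 / 2 * a t ^+ 2)%:C * coefs (v1 t))) \isO gauge.
Proof.
have [s1 s2] := slaved_moments; have [p0 p1 p2] := profile_moments.
apply: (isO_eq (fun t => congr1 (@cabs R) (coefs_excess _ _ _ _ _ _))).
apply: isO_cabsD; first apply: isO_cabsD; first exact: Omoment.
  by apply: Ocritical => //; exact: isO_cabsB.
by apply: Ogauge_rest; apply: nm1_avg excess_rest_bound; exact: nm_sin.
Qed.

Let gauge_nm : gauge \isO (fun t => e t ^+ 3 * X t + e t ^+ 2 * g t + e t * nm (F t)).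
Proof.
have Om : (fun t => m t) \isO (fun t => nm (F t)).
  have h (w : pfun P) : nm w <= 1 ->
      (fun t => cabs (avg (F t * w))) \isO (fun t => nm (F t)).
    by move=> w1; apply: nm1_avg => //; exact: isO_refl.
  by apply: isOD; [apply: isOD; [exact: isO_avg (isO_refl _ _)|exact: h]|exact: h].
have F0 t : 0 <= nm (F t) := nm_ge0 _.
have p t : 0 <= e t ^+ 3 * X t + e t ^+ 2 * g t by rewrite addr_ge0 ?mulr_ge0.
apply: isOD.
  by apply: isO_mono (isO_refl mag _) _ => t; rewrite lerDl mulr_ge0.
by apply: isO_mono (isOM e0' m0 (isO_refl mag e) Om) _ => t; rewrite lerDr.
Qed.

Lemma excess_cos_nm : (fun t => cabs (coefc (E t)
    - (e t ^+ 2 - 9 / 2 * a t ^+ 2)%:C * coefc (v1 t)))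
  \isO (fun t => e t ^+ 3 * X t + e t ^+ 2 * g t + e t * nm (F t)).
Proof. exact: isO_trans excess_cos gauge_nm. Qed.

Lemma excess_sin_nm : (fun t => cabs (coefs (E t)
    - (e t ^+ 2 - 3 / 2 * a t ^+ 2)%:C * coefs (v1 t)))
  \isO (fun t => e t ^+ 3 * X t + e t ^+ 2 * g t + e t * nm (F t)).
Proof. exact: isO_trans excess_sin gauge_nm. Qed.

(** * The reduced Bloch equations *)

Section Bloch.
Variable sg : T -> R.
Hypothesis Osg : isO mag (fun t => `|sg t|) e.
Local Notation F1 t := (bloch1 (e t) (k t) (sg t) (u1 t) (u2 t) (v1 t) (v2 t)).
Local Notation F2 t := (bloch2 (e t) (k t) (sg t) (u1 t) (u2 t) (v1 t) (v2 t)).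
Local Notation nF t := (nm (F1 t) + nm (F2 t)).

Let nF0 t : 0 <= nF t. Proof. by rewrite addr_ge0 ?nm_ge0. Qed.

Let Ok := Ocabs (prof_k prof).
Let Os := Ocabs Osg.

Let Os2 : (fun t => cabs (sg t ^+ 2)%:C) \isO (fun t => e t ^+ 2).
Proof.
apply: (isO_eq (g := fun t => cabs ((sg t)%:C * (sg t)%:C))).
  by move=> t; rewrite expr2 rmorphM.
by apply: isO_mono (isO_cabsM Os Os) _ => t; rewrite expr2.
Qed.

Let Osi : (fun t => cabs ('i * (sg t)%:C)) \isO e.
Proof. exact: isO_cabsZ Os. Qed.

Let Ok1 : (fun t => cabs (1 + k t)%:C) \isO (fun=> 1).
Proof.
apply: (isO_eq (g := fun t => cabs (1%:C + (k t)%:C))).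
  by move=> t; rewrite rmorphD.
apply: isO_cabsD.
  by apply: (@isO_le _ _ _ _ _ 1) => // t; rewrite cabsr normr1 mul1r.
exact: isO_mono Ok e1.
Qed.

(** Every Floquet term carries a factor [sg], which is of order [e]. *)
Let Ofloquet (f : T -> pfun P) h : (forall t, 0 <= h t) -> (fun t => nm2 (f t)) \isO h ->
  (fun t => nm (floquet (k t) (sg t) (f t))) \isO (fun t => e t * h t).
Proof.
move=> h0 fh; rewrite /floquet.
apply: isO_mono (isO_nmZ Ok1 (_ : _ \isO (fun t => e t * h t))) _; last first.
  by move=> t; rewrite mul1r.
apply: isO_nmB.
  apply: isO_nm_nat; apply: isO_nmZ Osi _.
  by apply: isO_pw fh => t; exact: nm_der_nm2.
apply: isO_mono (isO_nmZ Os2 (isO_pw (fun t => nm_nm2 (f t)) fh)) _ => t.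
by rewrite ler_wpM2r.
Qed.

Let G_of_F1 t : G1 t = F1 t - floquet (k t) (sg t) (v1 t).
Proof. by rewrite /bloch1 addrK. Qed.
Let G_of_F2 t : G2 t = F2 t - 4 * floquet (k t) (sg t) (v2 t).
Proof. by rewrite /bloch2 addrK. Qed.

Let OG : (fun t => g t) \isO (fun t => nF t + e t * (X t + N t)).
Proof.
have h (i : T -> R) : (forall t, i t <= nF t) -> i \isO (fun t => nF t + e t * (X t + N t)).
  move=> hi; apply: (@isO_le _ _ _ _ _ 1) => // t; rewrite mul1r.
  by apply: le_trans (hi t) _; rewrite lerDl mulr_ge0.
have h' (i : T -> R) : i \isO (fun t => e t * (X t + N t)) ->
    i \isO (fun t => nF t + e t * (X t + N t)).
  by move=> hi; apply: isO_mono hi _ => t; rewrite lerDr.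
apply: isOD.
  apply: (isO_eq (fun t => congr1 nm (G_of_F1 t))); apply: isO_nmB.
    by apply: h => t; rewrite lerDl nm_ge0.
  by apply: h'; exact: Ofloquet isO_comp1.
apply: (isO_eq (fun t => congr1 nm (G_of_F2 t))); apply: isO_nmB.
  by apply: h => t; rewrite lerDr nm_ge0.
by apply: h'; apply: isO_nm_nat; exact: Ofloquet isO_comp2.
Qed.

Lemma bloch_hypnorm : (fun t => N t) \isO (fun t => e t * X t + nF t).
Proof.
apply: isO_absorb => //; apply: isO_trans hypnorm_estimate _.
have h (i : T -> R) : i \isO (fun t => nF t + e t * (X t + N t)) ->
    i \isO (fun t => e t * X t + nF t + mag t * N t).
  move=> hi; apply: isO_mono hi _ => t.
  rewrite mulrDr addrA [nF t + _]addrC lerD2l ler_wpM2r //.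
  exact: (prof_mag prof).
apply: isOD; apply: h => //.
apply: (@isO_le _ _ _ _ _ 1) => // t; rewrite mul1r (mulrDr (e t) (X t)).
rewrite addrCA lerDl addr_ge0 //.
by rewrite mulr_ge0.
Qed.

Let OeN : (fun t => e t * N t) \isO (fun t => e t ^+ 2 * X t + e t * nF t).
Proof.
apply: isO_mono (isOM e0' N0 (isO_refl mag e) bloch_hypnorm) _ => t.
by rewrite mulrDr expr2 -!mulrA.
Qed.

Let Og : (fun t => g t) \isO (fun t => e t * X t + nF t).
Proof.
apply: isO_trans OG _; apply: isOD.
  by apply: (@isO_le _ _ _ _ _ 1) => // t; rewrite mul1r lerDr mulr_ge0.
apply: (@isO_pw _ _ _ _ (fun t => e t * X t + N t)).
  by move=> t; rewrite mulrDr lerD2l ler_piMl.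
apply: isOD bloch_hypnorm.
by apply: (@isO_le _ _ _ _ _ 1) => // t; rewrite mul1r lerDl.
Qed.

Let small t := e t ^+ 2 * X t + nF t.
Let small0 t : 0 <= small t. Proof. by rewrite addr_ge0 // mulr_ge0. Qed.

Let Oe_small (f : T -> R) : f \isO (fun t => e t ^+ 2 * X t + e t * nF t) -> f \isO small.
Proof. by move=> hf; apply: isO_mono hf _ => t; rewrite lerD2l ler_piMl. Qed.

Let OnF_small (f : T -> R) : (forall t, f t <= nF t) -> f \isO small.
Proof.
move=> hf; apply: (@isO_le _ _ _ _ _ 1) => // t; rewrite mul1r.
by apply: le_trans (hf t) _; rewrite lerDr mulr_ge0.
Qed.

Let Oeg : (fun t => e t * g t) \isO (fun t => e t ^+ 2 * X t + e t * nF t).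
Proof.
apply: isO_mono (isOM e0' g0 (isO_refl mag e) Og) _ => t.
by rewrite mulrDr expr2 -!mulrA.
Qed.

Let OE : (fun t => nm (E t)) \isO small.
Proof.
apply: isO_trans excess_bound _; apply: isOD; last exact: Oe_small Oeg.
by apply: (@isO_le _ _ _ _ _ 1) => // t; rewrite mul1r lerDl.
Qed.

Let OnmF : (fun t => nm (2 * F1 t + F2 t)) \isO small.
Proof.
apply: isO_nmD; [apply: isO_nm_nat|]; apply: OnF_small => t.
  by rewrite lerDl nm_ge0.
by rewrite lerDr nm_ge0.
Qed.

Let forcing_of_F t : F t = 2 * F1 t + F2 t - 2 * floquet (k t) (sg t) (y t).
Proof.
by rewrite /forcing G_of_F1 G_of_F2 /floquet /slaved derD der_nat; ring.
Qed.

Let OF : (fun t => nm (F t)) \isO small.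
Proof.
apply: (isO_eq (fun t => congr1 nm (forcing_of_F t))); apply: isO_nmB => //.
apply: isO_nm_nat; apply: Oe_small; apply: isO_trans OeN.
exact: Ofloquet isO_slaved.
Qed.

Let Om : (fun t => m t) \isO small.
Proof.
have h (w : pfun P) : nm w <= 1 -> (fun t => cabs (avg (F t * w))) \isO small.
  by move=> w1; exact: nm1_avg OF.
by apply: isOD; [apply: isOD; [exact: isO_avg OF|exact: h]|exact: h].
Qed.

Let gauge2 t := e t ^+ 3 * X t + e t * nF t.

Let Oe_gauge (f : T -> R) : (forall t, 0 <= f t) -> f \isO small ->
  (fun t => e t * f t) \isO gauge2.
Proof.
move=> f0 hf; apply: isO_mono (isOM e0' f0 (isO_refl mag e) hf) _ => t.
by rewrite /gauge2 /small mulrDr mulrA -exprS.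
Qed.

Let Ogauge : gauge \isO gauge2.
Proof.
rewrite /gauge; apply: isOD; last exact: Oe_gauge.
apply: isOD.
  apply: (@isO_le _ _ _ _ _ 1) => // t; rewrite mul1r lerDl mulr_ge0 //.
apply: (isO_eq (g := fun t => e t * (e t * g t))).
  by move=> t; rewrite mulrA -expr2.
by apply: Oe_gauge => [t|]; [rewrite mulr_ge0|exact: Oe_small Oeg].
Qed.

Let Oy1 : (fun t => nm (y t)) \isO (fun t => e t * X t + nF t).
Proof. exact: isO_trans Oy bloch_hypnorm. Qed.

(* The two coordinates of [2 y] on the critical modes, up to [small]. *)
Let rc t := coefc (F1 t) - 2 * ('i * (sg t)%:C) * (k t)%:C * coefs (v1 t)
  + (1 + k t)%:C * (sg t ^+ 2)%:C * coefc (v1 t) - coefc (E t).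
Let rs t := coefs (F1 t) + 2 * ('i * (sg t)%:C) * (k t)%:C * coefc (v1 t)
  + (1 + k t)%:C * (sg t ^+ 2)%:C * coefs (v1 t) - coefs (E t).

Let coefc_y t : 2 * coefc (y t) = (k t)%:C * coefc (v1 t)
  - 2 * ('i * (sg t)%:C) * coefs (v1 t) + rc t.
Proof.
rewrite (coefc_slaved (e t) (k t) (u1 t) (u2 t)) G_of_F1 /floquet /rc.
rewrite -(con_nat 2) !(coefcD, coefcN, coefcZ, coefc_der) rmorphD rmorph1.
by ring.
Qed.

Let coefs_y t : 2 * coefs (y t) = (k t)%:C * coefs (v1 t)
  + 2 * ('i * (sg t)%:C) * coefc (v1 t) + rs t.
Proof.
rewrite (coefs_slaved (e t) (k t) (u1 t) (u2 t)) G_of_F1 /floquet /rs.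
rewrite -(con_nat 2) !(coefsD, coefsN, coefsZ, coefs_der) rmorphD rmorph1.
by ring.
Qed.

Let cX t : cabs (coefc (v1 t)) <= X t. Proof. by rewrite lerDl cabs_ge0. Qed.
Let sX t : cabs (coefs (v1 t)) <= X t. Proof. by rewrite lerDr cabs_ge0. Qed.

Let Ocritical2 (z z' : T -> R[i]) : (fun t => cabs (z t)) \isO (fun t => e t ^+ 2) ->
  (forall t, cabs (z' t) <= X t) -> (fun t => cabs (z t * z' t)) \isO small.
Proof.
move=> hz hz'; apply: isO_mono (isO_cabsM hz (isO_pw hz' (isO_refl _ _))) _.
by move=> t; rewrite lerDl.
Qed.

Let Osk : (fun t => cabs (2 * ('i * (sg t)%:C) * (k t)%:C)) \isO (fun t => e t ^+ 2).
Proof.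
apply: isO_mono (isO_cabsM (isO_cabsZ 2 Osi) Ok) _ => t.
by rewrite expr2.
Qed.
Let Os2' : (fun t => cabs ((1 + k t)%:C * (sg t ^+ 2)%:C)) \isO (fun t => e t ^+ 2).
Proof. by apply: isO_mono (isO_cabsM Ok1 Os2) _ => t; rewrite mul1r. Qed.

Let Orc : (fun t => cabs (rc t)) \isO small.
Proof.
apply: isO_cabsB; last by apply: nm1_avg OE; exact: nm_cos.
apply: isO_cabsD; last exact: Ocritical2.
apply: isO_cabsB; last exact: Ocritical2.
apply: nm1_avg; first exact: nm_cos.
by apply: OnF_small => t; rewrite lerDl nm_ge0.
Qed.

Let Ors : (fun t => cabs (rs t)) \isO small.
Proof.
apply: isO_cabsB; last by apply: nm1_avg OE; exact: nm_sin.
apply: isO_cabsD; last exact: Ocritical2.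
apply: isO_cabsD; last exact: Ocritical2.
apply: nm1_avg; first exact: nm_sin.
by apply: OnF_small => t; rewrite lerDl nm_ge0.
Qed.

Let Oer (z r : T -> R[i]) : (fun t => cabs (z t)) \isO e ->
  (fun t => cabs (r t)) \isO small -> (fun t => cabs (z t * r t)) \isO gauge2.
Proof.
move=> hz hr; apply: isO_trans (isO_cabsM hz hr) _.
by apply: Oe_gauge => //; exact: isO_refl.
Qed.

Let Oe2y (z r : T -> R[i]) : (fun t => cabs (z t)) \isO (fun t => e t ^+ 2) ->
  (fun t => cabs (r t)) \isO (fun t => e t * X t + nF t) ->
  (fun t => cabs (z t * r t)) \isO gauge2.
Proof.
move=> hz hr; apply: isO_mono (isO_cabsM hz hr) _ => t.
by rewrite mulrDr mulrA -exprSr lerD2l ler_wpM2r.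
Qed.

Let Oyc : (fun t => cabs (coefc (y t))) \isO (fun t => e t * X t + nF t).
Proof. by apply: nm1_avg Oy1; exact: nm_cos. Qed.
Let Oys : (fun t => cabs (coefs (y t))) \isO (fun t => e t * X t + nF t).
Proof. by apply: nm1_avg Oy1; exact: nm_sin. Qed.

(** The reduced equations: to leading order the critical coordinates of a
    solution of [bloch V = F] see the Ginzburg-Landau symbol. *)
Lemma bloch_cos : (fun t => cabs (coefc (2 * F1 t + F2 t)
    + (k t ^+ 2 + 4 * sg t ^+ 2 - (e t ^+ 2 - 9 / 2 * a t ^+ 2))%:C * coefc (v1 t)
    - 4 * 'i * (k t)%:C * (sg t)%:C * coefs (v1 t)))
  \isO (fun t => e t ^+ 3 * X t + e t * nF t).
Proof.
apply: (isO_eq (g := fun t => cabs (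
  (coefc (E t) - (e t ^+ 2 - 9 / 2 * a t ^+ 2)%:C * coefc (v1 t))
  + 2 * ('i * (sg t)%:C) * rs t - (k t)%:C * rc t
  + 2 * (2 * ('i * (sg t)%:C) * (k t)%:C) * coefs (y t)
  - 2 * ((1 + k t)%:C * (sg t ^+ 2)%:C) * coefc (y t)))).
  move=> t; congr cabs.
  have h := coefc_solvability (e t) (k t) (u1 t) (u2 t) (v1 t) (v2 t).
  have -> : rs t = 2 * coefs (y t) - (k t)%:C * coefs (v1 t)
    - 2 * ('i * (sg t)%:C) * coefc (v1 t) by rewrite coefs_y; ring.
  have -> : rc t = 2 * coefc (y t) - (k t)%:C * coefc (v1 t)
    + 2 * ('i * (sg t)%:C) * coefs (v1 t) by rewrite coefc_y; ring.
  rewrite rmorph_reduced rmorph_floquet.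
  apply: reduced_identity; first exact: sqr_i.
  rewrite -{}h forcing_of_F /floquet; move: (2 * F1 t + F2 t) (y t) => A z.
  rewrite -(con_nat 2) coefcB !(coefcZ, coefcD, coefcN, coefc_der).
  by rewrite !(rmorphXn, rmorphD, rmorph1) mulrA.
apply: isO_cabsB; last first.
  by apply: Oe2y Oyc; exact: isO_cabsZ Os2'.
apply: isO_cabsD; last by apply: Oe2y Oys; exact: isO_cabsZ Osk.
apply: isO_cabsB; last exact: Oer Ok Orc.
apply: isO_cabsD; last by apply: Oer Ors; exact: isO_cabsZ Osi.
exact: isO_trans excess_cos Ogauge.
Qed.

Lemma bloch_sin : (fun t => cabs (coefs (2 * F1 t + F2 t)
    + (k t ^+ 2 + 4 * sg t ^+ 2 - (e t ^+ 2 - 3 / 2 * a t ^+ 2))%:C * coefs (v1 t)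
    + 4 * 'i * (k t)%:C * (sg t)%:C * coefc (v1 t)))
  \isO (fun t => e t ^+ 3 * X t + e t * nF t).
Proof.
apply: (isO_eq (g := fun t => cabs (
  (coefs (E t) - (e t ^+ 2 - 3 / 2 * a t ^+ 2)%:C * coefs (v1 t))
  - 2 * ('i * (sg t)%:C) * rc t - (k t)%:C * rs t
  - 2 * (2 * ('i * (sg t)%:C) * (k t)%:C) * coefc (y t)
  - 2 * ((1 + k t)%:C * (sg t ^+ 2)%:C) * coefs (y t)))).
  move=> t; congr cabs.
  have h := coefs_solvability (e t) (k t) (u1 t) (u2 t) (v1 t) (v2 t).
  have -> : rs t = 2 * coefs (y t) - (k t)%:C * coefs (v1 t)
    - 2 * ('i * (sg t)%:C) * coefc (v1 t) by rewrite coefs_y; ring.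
  have -> : rc t = 2 * coefc (y t) - (k t)%:C * coefc (v1 t)
    + 2 * ('i * (sg t)%:C) * coefs (v1 t) by rewrite coefc_y; ring.
  rewrite rmorph_reduced rmorph_floquet.
  have i2 : (- 'i : R[i]) ^+ 2 = -1 by rewrite sqrrN; exact: sqr_i.
  move: (_ - _)%:C => d; set A := coefs (2 * _ + _).
  transitivity (A + ((k t)%:C ^+ 2 + 4 * (sg t)%:C ^+ 2 - d) * coefs (v1 t)
    - 4 * (- 'i) * (k t)%:C * (sg t)%:C * coefc (v1 t)); first by ring.
  rewrite (@reduced_identity _ _ _ _ _ _ _ (coefs (y t)) (coefc (y t))
    (coefs (E t)) _ i2); first by ring.
  rewrite /A -{}h forcing_of_F /floquet; move: (2 * F1 t + F2 t) (y t) => B z.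
  rewrite -(con_nat 2) coefsB !(coefsZ, coefsD, coefsN, coefs_der).
  by rewrite !(rmorphXn, rmorphD, rmorph1); ring.
apply: isO_cabsB; last first.
  by apply: Oe2y Oys; exact: isO_cabsZ Os2'.
apply: isO_cabsB; last by apply: Oe2y Oyc; exact: isO_cabsZ Osk.
apply: isO_cabsB; last exact: Oer Ok Ors.
apply: isO_cabsB; last by apply: Oer Orc; exact: isO_cabsZ Osi.
exact: isO_trans excess_sin Ogauge.
Qed.

Lemma bloch_slaved :
  (fun t => nm (y t)) \isO (fun t => e t * X t + nF t).
Proof. exact: Oy1. Qed.

End Bloch.
End Linear.
End Family.

(** * Chains of eigenvectors *)

Section Chain.
Context {R : realType} {P : calculus R} {T : Type}.
Local Notation "x %:f" := (@con R P (real_complex R x)) (at level 2, format "x %:f").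
Variables (mag e k a sg : T -> R) (u1 u2 v1 v2 w1 w2 : T -> pfun P).
Variables (l mu : T -> R[i]).
Local Notation "f \isO g" := (isO mag f g) (at level 70).
Local Notation F1 t := (bloch1 (e t) (k t) (sg t) (u1 t) (u2 t) (v1 t) (v2 t)).
Local Notation F2 t := (bloch2 (e t) (k t) (sg t) (u1 t) (u2 t) (v1 t) (v2 t)).
Local Notation X t := (critnorm (v1 t)).
Local Notation N t := (hypnorm (v1 t, v2 t)).
Local Notation Z t := (critnorm (w1 t)).
Local Notation nF t := (nm (F1 t) + nm (F2 t)).

Hypothesis prof : profiles mag e k a u1 u2.
Hypothesis Osg : isO mag (fun t => `|sg t|) e.
Hypothesis l_mag : forall t, cabs (l t) <= mag t.
Hypothesis chain1 : forall t, F1 t = con (l t) * v1 t + con (mu t) * w1 t.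
Hypothesis chain2 : forall t, F2 t = con (l t) * v2 t + con (mu t) * w2 t.
Hypothesis hyp_w : (fun t => hypnorm (w1 t, w2 t)) \isO (fun t => e t * Z t).

Local Notation L t := (cabs (l t) * X t + cabs (mu t) * Z t).

(** Satisfied as soon as the critical parts of [v] and [w] are orthogonal. *)
Hypothesis transverse : forall t, L t <=
  4 * (cabs (l t * coefc (v1 t) + mu t * coefc (w1 t))
     + cabs (l t * coefs (v1 t) + mu t * coefs (w1 t))).

Let e0 t : 0 <= e t. Proof. by have /andP[/ltW] := prof_e prof t. Qed.
Let e1 t : e t <= 1. Proof. by have /andP[] := prof_e prof t. Qed.
Let X0 t : 0 <= X t. Proof. exact: critnorm_ge0. Qed.
Let Z0 t : 0 <= Z t. Proof. exact: critnorm_ge0. Qed.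
Let N0 t : 0 <= N t. Proof. exact: hypnorm_ge0. Qed.
Let nF0 t : 0 <= nF t. Proof. by rewrite addr_ge0 ?nm_ge0. Qed.
Let l0 t : 0 <= cabs (l t). Proof. exact: cabs_ge0. Qed.
Let mu0 t : 0 <= cabs (mu t). Proof. exact: cabs_ge0. Qed.
Let lX0 t : 0 <= cabs (l t) * X t. Proof. exact: mulr_ge0. Qed.
Let muZ0 t : 0 <= cabs (mu t) * Z t. Proof. exact: mulr_ge0. Qed.
Let L0 t : 0 <= L t. Proof. exact: addr_ge0. Qed.
Let mag0 t : 0 <= mag t. Proof. exact: le_trans (l0 t) (l_mag t). Qed.

Let le_isO (f g : T -> R) : (forall t, f t <= g t) -> f \isO g.
Proof. by move=> h; apply: isO_mono (isO_refl mag f) h. Qed.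

Let Ow1 : (fun t => nm2 (w1 t)) \isO (fun t => Z t).
Proof.
apply: isO_trans (isO_comp1 mag w1 w2) _; apply: isOD.
  exact: le_isO.
by apply: isO_mono hyp_w _ => t; rewrite ler_piMl.
Qed.

Let Ow2 : (fun t => nm2 (w2 t)) \isO (fun t => Z t).
Proof.
apply: isO_trans (isO_comp2 mag w1 w2) _; apply: isOD.
  exact: le_isO.
by apply: isO_mono hyp_w _ => t; rewrite ler_piMl.
Qed.

Let OnF1 : (fun t => nF t) \isO (fun t => cabs (l t) * (X t + N t) + cabs (mu t) * Z t).
Proof.
have h (v w : T -> pfun P) : (fun t => nm2 (v t)) \isO (fun t => X t + N t) ->
    (fun t => nm2 (w t)) \isO (fun t => Z t) ->
    (fun t => nm (con (l t) * v t + con (mu t) * w t)) \isO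
    (fun t => cabs (l t) * (X t + N t) + cabs (mu t) * Z t).
  move=> hv hw; apply: isO_nmD.
    apply: isO_mono (isO_nmZ (isO_refl mag _)
      (isO_pw (fun t => nm_nm2 (v t)) hv)) _ => t.
    by rewrite lerDl.
  apply: isO_mono (isO_nmZ (isO_refl mag _)
    (isO_pw (fun t => nm_nm2 (w t)) hw)) _ => t.
  by rewrite lerDr mulr_ge0 // addr_ge0.
apply: isOD.
  apply: (isO_eq (fun t => congr1 nm (chain1 t))).
  by apply: h => //; exact: isO_comp1.
apply: (isO_eq (fun t => congr1 nm (chain2 t))).
by apply: h => //; exact: isO_comp2.
Qed.

Let ON : (fun t => N t) \isO (fun t => e t * X t + L t).
Proof.
apply: isO_absorb => //; apply: isO_trans (bloch_hypnorm prof v1 v2 Osg) _.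
apply: isOD.
  apply: le_isO => t; rewrite -addrA lerDl addr_ge0 //.
  by rewrite mulr_ge0.
apply: isO_mono OnF1 _ => t; rewrite (mulrDr (cabs (l t)) (X t)).
have := ler_wpM2r (N0 t) (l_mag t).
have := mulr_ge0 (e0 t) (X0 t).
by move: (X t) (Z t) (N t) (cabs (l t)) (cabs (mu t)) (e t) (mag t) => *; lra.
Qed.

Let l1 t : mag t < 1 -> cabs (l t) <= 1.
Proof. by move=> /ltW; exact: le_trans. Qed.

Let OnF : (fun t => nF t) \isO (fun t => L t).
Proof.
apply: isO_trans OnF1 _.
apply: (@isO_trans _ _ _ _ (fun t => L t + cabs (l t) * N t)).
  by apply: le_isO => t; rewrite (mulrDr (cabs (l t)) (X t)) addrAC.
apply: isOD; first exact: isO_refl.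
apply: isO_trans (isOM l0 N0 (isO_refl mag _) ON) _.
apply: (@isO_le_small _ _ _ _ _ 2) => // t /l1 l1t.
rewrite (mulrDr (cabs (l t))).
have h1 : cabs (l t) * (e t * X t) <= L t.
  by apply: (@le_trans _ _ (cabs (l t) * X t));
    rewrite ?lerDl // ler_wpM2l // ler_piMl.
have h2 : cabs (l t) * L t <= L t by rewrite ler_piMl.
by move: h1 h2; move: (X t) (Z t) (N t) (cabs (l t)) (cabs (mu t)) (e t) (mag t) => *; lra.
Qed.

Let Oy : (fun t => nm (slaved (v1 t) (v2 t))) \isO (fun t => e t * X t + L t).
Proof.
apply: isO_trans (bloch_slaved prof v1 v2 Osg) _; apply: isOD.
  by apply: le_isO => t; rewrite lerDl.
by apply: isO_mono OnF _ => t; rewrite lerDr mulr_ge0.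
Qed.

Let Oyw : (fun t => nm (slaved (w1 t) (w2 t))) \isO (fun t => e t * Z t).
Proof.
apply: isO_trans hyp_w; apply: (@isO_le _ _ _ _ _ 2) => // t.
exact: le_trans (nm_nm2 _) (nm2_slaved _ _).
Qed.

(** Twice the left kernel projection of [F]; [3] is the pairing of the left
    kernel vector [(2, 1)] with the right kernel vector [(2, -1)]. *)
Let project (v w : pfun P) (v' w' : pfun P) (z z' : R[i]) :
  2 * (2 * (con z * v + con z' * v') + (con z * w + con z' * w')) =
  con (3 * z) * v + con (3 * z') * v'
    + (con z * slaved v w + con z' * slaved v' w').
Proof. by rewrite /slaved !rmorphM !rmorph_nat; ring. Qed.

Let g1 t : R := k t ^+ 2 + 4 * sg t ^+ 2 - (e t ^+ 2 - 9 / 2 * a t ^+ 2).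
Let g2 t : R := k t ^+ 2 + 4 * sg t ^+ 2 - (e t ^+ 2 - 3 / 2 * a t ^+ 2).
Let Gc t := (g1 t)%:C * coefc (v1 t) - 4 * 'i * (k t)%:C * (sg t)%:C * coefs (v1 t).
Let Gs t := (g2 t)%:C * coefs (v1 t) + 4 * 'i * (k t)%:C * (sg t)%:C * coefc (v1 t).
Let lc t := l t * coefc (v1 t) + mu t * coefc (w1 t).
Let ls t := l t * coefs (v1 t) + mu t * coefs (w1 t).

Let lc_eq t : 3 * lc t + 2 * Gc t =
  2 * (coefc (2 * F1 t + F2 t) + (g1 t)%:C * coefc (v1 t)
       - 4 * 'i * (k t)%:C * (sg t)%:C * coefs (v1 t))
  - (l t * coefc (slaved (v1 t) (v2 t)) + mu t * coefc (slaved (w1 t) (w2 t))).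
Proof.
have := congr1 coefc (project (v1 t) (v2 t) (w1 t) (w2 t) (l t) (mu t)).
rewrite -chain1 -chain2 /lc /Gc.
move: (2 * F1 t + F2 t) (slaved _ _) (slaved _ _) => A y' y.
rewrite -(con_nat 2) !(coefcD, coefcZ) => h.
have -> : 3 * (l t * coefc (v1 t) + mu t * coefc (w1 t)) =
    2 * coefc A - (l t * coefc y + mu t * coefc y') by rewrite h; ring.
by ring.
Qed.

Let ls_eq t : 3 * ls t + 2 * Gs t =
  2 * (coefs (2 * F1 t + F2 t) + (g2 t)%:C * coefs (v1 t)
       + 4 * 'i * (k t)%:C * (sg t)%:C * coefc (v1 t))
  - (l t * coefs (slaved (v1 t) (v2 t)) + mu t * coefs (slaved (w1 t) (w2 t))).
Proof.
have := congr1 coefs (project (v1 t) (v2 t) (w1 t) (w2 t) (l t) (mu t)).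
rewrite -chain1 -chain2 /ls /Gs.
move: (2 * F1 t + F2 t) (slaved _ _) (slaved _ _) => A y' y.
rewrite -(con_nat 2) !(coefsD, coefsZ) => h.
have -> : 3 * (l t * coefs (v1 t) + mu t * coefs (w1 t)) =
    2 * coefs A - (l t * coefs y + mu t * coefs y') by rewrite h; ring.
by ring.
Qed.

Let gauge t := e t ^+ 3 * X t + (e t + cabs (l t)) * L t.

Let Oslaved (q : pfun P -> R[i]) : (forall f, cabs (q f) <= 2 * nm f) ->
  (fun t => cabs (l t * q (slaved (v1 t) (v2 t)) + mu t * q (slaved (w1 t) (w2 t))))
  \isO gauge.
Proof.
move=> hq.
have O2 (f : T -> pfun P) h : (fun t => nm (f t)) \isO h ->
    (fun t => cabs (q (f t))) \isO h.
  by apply: isO_trans; apply: (@isO_le _ _ _ _ _ 2).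
have eL0 t : 0 <= e t * L t by rewrite mulr_ge0.
have lL0 t : 0 <= cabs (l t) * L t by rewrite mulr_ge0.
have eX0 t : 0 <= e t ^+ 3 * X t by rewrite mulr_ge0 ?exprn_ge0.
apply: isO_cabsD.
  apply: isO_mono (isO_cabsM (isO_refl mag _) (O2 _ _ Oy)) _ => t.
  have h : cabs (l t) * (e t * X t) <= e t * L t.
    by rewrite mulrCA ler_wpM2l // lerDl.
  rewrite /gauge (mulrDr (cabs (l t)) (e t * _)) (mulrDl (e t)).
  move: h (eX0 t); move: (X t) (Z t) (N t) (cabs (l t)) (cabs (mu t)) (e t) (mag t) => *; lra.
apply: isO_mono (isO_cabsM (isO_refl mag _) (O2 _ _ Oyw)) _ => t.
have h : cabs (mu t) * (e t * Z t) <= e t * L t.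
  by rewrite mulrCA ler_wpM2l // lerDr.
rewrite /gauge (mulrDl (e t)).
move: h (eX0 t) (lL0 t); move: (X t) (Z t) (N t) (cabs (l t)) (cabs (mu t)) (e t) (mag t) => *; lra.
Qed.

Let OnFgauge (f : T -> R) : f \isO (fun t => e t ^+ 3 * X t + e t * nF t) ->
  f \isO gauge.
Proof.
move=> hf; apply: isO_trans hf _; apply: isOD.
  by apply: le_isO => t; rewrite lerDl mulr_ge0 // addr_ge0.
apply: isO_mono (isOM e0 nF0 (isO_refl mag e) OnF) _ => t.
rewrite /gauge (mulrDl (e t)) addrCA lerDl addr_ge0 // mulr_ge0 //.
by rewrite exprn_ge0.
Qed.

Let Olc : (fun t => cabs (3 * lc t + 2 * Gc t)) \isO gauge.
Proof.
apply: (isO_eq (fun t => congr1 (@cabs R) (lc_eq t))).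
apply: isO_cabsB; last by apply: Oslaved => f; exact: cabs_coefc.
by apply: isO_cabsZ; apply: OnFgauge; have h := bloch_cos prof v1 v2 Osg; exact: h.
Qed.

Let Ols : (fun t => cabs (3 * ls t + 2 * Gs t)) \isO gauge.
Proof.
apply: (isO_eq (fun t => congr1 (@cabs R) (ls_eq t))).
apply: isO_cabsB; last by apply: Oslaved => f; exact: cabs_coefs.
by apply: isO_cabsZ; apply: OnFgauge; have h := bloch_sin prof v1 v2 Osg; exact: h.
Qed.

Let Osq (f : T -> R) : (fun t => `|f t|) \isO e ->
  (fun t => `|f t ^+ 2|) \isO (fun t => e t ^+ 2).
Proof.
move=> h; apply: (isO_eq (g := fun t => `|f t| * `|f t|)).
  by move=> t; rewrite expr2 normrM.
by apply: isO_mono (isOM _ _ h h) _ => // t; rewrite expr2.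
Qed.

Let Og (c : R) : (fun t => cabs (k t ^+ 2 + 4 * sg t ^+ 2
  - (e t ^+ 2 - c * a t ^+ 2))%:C) \isO (fun t => e t ^+ 2).
Proof.
apply: (@isO_pw _ _ _ _ (fun t => `|k t ^+ 2| + `|4| * `|sg t ^+ 2|
    + (e t ^+ 2 + `|c| * `|a t ^+ 2|))).
  move=> t; rewrite cabsr; apply: le_trans (ler_normB _ _) _.
  apply: lerD; first by rewrite -normrM; exact: ler_normD.
  apply: le_trans (ler_normB _ _) _.
  by rewrite (normrM c) (ger0_norm (sqr_ge0 (e t))).
have cst (d : R) (f g : T -> R) : (forall t, 0 <= f t) -> f \isO g ->
    (fun t => `|d| * f t) \isO g.
  move=> f0 h; apply: isO_trans h; apply: (@isO_le _ _ _ _ _ `|d|) => //.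
apply: isOD; apply: isOD; [exact: Osq (prof_k prof)| |exact: isO_refl|].
  by apply: cst => //; exact: Osq.
by apply: cst => //; exact: Osq (prof_a prof).
Qed.

Let Oks : (fun t => cabs (4 * 'i * (k t)%:C * (sg t)%:C)) \isO (fun t => e t ^+ 2).
Proof.
have Oc (f : T -> R) : (fun t => `|f t|) \isO e -> (fun t => cabs (f t)%:C) \isO e.
  by apply: isO_pw => t; rewrite cabsr.
apply: (isO_eq (g := fun t => cabs (4 * 'i * ((k t)%:C * (sg t)%:C)))).
  by move=> t; rewrite mulrA.
apply: isO_cabsZ; apply: isO_mono (isO_cabsM (Oc _ (prof_k prof)) (Oc _ Osg)) _.
by move=> t; rewrite expr2.
Qed.

Let Ocrit (z z' : T -> R[i]) : (fun t => cabs (z t)) \isO (fun t => e t ^+ 2) ->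
  (forall t, cabs (z' t) <= X t) ->
  (fun t => cabs (z t * z' t)) \isO (fun t => e t ^+ 2 * X t).
Proof. by move=> hz hz'; exact: isO_cabsM hz (le_isO hz'). Qed.

Let cX t : cabs (coefc (v1 t)) <= X t. Proof. by rewrite lerDl cabs_ge0. Qed.
Let sX t : cabs (coefs (v1 t)) <= X t. Proof. by rewrite lerDr cabs_ge0. Qed.

Let crude t := e t ^+ 2 * X t + mag t * L t.

Let Ogauge_crude (f : T -> R) : f \isO gauge -> f \isO crude.
Proof.
move=> hf; apply: (isO_leq (K := 2) hf) => // t; rewrite /gauge /crude.
have h1 : e t ^+ 3 * X t <= e t ^+ 2 * X t.
  by rewrite ler_wpM2r // exprS ler_piMl // exprn_ge0.
have h2 : e t * L t <= mag t * L t by rewrite ler_wpM2r // (prof_mag prof).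
have h3 : cabs (l t) * L t <= mag t * L t by rewrite ler_wpM2r.
have h4 : 0 <= e t ^+ 2 * X t by rewrite mulr_ge0 // exprn_ge0.
rewrite (mulrDl (e t)).
by move: h1 h2 h3 h4; move: (X t) (Z t) (N t) (cabs (l t)) (cabs (mu t)) (e t) (mag t) => *; lra.
Qed.

Let OG_crude (z : T -> R[i]) : (fun t => cabs (z t)) \isO (fun t => e t ^+ 2 * X t) ->
  (fun t => cabs (z t)) \isO crude.
Proof. by move=> h; apply: isO_mono h _ => t; rewrite lerDl mulr_ge0. Qed.

Let OL : (fun t => L t) \isO (fun t => e t ^+ 2 * X t).
Proof.
apply: isO_absorb => //.
apply: (@isO_trans _ _ _ _ (fun t => cabs (lc t) + cabs (ls t))).
  by apply: (@isO_le _ _ _ _ _ 4) => // t; exact: transverse.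
have sub (z z' : T -> R[i]) : (fun t => cabs (3 * z t + 2 * z' t)) \isO crude ->
    (fun t => cabs (z' t)) \isO crude -> (fun t => cabs (z t)) \isO crude.
  move=> h h'; apply: (isO_cabs_nat (n := 2)).
  apply: (isO_eq (g := fun t => cabs ((3 * z t + 2 * z' t) - 2 * z' t))).
    by move=> t; rewrite addrK.
  by apply: isO_cabsB => //; exact: isO_cabsZ.
apply: isOD; [apply: (sub _ Gc)|apply: (sub _ Gs)]; try exact: Ogauge_crude.
  apply: OG_crude; apply: isO_cabsB; first exact: Ocrit (Og _) cX.
  exact: Ocrit Oks sX.
apply: OG_crude; apply: isO_cabsD; first exact: Ocrit (Og _) sX.
exact: Ocrit Oks cX.
Qed.

Lemma chain_hypnorm : (fun t => N t) \isO (fun t => e t * X t).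
Proof.
apply: isO_trans ON _; apply: isOD; first exact: isO_refl.
by apply: isO_mono OL _ => t; rewrite ler_wpM2r // expr2 ler_piMl.
Qed.

Let Ogauge3 : gauge \isO (fun t => e t ^+ 3 * X t).
Proof.
apply: isOD; first exact: isO_refl.
apply: (isO_eq (g := fun t => e t * L t + cabs (l t) * L t)).
  by move=> t; rewrite mulrDl.
have OeL : (fun t => e t * L t) \isO (fun t => e t ^+ 3 * X t).
  apply: isO_mono (isOM e0 L0 (isO_refl mag e) OL) _ => t.
  by rewrite mulrA -exprS.
apply: isOD => //; apply: isO_trans (isOM l0 L0 (isO_refl mag _) OL) _.
apply: isO_trans OeL; apply: le_isO => t.
rewrite mulrCA expr2 -mulrA ler_wpM2l //.
by rewrite -[leRHS]mul1r ler_pM ?mulr_ge0 ?lerDl.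
Qed.

(** [bloch_cos] and [bloch_sin] with the eigenvalue equation as right hand side;
    the multiples of the slaved combinations in [project] are of higher order. *)
Lemma chain_cos : (fun t => cabs (3 * (l t * coefc (v1 t) + mu t * coefc (w1 t))
   + 2 * ((k t ^+ 2 + 4 * sg t ^+ 2 - (e t ^+ 2 - 9 / 2 * a t ^+ 2))%:C * coefc (v1 t)
     - 4 * 'i * (k t)%:C * (sg t)%:C * coefs (v1 t)))) \isO (fun t => e t ^+ 3 * X t).
Proof. exact: isO_trans Olc Ogauge3. Qed.

Lemma chain_sin : (fun t => cabs (3 * (l t * coefs (v1 t) + mu t * coefs (w1 t))
   + 2 * ((k t ^+ 2 + 4 * sg t ^+ 2 - (e t ^+ 2 - 3 / 2 * a t ^+ 2))%:C * coefs (v1 t)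
     + 4 * 'i * (k t)%:C * (sg t)%:C * coefc (v1 t)))) \isO (fun t => e t ^+ 3 * X t).
Proof. exact: isO_trans Ols Ogauge3. Qed.

Lemma chain_size : (fun t => cabs (l t) * X t + cabs (mu t) * Z t)
  \isO (fun t => e t ^+ 2 * X t).
Proof. exact: OL. Qed.

End Chain.

(** * Trace and determinant of the reduced operator *)

Section ReducedMatrix.
Context {R : realType}.
Implicit Types p q x z l m g h : R[i].

Lemma cabs_sqr z : (cabs z ^+ 2)%:C = z * z^*%C :> R[i].
Proof. by rewrite rmorphXn /= -cabsE sqr_normc. Qed.

Lemma sum_sqr_le2 (a b : R) : (a + b) ^+ 2 <= 2 * (a ^+ 2 + b ^+ 2).
Proof. by rewrite -subr_ge0; have := sqr_ge0 (a - b); lra. Qed.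

Lemma conj_orthogonal p q x z : x * p^*%C + z * q^*%C = 0 -> x^*%C * p + z^*%C * q = 0.
Proof.
move=> h; have := congr1 (@conjc R) h.
by rewrite rmorphD !rmorphM /= !conjcK => ->; exact: conjc0.
Qed.

(** Orthogonality bounds each of two vectors by any combination of them. *)
Lemma orthogonal_component p q x z l m : x * p^*%C + z * q^*%C = 0 ->
  cabs l * (cabs x + cabs z) <= 2 * (cabs (l * x + m * p) + cabs (l * z + m * q)).
Proof.
move=> /conj_orthogonal h; set D := _ + cabs (l * z + _).
have D0 : 0 <= D by rewrite addr_ge0 ?cabs_ge0.
have n0 : 0 <= cabs x + cabs z by rewrite addr_ge0 ?cabs_ge0.
have e : (cabs x ^+ 2 + cabs z ^+ 2)%:C * l =
    (l * x + m * p) * x^*%C + (l * z + m * q) * z^*%C.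
  rewrite rmorphD /= !cabs_sqr.
  transitivity ((x * x^*%C + z * z^*%C) * l + m * (x^*%C * p + z^*%C * q)).
    by rewrite h mulr0 addr0.
  by ring.
have le : (cabs x ^+ 2 + cabs z ^+ 2) * cabs l <= D * (cabs x + cabs z).
  have -> : (cabs x ^+ 2 + cabs z ^+ 2) * cabs l =
      cabs ((cabs x ^+ 2 + cabs z ^+ 2)%:C * l).
    by rewrite cabsM cabsr ger0_norm // addr_ge0 ?sqr_ge0.
  rewrite e; apply: le_trans (cabsD _ _) _; rewrite !cabsM !cabsJ mulrDl.
  by apply: lerD; rewrite ler_wpM2l ?cabs_ge0 // ?lerDl ?lerDr cabs_ge0.
have [->|nz] := eqVneq (cabs x + cabs z) 0; first by rewrite mulr0 mulr_ge0.
have pos : 0 < cabs x + cabs z by rewrite lt_def nz.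
have h2 : (cabs x + cabs z) ^+ 2 * cabs l <= 2 * (D * (cabs x + cabs z)).
  apply: (@le_trans _ _ (2 * ((cabs x ^+ 2 + cabs z ^+ 2) * cabs l))).
    by rewrite mulrA ler_wpM2r ?cabs_ge0 // sum_sqr_le2.
  by rewrite ler_wpM2l.
rewrite -(ler_pM2r pos) -(mulrA 2); apply: le_trans h2.
by rewrite le_eqVlt; apply/orP; left; apply/eqP; ring.
Qed.

Lemma orthogonal_transverse p q x z l m : x * p^*%C + z * q^*%C = 0 ->
  cabs l * (cabs x + cabs z) + cabs m * (cabs p + cabs q) <=
  4 * (cabs (l * x + m * p) + cabs (l * z + m * q)).
Proof.
move=> h; have h1 := orthogonal_component l m h.
have h2 : cabs m * (cabs p + cabs q) <=
    2 * (cabs (l * x + m * p) + cabs (l * z + m * q)).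
  rewrite [l * x + _]addrC [l * z + _]addrC; apply: orthogonal_component.
  by have := conj_orthogonal h; rewrite ![_^*%C * _]mulrC.
by move: h1 h2; norm_lra.
Qed.

Lemma trace_identity p q x z p' q' x' z' l1 l2 m g1 g2 h :
  x * p' + z * q' = 0 -> x' * p + z' * q = 0 ->
  (x * x' + z * z') * ((3 * (l1 * p) + 2 * (g1 * p - h * q)) * p'
                      + (3 * (l1 * q) + 2 * (g2 * q + h * p)) * q')
  + (p * p' + q * q') * ((3 * (l2 * x + m * p) + 2 * (g1 * x - h * z)) * x'
                      + (3 * (l2 * z + m * q) + 2 * (g2 * z + h * x)) * z') =
  (x * x' + z * z') * (p * p' + q * q') * (3 * (l1 + l2) + 2 * (g1 + g2)).
Proof.
move=> h1 h2; apply/eqP; rewrite -subr_eq0; apply/eqP.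
transitivity (
  2 * (g1 - g2) * ((x * p' + z * q') * (x' * p) - z * q' * (x' * p + z' * q))
  + 2 * h * ((x' * p + z' * q) * (x * q' - z * p')
             + (x * p' + z * q') * (z' * p - x' * q))
  + 3 * m * (p * p' + q * q') * (x' * p + z' * q)); last by rewrite h1 h2; ring.
by ring.
Qed.

(** In an orthogonal basis of the plane the reduced matrix is upper triangular up
    to an error [D], so that its trace is the sum of the diagonal entries. *)
Lemma trace_bound p q x z l1 l2 m g1 g2 h (D : R) : 0 <= D ->
  x * p^*%C + z * q^*%C = 0 ->
  cabs p + cabs q != 0 -> cabs x + cabs z != 0 ->
  cabs (3 * (l1 * p) + 2 * (g1 * p - h * q)) <= D * (cabs p + cabs q) ->
  cabs (3 * (l1 * q) + 2 * (g2 * q + h * p)) <= D * (cabs p + cabs q) ->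
  cabs (3 * (l2 * x + m * p) + 2 * (g1 * x - h * z)) <= D * (cabs x + cabs z) ->
  cabs (3 * (l2 * z + m * q) + 2 * (g2 * z + h * x)) <= D * (cabs x + cabs z) ->
  cabs (3 * (l1 + l2) + 2 * (g1 + g2)) <= 4 * D.
Proof.
move=> D0 o pq0 xz0; set r1 := 3 * (l1 * p) + _; set r2 := 3 * (l1 * q) + _.
set r3 := 3 * (l2 * x + _) + _; set r4 := 3 * (l2 * z + _) + _ => b1 b2 b3 b4.
have id := trace_identity l1 l2 m g1 g2 h o (conj_orthogonal o).
rewrite -/r1 -/r2 -/r3 -/r4 in id.
set S := 3 * (l1 + l2) + _ in id *.
set nd := cabs p ^+ 2 + cabs q ^+ 2; set nc := cabs x ^+ 2 + cabs z ^+ 2.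
have pos (u v : R[i]) : cabs u + cabs v != 0 -> 0 < cabs u ^+ 2 + cabs v ^+ 2.
  move=> nz; have h2 := sum_sqr_le2 (cabs u) (cabs v).
  have h3 : 0 < (cabs u + cabs v) ^+ 2 by rewrite lt_def sqrf_eq0 nz sqr_ge0.
  by move: h2 h3; clear; lra.
have nd0 : 0 < nd by exact: pos.
have nc0 : 0 < nc by exact: pos.
have bnd (u v r r' : R[i]) : cabs r <= D * (cabs u + cabs v) ->
    cabs r' <= D * (cabs u + cabs v) ->
    cabs (r * u^*%C + r' * v^*%C) <= 2 * D * (cabs u ^+ 2 + cabs v ^+ 2).
  move=> h1 h2; apply: le_trans (cabsD _ _) _; rewrite !cabsM !cabsJ.
  apply: (@le_trans _ _ (D * (cabs u + cabs v) ^+ 2)); last first.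
    by rewrite [2 * D]mulrC -mulrA ler_wpM2l // sum_sqr_le2.
  by rewrite expr2 mulrA mulrDr lerD // ler_wpM2r ?cabs_ge0.
have e1 : x * x^*%C + z * z^*%C = nc%:C by rewrite rmorphD /= !cabs_sqr.
have e2 : p * p^*%C + q * q^*%C = nd%:C by rewrite rmorphD /= !cabs_sqr.
rewrite e1 e2 in id.
have : cabs (nc%:C * nd%:C * S) <= nc * (2 * D * nd) + nd * (2 * D * nc).
  rewrite -id; apply: le_trans (cabsD _ _) _; rewrite !(cabsM _%:C) !cabsr.
  rewrite (ger0_norm (ltW nc0)) (ger0_norm (ltW nd0)).
  by apply: lerD; (apply: ler_wpM2l; [exact: ltW | exact: bnd]).
rewrite !cabsM !cabsr (ger0_norm (ltW nc0)) (ger0_norm (ltW nd0)) => h1.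
have ncd : 0 < nc * nd by rewrite mulr_gt0.
by rewrite -(ler_pM2l ncd); apply: le_trans h1 _; rewrite le_eqVlt; apply/orP; left; apply/eqP; ring.
Qed.

(** Cramer's rule: an approximate null vector makes the determinant small relative
    to the entries. *)
Lemma det_bound p q l g1 g2 h (D : R) :
  cabs p + cabs q != 0 ->
  cabs (3 * (l * p) + 2 * (g1 * p - h * q)) <= D * (cabs p + cabs q) ->
  cabs (3 * (l * q) + 2 * (g2 * q + h * p)) <= D * (cabs p + cabs q) ->
  cabs ((3 * l + 2 * g1) * (3 * l + 2 * g2) + 4 * h ^+ 2) <=
  D * (cabs (3 * l + 2 * g1) + cabs (3 * l + 2 * g2) + 4 * cabs h).
Proof.
move=> nz; set r1 := 3 * (l * p) + _; set r2 := 3 * (l * q) + _ => b1 b2.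
set S := _ + 4 * h ^+ 2.
have pos : 0 < cabs p + cabs q by rewrite lt_def nz addr_ge0 ?cabs_ge0.
have e1 : S * p = (3 * l + 2 * g2) * r1 + 2 * h * r2 by rewrite /S /r1 /r2; ring.
have e2 : S * q = (3 * l + 2 * g1) * r2 - 2 * h * r1 by rewrite /S /r1 /r2; ring.
have c2 : cabs (2 * h) = 2 * cabs h.
  by rewrite cabsM -(rmorph_nat (real_complex R)) cabsr ger0_norm.
have h1 : cabs S * cabs p <= (cabs (3 * l + 2 * g2) + 2 * cabs h)
    * (D * (cabs p + cabs q)).
  rewrite -cabsM e1; apply: le_trans (cabsD _ _) _; rewrite !(cabsM _ r1) (cabsM _ r2) c2.
  by rewrite (mulrDl (cabs (_ + 2 * g2))) lerD // ler_wpM2l ?mulr_ge0 ?cabs_ge0.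
have h2 : cabs S * cabs q <= (cabs (3 * l + 2 * g1) + 2 * cabs h)
    * (D * (cabs p + cabs q)).
  rewrite -cabsM e2; apply: le_trans (cabsB _ _) _; rewrite !(cabsM _ r1) (cabsM _ r2) c2.
  by rewrite (mulrDl (cabs (_ + 2 * g1))) lerD // ler_wpM2l ?mulr_ge0 ?cabs_ge0.
rewrite -(ler_pM2r pos) mulrDr; apply: le_trans (lerD h1 h2) _.
by rewrite le_eqVlt; apply/orP; left; apply/eqP; ring.
Qed.

End ReducedMatrix.

Section Pair.
Context {R : realType} {P : calculus R} {T : Type}.
Variables (mag e k a sg : T -> R) (u1 u2 v1 v2 w1 w2 : T -> pfun P).
Variables (l1 l2 mu : T -> R[i]).
Local Notation "f \isO g" := (isO mag f g) (at level 70).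
Hypothesis prof : profiles mag e k a u1 u2.
Hypothesis Osg : isO mag (fun t => `|sg t|) e.
Hypothesis l1_mag : forall t, cabs (l1 t) <= mag t.
Hypothesis l2_mag : forall t, cabs (l2 t) <= mag t.
Local Notation B1 t := (bloch1 (e t) (k t) (sg t) (u1 t) (u2 t)).
Local Notation B2 t := (bloch2 (e t) (k t) (sg t) (u1 t) (u2 t)).
Hypothesis v_eigen : forall t, B1 t (v1 t) (v2 t) = con (l1 t) * v1 t
  /\ B2 t (v1 t) (v2 t) = con (l1 t) * v2 t.
Hypothesis w_eigen : forall t,
  B1 t (w1 t) (w2 t) = con (l2 t) * w1 t + con (mu t) * v1 t
  /\ B2 t (w1 t) (w2 t) = con (l2 t) * w2 t + con (mu t) * v2 t.
Hypothesis independent : forall t (b c : R[i]),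
  con b * v1 t + con c * w1 t = 0 -> con b * v2 t + con c * w2 t = 0 ->
  b = 0 /\ c = 0.

Local Notation X t := (critnorm (v1 t)).

Let hypnorm_zero : hypnorm (0 : pfun P, 0 : pfun P) = 0.
Proof.
have c0 : coefc (0 : pfun P) = 0 by rewrite /coefc mul0r avg0.
have s0 : coefs (0 : pfun P) = 0 by rewrite /coefs mul0r avg0.
have d0 : der (0 : pfun P) = 0 by rewrite -{1}(rmorph0 con) der_con.
have n0 : nm (0 : pfun P) = 0 by rewrite -(rmorph0 con) nm_con cabs0.
rewrite /hypnorm /hyp1 /hyp2 /= c0 s0 mulr0 /cosin rmorph0 !mul0r addr0 subr0.
by rewrite addr0 /nm2 !d0 n0 !addr0.
Qed.

Let critnorm_zero : critnorm (0 : pfun P) = 0.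
Proof. by rewrite /critnorm /coefc /coefs !mul0r avg0 cabs0 addr0. Qed.

Let v_chain1 t : B1 t (v1 t) (v2 t) = con (l1 t) * v1 t + con 0 * 0.
Proof. by have [-> _] := v_eigen t; rewrite mulr0 addr0. Qed.
Let v_chain2 t : B2 t (v1 t) (v2 t) = con (l1 t) * v2 t + con 0 * 0.
Proof. by have [_ ->] := v_eigen t; rewrite mulr0 addr0. Qed.

Let zero_hyp : (fun t : T => hypnorm (0 : pfun P, 0 : pfun P))
  \isO (fun t => e t * critnorm (0 : pfun P)).
Proof.
apply: (@isO_le _ _ _ _ _ 1) => // t.
by rewrite hypnorm_zero critnorm_zero !mulr0.
Qed.

Let v_transverse t : cabs (l1 t) * X t + cabs 0 * critnorm (0 : pfun P) <=
  4 * (cabs (l1 t * coefc (v1 t) + 0 * coefc (0 : pfun P))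
     + cabs (l1 t * coefs (v1 t) + 0 * coefs (0 : pfun P))).
Proof.
rewrite critnorm_zero mulr0 !mul0r !addr0 !cabsM -mulrDr ler_peMl ?ler1n //.
by rewrite mulr_ge0 ?addr_ge0 ?cabs_ge0.
Qed.

Lemma eigen_hypnorm : (fun t => hypnorm (v1 t, v2 t)) \isO (fun t => e t * X t).
Proof.
exact: (chain_hypnorm prof Osg l1_mag v_chain1 v_chain2 zero_hyp v_transverse).
Qed.

Lemma eigen_size : (fun t => cabs (l1 t) * X t) \isO (fun t => e t ^+ 2 * X t).
Proof.
have := chain_size prof Osg l1_mag v_chain1 v_chain2 zero_hyp v_transverse.
by apply: isO_pw => t; rewrite critnorm_zero mulr0 addr0.
Qed.

Let g1 t : R := k t ^+ 2 + 4 * sg t ^+ 2 - (e t ^+ 2 - 9 / 2 * a t ^+ 2).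
Let g2 t : R := k t ^+ 2 + 4 * sg t ^+ 2 - (e t ^+ 2 - 3 / 2 * a t ^+ 2).
Let h t : R[i] := 4 * 'i * (k t)%:C * (sg t)%:C.

Lemma eigen_cos : (fun t => cabs (3 * (l1 t * coefc (v1 t))
  + 2 * ((g1 t)%:C * coefc (v1 t) - h t * coefs (v1 t))))
  \isO (fun t => e t ^+ 3 * X t).
Proof.
have := chain_cos prof Osg l1_mag v_chain1 v_chain2 zero_hyp v_transverse.
by apply: isO_pw => t; rewrite mul0r addr0.
Qed.

Lemma eigen_sin : (fun t => cabs (3 * (l1 t * coefs (v1 t))
  + 2 * ((g2 t)%:C * coefs (v1 t) + h t * coefc (v1 t))))
  \isO (fun t => e t ^+ 3 * X t).
Proof.
have := chain_sin prof Osg l1_mag v_chain1 v_chain2 zero_hyp v_transverse.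
by apply: isO_pw => t; rewrite mul0r addr0.
Qed.

(* Gram-Schmidt on the critical parts; where that of [v] vanishes the quotient
   is [0], and the result is still orthogonal to it. *)
Let beta t : R[i] := (coefc (w1 t) * (coefc (v1 t))^*%C
    + coefs (w1 t) * (coefs (v1 t))^*%C)
  / (coefc (v1 t) * (coefc (v1 t))^*%C + coefs (v1 t) * (coefs (v1 t))^*%C).
Let x1 t := w1 t - con (beta t) * v1 t.
Let x2 t := w2 t - con (beta t) * v2 t.
Let nu t := mu t + beta t * (l2 t - l1 t).

Let cx t : coefc (x1 t) = coefc (w1 t) - beta t * coefc (v1 t).
Proof. by rewrite coefcB coefcZ. Qed.
Let sx t : coefs (x1 t) = coefs (w1 t) - beta t * coefs (v1 t).
Proof. by rewrite coefsB coefsZ. Qed.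

Let orthogonal t : coefc (x1 t) * (coefc (v1 t))^*%C
  + coefs (x1 t) * (coefs (v1 t))^*%C = 0.
Proof.
rewrite cx sx; set d := coefc (v1 t) * (coefc (v1 t))^*%C
  + coefs (v1 t) * (coefs (v1 t))^*%C.
have dE : d = (cabs (coefc (v1 t)) ^+ 2 + cabs (coefs (v1 t)) ^+ 2)%:C.
  by rewrite rmorphD /= !cabs_sqr.
have [d0|d0] := eqVneq d 0.
  have : cabs (coefc (v1 t)) ^+ 2 + cabs (coefs (v1 t)) ^+ 2 = 0.
    by apply: complexI; rewrite -dE d0.
  move=> /eqP; rewrite paddr_eq0 ?sqr_ge0 // !sqrf_eq0 => /andP[/eqP h1 /eqP h2].
  by rewrite (cabs_eq0 h1) (cabs_eq0 h2) !rmorph0 !mulr0 addr0.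
transitivity ((coefc (w1 t) * (coefc (v1 t))^*%C
    + coefs (w1 t) * (coefs (v1 t))^*%C) - beta t * d); first by rewrite /d; ring.
by rewrite /beta -/d divfK // subrr.
Qed.

Lemma bloch_comb t :
  B1 t (x1 t) (x2 t) = B1 t (w1 t) (w2 t) - con (beta t) * B1 t (v1 t) (v2 t) /\
  B2 t (x1 t) (x2 t) = B2 t (w1 t) (w2 t) - con (beta t) * B2 t (v1 t) (v2 t).
Proof.
rewrite /x1 /x2 /bloch1 /bloch2 /linop1 /linop2 /floquet /potential.
rewrite !(derB, derZ); split; ring.
Qed.

Let x_chain1 t : B1 t (x1 t) (x2 t) = con (l2 t) * x1 t + con (nu t) * v1 t.
Proof.
have [-> _] := bloch_comb t; have [-> _] := v_eigen t; have [-> _] := w_eigen t.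
by rewrite /nu /x1 !(rmorphD, rmorphM, rmorphN); ring.
Qed.
Let x_chain2 t : B2 t (x1 t) (x2 t) = con (l2 t) * x2 t + con (nu t) * v2 t.
Proof.
have [_ ->] := bloch_comb t; have [_ ->] := v_eigen t; have [_ ->] := w_eigen t.
by rewrite /nu /x2 !(rmorphD, rmorphM, rmorphN); ring.
Qed.

Let x_transverse t : cabs (l2 t) * critnorm (x1 t) + cabs (nu t) * X t <=
  4 * (cabs (l2 t * coefc (x1 t) + nu t * coefc (v1 t))
     + cabs (l2 t * coefs (x1 t) + nu t * coefs (v1 t))).
Proof. exact: orthogonal_transverse. Qed.

Let x_hypnorm : (fun t => hypnorm (x1 t, x2 t)) \isO (fun t => e t * critnorm (x1 t)).
Proof.
exact: (chain_hypnorm prof Osg l2_mag x_chain1 x_chain2 eigen_hypnorm x_transverse).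
Qed.

Lemma zero_of_hypnorm (f1 f2 : pfun P) : hypnorm (f1, f2) <= 0 -> critnorm f1 = 0 ->
  f1 = 0 /\ f2 = 0.
Proof.
move=> hn cn0; have le0 (r s : R) : 0 <= r -> 0 <= s -> r + s <= 0 -> r = 0 /\ s = 0.
  by move=> r0 s0 rs; split; apply/eqP; rewrite eq_le ?r0 ?s0 andbT;
    apply: le_trans rs; rewrite ?lerDl ?lerDr.
have n1 := nm2_comp1 f1 f2; have n2 := nm2_comp2 f1 f2.
rewrite cn0 mulr0 add0r in n1 n2.
split; apply: nm_eq0; apply/eqP; rewrite eq_le nm_ge0 andbT.
  exact: le_trans (nm_nm2 _) (le_trans n1 hn).
exact: le_trans (nm_nm2 _) (le_trans n2 hn).
Qed.

(** The non-critical part is controlled by the critical one, by [eigen_hypnorm]. *)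
Lemma critical_nonzero : exists2 c : R, 0 < c & forall t, mag t < c ->
  X t != 0 /\ critnorm (x1 t) != 0.
Proof.
have [K [c [K0 c0 hK]]] := eigen_hypnorm; have [L [c' [L0 c'0 hL]]] := x_hypnorm.
exists (Num.min c c'); first by rewrite lt_min c0.
move=> t; rewrite lt_min => /andP[/hK h1 /hL h2]; split; apply/eqP => z.
  rewrite z !mulr0 in h1; have [z1 z2] := zero_of_hypnorm h1 z.
  have [||] := @independent t 1 0; rewrite ?z1 ?z2 ?rmorph0 ?mul0r ?mulr0 ?addr0 //.
  by move=> /eqP; rewrite oner_eq0.
rewrite z !mulr0 in h2; have [z1 z2] := zero_of_hypnorm h2 z.
have [||_] := @independent t (- beta t) 1.
- by rewrite rmorphN rmorph1 mul1r mulNr addrC.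
- by rewrite rmorphN rmorph1 mul1r mulNr addrC.
by move=> /eqP; rewrite oner_eq0.
Qed.

Lemma isO_nonzero (f g : T -> R) : (fun t => f t * X t) \isO (fun t => g t * X t) ->
  f \isO g.
Proof.
move=> [K [c [K0 c0 h']]]; have [c' c'0 nz] := critical_nonzero.
exists K, (Num.min c c'); split; rewrite ?lt_min ?c0 //.
move=> t; rewrite lt_min => /andP[/h' ht /nz[nzt _]].
have pos : 0 < X t by rewrite lt_def nzt critnorm_ge0.
by rewrite -(ler_pM2r pos) -mulrA.
Qed.

(** The two vectors span an invariant plane on which the Bloch operator has the
    eigenvalues [l1] and [l2]; its image under the critical coordinates is the
    reduced matrix, whose trace is computed in an orthogonalized basis. *)
Lemma pair_trace :
  (fun t => cabs (3 * (l1 t + l2 t) + 2 * ((g1 t)%:C + (g2 t)%:C)))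
  \isO (fun t => e t ^+ 3).
Proof.
have [c0 c00 nz] := critical_nonzero.
have [K1 [c1 [K10 c10 h1]]] := eigen_cos; have [K2 [c2 [K20 c20 h2]]] := eigen_sin.
have [K3 [c3 [K30 c30 h3]]] :=
  chain_cos prof Osg l2_mag x_chain1 x_chain2 eigen_hypnorm x_transverse.
have [K4 [c4 [K40 c40 h4]]] :=
  chain_sin prof Osg l2_mag x_chain1 x_chain2 eigen_hypnorm x_transverse.
pose K := K1 + K2 + K3 + K4; have K0 : 0 <= K by rewrite !addr_ge0.
exists (4 * K), (Num.min c0 (Num.min (Num.min c1 c2) (Num.min c3 c4))).
split; first by rewrite mulr_ge0.
  by rewrite !lt_min c00 c10 c20 c30 c40.
move=> t; rewrite !lt_min => /and3P[m0 /andP[m1 m2] /andP[m3 m4]].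
have [nz1 nz2] := nz t m0.
have e3 : 0 <= e t ^+ 3 by have /andP[/ltW ? _] := prof_e prof t; rewrite exprn_ge0.
have up (r K' n : R) : 0 <= n -> K' <= K -> r <= K' * (e t ^+ 3 * n) ->
    r <= K * e t ^+ 3 * n.
  move=> n0 KK /le_trans -> //; rewrite -mulrA ler_wpM2r //; exact: mulr_ge0.
rewrite -mulrA; apply: (@trace_bound _ (coefc (v1 t)) (coefs (v1 t))
    (coefc (x1 t)) (coefs (x1 t)) _ _ (nu t) _ _ (h t)).
- exact: mulr_ge0.
- exact: orthogonal.
- exact: nz1.
- exact: nz2.
- by apply: up (h1 t m1); rewrite ?critnorm_ge0 // /K -!addrA lerDl !addr_ge0.
- by apply: up (h2 t m2); rewrite ?critnorm_ge0 // /K -!addrA addrCA lerDl !addr_ge0.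
- by apply: up (h3 t m3); rewrite ?critnorm_ge0 // /K addrAC lerDr !addr_ge0.
- by apply: up (h4 t m4); rewrite ?critnorm_ge0 // /K lerDr !addr_ge0.
Qed.

Lemma pair_size : (fun t => cabs (l1 t)) \isO (fun t => e t ^+ 2).
Proof. exact: isO_nonzero eigen_size. Qed.

(** The reduced eigenvalue equation for [v] alone; the determinant on the left is
    the characteristic polynomial at [l1]. *)
Lemma pair_det : (fun t => cabs ((3 * l1 t + 2 * (g1 t)%:C)
    * (3 * l1 t + 2 * (g2 t)%:C) + 4 * h t ^+ 2))
  \isO (fun t => e t ^+ 3 * (cabs (3 * l1 t + 2 * (g1 t)%:C)
     + cabs (3 * l1 t + 2 * (g2 t)%:C) + 4 * cabs (h t))).
Proof.
have [c0 c00 nz] := critical_nonzero.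
have [K1 [c1 [K10 c10 h1]]] := eigen_cos; have [K2 [c2 [K20 c20 h2]]] := eigen_sin.
exists (K1 + K2), (Num.min c0 (Num.min c1 c2)).
split; rewrite ?addr_ge0 ?lt_min ?c00 ?c10 //.
move=> t; rewrite !lt_min => /and3P[m0 m1 m2]; have [nz1 _] := nz t m0.
have e3 : 0 <= e t ^+ 3 by have /andP[/ltW ? _] := prof_e prof t; rewrite exprn_ge0.
have e3X : 0 <= e t ^+ 3 * X t by rewrite mulr_ge0 ?critnorm_ge0.
rewrite mulrA; apply: (@det_bound _ (coefc (v1 t)) (coefs (v1 t))) => //.
  by apply: le_trans (h1 t m1) _; rewrite -mulrA ler_wpM2r // lerDl.
by apply: le_trans (h2 t m2) _; rewrite -mulrA ler_wpM2r // lerDr.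
Qed.

End Pair.

(** * Reflection and translation *)

Section Reflection.
Context {R : realType} {P : calculus R}.
Implicit Types (f v : pfun P).
Local Notation "x %:f" := (@con R P (real_complex R x)) (at level 2, format "x %:f").

Lemma coefc_refl f : coefc (refl f) = coefc f.
Proof. by rewrite /coefc -{1}[pcos]refl_cos -rmorphM avg_refl. Qed.

Lemma coefs_refl f : coefs (refl f) = - coefs f.
Proof.
rewrite /coefs -avgN -mulrN; have -> : - (psin : pfun P) = refl psin by rewrite refl_sin.
by rewrite -[in RHS]avg_refl rmorphM /= reflK.
Qed.

Lemma nm2_refl f : nm2 (refl f) <= nm2 f.
Proof.
rewrite /nm2 !der_refl derN der_refl opprK nmN.
by rewrite !lerD ?nm_refl.
Qed.

Lemma refl_cosin (b c : R[i]) : refl (cosin b c) = cosin (P := P) b (- c).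
Proof.
by rewrite rmorphD !rmorphM /= !refl_con refl_cos refl_sin /cosin rmorphN; ring.
Qed.

Lemma hyp_refl v1 v2 : hyp1 (refl v1, refl v2) = refl (hyp1 (v1, v2)) /\
  hyp2 (refl v1, refl v2) = refl (hyp2 (v1, v2)).
Proof.
rewrite /hyp1 /hyp2 /= !coefc_refl !coefs_refl mulrN.
by rewrite -(refl_cosin (2 * _)) -(refl_cosin (coefc v1)); split;
  [rewrite rmorphB | rewrite [RHS]rmorphD].
Qed.

Lemma hypD v1 v2 w1 w2 :
  hyp1 (v1 + w1, v2 + w2) = hyp1 (v1, v2) + hyp1 (w1, w2) /\
  hyp2 (v1 + w1, v2 + w2) = hyp2 (v1, v2) + hyp2 (w1, w2).
Proof.
rewrite /hyp1 /hyp2 /= !coefcD !coefsD /cosin !(mulrDr, rmorphD); split; ring.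
Qed.

Lemma hypN v1 v2 : hyp1 (- v1, - v2) = - hyp1 (v1, v2) /\
  hyp2 (- v1, - v2) = - hyp2 (v1, v2).
Proof.
rewrite /hyp1 /hyp2 /= !coefcN !coefsN /cosin !(mulrN, rmorphN); split; ring.
Qed.

Lemma hypnorm_odd v1 v2 : hypnorm (v1 - refl v1, v2 - refl v2) <=
  2 * hypnorm (v1, v2).
Proof.
rewrite /hypnorm; have [-> ->] := hypD v1 v2 (- refl v1) (- refl v2).
have [-> ->] := hypN (refl v1) (refl v2).
have [-> ->] := hyp_refl v1 v2; move: (hyp1 _) (hyp2 _) => f g.
have := nm2D f (- refl f); have := nm2D g (- refl g); rewrite !nm2N.
by have := nm2_refl f; have := nm2_refl g; norm2_lra.
Qed.

Lemma linop_refl e k (u1 u2 v1 v2 : pfun P) : refl u1 = u1 -> refl u2 = u2 ->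
  linop1 e k u1 u2 (refl v1) (refl v2) = refl (linop1 e k u1 u2 v1 v2) /\
  linop2 e k u1 u2 (refl v1) (refl v2) = refl (linop2 e k u1 u2 v1 v2).
Proof.
move=> r1 r2; rewrite /linop1 /linop2 /potential !der_refl !derN !der_refl.
move: (@refl_con R P (1 + k)%:C) (@refl_con R P (e ^+ 2 + 3)%:C)
  (@refl_con R P (e ^+ 2 + 4)%:C).
move: (con (1 + k)%:C) (con (e ^+ 2 + 3)%:C) (con (e ^+ 2 + 4)%:C) => A B D hA hB hD.
rewrite !opprK !(rmorphD, rmorphN, rmorphM, rmorphXn, rmorph_nat) /=.
by rewrite hA hB hD r1 r2 rmorph1; split; ring.
Qed.

Lemma linopD e k (u1 u2 v1 v2 w1 w2 : pfun P) :
  linop1 e k u1 u2 (v1 + w1) (v2 + w2) =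
    linop1 e k u1 u2 v1 v2 + linop1 e k u1 u2 w1 w2 /\
  linop2 e k u1 u2 (v1 + w1) (v2 + w2) =
    linop2 e k u1 u2 v1 v2 + linop2 e k u1 u2 w1 w2.
Proof. by rewrite /linop1 /linop2 /potential !derD; split; ring. Qed.

Lemma linopZ e k c (u1 u2 v1 v2 : pfun P) :
  linop1 e k u1 u2 (con c * v1) (con c * v2) = con c * linop1 e k u1 u2 v1 v2 /\
  linop2 e k u1 u2 (con c * v1) (con c * v2) = con c * linop2 e k u1 u2 v1 v2.
Proof. by rewrite /linop1 /linop2 /potential !derZ; split; ring. Qed.

Lemma floquet_refl k (sg : R) v : refl (floquet k sg v) = floquet k (- sg) (refl v).
Proof.
rewrite /floquet der_refl sqrrN.
have -> : con ('i * (- sg)%:C) = - con ('i * sg%:C) :> pfun P.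
  by rewrite rmorphN mulrN rmorphN.
by rewrite rmorphM /= rmorphB /= !rmorphM /= !refl_con rmorph_nat mulrNN.
Qed.

Lemma refl_defect1 c k (sg : R) v : refl (con c * v - floquet k sg v) =
  con c * refl v - floquet k (- sg) (refl v).
Proof.
rewrite -floquet_refl; move: (floquet k sg v) => f.
by rewrite rmorphB rmorphM /= refl_con.
Qed.

Lemma refl_defect2 c k (sg : R) v : refl (con c * v - 4 * floquet k sg v) =
  con c * refl v - 4 * floquet k (- sg) (refl v).
Proof.
rewrite -floquet_refl; move: (floquet k sg v) => f.
by rewrite rmorphB !rmorphM /= refl_con rmorph_nat.
Qed.

(** Translation invariance: the derivative of the profile is in the kernel of
    the linearization. *)
Lemma linop_translation e k (u1 u2 : pfun P) : is_profile e k u1 u2 ->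
  linop1 e k u1 u2 (der u1) (der u2) = 0 /\
  linop2 e k u1 u2 (der u1) (der u2) = 0.
Proof.
move=> [p1 p2].
have dN : der (nonlinearity e u1 u2) = potential e u1 u2 (der u1) (der u2).
  have d4 : der (4 : pfun P) = 0 by rewrite -(con_nat 4) der_con.
  have h : (e ^+ 2 + 4)%:f = (e ^+ 2 / 2 + 2)%:f * 2 :> pfun P.
    rewrite -(con_nat 2) -rmorphM -(rmorph_nat (real_complex R)) -rmorphM.
    by congr (con _%:C); field.
  rewrite /nonlinearity /potential h.
  by rewrite !(d4, derX, der_con, derM, derD) expr1; ring.
have d0 : der (0 : pfun P) = 0 by rewrite -{1}(rmorph0 con) der_con.
move: dN p1 p2; move: (nonlinearity e u1 u2) => N dN p1 p2.
have := congr1 der p1; have := congr1 der p2; rewrite d0 !(derB, derD) dN -!mulrA.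
rewrite !der_nat !derZ => q2 q1; split.
  by rewrite -[RHS]q1 /linop1.
by rewrite -[RHS]q2 /linop2; ring.
Qed.

End Reflection.

(** * The translation eigenvalue *)

(** The rough reduced equations have errors of order [e ^+ 3] even at [sg = 0],
    where one eigenvalue is exactly 0.  To see the factor [s ^+ 2] the eigenvector
    is split into its even and odd parts: without Floquet terms the equations
    decouple, the even mode is damped, and the odd one is removed by the
    derivative of the profile. *)
Section Sharp.
Context {R : realType} {P : calculus R} {T : Type}.
Variables (mag e k a s sg : T -> R) (u1 u2 v1 v2 : T -> pfun P) (l : T -> R[i]).
Local Notation "f \isO g" := (isO mag f g) (at level 70).
Local Notation "x %:f" := (@con R P (real_complex R x)) (at level 2, format "x %:f").
Hypothesis prof : profiles mag e k a u1 u2.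
Hypothesis u1_even : forall t, refl (u1 t) = u1 t.
Hypothesis u2_even : forall t, refl (u2 t) = u2 t.
Hypothesis u1_critical : forall t, coefc (u1 t) != 0.
Hypothesis sgE : forall t, sg t = 2 * e t * s t.
Hypothesis s_mag : forall t, `|s t| <= mag t.
Hypothesis l_mag : forall t, cabs (l t) <= mag t.
Hypothesis l_small : (fun t => cabs (l t)) \isO (fun t => e t ^+ 2 * mag t).
Local Notation B1 t := (bloch1 (e t) (k t) (sg t) (u1 t) (u2 t)).
Local Notation B2 t := (bloch2 (e t) (k t) (sg t) (u1 t) (u2 t)).
Hypothesis eigen : forall t, B1 t (v1 t) (v2 t) = con (l t) * v1 t
  /\ B2 t (v1 t) (v2 t) = con (l t) * v2 t.
Hypothesis sine_dominates :
  (fun t => critnorm (v1 t)) \isO (fun t => cabs (coefs (v1 t))).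
Local Notation d1 t := (e t ^+ 2 - 9 / 2 * a t ^+ 2).
Hypothesis nondegenerate : (fun t => e t ^+ 2) \isO (fun t => `|k t ^+ 2 - d1 t|).

(** Even and odd parts, up to the factor 2. *)
Let E1 t := v1 t + refl (v1 t). Let E2 t := v2 t + refl (v2 t).
Let O1 t := v1 t - refl (v1 t). Let O2 t := v2 t - refl (v2 t).
Let x t := coefc (E1 t). Let S t := coefs (O1 t).
Let r t : R := `|s t|. Let bx t : R := cabs (x t). Let bS t : R := cabs (S t).
Let one (t : T) : R := 1.
Let lS t : R := cabs (l t) * bS t. Let mx t : R := mag t * bx t.

Let e0 t : 0 < e t. Proof. by have /andP[] := prof_e prof t. Qed.
Let e1 t : e t <= 1. Proof. by have /andP[] := prof_e prof t. Qed.
Let r0 t : 0 <= r t. Proof. exact: normr_ge0. Qed.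
Let mag0 t : 0 <= mag t. Proof. exact: le_trans (r0 t) (s_mag t). Qed.
Let bx0 t : 0 <= bx t. Proof. exact: cabs_ge0. Qed.
Let bS0 t : 0 <= bS t. Proof. exact: cabs_ge0. Qed.
Let one0 t : 0 <= one t. Proof. exact: ler01. Qed.
Let lS0 t : 0 <= lS t. Proof. by rewrite mulr_ge0 ?cabs_ge0. Qed.
Let mx0 t : 0 <= mx t. Proof. exact: mulr_ge0. Qed.

Let M (i j : nat) (c : T -> R) t : R := e t ^+ i * r t ^+ j * c t.

Let M0 i j c : (forall t, 0 <= c t) -> forall t, 0 <= M i j c t.
Proof. by move=> c0 t; rewrite !mulr_ge0 ?exprn_ge0 // ltW. Qed.

Let isO_MM i j i' j' i'' j'' c : (i'' <= i + i')%N -> (j'' <= j + j')%N ->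
  (forall t, 0 <= c t) ->
  (fun t => M i j one t * M i' j' c t) \isO M i'' j'' c.
Proof.
move=> hi hj c0; apply: (@isO_le_small _ _ _ _ _ 1) => // t mt.
have r1 : r t <= 1 by apply: le_trans (s_mag t) (ltW mt).
rewrite /M /one mul1r mulr1 mulrA ler_wpM2r // mulrACA -!exprD.
have le0 n := exprn_ge0 n (ltW (e0 t)); have lr0 n := exprn_ge0 n (r0 t).
by rewrite ler_pM // ler_wiXn2l ?e1 // ltW.
Qed.

Let isO_M i' j' i'' j'' c : (i'' <= i')%N -> (j'' <= j')%N ->
  (forall t, 0 <= c t) -> M i' j' c \isO M i'' j'' c.
Proof.
move=> hi hj c0; apply: isO_trans (@isO_MM 0 0 i' j' i'' j'' c hi hj c0).
by apply: (@isO_le _ _ _ _ _ 1) => // t; rewrite !mul1r /M /one !expr0 !mul1r.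
Qed.

Let isO_addl (f g h : T -> R) : (forall t, 0 <= h t) -> f \isO g ->
  f \isO (fun t => g t + h t).
Proof. by move=> h0 fg; apply: isO_mono fg _ => t; rewrite lerDl. Qed.
Let isO_addr (f g h : T -> R) : (forall t, 0 <= h t) -> f \isO g ->
  f \isO (fun t => h t + g t).
Proof. by move=> h0 fg; apply: isO_mono fg _ => t; rewrite lerDr. Qed.

Let isO_distr (f g h G : T -> R) : (fun t => f t * g t) \isO G ->
  (fun t => f t * h t) \isO G -> (fun t => f t * (g t + h t)) \isO G.
Proof.
move=> fg fh; apply: isO_eq (isOD fg fh) => t; exact: mulrDr.
Qed.

Ltac pos := solve [ move=> ?; rewrite ?addr_ge0 ?hypnorm_ge0 ?nm_ge0 //;
  first [exact: bx0 | exact: bS0 | exact: lS0 | exact: mx0 | exact: one0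
    | exact: M0 ] ].
(* Closes comparisons of gauges that are sums of monomials. *)
Ltac gauge := solve
  [ apply: isO_refl
  | apply: isO_MM => //; pos | apply: isO_M => //; pos
  | apply: isO_addl; [pos | gauge] | apply: isO_addr; [pos | gauge]
  | apply: isO_distr; gauge | apply: isOD; gauge ].

Let Ok : (fun t => cabs (k t)%:C) \isO M 1 0 one.
Proof.
apply: isO_trans (_ : e \isO _).
  by apply: isO_pw (prof_k prof) => t; rewrite cabsr.
by apply: (@isO_le _ _ _ _ _ 1) => // t; rewrite /M /one expr1 expr0 !mulr1 mul1r.
Qed.
Let Ok1 : (fun t => cabs (1 + k t)%:C) \isO M 0 0 one.
Proof.
apply: (isO_eq (g := fun t => cabs (1%:C + (k t)%:C))).
  by move=> t; rewrite rmorphD.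
apply: isO_cabsD; last by apply: isO_trans Ok _; gauge.
apply: (@isO_le _ _ _ _ _ 1) => // t.
by rewrite cabsr normr1 /M /one !expr0 !mul1r.
Qed.
Let Osi : (fun t => cabs ('i * (sg t)%:C)) \isO M 1 1 one.
Proof.
apply: (@isO_le _ _ _ _ _ 2) => // t; rewrite cabsM cabsi mul1r cabsr sgE.
have h : 0 <= 2 * e t by rewrite mulr_ge0 // ltW.
by rewrite normrM (ger0_norm h) /M /one mulr1 !expr1 mulrA.
Qed.
Let Os2 : (fun t => cabs (sg t ^+ 2)%:C) \isO M 2 2 one.
Proof.
apply: (@isO_le _ _ _ _ _ 4) => // t; rewrite cabsr sgE ger0_norm ?sqr_ge0 //.
rewrite /M /r /one mulr1 real_normK ?num_real // le_eqVlt.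
by apply/orP; left; apply/eqP; ring.
Qed.
Let Ol : (fun t => cabs (l t)) \isO M 2 0 one.
Proof.
apply: isO_trans l_small _; apply: (@isO_le_small _ _ _ _ _ 1) => // t /ltW m1.
by rewrite /M /one expr0 !mulr1 mul1r ler_piMr // sqr_ge0.
Qed.
Let Osg : (fun t => `|sg t|) \isO e.
Proof.
apply: (@isO_trans _ _ _ _ (M 1 1 one)).
  by apply: isO_pw Osi => t; rewrite cabsM cabsi mul1r cabsr.
apply: (@isO_trans _ _ _ _ (M 1 0 one)); first gauge.
by apply: (@isO_le _ _ _ _ _ 1) => // t; rewrite /M /one expr1 expr0 !mulr1 mul1r.
Qed.

Let xE t : x t = 2 * coefc (v1 t).
Proof. by rewrite /x coefcD coefc_refl; ring. Qed.
Let SE t : S t = 2 * coefs (v1 t).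
Proof. by rewrite /S coefsB coefs_refl; ring. Qed.
Let coefsE t : coefs (E1 t) = 0.
Proof. by rewrite coefsD coefs_refl subrr. Qed.
Let coefcO t : coefc (O1 t) = 0.
Proof. by rewrite coefcB coefc_refl subrr. Qed.
Let critE t : critnorm (E1 t) = bx t.
Proof. by rewrite /critnorm coefsE cabs0 addr0. Qed.
Let critO t : critnorm (O1 t) = bS t.
Proof. by rewrite /critnorm coefcO cabs0 add0r. Qed.

Let X_bS : (fun t => critnorm (v1 t)) \isO bS.
Proof.
apply: isO_trans sine_dominates _; apply: (@isO_le _ _ _ _ _ 1) => // t.
by rewrite mul1r /bS SE cabs2 ler_peMl ?cabs_ge0 ?ler1n.
Qed.
Let Obx : bx \isO M 0 0 bS.
Proof.
apply: isO_trans (_ : bS \isO _); last first.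
  by apply: (@isO_le _ _ _ _ _ 1) => // t; rewrite /M !expr0 !mul1r.
apply: isO_trans X_bS; apply: (@isO_le _ _ _ _ _ 2) => // t.
by rewrite /bx xE cabs2 ler_wpM2l // lerDl cabs_ge0.
Qed.

Local Notation NE t := (hypnorm (E1 t, E2 t)).
Local Notation NO t := (hypnorm (O1 t, O2 t)).

Let Nv : (fun t => hypnorm (v1 t, v2 t)) \isO M 1 0 bS.
Proof.
apply: isO_trans (eigen_hypnorm prof Osg l_mag eigen) _.
have X0 t : 0 <= critnorm (v1 t) := critnorm_ge0 _.
have := isOM (fun t => ltW (e0 t)) X0 (isO_refl mag e) X_bS.
by move=> h; apply: isO_mono h _ => t; rewrite /M expr1 expr0 mulr1.
Qed.
Let NO_bS : (fun t => NO t) \isO M 1 0 bS.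
Proof.
by apply: isO_trans Nv; apply: (@isO_le _ _ _ _ _ 2) => // t; exact: hypnorm_odd.
Qed.

Let OE1 : (fun t => nm2 (E1 t)) \isO (fun t => M 0 0 bx t + NE t).
Proof.
apply: isO_mono (isO_comp1 mag E1 E2) _ => t.
by rewrite critE /M !expr0 !mul1r.
Qed.
Let OE2 : (fun t => nm2 (E2 t)) \isO (fun t => M 0 0 bx t + NE t).
Proof.
apply: isO_mono (isO_comp2 mag E1 E2) _ => t.
by rewrite critE /M !expr0 !mul1r.
Qed.
Let OO1 : (fun t => nm2 (O1 t)) \isO M 0 0 bS.
Proof.
apply: isO_trans (isO_comp1 mag O1 O2) _; apply: isOD.
  by apply: (@isO_le _ _ _ _ _ 1) => // t; rewrite critO /M !expr0 !mul1r.
by apply: isO_trans NO_bS _; gauge.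
Qed.
Let OO2 : (fun t => nm2 (O2 t)) \isO M 0 0 bS.
Proof.
apply: isO_trans (isO_comp2 mag O1 O2) _; apply: isOD.
  by apply: (@isO_le _ _ _ _ _ 1) => // t; rewrite critO /M !expr0 !mul1r.
by apply: isO_trans NO_bS _; gauge.
Qed.
Local Notation yE t := (slaved (E1 t) (E2 t)).
Local Notation yO t := (slaved (O1 t) (O2 t)).
Let OyO : (fun t => nm2 (yO t)) \isO M 1 0 bS.
Proof. by apply: isO_trans NO_bS; exact: isO_slaved. Qed.

(* The Floquet terms exchange the parities, except for the quadratic one. *)
Let cross t (f g : pfun P) : pfun P :=
  (1 + k t)%:f * (2 * (con ('i * (sg t)%:C) * der g) - (sg t ^+ 2)%:f * f).

Let Ocross (f g : T -> pfun P) (hf hg : T -> R) :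
  (fun t => nm2 (f t)) \isO hf -> (fun t => nm2 (g t)) \isO hg ->
  (forall t, 0 <= hf t) -> (forall t, 0 <= hg t) ->
  (fun t => nm (cross t (f t) (g t)))
    \isO (fun t => M 1 1 one t * hg t + M 2 2 one t * hf t).
Proof.
move=> Of Og f0 g0; have pg t : 0 <= M 1 1 one t * hg t by rewrite mulr_ge0 ?M0.
have pf t : 0 <= M 2 2 one t * hf t by rewrite mulr_ge0 ?M0.
apply: isO_trans (isO_nmZ Ok1 (_ : _ \isO (fun t => M 1 1 one t * hg t
    + M 2 2 one t * hf t))) _; last first.
  by apply: (@isO_le _ _ _ _ _ 1) => // t; rewrite {1}/M /one !expr0 !mul1r.
apply: isO_nmB.
  apply: isO_addl => //; apply: isO_nm_nat; apply: isO_nmZ Osi _.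
  by apply: isO_pw Og => t; exact: nm_der_nm2.
apply: isO_addr => //; apply: isO_nmZ Os2 _.
by apply: isO_pw Of => t; exact: nm_nm2.
Qed.

Local Notation L1 t := (linop1 (e t) (k t) (u1 t) (u2 t)).
Local Notation L2 t := (linop2 (e t) (k t) (u1 t) (u2 t)).

Let G_of_v t : L1 t (v1 t) (v2 t) = con (l t) * v1 t - floquet (k t) (sg t) (v1 t)
  /\ L2 t (v1 t) (v2 t) = con (l t) * v2 t - 4 * floquet (k t) (sg t) (v2 t).
Proof.
have [<- <-] := eigen t; rewrite /bloch1 /bloch2.
by rewrite !addrK.
Qed.

Let even_eq t : L1 t (E1 t) (E2 t) = con (l t) * E1 t - cross t (E1 t) (O1 t)
  /\ L2 t (E1 t) (E2 t) = con (l t) * E2 t - 4 * cross t (E2 t) (O2 t).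
Proof.
have [-> ->] := linopD (e t) (k t) (u1 t) (u2 t) (v1 t) (v2 t)
  (refl (v1 t)) (refl (v2 t)).
have [-> ->] := linop_refl (e t) (k t) (v1 t) (v2 t) (u1_even t) (u2_even t).
have [-> ->] := G_of_v t.
rewrite refl_defect1 refl_defect2.
rewrite /floquet /cross /E1 /O1 /E2 /O2 !derB sqrrN.
have -> : con ('i * (- sg t)%:C) = - con ('i * (sg t)%:C) :> pfun P.
  by rewrite rmorphN mulrN rmorphN.
by split; ring.
Qed.

Let odd_eq t : L1 t (O1 t) (O2 t) = con (l t) * O1 t - cross t (O1 t) (E1 t)
  /\ L2 t (O1 t) (O2 t) = con (l t) * O2 t - 4 * cross t (O2 t) (E2 t).
Proof.
have [-> ->] := linopD (e t) (k t) (u1 t) (u2 t) (v1 t) (v2 t)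
  (- refl (v1 t)) (- refl (v2 t)).
have rN (f : pfun P) : - f = con (-1) * f by rewrite rmorphN rmorph1 mulN1r.
rewrite (rN (refl (v1 t))) (rN (refl (v2 t))).
have [-> ->] := linopZ (e t) (k t) (-1) (u1 t) (u2 t) (refl (v1 t)) (refl (v2 t)).
have [-> ->] := linop_refl (e t) (k t) (v1 t) (v2 t) (u1_even t) (u2_even t).
have [-> ->] := G_of_v t.
rewrite refl_defect1 refl_defect2.
rewrite /floquet /cross /E1 /O1 /E2 /O2 !derD sqrrN !(rmorphN1 con).
have -> : con ('i * (- sg t)%:C) = - con ('i * (sg t)%:C) :> pfun P.
  by rewrite rmorphN mulrN rmorphN.
by split; ring.
Qed.

Local Notation gE t := (nm (L1 t (E1 t) (E2 t)) + nm (L2 t (E1 t) (E2 t))).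
Local Notation gO t := (nm (L1 t (O1 t) (O2 t)) + nm (L2 t (O1 t) (O2 t))).

Let NE0 t : 0 <= NE t. Proof. exact: hypnorm_ge0. Qed.

Let gE_crude : (fun t => gE t) \isO (fun t => M 1 0 bx t + M 1 1 bS t + mag t * NE t).
Proof.
have mN t : 0 <= mag t * NE t by rewrite mulr_ge0.
have p1 : forall t, 0 <= M 0 0 bx t + NE t by move=> t; rewrite addr_ge0 // M0.
have eNE i j : (0 < i)%N -> (fun t => M i j one t * NE t) \isO (fun t => mag t * NE t).
  move=> i0; apply: (@isO_le_small _ _ _ _ _ 1) => // t m1; rewrite mul1r ler_wpM2r //.
  have r1 : r t <= 1 by apply: le_trans (s_mag t) (ltW m1).
  apply: le_trans (prof_mag prof t); rewrite /M /one mulr1.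
  rewrite -[leRHS]mulr1 ler_pM ?exprn_ge0 ?exprn_ile1 // ?(ltW (e0 t)) //.
  by rewrite -[leRHS]expr1 ler_wiXn2l // ltW.
have half (f f' F : T -> pfun P) : (fun t => nm2 (f t)) \isO (fun t => M 0 0 bx t + NE t) ->
    (fun t => nm2 (f' t)) \isO M 0 0 bS ->
    (fun t => nm (con (l t) * f t)) \isO
      (fun t => M 1 0 bx t + M 1 1 bS t + mag t * NE t) /\
    (fun t => nm (cross t (f t) (f' t))) \isO
      (fun t => M 1 0 bx t + M 1 1 bS t + mag t * NE t).
  move=> hf hf'; split.
    apply: isO_trans (isO_nmZ Ol (isO_pw (fun t => nm_nm2 (f t)) hf)) _.
    apply: isO_distr; first by apply: isO_addl => //; gauge.
    by apply: isO_addr; [pos | exact: eNE].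
  apply: isO_trans (Ocross hf hf' p1 (M0 0 0 bS0)) _; apply: isOD.
    by apply: isO_addl => //; gauge.
  apply: isO_distr; first by apply: isO_addl => //; gauge.
  by apply: isO_addr; [pos | exact: eNE].
have [a1 a2] := half E1 O1 E1 OE1 OO1; have [b1 b2] := half E2 O2 E1 OE2 OO2.
apply: isOD.
  by apply: (isO_eq (fun t => congr1 nm (even_eq t).1)); apply: isO_nmB.
apply: (isO_eq (fun t => congr1 nm (even_eq t).2)); apply: isO_nmB => //.
exact: isO_nm_nat.
Qed.

Let NE_bound : (fun t => NE t) \isO (fun t => M 1 0 bx t + M 1 1 bS t).
Proof.
apply: isO_absorb => //; apply: isO_trans (hypnorm_estimate prof E1 E2) _.
apply: isOD; last exact: gE_crude.
apply: isO_addl; first by move=> t; rewrite mulr_ge0.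
apply: isO_addl; first pos.
by apply: (@isO_le _ _ _ _ _ 1) => // t; rewrite critE /M expr1 expr0 mulr1 mul1r.
Qed.

Let OE1' : (fun t => nm2 (E1 t)) \isO (fun t => M 0 0 bx t + M 1 1 bS t).
Proof.
apply: isO_trans OE1 _; apply: isOD; first gauge.
by apply: isO_trans NE_bound _; gauge.
Qed.
Let OE2' : (fun t => nm2 (E2 t)) \isO (fun t => M 0 0 bx t + M 1 1 bS t).
Proof.
apply: isO_trans OE2 _; apply: isOD; first gauge.
by apply: isO_trans NE_bound _; gauge.
Qed.
Let OyE : (fun t => nm2 (yE t)) \isO (fun t => M 1 0 bx t + M 1 1 bS t).
Proof. by apply: isO_trans NE_bound; exact: isO_slaved. Qed.

Let gE_bound : (fun t => gE t) \isO (fun t => M 2 0 bx t + M 1 1 bS t).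
Proof.
have p1 : forall t, 0 <= M 0 0 bx t + M 1 1 bS t by pos.
have half (f f' : T -> pfun P) :
    (fun t => nm2 (f t)) \isO (fun t => M 0 0 bx t + M 1 1 bS t) ->
    (fun t => nm2 (f' t)) \isO M 0 0 bS ->
    (fun t => nm (con (l t) * f t)) \isO (fun t => M 2 0 bx t + M 1 1 bS t) /\
    (fun t => nm (cross t (f t) (f' t))) \isO (fun t => M 2 0 bx t + M 1 1 bS t).
  move=> hf hf'; split.
    by apply: isO_trans (isO_nmZ Ol (isO_pw (fun t => nm_nm2 (f t)) hf)) _; gauge.
  by apply: isO_trans (Ocross hf hf' p1 (M0 0 0 bS0)) _; gauge.
have [a1 a2] := half E1 O1 OE1' OO1; have [b1 b2] := half E2 O2 OE2' OO2.
apply: isOD.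
  by apply: (isO_eq (fun t => congr1 nm (even_eq t).1)); apply: isO_nmB.
apply: (isO_eq (fun t => congr1 nm (even_eq t).2)); apply: isO_nmB => //.
exact: isO_nm_nat.
Qed.

Let gO_bound : (fun t => gO t) \isO (fun t => lS t + M 1 1 bx t + M 2 2 bS t).
Proof.
have p1 : forall t, 0 <= M 0 0 bx t + M 1 1 bS t by pos.
have half (f f' : T -> pfun P) :
    (fun t => nm2 (f t)) \isO M 0 0 bS ->
    (fun t => nm2 (f' t)) \isO (fun t => M 0 0 bx t + M 1 1 bS t) ->
    (fun t => nm (con (l t) * f t)) \isO (fun t => lS t + M 1 1 bx t + M 2 2 bS t) /\
    (fun t => nm (cross t (f t) (f' t))) \isO (fun t => lS t + M 1 1 bx t + M 2 2 bS t).
  move=> hf hf'; split.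
    apply: isO_addl; first pos; apply: isO_addl; first pos.
    apply: isO_mono (isO_nmZ (isO_refl mag (fun t => cabs (l t)))
      (isO_pw (fun t => nm_nm2 (f t)) hf)) _ => t.
    by rewrite /M !expr0 !mul1r.
  by apply: isO_trans (Ocross hf hf' (M0 0 0 bS0) p1) _; gauge.
have [a1 a2] := half O1 E1 OO1 OE1'; have [b1 b2] := half O2 E2 OO2 OE2'.
apply: isOD.
  by apply: (isO_eq (fun t => congr1 nm (odd_eq t).1)); apply: isO_nmB.
apply: (isO_eq (fun t => congr1 nm (odd_eq t).2)); apply: isO_nmB => //.
exact: isO_nm_nat.
Qed.

Let cross_slaved t (f1 f2 g1 g2 : pfun P) :
  2 * cross t f1 g1 + 4 * cross t f2 g2 = 2 * cross t (slaved f1 f2) (slaved g1 g2).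
Proof. by rewrite /cross /slaved derD der_nat; ring. Qed.

Let forcing_even t : forcing (e t) (k t) (u1 t) (u2 t) (E1 t) (E2 t) =
  con (l t) * (2 * E1 t + E2 t) - 2 * cross t (yE t) (yO t).
Proof.
rewrite /forcing; have [-> ->] := even_eq t.
by rewrite -cross_slaved; ring.
Qed.
Let forcing_odd t : forcing (e t) (k t) (u1 t) (u2 t) (O1 t) (O2 t) =
  con (l t) * (2 * O1 t + O2 t) - 2 * cross t (yO t) (yE t).
Proof.
rewrite /forcing; have [-> ->] := odd_eq t.
by rewrite -cross_slaved; ring.
Qed.

Let forcing_even_bound : (fun t => nm (forcing (e t) (k t) (u1 t) (u2 t) (E1 t) (E2 t)))
  \isO (fun t => M 2 0 bx t + M 2 1 bS t).
Proof.
have p1 : forall t, 0 <= M 1 0 bx t + M 1 1 bS t by pos.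
apply: (isO_eq (fun t => congr1 nm (forcing_even t))); apply: isO_nmB.
  apply: isO_trans (isO_nmZ Ol (_ : _ \isO (fun t => M 0 0 bx t + M 1 1 bS t))) _.
    apply: isO_nmD; [apply: isO_nm_nat; apply: isO_pw OE1'|apply: isO_pw OE2'] => t;
    exact: nm_nm2.
  by gauge.
by apply: isO_nm_nat; apply: isO_trans (Ocross OyE OyO p1 (M0 1 0 bS0)) _; gauge.
Qed.

Let e_gauge i (f : T -> R) c d p q p' q' : (forall t, 0 <= f t) ->
  f \isO (fun t => M p q c t + M p' q' d t) ->
  (fun t => e t ^+ i * f t) \isO (fun t => M (i + p) q c t + M (i + p') q' d t).
Proof.
move=> f0 hf; have ei t : 0 <= e t ^+ i by rewrite exprn_ge0 // ltW.
apply: isO_mono (isOM ei f0 (isO_refl mag _) hf) _ => t.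
by rewrite mulrDr /M !exprD !mulrA.
Qed.

Let excess_even : (fun t => nm (excess (e t) (u1 t) (u2 t) (E1 t) (E2 t)))
  \isO (fun t => M 2 0 bx t + M 2 1 bS t).
Proof.
apply: isO_trans (excess_bound prof E1 E2) _; apply: isOD.
  apply: isO_addl; first pos.
  by apply: (@isO_le _ _ _ _ _ 1) => // t; rewrite critE /M expr0 mulr1 mul1r.
have gE0 t : 0 <= gE t by rewrite addr_ge0 ?nm_ge0.
apply: isO_trans (_ : (fun t => e t ^+ 1 * gE t) \isO _).
  by apply: isO_mono (isO_refl mag _) _ => t; rewrite expr1.
by apply: isO_trans (e_gauge 1 gE0 gE_bound) _; gauge.
Qed.

Let excess_even_cos : (fun t => cabs (coefc (excess (e t) (u1 t) (u2 t) (E1 t) (E2 t))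
    - (d1 t)%:C * x t)) \isO (fun t => M 3 0 bx t + M 3 1 bS t).
Proof.
apply: isO_trans (excess_cos_nm prof E1 E2) _; apply: isOD; first apply: isOD.
- apply: isO_addl; first pos.
  by apply: (@isO_le _ _ _ _ _ 1) => // t; rewrite critE /M expr0 mulr1 mul1r.
- have gE0 t : 0 <= gE t by rewrite addr_ge0 ?nm_ge0.
  by apply: isO_trans (e_gauge 2 gE0 gE_bound) _; gauge.
apply: isO_trans (_ : (fun t => e t ^+ 1 *
  nm (forcing (e t) (k t) (u1 t) (u2 t) (E1 t) (E2 t))) \isO _).
  by apply: isO_mono (isO_refl mag _) _ => t; rewrite expr1.
by apply: isO_trans (e_gauge 1 (fun t => nm_ge0 _) forcing_even_bound) _; gauge.
Qed.

Let coefc_cross t f g : coefc (cross t f g) =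
  (1 + k t)%:C * (2 * ('i * (sg t)%:C) * coefs g - (sg t ^+ 2)%:C * coefc f).
Proof.
by rewrite /cross coefcZ coefcB -(con_nat 2) !coefcZ coefc_der mulrA.
Qed.
Let coefs_cross t f g : coefs (cross t f g) =
  (1 + k t)%:C * (- (2 * ('i * (sg t)%:C) * coefc g) - (sg t ^+ 2)%:C * coefs f).
Proof.
by rewrite /cross coefsZ coefsB -(con_nat 2) !coefsZ coefs_der mulrA mulrN.
Qed.

(* The remainders in the critical coordinates of the slaved combinations. *)
Let dE t := 2 * coefc (yE t) - ((k t)%:C * x t - 2 * ('i * (sg t)%:C) * S t).
Let dO t := 2 * coefs (yO t) - (k t)%:C * S t.

Let cx z (f : T -> R) : (fun t => cabs (z t)) \isO f ->
  (fun t => cabs (z t * x t)) \isO (fun t => f t * bx t).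
Proof. by move=> h; exact: isO_cabsM h (isO_refl _ _). Qed.
Let cS z (f : T -> R) : (fun t => cabs (z t)) \isO f ->
  (fun t => cabs (z t * S t)) \isO (fun t => f t * bS t).
Proof. by move=> h; exact: isO_cabsM h (isO_refl _ _). Qed.
Let Mc i j (f : T -> R) : (forall t, 0 <= f t) ->
  (fun t => M i j one t * f t) \isO M i j f.
Proof. by move=> f0; apply: isO_mono (isO_refl _ _) _ => t; rewrite /M /one mulr1. Qed.

Let dE_bound : (fun t => cabs (dE t)) \isO (fun t => M 2 0 bx t + M 2 1 bS t).
Proof.
apply: (isO_eq (g := fun t => cabs (l t * x t
    - 2 * ((k t)%:C * ('i * (sg t)%:C)) * S t + (1 + k t)%:C * (sg t ^+ 2)%:C * x t
    - coefc (excess (e t) (u1 t) (u2 t) (E1 t) (E2 t))))).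
  move=> t; congr cabs; rewrite /dE (coefc_slaved (e t) (k t) (u1 t) (u2 t)).
  have [-> _] := even_eq t; rewrite coefcB coefcZ coefc_cross -/(x t) -/(S t).
  by rewrite rmorphD rmorph1; ring.
apply: isO_cabsB; last first.
  apply: isO_trans excess_even; apply: (@isO_le _ _ _ _ _ 2) => // t.
  exact: cabs_coefc.
apply: isO_cabsD; first apply: isO_cabsB.
- by apply: isO_addl; [pos|apply: isO_trans (cx Ol) _; exact: Mc].
- apply: isO_addr; first pos.
  apply: isO_trans (cS (isO_cabsZ 2 (isO_cabsM Ok Osi))) _.
  by apply: (@isO_le _ _ _ _ _ 1) => // t; rewrite /M /one le_eqVlt; apply/orP; left; apply/eqP; ring.
- apply: isO_addl; first pos.
  apply: isO_trans (cx (isO_cabsM Ok1 Os2)) _.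
  apply: (@isO_trans _ _ _ _ (M 2 2 bx)); last by gauge.
  by apply: (@isO_le _ _ _ _ _ 1) => // t; rewrite /M /one le_eqVlt; apply/orP; left; apply/eqP; ring.
Qed.

Let dO_bound : (fun t => cabs (dO t)) \isO (fun t => M 1 1 bx t + M 2 0 bS t).
Proof.
have lS_M : lS \isO M 2 0 bS.
  apply: isO_mono (isOM (fun t => cabs_ge0 (l t)) bS0 Ol (isO_refl _ _)) _ => t.
  by rewrite /M /one mulr1.
have gO' : (fun t => gO t) \isO (fun t => M 1 1 bx t + M 2 0 bS t).
  apply: isO_trans gO_bound _; apply: isOD; last by gauge.
  by apply: isOD; [apply: isO_addr; [pos|]|gauge].
have gO0 t : 0 <= gO t by rewrite addr_ge0 ?nm_ge0.
apply: (isO_eq (g := fun t => cabs (coefs (L1 t (O1 t) (O2 t))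
    - coefs (excess (e t) (u1 t) (u2 t) (O1 t) (O2 t))))).
  move=> t; congr cabs; rewrite /dO (coefs_slaved (e t) (k t) (u1 t) (u2 t)).
  have -> : coefs (O1 t) = S t by [].
  by ring.
have c2 f h : (fun t => nm (f t : pfun P)) \isO h ->
    (fun t => cabs (coefs (f t))) \isO h.
  by apply: isO_trans; apply: (@isO_le _ _ _ _ _ 2) => // t; exact: cabs_coefs.
apply: isO_cabsB; apply: c2.
  by apply: isO_trans gO'; apply: (@isO_le _ _ _ _ _ 1) => // t; rewrite mul1r lerDl nm_ge0.
apply: isO_trans (excess_bound prof O1 O2) _; apply: isOD.
  apply: isO_addr; first pos.
  by apply: (@isO_le _ _ _ _ _ 1) => // t; rewrite critO /M expr0 mulr1 mul1r.
apply: isO_trans (_ : (fun t => e t ^+ 1 * gO t) \isO _).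
  by apply: isO_mono (isO_refl mag _) _ => t; rewrite expr1.
by apply: isO_trans (e_gauge 1 gO0 gO') _; gauge.
Qed.

Let Oc2 (f : T -> pfun P) h : (fun t => nm (f t)) \isO h ->
  (fun t => cabs (coefc (f t))) \isO h.
Proof. by apply: isO_trans; apply: (@isO_le _ _ _ _ _ 2) => // t; exact: cabs_coefc. Qed.
Let Os2' (f : T -> pfun P) h : (fun t => nm (f t)) \isO h ->
  (fun t => cabs (coefs (f t))) \isO h.
Proof. by apply: isO_trans; apply: (@isO_le _ _ _ _ _ 2) => // t; exact: cabs_coefs. Qed.

Let OyE_c : (fun t => cabs (coefc (yE t))) \isO (fun t => M 1 0 bx t + M 1 1 bS t).
Proof. by apply: Oc2; apply: isO_pw OyE => t; exact: nm_nm2. Qed.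
Let OyO_s : (fun t => cabs (coefs (yO t))) \isO M 1 0 bS.
Proof. by apply: Os2'; apply: isO_pw OyO => t; exact: nm_nm2. Qed.

Let mag_gauge : (fun t => e t ^+ 2 * mag t * (M 0 0 bx t + M 1 1 bS t))
  \isO (fun t => M 2 0 mx t + M 3 1 bS t).
Proof.
apply: isO_distr.
  apply: isO_addl; first pos.
  apply: (@isO_le _ _ _ _ _ 1) => // t; rewrite /M /mx le_eqVlt.
  by apply/orP; left; apply/eqP; ring.
apply: isO_addr; first pos.
apply: (@isO_le_small _ _ _ _ _ 1) => // t /ltW m1.
have -> : e t ^+ 2 * mag t * M 1 1 bS t = mag t * M 3 1 bS t by rewrite /M; ring.
by rewrite ler_wpM2r // M0.
Qed.

(** Solvability along the cosine.  The even part is driven by the odd one through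
    Floquet terms only, each with a factor [s], which determines the critical
    coefficient [x] of the former from that, [S], of the latter. *)
Lemma sharp_even : (fun t => cabs ((k t ^+ 2 - d1 t)%:C * x t
    - 4 * ('i * (sg t)%:C) * (k t)%:C * S t))
  \isO (fun t => M 2 0 mx t + M 3 1 bS t).
Proof.
apply: (isO_eq (g := fun t => cabs (
    (coefc (excess (e t) (u1 t) (u2 t) (E1 t) (E2 t)) - (d1 t)%:C * x t)
    - l t * coefc (2 * E1 t + E2 t)
    + 2 * ('i * (sg t)%:C) * ((1 + k t)%:C * dO t)
    + 2 * (('i * (sg t)%:C) * ((k t)%:C * (k t)%:C)) * S t
    - 2 * ((1 + k t)%:C * ((sg t ^+ 2)%:C * coefc (yE t)))
    - (k t)%:C * dE t))).
  move=> t; congr cabs.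
  have := coefc_solvability (e t) (k t) (u1 t) (u2 t) (E1 t) (E2 t).
  rewrite forcing_even /dE /dO.
  move: (excess _ _ _ _ _) (yE t) (yO t) (2 * E1 t + E2 t) => Ex Y Y' W.
  rewrite -(con_nat 2) coefcB (coefcZ _ W) (coefcZ _ (cross t Y Y')) coefc_cross => h.
  apply/eqP; rewrite -subr_eq0 -h; apply/eqP.
  by rewrite !(rmorphB, rmorphD, rmorph1, rmorphXn); ring.
have magx : M 3 0 bx \isO (fun t => M 2 0 mx t + M 3 1 bS t).
  apply: isO_addl; first pos.
  apply: (@isO_le _ _ _ _ _ 1) => // t; rewrite mul1r /M /mx !expr0 !mulr1.
  rewrite exprSr -mulrA ler_wpM2l ?sqr_ge0 // ler_wpM2r //; exact: prof_mag prof t.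
have g3 : (fun t => M 3 0 bx t + M 3 1 bS t) \isO (fun t => M 2 0 mx t + M 3 1 bS t).
  by apply: isOD => //; gauge.
have r2x : M 2 2 bx \isO (fun t => M 2 0 mx t + M 3 1 bS t).
  apply: isO_addl; first pos; apply: (@isO_le_small _ _ _ _ _ 1) => // t m1.
  rewrite mul1r /M /mx expr0 mulr1 -mulrA ler_wpM2l ?sqr_ge0 //.
  apply: ler_wpM2r => //.
  apply: le_trans (s_mag t); rewrite expr2 ler_piMr //.
  by apply: le_trans (s_mag t) (ltW m1).
apply: isO_cabsB; last first.
  apply: isO_trans (isO_cabsM Ok dE_bound) _; apply: isO_trans g3.
  by gauge.
apply: isO_cabsB; last first.
  apply: isO_cabsZ; apply: isO_trans (isO_cabsM Ok1 (isO_cabsM Os2 OyE_c)) _.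
  apply: isO_trans g3; apply: (@isO_trans _ _ _ _ (fun t => M 2 2 one t *
    (M 1 0 bx t + M 1 1 bS t))); last by gauge.
  by apply: (@isO_le _ _ _ _ _ 1) => // t; rewrite /M /one !expr0 !mul1r.
apply: isO_cabsD; last first.
  apply: isO_trans (cS (isO_cabsZ 2 (isO_cabsM Osi (isO_cabsM Ok Ok)))) _.
  apply: isO_addr; first pos; apply: (@isO_le _ _ _ _ _ 1) => // t.
  by rewrite /M /one le_eqVlt; apply/orP; left; apply/eqP; ring.
apply: isO_cabsD; last first.
  apply: isO_trans (isO_cabsM (isO_cabsZ 2 Osi) (isO_cabsM Ok1 dO_bound)) _.
  apply: (@isO_trans _ _ _ _ (fun t => M 1 1 one t * (M 1 1 bx t + M 2 0 bS t))).
    by apply: (@isO_le _ _ _ _ _ 1) => // t; rewrite /M /one !expr0 !mul1r.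
  by apply: isO_distr; [apply: isO_trans r2x; gauge | gauge].
apply: isO_cabsB; first exact: isO_trans excess_even_cos g3.
apply: isO_trans mag_gauge.
apply: isO_trans (isO_cabsM l_small (_ : _ \isO (fun t => M 0 0 bx t + M 1 1 bS t))) _.
  apply: Oc2; apply: isO_nmD; [apply: isO_nm_nat; apply: isO_pw OE1'|apply: isO_pw OE2'] => t;
  exact: nm_nm2.
exact: isO_refl.
Qed.

Let bx_bS : bx \isO M 0 1 bS.
Proof.
have mxE t : M 2 0 mx t = mag t * M 2 0 bx t by rewrite /M /mx !expr0; ring.
have key : M 2 0 bx \isO M 2 1 bS.
  apply: isO_absorb; first exact: M0.
  apply: (@isO_trans _ _ _ _ (fun t => `|k t ^+ 2 - d1 t| * bx t)).
    have := isOM (fun t => sqr_ge0 (e t)) bx0 nondegenerate (isO_refl mag bx).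
    by apply: isO_eq => t; rewrite /M expr0 mulr1.
  apply: (@isO_eq _ _ _ _ (fun t => cabs (((k t ^+ 2 - d1 t)%:C * x t
    - 4 * ('i * (sg t)%:C) * (k t)%:C * S t) + 4 * (('i * (sg t)%:C) * (k t)%:C) * S t))).
    by move=> t; rewrite -(mulrA 4) subrK cabsM cabsr.
  apply: isO_cabsD.
    apply: isO_trans sharp_even _; apply: isOD; last by apply: isO_addl; [by move=> t; rewrite mulr_ge0 ?M0|gauge].
    apply: isO_addr; first pos.
    by apply: (@isO_le _ _ _ _ _ 1) => // t; rewrite mxE mul1r.
  apply: isO_addl; first by move=> t; rewrite mulr_ge0 ?M0.
  apply: isO_trans (cS (isO_cabsZ 4 (isO_cabsM Osi Ok))) _.
  apply: (@isO_le _ _ _ _ _ 1) => // t.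
  by rewrite /M /one le_eqVlt; apply/orP; left; apply/eqP; ring.
have [K [c [K0 c0 hK]]] := key; exists K, c; split=> // t /hK.
have e2 : 0 < e t ^+ 2 by rewrite exprn_gt0.
rewrite /M !expr0 expr1 mulr1 mul1r -mulrA.
by rewrite [K * _]mulrCA ler_pM2l.
Qed.

Let bxM i : M i 1 bx \isO M i 2 bS.
Proof.
have p n t : 0 <= e t ^+ n * r t ^+ 1 by rewrite mulr_ge0 ?exprn_ge0 // ltW.
apply: isO_mono (isOM (p i) bx0 (isO_refl mag _) bx_bS) _ => t.
by rewrite le_eqVlt; apply/orP; left; apply/eqP; rewrite /M expr0; ring.
Qed.

(* Subtracting a multiple of the translation mode from the odd part removes its
   critical part altogether, and leaves the image under the linearized operator
   unchanged. *)
Let theta t := S t / coefs (der (u1 t)).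
Let Z1 t := O1 t - con (theta t) * der (u1 t).
Let Z2 t := O2 t - con (theta t) * der (u2 t).

Let coefs_u1 t : coefs (u1 t) = 0.
Proof.
have := coefs_refl (u1 t); rewrite u1_even => h.
have : 2 * coefs (u1 t) = 0 by rewrite mulr2n mulrDl !mul1r {2}h subrr.
by move/eqP; rewrite mulf_eq0 pnatr_eq0 => /eqP.
Qed.

Let crit_Z t : coefc (Z1 t) = 0 /\ coefs (Z1 t) = 0.
Proof.
rewrite /Z1 coefcB coefsB coefcZ coefsZ coefcO coefc_der coefs_u1 mulr0 subrr.
split=> //; rewrite /theta divfK ?subrr //.
by rewrite coefs_der oppr_eq0 u1_critical.
Qed.

Let linop_Z t : L1 t (Z1 t) (Z2 t) = L1 t (O1 t) (O2 t) /\
  L2 t (Z1 t) (Z2 t) = L2 t (O1 t) (O2 t).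
Proof.
have [] := linopD (e t) (k t) (u1 t) (u2 t) (O1 t) (O2 t)
  (con (- theta t) * der (u1 t)) (con (- theta t) * der (u2 t)).
have [-> ->] := linopZ (e t) (k t) (- theta t) (u1 t) (u2 t) (der (u1 t)) (der (u2 t)).
have [-> ->] := linop_translation (prof_eq prof t).
by rewrite !mulr0 !addr0 rmorphN !mulNr.
Qed.

Let forcing_Z t : forcing (e t) (k t) (u1 t) (u2 t) (Z1 t) (Z2 t) =
  forcing (e t) (k t) (u1 t) (u2 t) (O1 t) (O2 t).
Proof. by rewrite /forcing; have [-> ->] := linop_Z t. Qed.

Let XZ t : critnorm (Z1 t) = 0.
Proof. by rewrite /critnorm; have [-> ->] := crit_Z t; rewrite cabs0 addr0. Qed.

Let gO_sharp : (fun t => gO t) \isO (fun t => lS t + M 1 2 bS t).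
Proof.
apply: isO_trans gO_bound _; apply: isOD; first apply: isOD.
- by apply: isO_addl; [pos|exact: isO_refl].
- by apply: isO_addr; [pos|exact: bxM].
- by gauge.
Qed.

Let elS t : R := e t * lS t.
Let elS0 t : 0 <= elS t. Proof. by rewrite mulr_ge0 // ltW. Qed.
Let lS_le i : (0 < i)%N -> (fun t => e t ^+ i * lS t) \isO elS.
Proof.
move=> i0; apply: (@isO_le _ _ _ _ _ 1) => // t; rewrite mul1r /elS ler_wpM2r //.
by rewrite -[leRHS]expr1 ler_wiXn2l // ltW.
Qed.
Local Notation target := (fun t => elS t + M 3 2 bS t).
Let tl i : (0 < i)%N -> (fun t => e t ^+ i * lS t) \isO target.
Proof. by move=> i0; apply: isO_addl; [pos|exact: lS_le]. Qed.
Let tS i j : (3 <= i)%N -> (2 <= j)%N -> M i j bS \isO target.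
Proof. by move=> i3 j2; apply: isO_addr; [exact: elS0|gauge]. Qed.
Let tx i j : (3 <= i)%N -> (1 <= j)%N -> M i j bx \isO target.
Proof.
move=> i3 j1; apply: isO_trans (_ : M 3 1 bx \isO _); first gauge.
by apply: isO_trans (bxM 3) _; exact: tS.
Qed.

Let e_target n (f : T -> R) c : (0 < n)%N -> (3 <= n + c)%N ->
  f \isO (fun t => lS t + M c 2 bS t) -> (forall t, 0 <= f t) ->
  (fun t => e t ^+ n * f t) \isO target.
Proof.
move=> n0 nc hf f0; have ei t : 0 <= e t ^+ n by rewrite exprn_ge0 // ltW.
apply: isO_trans (isOM ei f0 (isO_refl mag _) hf) _; apply: isO_distr.
  exact: tl.
apply: isO_trans (_ : M (n + c) 2 bS \isO _); last exact: tS.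
by apply: (@isO_le _ _ _ _ _ 1) => // t; rewrite mul1r /M exprD !mulrA.
Qed.

Let forcing_Z_bound :
  (fun t => nm (forcing (e t) (k t) (u1 t) (u2 t) (Z1 t) (Z2 t)))
  \isO (fun t => lS t + M 2 2 bS t).
Proof.
have p1 : forall t, 0 <= M 1 0 bx t + M 1 1 bS t by pos.
apply: (isO_eq (fun t => congr1 nm (etrans (forcing_Z t) (forcing_odd t)))).
apply: isO_nmB.
  apply: isO_addl; first pos.
  apply: isO_trans (isO_nmZ (isO_refl mag (fun t => cabs (l t)))
    (_ : _ \isO M 0 0 bS)) _.
    apply: isO_nmD; [apply: isO_nm_nat; apply: isO_pw OO1|apply: isO_pw OO2] => t;
    exact: nm_nm2.
  by apply: (@isO_le _ _ _ _ _ 1) => // t; rewrite /M !expr0 !mul1r.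
apply: isO_nm_nat; apply: isO_trans (Ocross OyO OyE (M0 1 0 bS0) p1) _.
apply: isO_addr; first pos.
apply: isOD; last by gauge.
apply: isO_distr; last by gauge.
by apply: isO_trans (bxM 2); gauge.
Qed.

Let gZ_eq t : nm (L1 t (Z1 t) (Z2 t)) + nm (L2 t (Z1 t) (Z2 t)) = gO t.
Proof. by have [-> ->] := linop_Z t. Qed.

Let gO0 t : 0 <= gO t. Proof. by rewrite addr_ge0 ?nm_ge0. Qed.

Let excess_sin_Z : (fun t => cabs (coefs (excess (e t) (u1 t) (u2 t) (Z1 t) (Z2 t))))
  \isO target.
Proof.
apply: isO_trans (_ : (fun t => e t ^+ 2 * gO t + e t ^+ 1 *
  nm (forcing (e t) (k t) (u1 t) (u2 t) (Z1 t) (Z2 t))) \isO _).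
  apply: isO_mono (isO_eq _ (excess_sin_nm prof Z1 Z2)) _ => t.
    by have [_ ->] := crit_Z t; rewrite mulr0 subr0.
  by rewrite gZ_eq expr1 XZ mulr0 add0r.
apply: isOD; first exact: e_target gO_sharp _.
by apply: e_target forcing_Z_bound _ => // t; exact: nm_ge0.
Qed.

(** Solvability along the sine.  Error terms that neither carry the eigenvalue nor
    two Floquet factors are absent: they would come from the critical part of the
    odd function, which [Z1] does not have. *)
Lemma sharp_odd : (fun t => cabs (3 * l t * S t
    + 8 * ('i * (sg t)%:C) * (k t)%:C * x t + 8 * (sg t ^+ 2)%:C * S t)) \isO target.
Proof.
pose isg t := 'i * (sg t)%:C.
have coefL1 t : coefs (L1 t (Z1 t) (Z2 t)) = l t * S t
    + (1 + (k t)%:C) * (2 * isg t * x t + (sg t ^+ 2)%:C * S t).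
  have [-> _] := linop_Z t; have [-> _] := odd_eq t.
  by rewrite coefsB coefsZ coefs_cross -/(S t) -/(x t) -/(isg t) rmorphD rmorph1; ring.
have coefF t : coefs (forcing (e t) (k t) (u1 t) (u2 t) (Z1 t) (Z2 t)) =
    l t * (3 / 2 * S t + coefs (yO t) / 2)
    + (1 + (k t)%:C) * (2 * isg t * ((k t)%:C * x t - 2 * isg t * S t + dE t)
       + 2 * (sg t ^+ 2)%:C * coefs (yO t)).
  rewrite forcing_Z forcing_odd.
  have eqO : 2 * coefs (2 * O1 t + O2 t) = 3 * S t + coefs (yO t).
    have -> : S t = coefs (O1 t) by [].
    by move: (O1 t) (O2 t) => f g; rewrite /slaved -(con_nat 2) !coefsD !coefsZ; ring.
  have eqO' : coefs (2 * O1 t + O2 t) = 3 / 2 * S t + coefs (yO t) / 2.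
    apply: (mulfI (_ : (2 : R[i]) != 0)); first by rewrite pnatr_eq0.
    by rewrite eqO; field.
  have cyE : coefc (yE t) = ((k t)%:C * x t - 2 * isg t * S t + dE t) / 2.
    by rewrite /dE -/(isg t); field.
  move: eqO'; move: (2 * O1 t + O2 t) => W hW.
  rewrite -(con_nat 2) coefsB (coefsZ _ W) (coefsZ _ (cross t (yO t) (yE t))).
  by rewrite coefs_cross hW cyE rmorphD rmorph1 -/(isg t); field.
have i2 t : isg t * isg t = - (sg t ^+ 2)%:C.
  by rewrite mulrACA -expr2 sqrCi mulN1r rmorphXn expr2.
apply: (isO_eq (g := fun t => cabs (
    - ((l t * coefs (yO t)
      + 4 * ((1 + (k t)%:C) * (isg t * dE t))
      + 4 * ((1 + (k t)%:C) * ((sg t ^+ 2)%:C * coefs (yO t)))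
      + 4 * ((k t)%:C * (isg t * ((k t)%:C * x t)))
      + 8 * ((k t)%:C * ((sg t ^+ 2)%:C * S t)))
     + 2 * ((k t)%:C * (l t * S t))
     + 4 * ((k t)%:C * ((k t)%:C * (isg t * x t)))
     + 2 * ((k t)%:C * ((1 + (k t)%:C) * ((sg t ^+ 2)%:C * S t))))
    + 2 * ((k t)%:C * coefs (excess (e t) (u1 t) (u2 t) (Z1 t) (Z2 t)))
    + 2 * coefs (excess (e t) (u1 t) (u2 t) (Z1 t) (Z2 t))))).
  move=> t; congr cabs.
  have := coefs_solvability (e t) (k t) (u1 t) (u2 t) (Z1 t) (Z2 t).
  have := coefs_slaved (e t) (k t) (u1 t) (u2 t) (Z1 t) (Z2 t).
  rewrite coefF coefL1 (crit_Z t).2 -/(isg t).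
  move: (coefs (excess _ _ _ _ _)) (coefs (slaved (Z1 t) _)) (coefs (yO t)) => Ex Y Y'.
  move: (dE t) (i2 t) => D; move: ((sg t ^+ 2)%:C) (isg t) (l t) (k t)%:C (x t) (S t)
    => s2 I L K X SS hI hY h.
  have -> : 3 * L * SS + 8 * I * K * X + 8 * s2 * SS = 3 * L * SS + 8 * I * K * X
    - 8 * (I * I) * SS by rewrite hI; ring.
  have hI2 : s2 = - (I * I) by rewrite hI opprK.
  apply/eqP; rewrite -subr_eq0; apply/eqP.
  transitivity (2 * (L * (3 / 2 * SS + Y' / 2) + (1 + K) * (2 * I * (K * X - 2 * I * SS + D)
    + 2 * s2 * Y') + 2 * (K * Y) - Ex) - 2 * K * (2 * Y - (L * SS
    + (1 + K) * (2 * I * X + s2 * SS) + K * 0 - Ex))).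
    by rewrite hI2; field.
  by rewrite h hY; ring.
have b1 : (fun t => cabs (l t * S t)) \isO lS.
  by apply: (isO_eq (fun t => cabsM _ _)); exact: isO_refl.
have k_lS : (fun t => cabs ((k t)%:C * (l t * S t))) \isO target.
  apply: isO_trans (isO_cabsM Ok b1) _; apply: isO_trans (tl (ltn0Sn 0)).
  by apply: (@isO_le _ _ _ _ _ 1) => // t; rewrite /M /one expr0 !mulr1 mul1r.
have Oe (z : T -> R[i]) f : (fun t => cabs (z t)) \isO f ->
    (fun t => cabs ((1 + (k t)%:C) * z t)) \isO f.
  move=> hz; have h1 : (fun t => cabs (1 + (k t)%:C)) \isO M 0 0 one.
    by apply: isO_eq Ok1 => t; rewrite rmorphD rmorph1.
  apply: isO_mono (isO_cabsM h1 hz) _ => t.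
  by rewrite /M /one !expr0 !mul1r.
have kI i j i' j' (z w : T -> R[i]) (c f : T -> R) : (forall t, 0 <= c t) ->
    (fun t => cabs (w t)) \isO M i j one ->
    (fun t => cabs (z t)) \isO M i' j' c -> M (i + i') (j + j') c \isO f ->
    (fun t => cabs (w t * z t)) \isO f.
  move=> c0 hw hz; apply: isO_trans; apply: isO_trans (isO_cabsM hw hz) _.
  by apply: isO_MM.
have self z c : (forall t, c t = cabs (z t)) -> (fun t => cabs (z t)) \isO M 0 0 c.
  move=> hc; apply: (@isO_le _ _ _ _ _ 1) => // t.
  by rewrite /M !expr0 !mul1r hc.
have Sx := self x bx (fun t => erefl); have SS := self S bS (fun t => erefl).
have ks2S : (fun t => cabs ((k t)%:C * ((sg t ^+ 2)%:C * S t))) \isO target.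
  apply: (kI 1%N 0%N 2%N 2%N _ _ bS) => //; last exact: tS.
  by apply: (kI 2%N 2%N 0%N 0%N _ _ bS) => //; apply: isO_refl.
apply: isO_cabsD; last by apply: isO_cabsZ; exact: excess_sin_Z.
apply: isO_cabsD; last first.
  apply: isO_cabsZ; apply: isO_trans (isO_cabsM Ok excess_sin_Z) _.
  apply: (@isO_le _ _ _ _ _ 1) => // t; rewrite mul1r ler_piMl ?addr_ge0 ?M0 //.
  by rewrite /M /one expr0 expr1 !mulr1.
apply: isO_cabsN; apply: isO_cabsD; last first.
  apply: isO_cabsZ; have := Oe _ _ ks2S; apply: isO_eq => t; congr cabs; ring.
apply: isO_cabsD; last first.
  apply: isO_cabsZ; apply: (kI 1%N 0%N 2%N 1%N _ _ bx) => //; last exact: tx.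
  apply: (kI 1%N 0%N 1%N 1%N _ _ bx) => //; last exact: isO_refl.
  by apply: (kI 1%N 1%N 0%N 0%N _ _ bx) => //; apply: isO_refl.
apply: isO_cabsD; last by apply: isO_cabsZ.
apply: isO_cabsD; first apply: isO_cabsD; first apply: isO_cabsD;
  first apply: isO_cabsD.
- apply: isO_trans (isO_cabsM (isO_refl _ (fun t => cabs (l t))) OyO_s) _.
  apply: isO_trans (tl (ltn0Sn 0)); apply: (@isO_le _ _ _ _ _ 1) => // t.
  rewrite /M /lS expr0 mulr1 mul1r expr1 le_eqVlt; apply/orP; left; apply/eqP; ring.
- apply: isO_cabsZ; apply: Oe; apply: isO_trans (isO_cabsM Osi dE_bound) _.
  apply: isO_distr; [apply: isO_trans (_ : M 3 1 bx \isO _)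
    | apply: isO_trans (_ : M 3 2 bS \isO _)]; first gauge; first exact: tx;
  by [gauge|exact: tS].
- apply: isO_cabsZ; apply: Oe; apply: (kI 2%N 2%N 1%N 0%N _ _ bS) => //; exact: tS.
- apply: isO_cabsZ; apply: (kI 1%N 0%N 2%N 1%N _ _ bx) => //; last exact: tx.
  apply: (kI 1%N 1%N 1%N 0%N _ _ bx) => //; last exact: isO_refl.
  by apply: (kI 1%N 0%N 0%N 0%N _ _ bx) => //; apply: isO_refl.
- by apply: isO_cabsZ.
Qed.

Lemma sharp_critical : bx \isO (fun t => r t * bS t).
Proof. by apply: isO_mono bx_bS _ => t; rewrite /M expr0 mul1r expr1. Qed.

End Sharp.

(** * The Ginzburg-Landau eigenvalues *)

Section OfReal.
Context {R : realType}.
Implicit Types x y : R.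
Lemma ofrealM x y : (x * y)%:C = x%:C * y%:C :> R[i]. Proof. exact: rmorphM. Qed.
Lemma ofrealD x y : (x + y)%:C = x%:C + y%:C :> R[i]. Proof. exact: rmorphD. Qed.
Lemma ofrealN x : (- x)%:C = - x%:C :> R[i]. Proof. exact: rmorphN. Qed.
Lemma ofrealV x : x^-1%:C = x%:C^-1 :> R[i]. Proof. exact: fmorphV. Qed.
Lemma ofrealn n : (n%:R : R)%:C = n%:R :> R[i]. Proof. exact: rmorph_nat. Qed.
Definition ofrealE := (ofrealM, ofrealD, ofrealN, ofrealV, ofrealn).
End OfReal.

Section GinzburgLandau.
Context {R : realType}.
Variable w : R.
Hypothesis w_lt : - 4^-1 < w < 4^-1.
Implicit Types s : R.

Definition gl_amp2 : R := 1 - 16 * w ^+ 2.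
Local Notation a0 := gl_amp2.

Lemma gl_amp2_gt0 : 0 < a0.
Proof.
have /andP[h1 h2] := w_lt; rewrite /gl_amp2 -(mulr1 16).
have -> : (1 : R) - 16 * 1 * w ^+ 2 = 16 * ((4^-1 - w) * (w - - 4^-1)) by field.
by rewrite !mulr_gt0 ?subr_gt0.
Qed.

Definition gl_disc s : R := Num.sqrt ((2 / 3 * a0) ^+ 2 + (64 / 3 * w * s) ^+ 2).
Definition gl1 s : R := - (2 / 3) * a0 - 32 / 3 * s ^+ 2 - gl_disc s.
Definition gl2 s : R := - (2 / 3) * a0 - 32 / 3 * s ^+ 2 + gl_disc s.

Lemma gl_disc_sqr s : gl_disc s ^+ 2 = (2 / 3 * a0) ^+ 2 + (64 / 3 * w * s) ^+ 2.
Proof. by rewrite sqr_sqrtr // addr_ge0 ?sqr_ge0. Qed.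

Lemma gl_disc_ge s : 2 / 3 * a0 <= gl_disc s.
Proof.
have a0' := gl_amp2_gt0; rewrite -(@ler_pXn2r _ 2) ?nnegrE ?sqrtr_ge0 //.
  by rewrite gl_disc_sqr lerDl sqr_ge0.
by rewrite !mulr_ge0 // ltW.
Qed.

Lemma gl_gap s : 4 / 3 * a0 <= gl2 s - gl1 s.
Proof. by have := gl_disc_ge s; rewrite /gl2 /gl1; lra. Qed.

Lemma gl_sum s : gl1 s + gl2 s = - (4 / 3) * a0 - 64 / 3 * s ^+ 2.
Proof. by rewrite /gl1 /gl2; field. Qed.

Lemma gl_mul s : gl1 s * gl2 s =
  (4 / 3 * a0 + 32 / 3 * s ^+ 2) * (32 / 3 * s ^+ 2) - (64 / 3 * w * s) ^+ 2.
Proof.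
transitivity ((2 / 3 * a0 + 32 / 3 * s ^+ 2) ^+ 2 - gl_disc s ^+ 2).
  by rewrite /gl1 /gl2; field.
by rewrite gl_disc_sqr; field.
Qed.

(** With [D] the root of [p ^+ 2 + q ^+ 2], the remainder [D - p - q ^+ 2 / (2 * p)]
    equals [- q ^+ 4 / (2 * p * (D + p) ^+ 2)]. *)
Lemma gl_disc_expansion : exists2 K : R, 0 <= K & forall s, `|s| <= 1 ->
  `|gl_disc s - 2 / 3 * a0 - 1024 / 3 * w ^+ 2 * s ^+ 2 / a0| <= K * `|s| ^+ 3.
Proof.
have a0' := gl_amp2_gt0; have an0 : a0 != 0 by rewrite gt_eqF.
pose K := (64 / 3 * w) ^+ 4 / (4 / 3 * a0) / (4 / 3 * a0) ^+ 2.
have q4 : 0 <= (64 / 3 * w) ^+ 4 by rewrite exprn_even_ge0.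
have pa : 0 < 4 / 3 * a0 by rewrite !mulr_gt0.
have K0 : 0 <= K by rewrite /K !divr_ge0 // ?exprn_ge0 // ltW.
exists K => // s s1; pose D := gl_disc s; pose p := 2 / 3 * a0; pose q := 64 / 3 * w * s.
have Dp : p <= D by exact: gl_disc_ge.
have D2 : D ^+ 2 = p ^+ 2 + q ^+ 2 by exact: gl_disc_sqr.
have p0 : 0 < p by rewrite /p !mulr_gt0.
have S0 : 0 < D + p by apply: addr_gt0 => //; apply: lt_le_trans Dp.
have -> : D - 2 / 3 * a0 - 1024 / 3 * w ^+ 2 * s ^+ 2 / a0 = D - p - q ^+ 2 / (2 * p).
  by rewrite /p /q; field.
have q2 : q ^+ 2 = (D - p) * (D + p) by rewrite -subr_sqr D2 addrAC subrr add0r.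
have -> : D - p - q ^+ 2 / (2 * p) = - (q ^+ 4 / (2 * p) / (D + p) ^+ 2).
  have -> : q ^+ 4 = ((D - p) * (D + p)) ^+ 2 by rewrite -q2 -exprM.
  by rewrite q2; field; rewrite ?gt_eqF.
have q40 : 0 <= q ^+ 4 by rewrite exprn_even_ge0.
have i0 : 0 <= (2 * p)^-1 by rewrite invr_ge0 mulr_ge0 // ltW.
rewrite normrN ger0_norm; last first.
  by apply: divr_ge0; [exact: mulr_ge0|rewrite exprn_ge0 // ltW].
have -> : 2 * p = 4 / 3 * a0 by rewrite /p; field.
have -> : q ^+ 4 = (64 / 3 * w) ^+ 4 * `|s| ^+ 4.
  by rewrite /q exprMn -normrX (ger0_norm (exprn_even_ge0 s (_ : ~~ odd 4))).
have sX : `|s| ^+ 4 <= `|s| ^+ 3 by apply: ler_wiXn2l.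
have pD : 4 / 3 * a0 <= D + p by move: Dp; rewrite /p => h; lra.
have inv : ((D + p) ^+ 2)^-1 <= ((4 / 3 * a0) ^+ 2)^-1.
  rewrite lef_pV2 ?posrE ?exprn_gt0 //.
  by apply: lerXn2r; rewrite ?nnegrE // ltW.
have c0 : 0 <= (64 / 3 * w) ^+ 4 / (4 / 3 * a0) by rewrite divr_ge0 // ltW.
rewrite /K; move: c0 inv sX; rewrite -/a0 (mulrAC _ (`|s| ^+ 4)).
move: ((64 / 3 * w) ^+ 4 / (4 / 3 * a0)) => c c0 inv sX.
rewrite -[leLHS]mulrA -[leRHS]mulrA ler_wpM2l // [leRHS]mulrC.
by rewrite ler_pM ?exprn_ge0 // invr_ge0 sqr_ge0.
Qed.

Lemma gl_expansion : exists2 K : R, 0 <= K & forall s, `|s| <= 1 ->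
  [/\ `|gl1 s - expansion1 w s| <= K * `|s| ^+ 3,
      `|gl2 s - expansion2 w s| <= K * `|s| ^+ 3 & `|gl2 s| <= K * s ^+ 2].
Proof.
have [K K0 hK] := gl_disc_expansion; have an0 : a0 != 0 by rewrite gt_eqF ?gl_amp2_gt0.
have a16 : 1 - 16 * w ^+ 2 != 0 by [].
pose r s := gl_disc s - 2 / 3 * a0 - 1024 / 3 * w ^+ 2 * s ^+ 2 / a0.
have e1 s : gl1 s - expansion1 w s = - r s.
  by rewrite /r /gl1 /expansion1; move: (gl_disc s) => D; rewrite /gl_amp2; field.
have e2 s : gl2 s - expansion2 w s = r s.
  by rewrite /r /gl2 /expansion2; move: (gl_disc s) => D; rewrite /gl_amp2; field.
pose L := `|32 * (1 - 48 * w ^+ 2) / (3 * (1 - 16 * w ^+ 2))|.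
have L0 : 0 <= L by exact: normr_ge0.
exists (K + L) => [|s s1]; first by rewrite addr_ge0.
have h := hK s s1.
have s3 : 0 <= `|s| ^+ 3 by rewrite exprn_ge0.
have h' : `|r s| <= (K + L) * `|s| ^+ 3.
  by apply: le_trans h _; rewrite ler_wpM2r // lerDl.
split; rewrite ?e1 ?e2 ?normrN //.
have -> : gl2 s = r s + expansion2 w s by rewrite -e2 subrK.
rewrite mulrDl; apply: le_trans (ler_normD _ _) (lerD _ _).
  apply: le_trans h _; rewrite ler_wpM2l // -[leRHS]real_normK ?num_real //.
  by apply: ler_wiXn2l.
by rewrite /expansion2 normrM normrN ger0_norm ?sqr_ge0.
Qed.
End GinzburgLandau.

Lemma char_poly_GLmx {R : realType} (w s : R) :
  char_poly (GLmx w s) = ('X - ((gl1 w s)%:C)%:P) * ('X - ((gl2 w s)%:C)%:P).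
Proof.
rewrite /char_poly /char_poly_mx (expand_det_row _ 0) !big_ord_recl big_ord0 addr0.
rewrite /cofactor !det_mx11 !mxE /= expr0 expr1 !mul1r.
have quad (A B C D : R[i]) : ('X - A%:P) * ('X - D%:P) - C%:P * B%:P =
    'X^2 - (A + D)%:P * 'X + (A * D - B * C)%:P.
  by rewrite !(polyCD, polyCB, polyCM); ring.
set A := (_ - 32 / 3 * s ^+ 2)%:C; set D := (- (32 / 3) * s ^+ 2)%:C.
set B := (64 / 3 * w * s) *i.
transitivity ('X^2 - (A + D)%:P * 'X + (A * D - B * - B)%:P).
  by rewrite -quad !(polyCN, mulr0n, mulr1n); ring.
move: (gl1 w s) (gl2 w s) (gl_sum w s) (gl_mul w s) => g1 g2 hs hm.
have := quad g1%:C 0 0 g2%:C; rewrite polyC0 mul0r subr0 => ->.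
have -> : g1%:C + g2%:C = A + D.
  by rewrite -ofrealD hs /A /D -ofrealD; congr (_%:C); rewrite /gl_amp2; field.
have -> : g1%:C * g2%:C - 0 * 0 = A * D - B * - B; last by [].
rewrite mul0r subr0 -ofrealM hm /A /D -ofrealM mulrN opprK.
have -> : B * B = - ((64 / 3 * w * s) ^+ 2)%:C.
  apply/eqP; rewrite eq_complex /=; apply/andP; split; apply/eqP; ring.
rewrite -ofrealN -!ofrealD; congr (_%:C).
by rewrite /gl_amp2; field.
Qed.

(** * Comparison with the Ginzburg-Landau eigenvalues *)


Section Waves.
Context {R : realType} {P : calculus R}.
Variables w K : R.
Hypothesis w_lt : - 4^-1 < w < 4^-1.
Hypothesis K0 : 0 <= K.
Local Notation "x %:f" := (@con R P (real_complex R x)) (at level 2, format "x %:f").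
Local Notation a0 := (gl_amp2 w).

(** A profile together with its bounds, so that families of them can be the index
    type of the asymptotic estimates, whose constants only depend on [w] and
    [K]. *)
Record wave := Wave {
  wave_e : R;
  wave_k : R;
  wave_1 : pfun P;
  wave_2 : pfun P;
  wave_e_range : 0 < wave_e <= 1;
  wave_k_near : `|wave_k - 4 * wave_e * w| <= K * wave_e ^+ 2;
  wave_1_near : nm (wave_1 - (2 * (wave_e * Num.sqrt (2 / 3 * a0)))%:f * pcos)
    <= K * wave_e ^+ 2;
  wave_2_near : nm (wave_2 + (wave_e * Num.sqrt (2 / 3 * a0))%:f * pcos)
    <= K * wave_e ^+ 2;
  wave_eq : is_profile wave_e wave_k wave_1 wave_2;
  wave_1_even : refl wave_1 = wave_1;
  wave_2_even : refl wave_2 = wave_2;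
  wave_critical : coefc wave_1 != 0
}.

Section Family.
Variables (T : Type) (W : T -> wave) (mag : T -> R).
Local Notation "f \isO g" := (isO mag f g) (at level 70).
Local Notation e t := (wave_e (W t)).
Local Notation k t := (wave_k (W t)).
Local Notation a t := (e t * Num.sqrt (2 / 3 * a0)).
Hypothesis e_mag : forall t, e t <= mag t.

Let e0 t : 0 < e t. Proof. by have /andP[] := wave_e_range (W t). Qed.
Let e1 t : e t <= 1. Proof. by have /andP[] := wave_e_range (W t). Qed.
Let le0 t : 0 <= e t. Proof. exact: ltW. Qed.

Let w1 : `|w| <= 1.
Proof.
have /andP[h1 h2] := w_lt; rewrite ler_norml.
by rewrite (le_trans _ (ltW h1)) ?(le_trans (ltW h2)) // ?lerN2 invf_le1 ?ler1n.
Qed.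

Lemma wave_k_size t : `|k t| <= (K + 4) * e t.
Proof.
have -> : k t = (k t - 4 * e t * w) + 4 * e t * w by rewrite subrK.
apply: le_trans (ler_normD _ _) _; rewrite (mulrDl K 4); apply: lerD.
  apply: le_trans (wave_k_near (W t)) _.
  by rewrite ler_wpM2l // expr2 ler_piMl //.
rewrite normrM [`|4 * _|]ger0_norm ?mulr_ge0 //.
by rewrite ler_piMr ?mulr_ge0 //.
Qed.

Lemma wave_profiles : profiles mag (fun t => e t) (fun t => k t) (fun t => a t)
  (fun t => wave_1 (W t)) (fun t => wave_2 (W t)).
Proof.
split=> //.
- by move=> t; exact: wave_e_range.
- by apply: (@isO_le _ _ _ _ _ (K + 4)) => [|t]; [rewrite addr_ge0|exact: wave_k_size].
- apply: (@isO_le _ _ _ _ _ (Num.sqrt (2 / 3 * a0))) => [|t]; first exact: sqrtr_ge0.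
  by rewrite ger0_norm ?mulr_ge0 ?sqrtr_ge0 // mulrC.
- by apply: (@isO_le _ _ _ _ _ K) => // t; exact: wave_1_near.
- by apply: (@isO_le _ _ _ _ _ K) => // t; exact: wave_2_near.
- by move=> t; exact: wave_eq.
Qed.

(** Deviation of the squared detuning from its leading part. *)
Definition detuning t : R := k t ^+ 2 - 16 * e t ^+ 2 * w ^+ 2.

Lemma detuning_bound : (fun t => `|detuning t|) \isO (fun t => e t ^+ 3).
Proof.
apply: (@isO_le _ _ _ _ _ (K * (K + 8))) => [|t]; first by rewrite mulr_ge0 ?addr_ge0.
have -> : detuning t = (k t - 4 * e t * w) * (k t + 4 * e t * w).
  by rewrite /detuning; ring.
rewrite normrM.
have -> : K * (K + 8) * e t ^+ 3 = (K * e t ^+ 2) * ((K + 8) * e t) by ring.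
apply: ler_pM => //; first exact: wave_k_near.
apply: le_trans (ler_normD _ _) _.
have -> : (K + 8) * e t = (K + 4) * e t + 4 * e t by ring.
apply: lerD; first exact: wave_k_size.
rewrite normrM [`|4 * _|]ger0_norm ?mulr_ge0 //.
by rewrite ler_piMr ?mulr_ge0 //.
Qed.

Lemma wave_amp t : a t ^+ 2 = 2 / 3 * e t ^+ 2 * a0.
Proof.
rewrite exprMn sqr_sqrtr; first by ring.
by rewrite !mulr_ge0 // ltW ?gl_amp2_gt0.
Qed.

End Family.

Record floquet_pair (S0 : R) := FloquetPair {
  fp_wave : wave;
  fp_s : R;
  fp_v1 : pfun P; fp_v2 : pfun P; fp_w1 : pfun P; fp_w2 : pfun P;
  fp_l1 : R[i]; fp_l2 : R[i]; fp_mu : R[i];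
  fp_s_bound : `|fp_s| <= S0;
  fp_eigen : let e := wave_e fp_wave in let k := wave_k fp_wave in
    bloch1 e k (2 * e * fp_s) (wave_1 fp_wave) (wave_2 fp_wave) fp_v1 fp_v2
      = con fp_l1 * fp_v1 /\
    bloch2 e k (2 * e * fp_s) (wave_1 fp_wave) (wave_2 fp_wave) fp_v1 fp_v2
      = con fp_l1 * fp_v2;
  fp_chain : let e := wave_e fp_wave in let k := wave_k fp_wave in
    bloch1 e k (2 * e * fp_s) (wave_1 fp_wave) (wave_2 fp_wave) fp_w1 fp_w2
      = con fp_l2 * fp_w1 + con fp_mu * fp_v1 /\
    bloch2 e k (2 * e * fp_s) (wave_1 fp_wave) (wave_2 fp_wave) fp_w1 fp_w2
      = con fp_l2 * fp_w2 + con fp_mu * fp_v2;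
  fp_independent : forall b c : R[i],
    con b * fp_v1 + con c * fp_w1 = 0 -> con b * fp_v2 + con c * fp_w2 = 0 ->
    b = 0 /\ c = 0
}.

Section NearGL.
Variable S0 : R.
Hypothesis S00 : 0 <= S0.
Local Notation T := (floquet_pair S0).
Local Notation e t := (wave_e (fp_wave t)).
Local Notation k t := (wave_k (fp_wave t)).
Local Notation s t := (fp_s t).
Local Notation l1 t := (fp_l1 t).
Local Notation l2 t := (fp_l2 t).
Let mag (t : T) : R := e t + cabs (l1 t) + cabs (l2 t).
Local Notation "f \isO g" := (isO mag f g) (at level 70).
Let delta := @detuning T (@fp_wave S0).

Let e0 (t : T) : 0 < e t. Proof. by have /andP[] := wave_e_range (fp_wave t). Qed.
Let e1 (t : T) : e t <= 1. Proof. by have /andP[] := wave_e_range (fp_wave t). Qed.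
Let le0 (t : T) : 0 <= e t. Proof. exact: ltW. Qed.
Let e_mag t : e t <= mag t.
Proof. by rewrite /mag -addrA lerDl addr_ge0 ?cabs_ge0. Qed.
Let l1_mag t : cabs (l1 t) <= mag t.
Proof. by rewrite /mag addrAC lerDr addr_ge0 ?cabs_ge0 //. Qed.
Let l2_mag t : cabs (l2 t) <= mag t.
Proof. by rewrite /mag lerDr addr_ge0 ?cabs_ge0 //. Qed.
Let prof := wave_profiles e_mag.
Let Osg : (fun t : T => `|2 * e t * s t|) \isO (fun t => e t).
Proof.
apply: (@isO_le _ _ _ _ _ (2 * S0)) => [|t]; first by rewrite mulr_ge0.
rewrite normrM ger0_norm ?mulr_ge0 // mulrAC ler_wpM2r // ler_wpM2l //.
exact: fp_s_bound.
Qed.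
Let independent (t : T) := @fp_independent _ t.

Let g1 (t : T) : R := e t ^+ 2 * (2 * a0 + 16 * s t ^+ 2) + delta t.
Let g2 (t : T) : R := e t ^+ 2 * (16 * s t ^+ 2) + delta t.
Let h (t : T) : R[i] := 4 * 'i * (k t)%:C * (2 * e t * s t)%:C.

Let g1E t : k t ^+ 2 + 4 * (2 * e t * s t) ^+ 2
  - (e t ^+ 2 - 9 / 2 * (e t * Num.sqrt (2 / 3 * a0)) ^+ 2) = g1 t.
Proof. by rewrite wave_amp // /g1 /delta /detuning /gl_amp2; field. Qed.
Let g2E t : k t ^+ 2 + 4 * (2 * e t * s t) ^+ 2
  - (e t ^+ 2 - 3 / 2 * (e t * Num.sqrt (2 / 3 * a0)) ^+ 2) = g2 t.
Proof. by rewrite wave_amp // /g2 /delta /detuning /gl_amp2; field. Qed.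

Let Odelta : (fun t => `|delta t|) \isO (fun t => e t ^+ 3).
Proof. exact: detuning_bound. Qed.

Let trace : (fun t => cabs (3 * (l1 t + l2 t) + 2 * ((g1 t)%:C + (g2 t)%:C)))
  \isO (fun t => e t ^+ 3).
Proof.
have := pair_trace prof Osg l1_mag l2_mag (@fp_eigen S0) (@fp_chain S0) independent.
by apply: isO_eq => t /=; rewrite g1E g2E.
Qed.

Let det : (fun t => cabs ((3 * l1 t + 2 * (g1 t)%:C) * (3 * l1 t + 2 * (g2 t)%:C)
    + 4 * h t ^+ 2))
  \isO (fun t => e t ^+ 3 * (cabs (3 * l1 t + 2 * (g1 t)%:C)
     + cabs (3 * l1 t + 2 * (g2 t)%:C) + 4 * cabs (h t))).
Proof.
have := pair_det prof Osg l1_mag l2_mag (@fp_eigen S0) (@fp_chain S0) independent.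
by rewrite /= => hd; apply: isO_trans (isO_eq _ hd) _ => [t|];
  [rewrite g1E g2E|apply: isO_eq (isO_refl _ _) => t; rewrite g1E g2E].
Qed.

Let size1 : (fun t => cabs (l1 t)) \isO (fun t => e t ^+ 2).
Proof. exact: pair_size prof Osg l1_mag l2_mag (@fp_eigen S0) (@fp_chain S0) independent. Qed.

Let Os (c d : R) : (fun t => `|c + d * s t ^+ 2|) \isO (fun=> 1).
Proof.
apply: (@isO_le _ _ _ _ _ (`|c| + `|d| * S0 ^+ 2)) => [|t].
  by rewrite addr_ge0 ?mulr_ge0 ?sqr_ge0.
rewrite mulr1; apply: le_trans (ler_normD _ _) _; rewrite lerD2l normrM ler_wpM2l //.
rewrite normrX lerXn2r ?nnegrE //; exact: fp_s_bound.
Qed.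

Let OM i j (f g : T -> R) : (fun t => `|f t|) \isO (fun t => e t ^+ i) ->
  (fun t => `|g t|) \isO (fun t => e t ^+ j) ->
  (fun t => `|f t * g t|) \isO (fun t => e t ^+ (i + j)).
Proof.
move=> hf hg; have h' := isOM (fun t => normr_ge0 _) (fun t => normr_ge0 _) hf hg.
by apply: (isO_mono (isO_eq _ h')) => t; rewrite ?normrM ?exprD.
Qed.

Let OMc i j (f g : T -> R[i]) : (fun t => cabs (f t)) \isO (fun t => e t ^+ i) ->
  (fun t => cabs (g t)) \isO (fun t => e t ^+ j) ->
  (fun t => cabs (f t * g t)) \isO (fun t => e t ^+ (i + j)).
Proof. by move=> hf hg; apply: isO_mono (isO_cabsM hf hg) _ => t; rewrite exprD. Qed.

Let Oe i : (fun t => `|e t ^+ i|) \isO (fun t => e t ^+ i).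
Proof. by apply: (@isO_le _ _ _ _ _ 1) => // t; rewrite mul1r ger0_norm ?exprn_ge0. Qed.

Let OC (f : T -> R) g : (fun t => `|f t|) \isO g -> (fun t => cabs (f t)%:C) \isO g.
Proof. by apply: isO_eq => t; rewrite cabsr. Qed.

Let leO i j (f : T -> R) : (j <= i)%N -> f \isO (fun t => e t ^+ i) ->
  f \isO (fun t => e t ^+ j).
Proof. by move=> ij hf; apply: isO_mono hf _ => t; rewrite ler_wiXn2l. Qed.

Let OsE (c d : R) : (fun t => `|c + d * s t ^+ 2|) \isO (fun t => e t ^+ 0).
Proof. by apply: isO_mono (Os c d) _ => t; rewrite expr0. Qed.

Let A (t : T) : R := e t ^+ 2 * (4 / 3 * a0 + 32 / 3 * s t ^+ 2).
Let B (t : T) : R := e t ^+ 2 * (0 + 32 / 3 * s t ^+ 2).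
Let OA : (fun t => `|A t|) \isO (fun t => e t ^+ 2).
Proof. exact: OM (Oe 2) (OsE _ _). Qed.
Let OB : (fun t => `|B t|) \isO (fun t => e t ^+ 2).
Proof. exact: OM (Oe 2) (OsE _ _). Qed.
Let Oh : (fun t => cabs (h t)) \isO (fun t => e t ^+ 2).
Proof.
apply: (@isO_le _ _ _ _ _ (4 * (K + 4) * (2 * S0))) => [|t].
  by rewrite !mulr_ge0 // addr_ge0.
rewrite /h !cabsM cabsi !cabsr mulr1 -(rmorph_nat (real_complex R)) cabsr.
rewrite (ger0_norm (_ : 0 <= 4)) //.
have -> : 4 * (K + 4) * (2 * S0) * e t ^+ 2 = (4 * ((K + 4) * e t)) * ((2 * S0) * e t).
  by ring.
apply: ler_pM => //; first by rewrite ler_wpM2l // wave_k_size.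
rewrite normrM ger0_norm ?mulr_ge0 // mulrAC ler_wpM2r // ler_wpM2l //.
exact: fp_s_bound.
Qed.

Let gA t : 2 * (g1 t)%:C = 3 * (A t)%:C + 2 * (delta t)%:C.
Proof.
rewrite -!(rmorph_nat (real_complex R)) -!rmorphM -rmorphD; congr (_%:C).
by rewrite /g1 /A; field.
Qed.
Let gB t : 2 * (g2 t)%:C = 3 * (B t)%:C + 2 * (delta t)%:C.
Proof.
rewrite -!(rmorph_nat (real_complex R)) -!rmorphM -rmorphD; congr (_%:C).
by rewrite /g2 /B; field.
Qed.

Let glA t : e t ^+ 2 * (gl1 w (s t) + gl2 w (s t)) = - (A t + B t).
Proof. by rewrite gl_sum /A /B; field. Qed.
Let glB t : e t ^+ 4 * (gl1 w (s t) * gl2 w (s t)) =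
  A t * B t - e t ^+ 4 * (64 / 3 * w * s t) ^+ 2.
Proof. by rewrite gl_mul // /A /B; field. Qed.

Let near_sum : (fun t => cabs (l1 t + l2 t
  - (e t ^+ 2 * (gl1 w (s t) + gl2 w (s t)))%:C)) \isO (fun t => e t ^+ 3).
Proof.
apply: (isO_eq (g := fun t => cabs (1 / 3 * (3 * (l1 t + l2 t)
    + 2 * ((g1 t)%:C + (g2 t)%:C)) - 4 / 3 * (delta t)%:C))).
  move=> t; congr cabs; rewrite (mulrDr 2 (g1 t)%:C) gA gB glA rmorphN rmorphD.
  by field.
by apply: isO_cabsB; apply: isO_cabsZ => //; apply: OC.
Qed.

Let near_prod : (fun t => cabs ((l1 t - (e t ^+ 2 * gl1 w (s t))%:C)
  * (l1 t - (e t ^+ 2 * gl2 w (s t))%:C))) \isO (fun t => e t ^+ 5).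
Proof.
pose D t := (3 * l1 t + 2 * (g1 t)%:C) * (3 * l1 t + 2 * (g2 t)%:C) + 4 * h t ^+ 2.
apply: (isO_eq (g := fun t => cabs (1 / 9 * (D t - 6 * ((delta t)%:C
    * (l1 t + (A t)%:C + (l1 t + (B t)%:C))) - 4 * ((delta t)%:C * (delta t)%:C)
    + (e t ^+ 2 * (0 + 256 * s t ^+ 2))%:C * (delta t)%:C)))).
  move=> t; congr cabs; rewrite /D gA gB.
  have -> : 4 * h t ^+ 2 = - (256 * e t ^+ 2 * s t ^+ 2 * k t ^+ 2)%:C.
    rewrite /h exprMn exprMn exprMn sqrCi -!rmorphXn /=.
    by rewrite -!(rmorph_nat (real_complex R)) !rmorphM /=; ring.
  have -> : k t ^+ 2 = delta t + 16 * e t ^+ 2 * w ^+ 2.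
    by rewrite /delta /detuning subrK.
  transitivity (l1 t ^+ 2 - (e t ^+ 2 * (gl1 w (s t) + gl2 w (s t)))%:C * l1 t
    + (e t ^+ 4 * (gl1 w (s t) * gl2 w (s t)))%:C).
    have -> : e t ^+ 4 = e t ^+ 2 * e t ^+ 2 by ring.
    by rewrite !(rmorphM, rmorphD) /=; ring.
  rewrite glA glB.
  have -> : A t * B t - e t ^+ 4 * (64 / 3 * w * s t) ^+ 2 = A t * B t
     - 1 / 9 * (256 * e t ^+ 2 * s t ^+ 2 * (16 * e t ^+ 2 * w ^+ 2)) by field.
  move: (A t) (B t) (delta t) (e t ^+ 2) (s t ^+ 2) (w ^+ 2) (l1 t) => a b d ee ss ww l.
  by rewrite add0r !ofrealE; field.
have O1A : (fun t => cabs (l1 t + (A t)%:C)) \isO (fun t => e t ^+ 2).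
  by apply: isO_cabsD => //; exact: OC.
have O1B : (fun t => cabs (l1 t + (B t)%:C)) \isO (fun t => e t ^+ 2).
  by apply: isO_cabsD => //; exact: OC.
have OCd := OC Odelta.
apply: isO_cabsZ; apply: isO_cabsD; first apply: isO_cabsB; first apply: isO_cabsB.
- have Og f : (fun t => cabs (3 * (l1 t + (f t)%:C) + 2 * (delta t)%:C))
      \isO (fun t => e t ^+ 2) -> (fun t => cabs (3 * l1 t + (3 * (f t)%:C
      + 2 * (delta t)%:C))) \isO (fun t => e t ^+ 2).
    by apply: isO_eq => t; congr cabs; ring.
  have O2d : (fun t => cabs (2 * (delta t)%:C)) \isO (fun t => e t ^+ 2).
    by apply: isO_cabsZ; exact: leO OCd.
  apply: isO_trans det _.
  have pos (t : T) : 0 <= e t ^+ 3 by rewrite exprn_ge0.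
  apply: isO_mono (isOM pos _ (isO_refl mag _) (_ : _ \isO (fun t => e t ^+ 2))) _.
  + by move=> t; rewrite !addr_ge0 ?mulr_ge0 ?cabs_ge0.
  + apply: isOD; first apply: isOD.
    * by apply: isO_eq (Og A _) => [t|]; [rewrite gA|apply: isO_cabsD => //; exact: isO_cabsZ].
    * by apply: isO_eq (Og B _) => [t|]; [rewrite gB|apply: isO_cabsD => //; exact: isO_cabsZ].
    apply: isO_trans Oh; exact: (@isO_le _ _ _ _ _ 4).
  by move=> t; rewrite -exprD.
- by apply: isO_cabsZ; apply: (OMc OCd (_ : _ \isO (fun t => e t ^+ 2))); exact: isO_cabsD.
- by apply: isO_cabsZ; apply: (@leO 6) => //; exact: (OMc OCd OCd).
- by apply: (@OMc 2 3) => //; apply: OC; exact: (@OM 2 0).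
Qed.

(** The sum of the eigenvalues and the characteristic equation of one of them agree
    with those of the linearized Ginzburg-Landau equation; since the roots [gl1]
    and [gl2] are apart, [l1] is close to one of them, and [l2] to the other. *)
Lemma pair_near_gl : exists C d : R, [/\ 0 <= C, 0 < d & forall t : T,
  e t + cabs (l1 t) + cabs (l2 t) < d ->
  let near l g := cabs (l - (e t ^+ 2 * g)%:C) <= C * e t ^+ 3 in
  near (l1 t) (gl1 w (s t)) /\ near (l2 t) (gl2 w (s t)) \/
  near (l1 t) (gl2 w (s t)) /\ near (l2 t) (gl1 w (s t))].
Proof.
have [C1 [c1 [C10 c10 h1]]] := near_sum; have [C2 [c2 [C20 c20 h2]]] := near_prod.
have a0' := gl_amp2_gt0 w_lt; have g0 : 0 < 4 / 3 * a0 by rewrite !mulr_gt0.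
pose C := C2 / (2 / 3 * a0); have CC0 : 0 <= C by rewrite divr_ge0 // !mulr_ge0 // ltW.
exists (C1 + C), (Num.min c1 c2); split; rewrite ?lt_min ?c10 ?addr_ge0 //.
move=> t; rewrite lt_min => /andP[/h1 {}h1 /h2 {}h2] /=.
have e3 : 0 <= e t ^+ 3 by rewrite exprn_ge0.
have e2 : 0 < e t ^+ 2 by rewrite exprn_gt0.
have split z z' g g' : z + z' - (e t ^+ 2 * (g + g'))%:C = l1 t + l2 t
    - (e t ^+ 2 * (gl1 w (s t) + gl2 w (s t)))%:C ->
    cabs (z - (e t ^+ 2 * g)%:C) <= C * e t ^+ 3 ->
    cabs (z - (e t ^+ 2 * g)%:C) <= (C1 + C) * e t ^+ 3 /\
    cabs (z' - (e t ^+ 2 * g')%:C) <= (C1 + C) * e t ^+ 3.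
  move=> eq hz; split; first by apply: le_trans hz _; rewrite ler_wpM2r // lerDr.
  have -> : z' - (e t ^+ 2 * g')%:C = (z + z' - (e t ^+ 2 * (g + g'))%:C)
      - (z - (e t ^+ 2 * g)%:C).
    by rewrite (mulrDr (e t ^+ 2)) rmorphD /=; ring.
  by rewrite eq (mulrDl C1); apply: le_trans (cabsB _ _) (lerD h1 hz).
pose p := cabs (l1 t - (e t ^+ 2 * gl1 w (s t))%:C).
pose q := cabs (l1 t - (e t ^+ 2 * gl2 w (s t))%:C).
have pq : p * q <= C2 * e t ^+ 5 by rewrite -cabsM.
have gap : e t ^+ 2 * (4 / 3 * a0) <= p + q.
  have := cabsB (l1 t - (e t ^+ 2 * gl1 w (s t))%:C) (l1 t - (e t ^+ 2 * gl2 w (s t))%:C).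
  have -> : l1 t - (e t ^+ 2 * gl1 w (s t))%:C - (l1 t - (e t ^+ 2 * gl2 w (s t))%:C)
      = (e t ^+ 2 * (gl2 w (s t) - gl1 w (s t)))%:C.
    by move: (gl1 w _) (gl2 w _) => x y; rewrite !ofrealE; ring.
  rewrite cabsr; apply: le_trans; apply: le_trans (ler_norm _).
  by rewrite ler_wpM2l ?gl_gap ?ltW.
have close (x y : R) : 0 <= x -> x * y <= C2 * e t ^+ 5 ->
    e t ^+ 2 * (2 / 3 * a0) <= y -> x <= C * e t ^+ 3.
  move=> x0 xy hy; have m0 : 0 < e t ^+ 2 * (2 / 3 * a0) by rewrite !mulr_gt0.
  rewrite -(ler_pM2r m0); apply: le_trans (ler_wpM2l x0 hy) _; apply: le_trans xy _.
  rewrite le_eqVlt; apply/orP; left; apply/eqP; rewrite /C; field.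
  by rewrite gt_eqF.
have [pq'|qp'] := leP p q.
- left; apply: split => //; apply: (close p q) => //; first exact: cabs_ge0.
  by move: gap pq'; rewrite /p /q; lra.
right; apply: split; first by rewrite [gl2 _ _ + _]addrC.
apply: (close q p) => //; [exact: cabs_ge0|by rewrite mulrC|].
by move: gap qp'; rewrite /p /q; lra.
Qed.
End NearGL.

(** * Expansion of the translation eigenvalue *)

Record floquet_mode (C : R) := FloquetMode {
  fm_wave : wave;
  fm_s : R;
  fm_v1 : pfun P; fm_v2 : pfun P;
  fm_l : R[i];
  fm_eigen : let e := wave_e fm_wave in let k := wave_k fm_wave in
    bloch1 e k (2 * e * fm_s) (wave_1 fm_wave) (wave_2 fm_wave) fm_v1 fm_v2
      = con fm_l * fm_v1 /\
    bloch2 e k (2 * e * fm_s) (wave_1 fm_wave) (wave_2 fm_wave) fm_v1 fm_v2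
      = con fm_l * fm_v2;
  fm_nonzero : fm_v1 = 0 -> fm_v2 <> 0;
  fm_near : cabs (fm_l - (wave_e fm_wave ^+ 2 * gl2 w fm_s)%:C)
    <= C * wave_e fm_wave ^+ 3
}.

Section SharpGL.
Variable C : R.
Hypothesis C0 : 0 <= C.
Local Notation T := (floquet_mode C).
Local Notation e t := (wave_e (fm_wave t)).
Local Notation k t := (wave_k (fm_wave t)).
Local Notation s t := (fm_s t).
Local Notation l t := (fm_l t).
Let mag (t : T) : R := e t + `|s t| + cabs (l t).
Local Notation "f \isO g" := (isO mag f g) (at level 70).
Let delta := @detuning T (@fm_wave C).

Let e0 (t : T) : 0 < e t. Proof. by have /andP[] := wave_e_range (fm_wave t). Qed.
Let e1 (t : T) : e t <= 1. Proof. by have /andP[] := wave_e_range (fm_wave t). Qed.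
Let le0 (t : T) : 0 <= e t. Proof. exact: ltW. Qed.
Let mag0 t : 0 <= mag t. Proof. by rewrite !addr_ge0 ?cabs_ge0. Qed.
Let e_mag t : e t <= mag t.
Proof. by rewrite /mag -addrA lerDl addr_ge0 ?cabs_ge0. Qed.
Let s_mag t : `|s t| <= mag t.
Proof. by rewrite /mag addrAC lerDr addr_ge0 ?cabs_ge0. Qed.
Let l_mag t : cabs (l t) <= mag t.
Proof. by rewrite /mag lerDr addr_ge0. Qed.
Let prof := wave_profiles e_mag.

Let Osg : (fun t : T => `|2 * e t * s t|) \isO (fun t => e t).
Proof.
apply: (@isO_le_small _ _ _ _ _ 2) => // t /ltW m1.
rewrite normrM ger0_norm ?mulr_ge0 // ler_piMr ?mulr_ge0 //.
exact: le_trans (s_mag t) m1.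
Qed.

Let Odelta : (fun t => `|delta t|) \isO (fun t => e t ^+ 3).
Proof. exact: detuning_bound. Qed.

Let Odelta_mag : (fun t => `|delta t|) \isO (fun t => e t ^+ 2 * mag t).
Proof.
by apply: isO_mono Odelta _ => t; rewrite exprSr ler_wpM2l ?sqr_ge0.
Qed.

Let l_small : (fun t => cabs (l t)) \isO (fun t => e t ^+ 2 * mag t).
Proof.
have [L L0 hL] := gl_expansion w_lt.
apply: (@isO_le_small _ _ _ _ _ (C + L)) => [|t /ltW m1]; first exact: addr_ge0.
have s1 : `|s t| <= 1 := le_trans (s_mag t) m1; have [_ _ h] := hL _ s1.
have -> : l t = (l t - (e t ^+ 2 * gl2 w (s t))%:C) + (e t ^+ 2 * gl2 w (s t))%:C.
  by rewrite subrK.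
have e2 : 0 <= e t ^+ 2 := sqr_ge0 _.
apply: le_trans (cabsD _ _) _; rewrite (mulrDl C); apply: lerD.
  apply: le_trans (fm_near t) _; rewrite ler_wpM2l // exprSr ler_wpM2l //.
rewrite cabsr normrM ger0_norm // mulrCA ler_wpM2l //; apply: le_trans h _.
rewrite ler_wpM2l // -[leLHS]real_normK ?num_real // expr2.
by apply: le_trans (s_mag t); rewrite ler_piMr.
Qed.

Let d1E t : k t ^+ 2 - (e t ^+ 2 - 9 / 2 * (e t * Num.sqrt (2 / 3 * a0)) ^+ 2)
  = 2 * a0 * e t ^+ 2 + delta t.
Proof. by rewrite wave_amp // /delta /detuning /gl_amp2; field. Qed.

Let nondegenerate : (fun t => e t ^+ 2) \isO (fun t =>
  `|k t ^+ 2 - (e t ^+ 2 - 9 / 2 * (e t * Num.sqrt (2 / 3 * a0)) ^+ 2)|).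
Proof.
have a0' := gl_amp2_gt0 w_lt.
apply: isO_absorb => [t|]; first exact: sqr_ge0.
apply: (@isO_trans _ _ _ _ (fun t => `|2 * a0 * e t ^+ 2 + delta t| + `|delta t|)).
  apply: (@isO_le _ _ _ _ _ (2 * a0)^-1) => [|t]; first by rewrite invr_ge0 mulr_ge0 // ltW.
  rewrite ler_pdivlMl ?mulr_gt0 //.
  have -> : 2 * a0 * e t ^+ 2 = (2 * a0 * e t ^+ 2 + delta t) - delta t by rewrite addrK.
  apply: le_trans (ler_norm _) (le_trans (ler_normB _ _) _).
  by rewrite addrK.
apply: isOD.
  by apply: (@isO_le _ _ _ _ _ 1) => // t; rewrite d1E mul1r lerDl mulr_ge0 ?sqr_ge0.
apply: isO_mono Odelta_mag _ => t.
by rewrite mulrC lerDr.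
Qed.

Let X (t : T) : R := critnorm (fm_v1 t).
Let X0 t : 0 <= X t. Proof. exact: critnorm_ge0. Qed.

Let sine_dominates : (fun t => X t) \isO (fun t => cabs (coefs (fm_v1 t))).
Proof.
have a0' := gl_amp2_gt0 w_lt.
have mX (t : T) : 0 <= mag t * X t by exact: mulr_ge0.
suff cos_small : (fun t : T => cabs (coefc (fm_v1 t))) \isO (fun t => mag t * X t).
  apply: isO_absorb => //; apply: isOD.
    by apply: isO_mono cos_small _ => t; rewrite lerDr cabs_ge0.
  by apply: (@isO_le _ _ _ _ _ 1) => // t; rewrite mul1r lerDl.
suff key : (fun t : T => cabs ((4 * a0 * e t ^+ 2)%:C * coefc (fm_v1 t)))
    \isO (fun t => e t ^+ 2 * (mag t * X t)).
  have [L [d [L0 d0 hL]]] := key; exists (L / (4 * a0)), d; split=> // [|t /hL].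
    by rewrite divr_ge0 // mulr_ge0 // ltW.
  have p1 : 0 < 4 * a0 by rewrite mulr_gt0.
  have p2 : 0 < e t ^+ 2 by rewrite exprn_gt0.
  have p3 : 0 < 4 * a0 * e t ^+ 2 by rewrite mulr_gt0.
  rewrite cabsM cabsr ger0_norm ?(ltW p3) // => hh; rewrite -(ler_pM2l p3).
  apply: le_trans hh _; rewrite le_eqVlt; apply/orP; left; apply/eqP.
  by field; rewrite gt_eqF.
have hc := eigen_cos prof Osg l_mag (@fm_eigen C); rewrite /= in hc.
pose h (t : T) : R[i] := 4 * 'i * (k t)%:C * (2 * e t * s t)%:C.
apply: (isO_eq (g := fun t : T => cabs (
    3 * (l t * coefc (fm_v1 t))
    + 2 * ((2 * a0 * e t ^+ 2 + 4 * (2 * e t * s t) ^+ 2 + delta t)%:C * coefc (fm_v1 t)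
        - h t * coefs (fm_v1 t))
    - 3 * (l t * coefc (fm_v1 t)) + 2 * (h t * coefs (fm_v1 t))
    - 2 * ((4 * (2 * e t * s t) ^+ 2)%:C * coefc (fm_v1 t))
    - 2 * ((delta t)%:C * coefc (fm_v1 t))))).
  by move=> t; congr cabs; move: (delta t) (h t) => d hh; rewrite !ofrealE; ring.
have cX (z : T -> R[i]) f : (fun t => cabs (z t)) \isO (fun t => e t ^+ 2 * mag t) ->
    (forall t : T, cabs (f t) <= X t) ->
    (fun t => cabs (z t * f t)) \isO (fun t => e t ^+ 2 * (mag t * X t)).
  move=> hz hf; apply: isO_mono (isO_cabsM hz (_ : _ \isO X)) _.
    by apply: (@isO_le _ _ _ _ _ 1) => // t; rewrite mul1r.
  by move=> t; rewrite mulrA.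
have cc (t : T) : cabs (coefc (fm_v1 t)) <= X t by rewrite lerDl cabs_ge0.
have cs (t : T) : cabs (coefs (fm_v1 t)) <= X t by rewrite lerDr cabs_ge0.
have e2 (t : T) : 0 <= e t ^+ 2 := sqr_ge0 _.
apply: isO_cabsB; last first.
  by apply: isO_cabsZ; apply: cX => //; apply: isO_eq Odelta_mag => t; rewrite cabsr.
apply: isO_cabsB; last first.
  apply: isO_cabsZ; apply: cX => //; apply: (@isO_le_small _ _ _ _ _ 16) => // t /ltW m1.
  rewrite cabsr (ger0_norm (mulr_ge0 (ler0n _ 4) (sqr_ge0 _))).
  have -> : 4 * (2 * e t * s t) ^+ 2 = 16 * (e t ^+ 2 * s t ^+ 2) by ring.
  rewrite ler_wpM2l // ler_wpM2l // -[leLHS]real_normK ?num_real // expr2.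
  by apply: le_trans (s_mag t); rewrite ler_piMr //; apply: le_trans (s_mag t) m1.
apply: isO_cabsD; last first.
  apply: isO_cabsZ; apply: cX => //; apply: (@isO_le _ _ _ _ _ (4 * (K + 4) * 2)) => [|t].
    by rewrite !mulr_ge0 // addr_ge0.
  rewrite /h !cabsM cabsi !cabsr mulr1 -(ofrealn 4) cabsr (ger0_norm (_ : 0 <= 4)) //.
  have -> : 4 * (K + 4) * 2 * (e t ^+ 2 * mag t) = (4 * ((K + 4) * e t)) * (2 * e t * mag t).
    by ring.
  apply: ler_pM => //; first by rewrite ler_wpM2l // wave_k_size.
  by rewrite normrM ger0_norm ?mulr_ge0 // ler_wpM2l ?mulr_ge0.
apply: isO_cabsB; last by apply: isO_cabsZ; exact: cX.
apply: isO_mono (isO_eq _ hc) _ => t.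
  congr cabs; congr (_ + 2 * (_%:C * _ - _)).
  by rewrite wave_amp // /delta /detuning /gl_amp2; field.
rewrite exprSr -mulrA; apply: ler_wpM2l => //; apply: ler_wpM2r; first exact: X0.
exact: e_mag.
Qed.

Let x (t : T) : R[i] := coefc (fm_v1 t + refl (fm_v1 t)).
Let S (t : T) : R[i] := coefs (fm_v1 t - refl (fm_v1 t)).
Let r (t : T) : R := `|s t|. Let bS (t : T) : R := cabs (S t).
Let r0 t : 0 <= r t. Proof. exact: normr_ge0. Qed.
Let bS0 t : 0 <= bS t. Proof. exact: cabs_ge0. Qed.
Let isk (t : T) : R[i] := 'i * (2 * e t * s t)%:C * (k t)%:C.

Let sg_eq (t : T) : 2 * e t * s t = 2 * e t * s t. Proof. by []. Qed.
Let even1 (t : T) := wave_1_even (fm_wave t).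
Let even2 (t : T) := wave_2_even (fm_wave t).
Let critical (t : T) := wave_critical (fm_wave t).

Let Ox : (fun t => cabs (x t)) \isO (fun t => r t * bS t).
Proof.
exact: (sharp_critical prof even1 even2 sg_eq s_mag l_mag l_small (@fm_eigen C)
  sine_dominates nondegenerate).
Qed.

Let E t := (2 * a0 * e t ^+ 2 + delta t)%:C * x t - 4 * isk t * S t.
Let OE : (fun t => cabs (E t)) \isO (fun t => e t ^+ 2 * mag t * (r t * bS t)).
Proof.
have := sharp_even prof even1 even2 sg_eq s_mag l_mag l_small (@fm_eigen C)
  sine_dominates.
move=> h; apply: isO_trans (isO_eq _ h) _ => [t|/=].
  by congr cabs; rewrite /E d1E /isk !mulrA.
have em (t : T) : 0 <= e t ^+ 2 * mag t by rewrite mulr_ge0 ?sqr_ge0.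
apply: isOD.
  apply: (isO_eq (g := fun t => e t ^+ 2 * mag t * cabs (x t))) => [t|].
    by rewrite expr0 mulr1 mulrA.
  exact: isOM em (fun t => cabs_ge0 _) (isO_refl mag _) Ox.
apply: (@isO_le _ _ _ _ _ 1) => // t; rewrite mul1r -mulrA expr1.
apply: ler_wpM2r; first exact: (mulr_ge0 (r0 t) (bS0 t)).
by rewrite exprSr ler_wpM2l ?sqr_ge0.
Qed.

Let Odd t := 3 * l t * S t + 8 * isk t * x t + 8 * ((2 * e t * s t) ^+ 2)%:C * S t.
Let OOdd : (fun t => cabs (Odd t))
  \isO (fun t => e t * cabs (l t) * bS t + e t ^+ 3 * r t ^+ 2 * bS t).
Proof.
have := sharp_odd prof even1 even2 critical sg_eq s_mag l_mag l_small (@fm_eigen C)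
  sine_dominates nondegenerate.
move=> h; apply: isO_trans (isO_eq _ h) _ => [t|/=].
  by congr cabs; rewrite /Odd /isk !mulrA.
by apply: isO_eq (isO_refl _ _) => t; rewrite mulrA.
Qed.

Let Oisk : (fun t => cabs (isk t)) \isO (fun t => e t ^+ 2 * r t).
Proof.
apply: (@isO_le _ _ _ _ _ (2 * (K + 4))) => [|t]; first by rewrite mulr_ge0 // addr_ge0.
rewrite /isk !cabsM cabsi mul1r !cabsr normrM [`|2 * e t|]ger0_norm ?mulr_ge0 //.
have -> : 2 * (K + 4) * (e t ^+ 2 * r t) = 2 * e t * r t * ((K + 4) * e t) by ring.
by rewrite ler_wpM2l ?mulr_ge0 // wave_k_size.
Qed.

Let gap (t : T) : R[i] := l t - (e t ^+ 2 * expansion2 w (s t))%:C.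

Let gap_identity (t : T) : (3 * a0 * e t ^+ 2)%:C * gap t * S t =
  (a0 * e t ^+ 2)%:C * Odd t - 4 * (isk t * E t) + 4 * (isk t * ((delta t)%:C * x t))
  + 64 * ((e t ^+ 2 * s t ^+ 2)%:C * ((delta t)%:C * S t)).
Proof.
have an0 : a0 != 0 by rewrite gt_eqF ?gl_amp2_gt0.
have ex : 3 * a0 * expansion2 w (s t) = - (32 * (a0 - 32 * w ^+ 2) * s t ^+ 2).
  by rewrite /expansion2; move: an0; rewrite /gl_amp2 => an0; field.
have -> : (3 * a0 * e t ^+ 2)%:C * gap t = (3 * a0 * e t ^+ 2)%:C * l t
    + (e t ^+ 4 * (32 * (a0 - 32 * w ^+ 2) * s t ^+ 2))%:C.
  rewrite /gap mulrBr; congr (_ + _); rewrite -rmorphM -rmorphN; congr (_%:C).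
  have -> : e t ^+ 4 * (32 * (a0 - 32 * w ^+ 2) * s t ^+ 2) =
    - (e t ^+ 4 * (3 * a0 * expansion2 w (s t))) by rewrite ex; ring.
  by ring.
have isk2 : isk t * isk t = - (4 * e t ^+ 2 * s t ^+ 2 * (delta t + 16 * e t ^+ 2 * w ^+ 2))%:C.
  rewrite /delta /detuning subrK /isk.
  transitivity ('i ^+ 2 * ((2 * e t * s t)%:C * (k t)%:C) ^+ 2); first by ring.
  rewrite sqrCi mulN1r -rmorphM -rmorphXn; congr (- _%:C); ring.
rewrite /Odd /E.
transitivity ((a0 * e t ^+ 2)%:C * (3 * l t * S t + 8 * ((2 * e t * s t) ^+ 2)%:C * S t)
   + 16 * (isk t * isk t) * S t
   + 64 * ((e t ^+ 2 * s t ^+ 2)%:C * ((delta t)%:C * S t))).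
  rewrite isk2; move: (delta t) (S t) (l t) => d SS L.
  have -> : (2 * e t * s t) ^+ 2 = 4 * e t ^+ 2 * s t ^+ 2 by ring.
  have -> : e t ^+ 4 = e t ^+ 2 * e t ^+ 2 by ring.
  move: (e t ^+ 2) (s t ^+ 2) (w ^+ 2) a0 => ee ss ww a.
  by rewrite !ofrealE; ring.
by move: (isk t) (delta t) (e t ^+ 2) (s t ^+ 2) => I d ee ss; rewrite !ofrealE; ring.
Qed.

Let OdX (c : T -> R[i]) (f : T -> R) : (fun t => cabs (c t)) \isO f ->
  (fun t => cabs ((delta t)%:C * c t)) \isO (fun t => e t ^+ 3 * f t).
Proof. by apply: isO_cabsM; apply: isO_eq Odelta => t; rewrite cabsr. Qed.

Let Ogap_S : (fun t => cabs ((3 * a0 * e t ^+ 2)%:C * gap t * S t)) \isO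
  (fun t => e t ^+ 2 * ((e t * cabs (l t) + e t ^+ 2 * (mag t * r t ^+ 2)) * bS t)).
Proof.
apply: (isO_eq (fun t => congr1 (@cabs R) (gap_identity t))).
have e2 (t : T) : 0 <= e t ^+ 2 := sqr_ge0 _.
have r2 (t : T) : 0 <= r t ^+ 2 := sqr_ge0 _.
have l0 (t : T) : 0 <= e t * cabs (l t) by rewrite mulr_ge0 ?cabs_ge0.
have tail (f : T -> R) : f \isO (fun t => e t ^+ 2 * (e t ^+ 2 * (mag t * r t ^+ 2) * bS t)) ->
    f \isO (fun t => e t ^+ 2 * ((e t * cabs (l t) + e t ^+ 2 * (mag t * r t ^+ 2)) * bS t)).
  by move=> hf; apply: isO_mono hf _ => t; do 2 rewrite ?ler_wpM2l ?ler_wpM2r ?lerDr //.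
have e5 (f : T -> R) : f \isO (fun t => e t ^+ 5 * (r t ^+ 2 * bS t)) ->
    f \isO (fun t => e t ^+ 2 * (e t ^+ 2 * (mag t * r t ^+ 2) * bS t)).
  move=> hf; apply: isO_mono hf _ => t.
  have -> : e t ^+ 5 * (r t ^+ 2 * bS t) = e t ^+ 2 * (e t ^+ 2 * (e t * r t ^+ 2) * bS t).
    by ring.
  by apply: ler_wpM2l => //; apply: ler_wpM2r => //; apply: ler_wpM2l => //;
    apply: ler_wpM2r.
apply: isO_cabsD; first apply: isO_cabsD; first apply: isO_cabsB.
- have a0' := gl_amp2_gt0 w_lt.
  have Oa : (fun t : T => cabs (a0 * e t ^+ 2)%:C) \isO (fun t => e t ^+ 2).
    apply: (@isO_le _ _ _ _ _ a0) => [|t]; first exact: ltW.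
    by rewrite cabsr ger0_norm // mulr_ge0 // ltW.
  apply: isO_mono (isO_cabsM Oa OOdd) _ => t; apply: ler_wpM2l => //.
  rewrite (mulrDl (e t * cabs (l t))) lerD2l; apply: ler_wpM2r => //.
  by rewrite exprSr -mulrA; apply: ler_wpM2l => //; apply: ler_wpM2r.
- apply: tail; apply: isO_cabsZ; apply: isO_mono (isO_cabsM Oisk OE) _ => t.
  by rewrite le_eqVlt; apply/orP; left; apply/eqP; ring.
- apply: tail; apply: e5; apply: isO_cabsZ.
  apply: isO_mono (isO_cabsM Oisk (OdX Ox)) _ => t.
  by rewrite le_eqVlt; apply/orP; left; apply/eqP; ring.
- apply: tail; apply: e5; apply: isO_cabsZ.
  have Oes : (fun t : T => cabs (e t ^+ 2 * s t ^+ 2)%:C) \isO (fun t => e t ^+ 2 * r t ^+ 2).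
    apply: (@isO_le _ _ _ _ _ 1) => // t.
    by rewrite mul1r cabsr normrM !normrX [`|e t|]ger0_norm.
  apply: isO_mono (isO_cabsM Oes (OdX (isO_refl _ bS))) _ => t.
  by rewrite le_eqVlt; apply/orP; left; apply/eqP; ring.
Qed.

Let S_nonzero : exists2 c : R, 0 < c & forall t, mag t < c -> 0 < bS t.
Proof.
have [K1 [c1 [K10 c10 h1]]] := sine_dominates.
have [K2 [c2 [K20 c20 h2]]] := eigen_hypnorm prof Osg l_mag (@fm_eigen C).
exists (Num.min c1 c2); first by rewrite lt_min c10.
move=> t; rewrite lt_min => /andP[/h1 {}h1 /h2 {}h2]; rewrite lt_def bS0 andbT.
apply/negP => /eqP bS_0.
have cs0 : cabs (coefs (fm_v1 t)) = 0.
  have : cabs (2 * coefs (fm_v1 t)) = 0.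
    by rewrite -bS_0 /bS /S coefsB coefs_refl opprK; congr cabs; ring.
  by rewrite cabs2 => /eqP; rewrite mulf_eq0 pnatr_eq0 => /eqP.
have Xz : X t = 0.
  by apply/eqP; rewrite eq_le X0 andbT; move: h1; rewrite cs0 mulr0.
rewrite -/(X t) Xz !mulr0 in h2.
have [] := zero_of_hypnorm h2 Xz; exact: fm_nonzero.
Qed.

Let Ogap_mag : (fun t => cabs (gap t)) \isO (fun t => e t ^+ 2 * (mag t * r t ^+ 2)).
Proof.
have a0' := gl_amp2_gt0 w_lt; have a3 : 0 < 3 * a0 by rewrite mulr_gt0.
apply: isO_absorb => [t|]; first exact: cabs_ge0.
have e2 (t : T) : 0 < e t ^+ 2 by rewrite exprn_gt0.
apply: (@isO_trans _ _ _ _ (fun t => e t * cabs (l t) + e t ^+ 2 * (mag t * r t ^+ 2))).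
  have [L [d [L0 d0 hL]]] := Ogap_S; have [c c0 hc] := S_nonzero.
  exists (L / (3 * a0)), (Num.min d c); split; rewrite ?lt_min ?d0 //.
    by rewrite divr_ge0 // ltW.
  move=> t; rewrite lt_min => /andP[/hL {}hL /hc bS1].
  have p : 0 < 3 * a0 * e t ^+ 2 by rewrite mulr_gt0.
  move: hL; rewrite !cabsM cabsr (ger0_norm (ltW p)) -/(bS t) [e t ^+ 2 * (_ * bS t)]mulrA.
  rewrite mulrA ler_pM2r // => hL.
  rewrite -(ler_pM2l p); apply: le_trans hL _.
  by rewrite le_eqVlt; apply/orP; left; apply/eqP; field; rewrite gt_eqF.
have mr (t : T) : 0 <= mag t * r t ^+ 2 by rewrite mulr_ge0 ?sqr_ge0.
apply: isOD; last first.
  by apply: (@isO_le _ _ _ _ _ 1) => // t; rewrite mul1r lerDl mulr_ge0 ?cabs_ge0.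
pose L := `|32 * (1 - 48 * w ^+ 2) / (3 * (1 - 16 * w ^+ 2))|.
have L0 : 0 <= L := normr_ge0 _.
apply: (@isO_le _ _ _ _ _ (1 + L)) => [|t]; first exact: addr_ge0.
have hl : cabs (l t) <= cabs (gap t) + e t ^+ 2 * (L * r t ^+ 2).
  have -> : l t = gap t + (e t ^+ 2 * expansion2 w (s t))%:C by rewrite /gap subrK.
  apply: le_trans (cabsD _ _) _; rewrite lerD2l cabsr normrM (ger0_norm (ltW (e2 t))).
  apply: ler_wpM2l; first exact: ltW.
  by rewrite /expansion2 normrM normrN normrX.
apply: le_trans (ler_wpM2l (le0 t) hl) _.
have g1 : e t * cabs (gap t) <= mag t * cabs (gap t) by rewrite ler_wpM2r ?cabs_ge0.
have g2 : e t * (e t ^+ 2 * r t ^+ 2) <= mag t * (e t ^+ 2 * r t ^+ 2).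
  by rewrite ler_wpM2r // mulr_ge0 ?sqr_ge0 ?ltW.
have g3 : 0 <= e t ^+ 2 * (mag t * r t ^+ 2) by rewrite mulr_ge0 // ltW.
have g4 : 0 <= mag t * cabs (gap t) by rewrite mulr_ge0 ?cabs_ge0.
have -> : e t * (cabs (gap t) + e t ^+ 2 * (L * r t ^+ 2)) = e t * cabs (gap t)
   + L * (e t * (e t ^+ 2 * r t ^+ 2)) by ring.
have -> : (1 + L) * (e t ^+ 2 * (mag t * r t ^+ 2) + mag t * cabs (gap t)) =
  (mag t * cabs (gap t) + L * (mag t * (e t ^+ 2 * r t ^+ 2)))
  + (e t ^+ 2 * (mag t * r t ^+ 2) + L * (mag t * cabs (gap t))) by ring.
apply: le_trans (lerD g1 (ler_wpM2l L0 g2)) _.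
by rewrite lerDl addr_ge0 // mulr_ge0.
Qed.

Let Omag : mag \isO (fun t => e t + r t).
Proof.
apply: isO_absorb => //; apply: isOD.
  by apply: (@isO_le _ _ _ _ _ 1) => // t; rewrite mul1r lerDl mulr_ge0.
apply: isO_mono l_small _ => t.
apply: (@le_trans _ _ (mag t * mag t)); last by rewrite lerDr addr_ge0.
by rewrite ler_wpM2r // expr2; apply: le_trans (e_mag t); rewrite ler_piMl.
Qed.

(** Inserting [sharp_even] into [sharp_odd] ([gap_identity]) leaves an equation for
    the eigenvalue times [S]; the odd critical coefficient [S] does not vanish
    because it dominates the eigenvector. *)
Lemma sharp_expansion : exists L d : R, [/\ 0 <= L, 0 < d & forall t : T,
  e t + `|s t| + cabs (l t) < d ->
  cabs (l t - (e t ^+ 2 * expansion2 w (s t))%:C)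
    <= L * (e t ^+ 2 * (`|s t| ^+ 3 + e t * s t ^+ 2))].
Proof.
have r2 (t : T) : 0 <= r t ^+ 2 := sqr_ge0 _.
have e2 (t : T) : 0 <= e t ^+ 2 := sqr_ge0 _.
have h := isOM e2 (fun t => mulr_ge0 (mag0 t) (r2 t)) (isO_refl mag _)
  (isOM mag0 r2 Omag (isO_refl mag _)).
have [L [d [L0 d0 hL]]] := isO_trans Ogap_mag h.
exists L, d; split=> // t /hL; rewrite (mulrDl (e t)) addrC.
by rewrite /r -exprS real_normK ?num_real.
Qed.

End SharpGL.
End Waves.

(** * Weak periodic derivatives *)



Section Regularity.
Context {R : realType}.
Local Notation mu := (@lebesgue_measure R).
Local Notation tpi := (pi *+ 2 : R).
Local Notation I := (`[0, tpi]%classic : set R).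
Implicit Types (f g G : R -> R).

Lemma continuous_L2_per g : continuous g -> L2_per g.
Proof.
move=> cg; have mI : measurable (I : set R) by exact: measurable_itv.
have mg : measurable_fun setT (g \_ I).
  apply/(measurable_restrict _ mI measurableT); rewrite setTI.
  by apply: measurable_funTS; exact: continuous_measurable_fun.
rewrite /L2_per inE; apply/andP; split; rewrite inE //=.
rewrite /finite_norm unlock; apply: poweR_lty.
have -> : (fun x => `|(EFin \o g \_ I) x| `^ 2)%E = ((EFin \o (fun x => g x ^+ 2)) \_ I).
  apply: funext => x /=; rewrite /patch; case: ifPn => _ /=.
    by rewrite powR_mulrn // real_normK ?num_real.
  by rewrite normr0 powR0.
have : mu.-integrable I (EFin \o (fun x => g x ^+ 2)).
  apply: continuous_integrable_itv => x.
  by apply: (@continuous_comp _ _ _ g (fun y => y ^+ 2)); [exact: cg|exact: exprn_continuous].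
move=> h; have /(_ h)/integrableP[_] := (@integrable_mkcond _ _ _ mu _ (EFin \o (fun x => g x ^+ 2)) mI).1; apply: le_lt_trans.
rewrite le_eqVlt; apply/orP; left; apply/eqP; apply: eq_integral => x _ /=.
rewrite /patch; case: ifPn => _ /=; last by rewrite normr0.
by rewrite ger0_norm // sqr_ge0.
Qed.

Lemma L2_per_integrable g : L2_per g -> mu.-integrable I (EFin \o g).
Proof.
move=> lg; have mI : measurable (I : set R) by exact: measurable_itv.
apply/(@integrable_mkcond _ _ _ mu _ (EFin \o g) mI).
have l1 : L2_per (fun=> 1 : R) by apply: continuous_L2_per => x; exact: cst_continuous.
have /Lfun1_integrable := Lfun2_mul_Lfun1 lg l1.
apply: eq_integrable => // x _ /=; rewrite /patch.
by case: ifPn; rewrite ?mulr1 ?mulr0.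
Qed.

Lemma integral_continuous g : mu.-integrable I (EFin \o g) ->
  {within I, continuous (fun x => \int[mu]_(t in `[0, x]) g t)}%classic.
Proof.
move=> ig; have := parameterized_integral_continuous (ltW (@tpi_gt0 R)) ig.
apply.
Qed.

Lemma periodic_shift (x : R) : exists2 k : R, 0 <= x + k < tpi &
  forall f, periodic f tpi -> f \o shift k = f.
Proof.
have p0 := @tpi_gt0 R; pose m := Num.floor (x / tpi).
exists (- (tpi *~ m)) => [|f pf].
  have /andP[l u] := floor_itv (x / tpi); rewrite -/m in l u.
  rewrite subr_ge0 ltrBlDl; move: l u; rewrite ler_pdivlMr // ltr_pdivrMr //.
  by rewrite intrD mulrDl mul1r !mulrzl => -> ->.
have pn n z : f (z + tpi *+ n) = f z.
  by elim: n => [|n IH]; rewrite ?mulr0n ?addr0 // mulrSr addrA pf.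
apply: funext => y /=; case: (intP m) => [|n|n]; first by rewrite mulr0z subr0.
  by rewrite -(pn n.+1) subrK.
by rewrite mulrNz opprK; exact: pn n.+1 y.
Qed.

(** At the ends of the period the two one-sided limits match by periodicity. *)
Lemma periodic_within_continuous f : periodic f tpi -> {within I, continuous f}%classic ->
  continuous f.
Proof.
move=> pf cf; have p0 := @tpi_gt0 R.
have /(continuous_within_itvP _ p0)[cI c0 c1] := cf.
have main t : 0 <= t < tpi -> {for t, continuous f}.
  move=> /andP[]; rewrite le_eqVlt => /predU1P[<- _|t0 t1]; last first.
    by apply: cI; rewrite in_itv /= t0.
  move: c0 c1 => /cvgrPdist_le h0 /cvgrPdist_le h1; apply/cvgrPdist_le => e e0.
  have [a /= a0 {}h0] := h0 _ e0.
  have [b /= b0 {}h1] := h1 _ e0.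
  exists (Num.min a b); rewrite /= ?lt_min ?a0 // => y; rewrite /ball_ /= lt_min.
  move=> /andP[ta tb]; have [t0|t0|->] := ltgtP y 0.
  - rewrite -(pf y) -[f 0]pf add0r; apply: h1; rewrite /= ?gtrDr //.
    by rewrite opprD addrCA addrN addr0 -[- y]sub0r.
  - exact: h0.
  - by rewrite subrr normr0 ltW.
move=> x; have [k /main ck fk] := periodic_shift x.
rewrite -(fk f pf); apply: continuous_comp; last exact: ck.
by apply: cvgD; [exact: cvg_id|exact: cvg_cst].
Qed.

Lemma H2_derivs_periodic g g1 g2 : H2_derivs g g1 g2 -> periodic g1 tpi.
Proof. by move=> [pg dg _ _]; exact: periodic_is_derive pg dg. Qed.

Lemma H2_derivs_continuous g g1 g2 : H2_derivs g g1 g2 -> continuous g1.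
Proof.
move=> H; have pg1 := H2_derivs_periodic H; move: H => [_ _ lg2 eg1].
apply: periodic_within_continuous => //.
have c := integral_continuous (L2_per_integrable lg2).
have c' : {within I, continuous (fun x => g1 0 + \int[mu]_(t in `[0, x]) g2 t)}%classic.
  by move=> x; apply: cvgD; [exact: cvg_cst|exact: c].
apply: subspace_eq_continuous c' => x; rewrite inE /= in_itv /= => hx.
by rewrite /from_subspace /= -eg1.
Qed.

(** On the period [g1] agrees with a primitive of [G].  That primitive takes the
    same value at both ends, because [g1] does, and is therefore periodic, so that
    the two agree on both sides of the end points. *)
Lemma H2_derivs_classical g g1 g2 G : H2_derivs g g1 g2 -> continuous G ->
  periodic G tpi -> {ae mu, forall x, I x -> g2 x = G x} ->
  forall x : R, is_derive x 1 g1 (G x).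
Proof.
move=> H cG pG aeG x; have pg1 := H2_derivs_periodic H; move: H => [_ _ lg2 eg1].
have p0 := @tpi_gt0 R.
have [Q dQ] := primitive_ex (- (tpi + 1)) cG.
have eq t : 0 <= t <= tpi -> g1 t = g1 0 + (Q t - Q 0).
  move=> /andP[t0 t1]; rewrite eg1 ?t0 //; congr (_ + _).
  have dQ' y : 0 <= y <= t -> is_derive y 1 Q (G y).
    move=> /andP[y0 _]; apply: dQ; apply: lt_le_trans y0.
    by rewrite oppr_lt0 addr_gt0.
  rewrite -(integral_FTC2 t0 cG dQ').
  have sub : (`[0, t] `<=` I)%classic.
    by move=> y /=; rewrite !in_itv /= => /andP[-> yt]; exact: le_trans yt t1.
  have i2 : mu.-integrable `[0, t] (EFin \o g2).
    by apply: (integrableS _ _ _ (L2_per_integrable lg2)) => //; exact: measurable_itv.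
  congr fine; apply: ae_eq_integral => //.
  - exact: measurable_int i2.
  - exact: measurable_int (continuous_integrable_itv 0 t cG).
  - case: aeG => N [mN N0 sN]; exists N; split=> // y ny; apply: sN => h; apply: ny.
    by move=> yt /=; rewrite h //; exact: sub.
pose h t := g1 0 + (Q t - Q 0).
have dh t : - (tpi + 1) < t -> is_derive t 1 h (G t).
  move=> ht; have := dQ t ht => dQt.
  by rewrite -[G t]add0r -[G t]subr0; apply: is_deriveD.
have hp y : - tpi <= y -> h (y + tpi) = h y.
  move=> hy; pose D := (h \o shift tpi) - h.
  have dD t : - tpi <= t -> is_derive t 1 D 0.
    move=> ht; have lt1 : - (tpi + 1) < t.
      by apply: lt_le_trans ht; rewrite opprD gtrDl oppr_lt0.
    have lt2 : - (tpi + 1) < t + tpi by apply: lt_trans lt1 _; rewrite ltrDl.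
    have := is_deriveB (is_derive_compD (dh _ lt2)) (dh _ lt1).
    by rewrite -(pG t) subrr.
  have D0 : D 0 = 0.
    by rewrite /D /= !fctE /= add0r /h -!eq ?lexx ?ltW // -[X in g1 X - _]add0r pg1 subrr.
  have dD' a b : - tpi <= a -> forall t : R, a <= t <= b -> is_derive t 1 D 0.
    by move=> ha t /andP[at_ _]; apply: dD; exact: le_trans at_.
  have : D y = 0.
    have [y0|y0] := leP 0 y.
      have n0 : - tpi <= 0 by rewrite oppr_le0 ltW.
      by have [c _] := is_derive_MVT y0 (dD' 0 y n0); rewrite mul0r D0 subr0.
    have [c _] := is_derive_MVT (ltW y0) (dD' y 0 hy).
    by rewrite mul0r D0 sub0r => /eqP; rewrite oppr_eq0 => /eqP.
  by rewrite /D /= => /eqP; rewrite subr_eq0 => /eqP.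
have gh y : - tpi < y < tpi -> g1 y = h y.
  move=> /andP[y0 y1]; have [yp|yn] := leP 0 y; first by apply: eq; rewrite yp ltW.
  by rewrite -pg1 -hp ?ltW // eq // -lerBlDr sub0r ltW //= -[leRHS]add0r lerD2r ltW.
have main t : 0 <= t < tpi -> is_derive t 1 g1 (G t).
  move=> /andP[t0 t1]; have tm : - tpi < t by apply: lt_le_trans t0; rewrite oppr_lt0.
  have tm' : - (tpi + 1) < t.
    by apply: lt_trans tm; rewrite opprD gtrDl oppr_lt0.
  apply: near_eq_is_derive (dh t tm').
  near=> y; rewrite gh // ltrNl; apply/andP; split; near: y;
    [by apply: Nlt_nbhsl; rewrite ltrNl|exact: lt_nbhsl].
have [k /main dk fk] := periodic_shift x.
have := is_derive_compD dk; rewrite (fk g1 pg1).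
by have := congr1 (fun f => f x) (fk G pG) => /= ->.
Unshelve. all: by end_near.
Qed.
End Regularity.

(** * Regularity and the Bloch operator on smooth functions *)

Section Frontend.
Context {R : realType}.
Local Notation C := R[i].
Local Notation mu := (@lebesgue_measure R).
Local Notation tpi := (pi *+ 2 : R).
Local Notation I := (`[0, tpi]%classic : set R).
Local Notation P := (sfun_calculus R).
Implicit Types (V W F : @C2fun R).

Definition comp V (j : 'I_2) : R -> C := fun x => V x j 0.

Lemma complexE_eq (a b : C) : complex.Re a = complex.Re b ->
  complex.Im a = complex.Im b -> a = b.
Proof. by case: a b => ? ? [] ? ? /= -> ->. Qed.

Section Smoothness.
Variables (V V1 V2 : @C2fun R) (G : 'I_2 -> R -> C).
Hypothesis H2V : H2_derivsC2 V V1 V2.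
Hypothesis G_periodic : forall j, periodic (G j) tpi.
Hypothesis G_regular : forall n, (forall j, Ck n (comp V j)) ->
  (forall j, Ck n (comp V1 j)) -> forall j, Ck n (G j).
Hypothesis aeG : {ae mu, forall x, I x -> forall j, V2 x j 0 = G j x}.

Let periodicV j : periodic (comp V j) tpi.
Proof.
by move=> x; have [[pr _ _ _] [pi' _ _ _]] := H2V j; apply: complexE_eq; [exact: pr|exact: pi'].
Qed.

Let derV j : cderiv (comp V j) (comp V1 j).
Proof. by move=> x; have [[_ dr _ _] [_ di _ _]] := H2V j; split; [exact: dr|exact: di]. Qed.

Lemma comp_periodic j : periodic (comp V j) tpi /\ periodic (comp V1 j) tpi.
Proof. by split=> //; exact: cderiv_periodic (derV j). Qed.

Let contV1 j : ccontinuous (comp V1 j).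
Proof.
by have [hr hi] := H2V j; split; [exact: H2_derivs_continuous hr|exact: H2_derivs_continuous hi].
Qed.

Let derV1 j : cderiv (comp V1 j) (G j).
Proof.
have [cr ci] : ccontinuous (G j).
  by apply: (G_regular (n := 0)) => // i; exact: cderiv_continuous (derV i).
have ae f : {ae mu, forall x, I x -> f (V2 x j 0) = f (G j x) :> R}.
  by case: aeG => N [mN N0 sN]; exists N; split=> // y ny; apply: sN => h; apply: ny => Iy;
    rewrite h.
move=> x; have [hr hi] := H2V j; split.
  apply: (H2_derivs_classical (G := @complex.Re R \o G j) hr) => //.
    by move=> y /=; rewrite G_periodic.
  exact: ae.
apply: (H2_derivs_classical (G := @complex.Im R \o G j) hi) => //.
  by move=> y /=; rewrite G_periodic.
exact: ae.
Qed.

Let Ck_all n : (forall j, Ck n (comp V j)) /\ (forall j, Ck n (comp V1 j)).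
Proof.
elim: n => [|n [h1 h2]]; first by split=> // j; exact: cderiv_continuous (derV j).
by split=> j; [exists (comp V1 j)|exists (G j)] => //; exact: G_regular.
Qed.

(** Bootstrapping: the right hand side of the equation is as regular as the solution
    and its first derivative, so each differentiation gains one order. *)
Lemma ode_smooth : exists v : 'I_2 -> sfun R,
  [/\ forall j x, v j x = V x j 0, forall j x, sder (v j) x = V1 x j 0 &
      forall j x, sder (sder (v j)) x = G j x].
Proof.
have sV j : comp V j \in @smooth_periodic R.
  by apply/asboolP; split=> // n; have [] := Ck_all n.
have sV1 j : comp V1 j \in @smooth_periodic R.
  apply/asboolP; split=> [|n]; last by have [] := Ck_all n.
  exact: cderiv_periodic (derV j).
have e1 j : sder (SFun (sV j)) = SFun (sV1 j).
  by apply: sder_eq; exact: derV.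
exists (fun j => SFun (sV j)); split=> // j x; rewrite e1 //.
have -> : G j = sder (SFun (sV1 j)); last by [].
exact: cderiv_uniq (derV1 j) (sderP (SFun (sV1 j))).
Qed.

End Smoothness.

Lemma sfun_H2 (f : sfun R) (p : C -> R) :
  p = @complex.Re R \/ p = @complex.Im R ->
  H2_derivs (p \o f) (p \o sder f) (p \o sder (sder f)).
Proof.
move=> hp; have dp (g : sfun R) (x : R) : is_derive x 1 (p \o g) (p (sder g x)).
  by case: hp => ->; have [] := sderP g x.
have cp (g : sfun R) : continuous (p \o g).
  by case: hp => ->; have [] := sfun_continuous g.
split=> [x|x||x /andP[x0 _]]; first by rewrite /= sfun_periodic.
- exact: dp.
- exact: continuous_L2_per.
by rewrite (integral_FTC2 x0 (cp _) (fun y _ => dp (sder f) y)) addrC subrK.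
Qed.

Definition sfunC2 (v1 v2 : sfun R) : @C2fun R := fun x => col2 (v1 x) (v2 x).

Lemma sfunC2_H2 v1 v2 : H2_derivsC2 (sfunC2 v1 v2) (sfunC2 (sder v1) (sder v2))
  (sfunC2 (sder (sder v1)) (sder (sder v2))).
Proof.
have E (f1 f2 : sfun R) (j : 'I_2) p : (fun x => p (sfunC2 f1 f2 x j 0)) =
    p \o (if j == 0 then f1 else f2) :> (R -> R).
  by apply: funext => x; rewrite /= mxE; case: ifP.
move=> j; rewrite /ReC /ImC !E.
have ej (g : sfun R -> sfun R) : (if j == 0 then g v1 else g v2)
  = g (if j == 0 then v1 else v2) by case: ifP.
rewrite (ej (@sder R)) (ej (fun f => sder (sder f))).
by split; apply: sfun_H2; [left|right].
Qed.

Section Bloch.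
Variables (e w sg : R) (u : R -> 'cV[R]_2) (u1 u2 : sfun R).
Hypothesis u1E : forall x, u1 x = (u x 0 0)%:C.
Hypothesis u2E : forall x, u2 x = (u x 1 0)%:C.
Hypothesis k0 : wavenumber e w != 0.

(** The profile equation at wave number [k] has leading coefficients [4 * k ^+ 2]
    and [16 * k ^+ 2], that is, [1 + detune] and [4 * (1 + detune)]. *)
Definition detune : R := 4 * wavenumber e w ^+ 2 - 1.
Local Notation kp := detune.
Local Notation m := (1 + kp)%:C.

Let m_neq0 : m != 0 :> C.
Proof.
rewrite (inj_eq (@complexI R) _ 0) /detune addrC subrK.
by rewrite mulf_neq0 ?pnatr_eq0 // expf_neq0.
Qed.

Let p x : C := (e ^+ 2 + 4)%:C * u1 x + 4 * u2 x + 2 * u1 x * u2 x.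
Let q x : C := 4 * u1 x + u1 x ^+ 2.

Lemma bloch_components (V V1 V2 : @C2fun R) x :
  let rhs := (wavenumber e w ^+ 2)%:C *:
               (map_mx (real_complex R) Dmx *m
                  (V2 x + (2 * (sg *i)) *: V1 x + (sg *i) ^+ 2 *: V x))
             + map_mx (real_complex R) (dreaction e (u x)) *m V x in
  let d j := V2 x j 0 + 2 * ('i * sg%:C) * V1 x j 0 - (sg ^+ 2)%:C * V x j 0 in
  rhs 0 0 = m * d 0 + (e ^+ 2 + 3)%:C * V x 0 0 + 4 * V x 1 0
     + (p x * V x 0 0 + q x * V x 1 0) /\
  rhs 1 0 = 4 * m * d 1 - (e ^+ 2 + 4)%:C * V x 0 0 - 4 * V x 1 0
     - (p x * V x 0 0 + q x * V x 1 0).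
Proof.
have isg : sg *i = 'i * sg%:C.
  by rewrite -complexiE; apply: complexE_eq => /=; ring.
have isg2 : (sg *i) ^+ 2 = - (sg ^+ 2)%:C.
  by rewrite isg exprMn sqrCi mulN1r -rmorphXn.
have mE : m = 4 * (wavenumber e w ^+ 2)%:C.
  by rewrite /detune addrC subrK ofrealM ofrealn.
have four : lift 0 0 = 1 :> 'I_2 by apply: val_inj.
rewrite mE /= isg2 isg /p /q u1E u2E.
rewrite !mxE !big_ord_recl !big_ord0 /= ?mxE /= ?four ?mxE /=.
move: (V2 x 0 0) (V2 x 1 0) (V1 x 0 0) (V1 x 1 0) (V x 0 0) (V x 1 0) (u x 0 0) (u x 1 0).
move: (wavenumber e w ^+ 2) ('i * sg%:C) (sg ^+ 2) (e ^+ 2) => K2 S S2 E2.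
move=> a1 a2 b1 b2 c1 c2 y1 y2.
rewrite !(ofrealE, rmorphXn, rmorph0) /= ?ofrealE; split; ring.
Qed.

Lemma sfun_nat n x : (n%:R : sfun R) x = n%:R.
Proof. by rewrite -scst_nat. Qed.

Lemma bloch_eval (v1 v2 : sfun R) x :
  let d (v : sfun R) := sder (sder v) x + 2 * ('i * sg%:C) * sder v x - (sg ^+ 2)%:C * v x in
  (bloch1 (P := P) e kp sg u1 u2 v1 v2) x = m * d v1 + (e ^+ 2 + 3)%:C * v1 x + 4 * v2 x
     + (p x * v1 x + q x * v2 x) /\
  (bloch2 (P := P) e kp sg u1 u2 v1 v2) x = 4 * m * d v2 - (e ^+ 2 + 4)%:C * v1 x - 4 * v2 x
     - (p x * v1 x + q x * v2 x).
Proof.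
pose pv := ((e ^+ 2 + 4)%:C * u1 x + 4 * u2 x + 2 * u1 x * u2 x) * v1 x
  + (4 * u1 x + u1 x ^+ 2) * v2 x.
pose fl (v : sfun R) := m * (2 * ('i * sg%:C * sder v x) - (sg ^+ 2)%:C * v x).
move=> d; split.
  transitivity (m * sder (sder v1) x + (e ^+ 2 + 3)%:C * v1 x + 4 * v2 x + pv + fl v1).
    by [].
  by rewrite /d /fl /pv /p /q; ring.
transitivity (4 * m * sder (sder v2) x - (e ^+ 2 + 4)%:C * v1 x - 4 * v2 x - pv
  + 4 * fl v2); first by [].
by rewrite /d /fl /pv /p /q; ring.
Qed.

Let four_inv : (4 : C) != 0. Proof. by rewrite pnatr_eq0. Qed.

(** The equation is solved for the second derivative, with smooth coefficients, and
    [ode_smooth] applies. *)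
Lemma bloch_smooth (z : C) (W1 W2 : sfun R) (V : @C2fun R) :
  bloch e w sg u V (fun x => z *: V x + sfunC2 W1 W2 x) ->
  exists v1 v2 : sfun R, [/\ forall x, V x = sfunC2 v1 v2 x,
    bloch1 (P := P) e kp sg u1 u2 v1 v2 = @scst R z * v1 + W1 &
    bloch2 (P := P) e kp sg u1 u2 v1 v2 = @scst R z * v2 + W2].
Proof.
move=> [V1 [V2 [H2 ae]]].
pose ps : sfun R := scst (e ^+ 2 + 4)%:C * u1 + 4 * u2 + 2 * u1 * u2.
pose qs : sfun R := 4 * u1 + u1 ^+ 2.
have pE x : ps x = p x by rewrite /ps /p !(sfun_nat, sfunD, sfunM).
have qE x : qs x = q x by rewrite /qs /q !(sfun_nat, expr2, sfunD, sfunM).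
pose A (j i : 'I_2) : sfun R :=
  if j == 0 then
    if i == 0 then scst m^-1 * (scst z - scst (e ^+ 2 + 3)%:C - ps) + scst (sg ^+ 2)%:C
    else - (scst m^-1 * (4 + qs))
  else
    if i == 0 then scst (4 * m)^-1 * (scst (e ^+ 2 + 4)%:C + ps)
    else scst (4 * m)^-1 * (scst z + 4 + qs) + scst (sg ^+ 2)%:C.
pose B (j : 'I_2) : sfun R := if j == 0 then scst m^-1 * W1 else scst (4 * m)^-1 * W2.
pose c : C := - (2 * ('i * sg%:C)).
pose G (j : 'I_2) : R -> C := (A j 0 : R -> C) \* comp V 0 \+ ((A j 1 : R -> C) \* comp V 1
   \+ ((fun=> c) \* comp V1 j \+ (B j : R -> C))).
have AE y : [/\ A 0 0 y = m^-1 * (z - (e ^+ 2 + 3)%:C - p y) + (sg ^+ 2)%:C,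
    A 0 1 y = - (m^-1 * (4 + q y)),
    A 1 0 y = (4 * m)^-1 * ((e ^+ 2 + 4)%:C + p y) &
    A 1 1 y = (4 * m)^-1 * (z + 4 + q y) + (sg ^+ 2)%:C].
  by rewrite -pE -qE; split.
have BE y : B 0 y = m^-1 * W1 y /\ B 1 y = (4 * m)^-1 * W2 y by [].
have GE0 y : G 0 y = A 0 0 y * V y 0 0 + (A 0 1 y * V y 1 0 + (c * V1 y 0 0 + B 0 y)) by [].
have GE1 y : G 1 y = A 1 0 y * V y 0 0 + (A 1 1 y * V y 1 0 + (c * V1 y 1 0 + B 1 y)) by [].
have [|||v [v0 v1' v2']] := @ode_smooth V V1 V2 G H2.
- move=> j x; rewrite /G /= !sfun_periodic.
  have [p1 p2] := comp_periodic H2 j; have [p3 _] := comp_periodic H2 0.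
  by have [p4 _] := comp_periodic H2 1; rewrite p2 p3 p4.
- move=> n hV hV1 j; apply: CkD; first by apply: CkM => //; exact: sfun_Ck.
  apply: CkD; first by apply: CkM => //; exact: sfun_Ck.
  by apply: CkD; [apply: CkM => //; exact: Ck_cst|exact: sfun_Ck].
- case: ae => N [mN N0 sN]; exists N; split=> // y ny; apply: sN => h; apply: ny => Iy j.
  have := h Iy; have [c1 c2] := bloch_components V V1 V2 y => E.
  have := congr1 (fun M : 'cV[C]_2 => M 0 0) E; have := congr1 (fun M : 'cV[C]_2 => M 1 0) E.
  rewrite c1 c2 !mxE /= => {c1 c2 E} E1 E0; have [a00 a01 a10 a11] := AE y.
  have [b0 b1] := BE y.
  have [->|j1] : j = 0 \/ j = 1.
  + by case: j => [[|[|?]] ?] //; [left|right]; apply: val_inj.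
  + rewrite GE0 a00 a01 b0 /c.
    have -> : W1 y = m * (V2 y 0 0 + 2 * ('i * sg%:C) * V1 y 0 0 - (sg ^+ 2)%:C * V y 0 0)
       + (e ^+ 2 + 3)%:C * V y 0 0 + 4 * V y 1 0 + (p y * V y 0 0 + q y * V y 1 0)
       - z * V y 0 0 by rewrite -E0; ring.
    by move: m_neq0; move: m => m' m0; field.
  rewrite j1 GE1 a10 a11 b1 /c.
  have -> : W2 y = 4 * m * (V2 y 1 0 + 2 * ('i * sg%:C) * V1 y 1 0 - (sg ^+ 2)%:C * V y 1 0)
       - (e ^+ 2 + 4)%:C * V y 0 0 - 4 * V y 1 0 - (p y * V y 0 0 + q y * V y 1 0)
       - z * V y 1 0 by rewrite -E1; ring.
  by move: m_neq0; move: m => m' m0; field.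
exists (v 0), (v 1).
have V0 x : V x 0 0 = v 0 x by rewrite v0.
have Vv1 x : V x 1 0 = v 1 x by rewrite v0.
split.
- move=> x; apply/matrixP => i j; rewrite mxE (ord1 j) -!v0.
  by case: i => [[|[|?]] ?] //=; congr (v _ x); apply: val_inj.
- apply: sfun_inj => x; have [-> _] := bloch_eval (v 0) (v 1) x.
  have [a00 a01 _ _] := AE x; have [b0 _] := BE x.
  rewrite v2' GE0 a00 a01 b0 /c V0 Vv1 -(v1' 0) sfunD sfunM.
  have -> : scst z x = z by [].
  by move: m_neq0; move: m => m' m0; field.
apply: sfun_inj => x; have [_ ->] := bloch_eval (v 0) (v 1) x.
have [_ _ a10 a11] := AE x; have [_ b1] := BE x.
rewrite v2' GE1 a10 a11 b1 /c V0 Vv1 -(v1' 1) sfunD sfunM.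
  have -> : scst z x = z by [].
by move: m_neq0; move: m => m' m0; field.
Qed.

Lemma bloch_of_smooth (z : C) (v1 v2 : sfun R) :
  bloch1 (P := P) e kp sg u1 u2 v1 v2 = @scst R z * v1 ->
  bloch2 (P := P) e kp sg u1 u2 v1 v2 = @scst R z * v2 ->
  bloch e w sg u (sfunC2 v1 v2) (fun x => z *: sfunC2 v1 v2 x).
Proof.
move=> b1 b2; exists (sfunC2 (sder v1) (sder v2)).
exists (sfunC2 (sder (sder v1)) (sder (sder v2))); split; first exact: sfunC2_H2.
apply: aeW => x _; apply/matrixP => i j; rewrite (ord1 j) mxE.
have [c1 c2] := bloch_components (sfunC2 v1 v2) (sfunC2 (sder v1) (sder v2))
  (sfunC2 (sder (sder v1)) (sder (sder v2))) x.
have [d1 d2] := bloch_eval v1 v2 x.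
have [->|->] : i = 0 \/ i = 1.
- by case: i => [[|[|?]] ?] //; [left|right]; apply: val_inj.
- by rewrite c1 !mxE /= -d1 b1.
by rewrite c2 !mxE /= -d2 b2.
Qed.

End Bloch.
End Frontend.

(** * From the profile family to smooth profiles *)

Section ProfileWave.
Context {R : realType}.
Local Notation C := R[i].
Local Notation mu := (@lebesgue_measure R).
Local Notation tpi := (pi *+ 2 : R).
Local Notation I := (`[0, tpi]%classic : set R).
Local Notation P := (sfun_calculus R).

Lemma tpi_ge1 : 1 <= tpi.
Proof. by have := pi_ge2 R; rewrite mulr2n => h; lra. Qed.

(** The one-dimensional Sobolev inequality: [g ^+ 2] varies by at most the
    integral of [g ^+ 2 + g1 ^+ 2], and does not exceed its mean everywhere. *)
Lemma H2_sup_bound (V : @C2fun R) (c : R) : H2norm_le V c ->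
  forall j (x : R), `|ReC V j x| <= 2 * c.
Proof.
move=> [V1 [V2 [H2 nc]]] j.
pose h (W : @C2fun R) (x : R) : R := \sum_i (ReC W i x ^+ 2 + ImC W i x ^+ 2).
have sq (f : R -> R) : continuous f -> continuous (fun x => f x ^+ 2).
  by move=> cf x; apply: (@continuous_comp _ _ _ f (fun y => y ^+ 2)); [exact: cf|exact: exprn_continuous].
have ch (W : @C2fun R) : (forall i, continuous (ReC W i) /\ continuous (ImC W i)) ->
    continuous (h W).
  move=> cW; have -> : h W = (fun x => (ReC W 0 x ^+ 2 + ImC W 0 x ^+ 2)
      + (ReC W 1 x ^+ 2 + ImC W 1 x ^+ 2)).
    apply: funext => x; rewrite /h !big_ord_recl big_ord0 addr0.
    by have -> : lift ord0 ord0 = 1 :> 'I_2 by apply: val_inj.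
  by move=> x; apply: cvgD; apply: cvgD; apply: sq; have [] := cW 0; have [] := cW 1.
have cV : continuous (h V).
  by apply: ch => i; have [[_ dr _ _] [_ di _ _]] := H2 i; split;
    [exact: is_derive_continuous dr|exact: is_derive_continuous di].
have cV1 : continuous (h V1).
  by apply: ch => i; have [hr hi] := H2 i; split; [exact: H2_derivs_continuous hr|
    exact: H2_derivs_continuous hi].
have hge (W : @C2fun R) x : ReC W j x ^+ 2 <= h W x.
  rewrite /h (bigD1 j) //= -addrA lerDl addr_ge0 ?sqr_ge0 //.
  by apply: sumr_ge0 => i _; rewrite addr_ge0 ?sqr_ge0.
have c0 : 0 <= c by exact: le_trans (sqrtr_ge0 _) nc.
pose J := L2norm V ^+ 2 + L2norm V1 ^+ 2.
have Jc : J <= c ^+ 2.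
  have : J + L2norm V2 ^+ 2 <= c ^+ 2.
    rewrite -(@sqr_sqrtr _ (J + _)) ?lerXn2r ?nnegrE ?sqrtr_ge0 //.
    by rewrite !addr_ge0 ?sqr_ge0.
  by apply: le_trans; rewrite lerDl sqr_ge0.
have intL (W : @C2fun R) : \int[mu]_(x in I) h W x <= L2norm W ^+ 2.
  rewrite /L2norm -/(h W); set y := (\int[mu]_(x in I) _).
  have [y0|y0] := leP 0 y; first by rewrite sqr_sqrtr.
  by apply: le_trans (ltW y0) (sqr_ge0 _).
have [H0 dH0] := primitive0_ex cV; have [H1 dH1] := primitive0_ex cV1.
have p0 := @tpi_gt0 R.
have I0 := integral_FTC2 (ltW p0) cV dH0; have I1 := integral_FTC2 (ltW p0) cV1 dH1.
have [[pg dg _ _] _] := H2 j; set g := ReC V j in pg dg *; set g1 := ReC V1 j in dg.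
have dg2 (x : R) : is_derive x 1 (g * g) (g x * g1 x + g x * g1 x).
  exact: is_deriveM (dg x) (dg x).
have mono (sgn : R) : sgn ^+ 2 = 1 -> forall a b : R, 0 <= a -> b <= tpi -> a <= b ->
    sgn * (g b ^+ 2 - g a ^+ 2) <= J.
  move=> s1 a b a0 b1 ab.
  pose F := (H0 + H1) - sgn *: (g * g).
  have dF x : 0 <= x <= tpi -> is_derive x 1 F ((h V x + h V1 x) - sgn * (g x * g1 x + g x * g1 x)).
    by move=> hx; exact: (is_deriveB (is_deriveD (dH0 x hx) (dH1 x hx)) (is_deriveZ sgn (dg2 x))).
  have F'0 x : 0 <= (h V x + h V1 x) - sgn * (g x * g1 x + g x * g1 x).
    rewrite subr_ge0; apply: le_trans (lerD (hge V x) (hge V1 x)).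
    rewrite -subr_ge0 -/g -/g1.
    have -> : g x ^+ 2 + g1 x ^+ 2 - sgn * (g x * g1 x + g x * g1 x) =
      (g x - sgn * g1 x) ^+ 2 + (1 - sgn ^+ 2) * g1 x ^+ 2 by ring.
    by rewrite s1 subrr mul0r addr0 sqr_ge0.
  have incr (y z : R) : 0 <= y -> z <= tpi -> y <= z -> F y <= F z.
    move=> y0 z1 yz; have dF' t : y <= t <= z -> is_derive t 1 F
        ((h V t + h V1 t) - sgn * (g t * g1 t + g t * g1 t)).
      by move=> /andP[yt tz]; apply: dF; rewrite (le_trans y0 yt) (le_trans tz z1).
    have [t _ e] := is_derive_MVT yz dF'.
    by rewrite -subr_ge0 e mulr_ge0 ?F'0 // subr_ge0.
  have FE y : F y = H0 y + H1 y - sgn * g y ^+ 2 by rewrite expr2.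
  pose E (y : R) : R := H0 y + H1 y.
  have Einc (y z : R) : 0 <= y -> z <= tpi -> y <= z -> E y <= E z.
    move=> y0 z1 yz; have dE t : y <= t <= z -> is_derive t 1 (H0 + H1) (h V t + h V1 t).
      move=> /andP[yt tz]; have ht : 0 <= t <= tpi.
        by rewrite (le_trans y0 yt) (le_trans tz z1).
      exact: (is_deriveD (dH0 t ht) (dH1 t ht)).
    have [t _ e] := is_derive_MVT yz dE.
    rewrite -subr_ge0 [_ - _]e mulr_ge0 ?subr_ge0 //.
    by rewrite addr_ge0 //; apply: le_trans (sqr_ge0 _) (hge _ t).
  have := incr a b a0 b1 ab; rewrite !FE -/(E a) -/(E b) => h1.
  have h2 := Einc 0 a (lexx _) (le_trans ab b1) a0.
  have h3 := Einc b tpi (le_trans a0 ab) (lexx _) b1.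
  have h4 : E tpi - E 0 <= J.
    apply: le_trans (lerD (intL V) (intL V1)); rewrite I0 I1 /E.
    by rewrite le_eqVlt; apply/orP; left; apply/eqP; ring.
  rewrite mulrBr; move: (E a) (E b) (E 0) (E tpi) (sgn * g a ^+ 2) (sgn * g b ^+ 2) h1 h2 h3 h4.
  by move: (J) => J' ? ? ? ? ? ? *; lra.
have [t /andP[t0 t1] mt] := mean_MVT cV.
have gt : g t ^+ 2 <= J.
  apply: le_trans (hge V t) _; rewrite -mt /mean ler_pdivrMr //.
  have J0 : 0 <= J by rewrite addr_ge0 ?sqr_ge0.
  apply: le_trans (intL V) _; apply: (@le_trans _ _ J); first by rewrite lerDl sqr_ge0.
  by rewrite ler_peMr // tpi_ge1.
move=> x; have [y /andP[y0 y1] ey] := periodic_reduce R x; rewrite (ey g pg).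
have : g y ^+ 2 - g t ^+ 2 <= J.
  have [yt|ty] := leP y t.
    have := mono (-1) _ y t y0 t1 yt; rewrite sqrrN expr1n => /(_ erefl).
    by rewrite mulN1r opprB.
  by have := mono 1 _ t y t0 y1 (ltW ty); rewrite expr1n mul1r => /(_ erefl).
move=> gy; rewrite -(@ler_pXn2r _ 2) ?nnegrE ?mulr_ge0 // real_normK ?num_real //.
have cc : 0 <= c ^+ 2 := sqr_ge0 _.
rewrite exprMn; move: (g y ^+ 2) (g t ^+ 2) (c ^+ 2) gy gt Jc cc => p q r.
by move: (J) => J' *; lra.
Qed.

Lemma detune_near (e w : R) : 0 <= e <= 1 -> - 4^-1 < w < 4^-1 ->
  `|detune e w - 4 * e * w| <= e ^+ 2.
Proof.
move=> /andP[e0 e1] /andP[w0 w1].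
have w1' : `|w| <= 4^-1 by rewrite ler_norml !ltW.
pose r := Num.sqrt (4 * e ^+ 2 * w ^+ 2 + 1).
have e2 (n : nat) : 0 <= n%:R * e ^+ 2 by apply: mulr_ge0 => //; exact: sqr_ge0.
have q0 : 0 <= 4 * e ^+ 2 * w ^+ 2 by apply: mulr_ge0 => //; exact: sqr_ge0.
have r2 : r ^+ 2 = 4 * e ^+ 2 * w ^+ 2 + 1 by rewrite sqr_sqrtr // addr_ge0.
have r0 : 0 <= r := sqrtr_ge0 _.
have -> : detune e w - 4 * e * w = 8 * e ^+ 2 * w ^+ 2 + 4 * e * w * (r - 1).
  transitivity (4 * e ^+ 2 * w ^+ 2 + 4 * e * w * r + r ^+ 2 - 1 - 4 * e * w).
    by rewrite /detune /wavenumber -/r; field.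
  by rewrite r2; ring.
have r1 : 1 <= r by rewrite -(@ler_pXn2r _ 2) ?nnegrE // r2 expr1n lerDr.
have rb : r - 1 <= 4 * e ^+ 2 * w ^+ 2.
  have : r <= r ^+ 2 by rewrite expr2 ler_peMl.
  by rewrite r2 -lerBlDr.
have w2 : w ^+ 2 <= 16^-1.
  rewrite -real_normK ?num_real // (_ : 16^-1 = 4^-1 ^+ 2 :> R); last by field.
  by rewrite lerXn2r ?nnegrE // invr_ge0.
apply: le_trans (ler_normD _ _) _.
have b1 : `|8 * e ^+ 2 * w ^+ 2| <= e ^+ 2 / 2.
  rewrite ger0_norm; last by apply: mulr_ge0 => //; exact: sqr_ge0.
  rewrite mulrAC.
  have -> : e ^+ 2 / 2 = 8 * 16^-1 * e ^+ 2 :> R by field.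
  by apply: ler_wpM2r; [exact: sqr_ge0|rewrite ler_wpM2l].
have b2 : `|4 * e * w * (r - 1)| <= e ^+ 2 / 2.
  rewrite normrM [`|r - 1|]ger0_norm ?subr_ge0 //.
  have -> : e ^+ 2 / 2 = 1 * (e ^+ 2 / 2) :> R by rewrite mul1r.
  apply: ler_pM; rewrite ?subr_ge0 //.
    rewrite normrM ger0_norm ?mulr_ge0 //.
    apply: (@le_trans _ _ (4 * 4^-1)); last by rewrite divff.
    by apply: ler_pM => //; [rewrite mulr_ge0|rewrite ler_piMr].
  apply: le_trans rb _.
  have -> : e ^+ 2 / 2 = 4 * e ^+ 2 * 8^-1 :> R by field.
  apply: ler_wpM2l => //; apply: le_trans w2 _.
  by rewrite lef_pV2 ?posrE // ler_nat.
by move: (e ^+ 2) b1 b2 => y b1 b2; lra.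
Qed.


(** The equation expresses the second derivative as a polynomial in the solution, so
    that [ode_smooth] applies. *)
Lemma profile_smooth (e w : R) (u : R -> 'cV[R]_2) :
  wavenumber e w != 0 -> profile_solution e w u ->
  exists U1 U2 : sfun R, [/\ forall x, U1 x = (u x 0 0)%:C,
    forall x, U2 x = (u x 1 0)%:C & is_profile (P := P) e (detune e w) U1 U2].
Proof.
move=> k0 [u1 [u2 [H2 ae]]].
pose m : R := 4 * wavenumber e w ^+ 2.
have m0 : m != 0 by rewrite mulf_neq0 ?pnatr_eq0 // expf_neq0.
have mE : m = 1 + detune e w by rewrite /detune addrC subrK.
pose f (j : 'I_2) := comp (toC2 u) j.
pose N : R -> C := ((fun=> (e ^+ 2 / 2 + 2)%:C) \* (f 0 \* f 0)) \+
  (((fun=> 4) \* (f 0 \* f 1)) \+ ((f 0 \* f 0) \* f 1)).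
pose G (j : 'I_2) : R -> C := if j == 0 then
    (fun=> - m%:C^-1) \* (((fun=> (e ^+ 2 + 3)%:C) \* f 0) \+ (((fun=> 4) \* f 1) \+ N))
  else (fun=> (4 * m%:C)^-1) \*
    (((fun=> (e ^+ 2 + 4)%:C) \* f 0) \+ (((fun=> 4) \* f 1) \+ N)).
have four : lift ord0 ord0 = 1 :> 'I_2 by apply: val_inj.
have j01 (j : 'I_2) : j = 0 \/ j = 1.
  by case: j => [[|[|?]] ?] //; [left|right]; apply: val_inj.
have G0 x : G 0 x = - m%:C^-1 * ((e ^+ 2 + 3)%:C * f 0 x + (4 * f 1 x + N x)) by [].
have G1 x : G 1 x = (4 * m%:C)^-1 * ((e ^+ 2 + 4)%:C * f 0 x + (4 * f 1 x + N x)) by [].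
have NE x : N x = (e ^+ 2 / 2 + 2)%:C * (f 0 x * f 0 x) + (4 * (f 0 x * f 1 x)
  + f 0 x * f 0 x * f 1 x) by [].
have [|||v [v0 v1 v2]] := @ode_smooth R (toC2 u) (toC2 u1) (toC2 u2) G H2.
- move=> j x; have pf i : f i (x + tpi) = f i x by have [] := comp_periodic H2 i.
  by have [->|->] := j01 j; rewrite ?G0 ?G1 !NE !pf.
- move=> n hf _ j; have CN : Ck n N.
    by apply: CkD; [|apply: CkD]; apply: CkM; try exact: Ck_cst; try apply: CkM; exact: hf.
  have Cf (c : C) : Ck n (((fun=> c) \* f 0) \+ (((fun=> 4) \* f 1) \+ N)).
    by apply: CkD; [|apply: CkD => //]; apply: CkM; try exact: Ck_cst; exact: hf.
  by rewrite /G; case: ifP => _; apply: CkM; try exact: Ck_cst; exact: Cf.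
- case: ae => A [mA A0 sA]; exists A; split=> // y ny; apply: sA => h; apply: ny => Iy j.
  have E := h Iy.
  have := congr1 (fun M : 'cV[R]_2 => M 0 0) E; have := congr1 (fun M : 'cV[R]_2 => M 1 0) E.
  rewrite /Dmx /mx2 !mxE !big_ord_recl !big_ord0 !mxE /= ?four ?mxE /= => E1 E0.
  have f0 : f 0 y = (u y 0 0)%:C by rewrite /f /comp mxE.
  have f1 : f 1 y = (u y 1 0)%:C by rewrite /f /comp mxE.
  have [->|->] := j01 j; rewrite ?G0 ?G1 NE f0 f1.
    have -> : u2 y 0 0 = - m^-1 * ((e ^+ 2 + 3) * u y 0 0 + (4 * u y 1 0
      + ((e ^+ 2 / 2 + 2) * (u y 0 0 * u y 0 0) + (4 * (u y 0 0 * u y 1 0)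
        + u y 0 0 * u y 0 0 * u y 1 0)))).
      apply: (mulfI m0); rewrite mulNr mulrN mulVKf //.
      by apply/eqP; rewrite -addr_eq0 -[X in _ == X]E0 /m; apply/eqP; ring.
    move: (u y 0 0) (u y 1 0) (m) => a b c; move: (e ^+ 2) => ee.
    by rewrite !ofrealE; ring.
  have -> : u2 y 1 0 = (4 * m)^-1 * ((e ^+ 2 + 4) * u y 0 0 + (4 * u y 1 0
      + ((e ^+ 2 / 2 + 2) * (u y 0 0 * u y 0 0) + (4 * (u y 0 0 * u y 1 0)
        + u y 0 0 * u y 0 0 * u y 1 0)))).
    have m40 : 4 * m != 0 by rewrite mulf_neq0 ?pnatr_eq0.
    apply: (mulfI m40); rewrite mulVKf //.
    by apply/eqP; rewrite -subr_eq0 -[X in _ == X]E1 /m; apply/eqP; ring.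
  move: (u y 0 0) (u y 1 0) (m) => a b c; move: (e ^+ 2) => ee.
  by rewrite !ofrealE; ring.
have fv j x : f j x = v j x by rewrite v0.
exists (v 0), (v 1); split=> [x|x|]; rewrite ?v0 ?mxE //.
have mC : m%:C != 0 :> C by rewrite (inj_eq (@complexI R) _ 0).
pose nlx x := (e ^+ 2 / 2 + 2)%:C * v 0 x ^+ 2 + 4 * v 0 x * v 1 x + v 0 x ^+ 2 * v 1 x.
split; apply: sfun_inj => x.
  transitivity ((1 + detune e w)%:C * sder (sder (v 0)) x + (e ^+ 2 + 3)%:C * v 0 x
    + 4 * v 1 x + nlx x); first by [].
  rewrite v2 G0 NE !fv -mE /nlx; move: mC; move: (m%:C) => mc mc0.
  have -> : (0 : sfun R) x = 0 by []. 
  by field.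
transitivity (4 * (1 + detune e w)%:C * sder (sder (v 1)) x - (e ^+ 2 + 4)%:C * v 0 x
    - 4 * v 1 x - nlx x); first by [].
rewrite v2 G1 NE !fv -mE /nlx; move: mC; move: (m%:C) => mc mc0.
have -> : (0 : sfun R) x = 0 by [].
by field.
Qed.

Lemma wavenumber_gt0 (e w : R) : 0 <= e <= 1 -> - 4^-1 < w < 4^-1 -> 0 < wavenumber e w.
Proof.
move=> /andP[e0 e1] /andP[w0 w1]; rewrite divr_gt0 //.
have : 1 <= Num.sqrt (4 * e ^+ 2 * w ^+ 2 + 1).
  rewrite -[leLHS]sqrtr1 ler_wsqrtr // lerDr; apply: mulr_ge0; last exact: sqr_ge0.
  by apply: mulr_ge0 => //; exact: sqr_ge0.
have : - 2^-1 <= 2 * e * w.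
  have [w0'|w0'] := leP 0 w; first by apply: (@le_trans _ _ 0); rewrite ?mulr_ge0 ?oppr_le0.
  have -> : - 2^-1 = 2 * 1 * (- 4^-1) :> R by field.
  apply: (@le_trans _ _ (2 * 1 * w)); first by rewrite ler_wpM2l ?mulr_ge0 // ltW.
  by apply: ler_wnM2r; [exact: ltW|apply: ler_wpM2l].
by move: (2 * e * w) (Num.sqrt _) => a b; lra.
Qed.

(** The bound on the distance to the leading part in the H^2 norm becomes one in the
    supremum norm by [H2_sup_bound].  The first Fourier coefficient is that of the
    leading part, of order [e], up to an error of order [e ^+ 2]. *)
Lemma profile_wave (e0 : R) (ut : R -> R -> R -> 'cV[R]_2) (w : R) :
  profile_family e0 ut -> - 4^-1 < w < 4^-1 ->
  exists K d : R, [/\ 0 <= K, 0 < d & forall e, 0 < e < e0 -> e < d ->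
    exists W : wave (P := P) w K, [/\ wave_e W = e, wave_k W = detune e w,
      (forall x, (wave_1 W : sfun R) x = (ut e w x 0 0)%:C) &
      (forall x, (wave_2 W : sfun R) x = (ut e w x 1 0)%:C)]].
Proof.
move=> [_ solves evenp _ _ [L hL]] w_lt; have /andP[w0 w1] := w_lt.
have w1' : `|w| <= 4^-1 by rewrite ler_norml !ltW.
have w1s : `|w| < 4^-1 by rewrite ltr_norml w0.
pose A := Num.sqrt (2 / 3 * gl_amp2 w).
have A0 : 0 < A by rewrite sqrtr_gt0 !mulr_gt0 // gl_amp2_gt0.
pose K := 2 * `|L| + 1; have K0 : 0 <= K by rewrite addr_ge0 ?mulr_ge0.
exists K, (Num.min 1 (A / (2 * K + 1))); split=> //.
  by rewrite lt_min ltr01 divr_gt0 // ltr_wpDl ?mulr_ge0.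
move=> e /andP[ep ee0]; rewrite lt_min => /andP[e1 eA].
have e01 : 0 <= e <= 1 by rewrite !ltW.
have e2 : 0 <= e ^+ 2 := sqr_ge0 e.
have kn0 : wavenumber e w != 0 by rewrite gt_eqF // wavenumber_gt0.
have eh : 0 <= e < e0 by rewrite ltW.
have [U1 [U2 [U1E U2E eqn]]] := profile_smooth kn0 (solves e w eh w1').
have [uev _] := evenp e w (introT andP (conj ep ee0)) w1s.
have near := H2_sup_bound (hL e w eh w1').
have bound (f : sfun R) j : (forall x, f x = (ut e w x j 0 - leading_profile e w x j 0)%:C) ->
    snorm f <= K * e ^+ 2.
  move=> fE; apply: snorm_le => x; rewrite fE cabsr.
  have := near j x; rewrite /ReC /toC2 !mxE /= => h; apply: le_trans h _.
  rewrite mulrA; apply: ler_wpM2r => //; rewrite /K.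
  by apply: (@le_trans _ _ (2 * `|L|)); rewrite ?lerDl // ler_wpM2l // ler_norm.
have Aeq : e * A = e * Num.sqrt (2 / 3 * (1 - 16 * w ^+ 2)) by [].
have n1 : snorm (U1 - scst (2 * (e * A))%:C * @scos R) <= K * e ^+ 2.
  apply: (bound _ 0) => x; rewrite sfunD sfunN sfunM U1E !mxE /= -/(e * A).
  by rewrite -ofrealM -ofrealN -ofrealD; congr (_%:C); rewrite Aeq /=; ring.
have n2 : snorm (U2 + scst (e * A)%:C * @scos R) <= K * e ^+ 2.
  apply: (bound _ 1) => x; rewrite sfunD sfunM U2E !mxE /=.
  by rewrite -ofrealM -ofrealD; congr (_%:C); rewrite Aeq /=; ring.
have kn : `|detune e w - 4 * e * w| <= K * e ^+ 2.
  apply: le_trans (detune_near e01 w_lt) _.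
  by rewrite ler_peMl // lerDr mulr_ge0.
have ev1 : @refl R P U1 = U1.
  by apply: sfun_inj => x; have -> : @refl R P U1 x = U1 (- x) by []; rewrite !U1E uev.
have ev2 : @refl R P U2 = U2.
  by apply: sfun_inj => x; have -> : @refl R P U2 x = U2 (- x) by []; rewrite !U2E uev.
have crit : coefc (P := P) U1 != 0.
  apply/eqP => c0.
  have := cabs_coefc (P := P) (U1 - scst (2 * (e * A))%:C * @scos R).
  rewrite coefcB c0 coefcZ.
  have -> : coefc (@scos R : pfun P) = 1 / 2 by rewrite /coefc -expr2 (@avg_cos2 R P).
  rewrite sub0r cabsN cabsM cabsr ger0_norm ?mulr_ge0 ?sqrtr_ge0 ?(ltW ep) //.
  have -> : cabs (1 / 2 : C) = 1 / 2.
    have -> : (1 / 2 : C) = (1 / 2 : R)%:C by rewrite !ofrealE.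
    by rewrite cabsr ger0_norm.
  move=> h; have : 2 * (e * A) * (1 / 2) <= 2 * (K * e ^+ 2).
    by apply: le_trans h _; rewrite ler_wpM2l.
  have -> : 2 * (e * A) * (1 / 2) = e * A by field.
  have -> : 2 * (K * e ^+ 2) = e * (2 * K * e) by ring.
  rewrite ler_pM2l // leNgt => /negP; apply.
  have K1 : 0 < 2 * K + 1 by rewrite ltr_wpDl ?mulr_ge0.
  move: eA; rewrite ltr_pdivlMr // mulrC => h2; apply: le_lt_trans h2.
  by apply: ler_wpM2r; [exact: ltW|rewrite lerDl].
have ep1 : 0 < e <= 1 by rewrite ep ltW.
by exists (@Wave R P w K e (detune e w) U1 U2 ep1 kn n1 n2 eqn ev1 ev2 crit).
Qed.

End ProfileWave.

(** * Generalized eigenvectors and the spectrum *)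

Section GeneralizedEigenvectors.
Context {R : realType}.
Local Notation C := R[i].
Variable A : @C2fun R -> @C2fun R -> Prop.
Implicit Types (V W : @C2fun R).

(** The last nonzero element of the chain that ends at [0]. *)
Lemma ker_pow_eigenvector (z : C) n V : in_ker_pow A z n V -> ~ (forall x, V x = 0) ->
  exists2 W : @C2fun R, ~ (forall x, W x = 0) & in_ker_pow A z 1 W.
Proof.
elim: n V => [V h /(_ h)[]|n IH V [W [hW AV]] nz].
have [W0|] := pselect (forall x, W x = 0); last exact: IH hW.
by exists V => //; exists W.
Qed.

(** A vector outside the line of [V1] can be pushed along its chain until the
    next step falls into that line. *)
Lemma ker_pow_chain (z : C) n V V1 : in_ker_pow A z n V ->
  (forall c : C, ~ (forall x, V x = c *: V1 x)) ->
  exists W (mu : C), (forall c : C, ~ (forall x, W x = c *: V1 x)) /\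
    A W (fun x => z *: W x + mu *: V1 x).
Proof.
elim: n V => [V h|n IH V [W [hW AV]]] nV.
  by case: (nV 0) => x; rewrite scale0r h.
have [[mu hmu]|no] := pselect (exists mu : C, forall x, W x = mu *: V1 x).
  exists V, mu; split=> //; move: AV; congr (A V _); apply: funext => x.
  by rewrite hmu.
by apply: IH hW _ => c hc; apply: no; exists c.
Qed.

Lemma alg_mult_nonzero (z : C) m : alg_mult A z m.+1 ->
  exists2 V : @C2fun R, ~ (forall x, V x = 0) & in_ker_pow A z 1 V.
Proof.
move=> [v [gv uv]]; have [n hn] := gv ord0; apply: ker_pow_eigenvector hn _ => v0.
have [|c [hc uc]] := uv (fun=> 0); first by exists 0%N.
have e1 := uc 0; have e2 := uc (delta_mx 0 ord0).
have : c = delta_mx 0 ord0.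
  apply: e2 => x; rewrite (bigD1 ord0) //= mxE !eqxx scale1r v0 add0r.
  by rewrite big1 // => i /negPf i0; rewrite mxE i0 scale0r.
have -> : c = 0.
  by apply: e1 => x; rewrite big1 // => i _; rewrite mxE scale0r.
by move=> /matrixP/(_ 0 ord0)/eqP; rewrite !mxE !eqxx eq_sym oner_eq0.
Qed.

Lemma alg_mult2_outside (z : C) V1 : alg_mult A z 2 ->
  exists2 V, gen_eigenvector A z V & forall c : C, ~ (forall x, V x = c *: V1 x).
Proof.
move=> [v [gv uv]].
have [[c0 h0]|no] := pselect (exists c : C, forall x, v 0 x = c *: V1 x); last first.
  by exists (v 0) => // c hc; apply: no; exists c.
have [[c1 h1]|no] := pselect (exists c : C, forall x, v 1 x = c *: V1 x); last first.
  by exists (v 1) => // c hc; apply: no; exists c.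
have [|c [hc uc]] := uv (fun=> 0); first by exists 0%N.
have four : lift ord0 ord0 = 1 :> 'I_2 by apply: val_inj.
have coord (a b : C) : (forall x, a *: v 0 x + b *: v 1 x = 0) -> a = 0 /\ b = 0.
  move=> ab; have e1 := uc 0; have e2 := uc (\row_j (if j == 0 then a else b)).
  have eq : c = \row_j (if j == 0 then a else b).
    by apply: e2 => x; rewrite !big_ord_recl big_ord0 addr0 four !mxE /= ab.
  have e : \row_j (if j == 0 then a else b) = 0 :> 'rV[C]_2.
    by rewrite -eq; apply: e1 => x; rewrite big1 // => i _; rewrite mxE scale0r.
  by have := congr1 (fun M : 'rV[C]_2 => (M 0 0, M 0 1)) e; rewrite !mxE /= => -[].
have [c10 c00] : c1 = 0 /\ - c0 = 0.
  by apply: coord => x; rewrite h0 h1 !scalerA mulNr mulrC scaleNr subrr.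
have [] := coord 1 0; last by move=> /eqP; rewrite oner_eq0.
by move=> x; rewrite scale1r scale0r addr0 h0 -[c0]opprK c00 oppr0 scale0r.
Qed.

End GeneralizedEigenvectors.

Section BlochSpectrum.
Context {R : realType}.
Local Notation C := R[i].
Local Notation mu := (@lebesgue_measure R).
Local Notation tpi := (pi *+ 2 : R).
Local Notation I := (`[0, tpi]%classic : set R).
Local Notation P := (sfun_calculus R).
Variables (e w sg : R) (u : R -> 'cV[R]_2) (u1 u2 : sfun R).
Hypothesis u1E : forall x, u1 x = (u x 0 0)%:C.
Hypothesis u2E : forall x, u2 x = (u x 1 0)%:C.
Hypothesis k0 : wavenumber e w != 0.
Local Notation B1 := (bloch1 (P := P) e (detune e w) sg u1 u2).
Local Notation B2 := (bloch2 (P := P) e (detune e w) sg u1 u2).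

Lemma sfunC2_eq0 (v1 v2 : sfun R) :
  (forall x, sfunC2 v1 v2 x = 0) <-> v1 = 0 /\ v2 = 0.
Proof.
split=> [h|[-> ->] x]; last by apply/matrixP => i j; rewrite !mxE; case: ifP.
by split; apply: sfun_inj => x; [have := congr1 (fun M : 'cV[C]_2 => M 0 0) (h x)
  | have := congr1 (fun M : 'cV[C]_2 => M 1 0) (h x)]; rewrite !mxE.
Qed.

Lemma bloch_eigenvector (z : C) V : ~ (forall x, V x = 0) ->
  in_ker_pow (bloch e w sg u) z 1 V ->
  exists v1 v2 : sfun R, [/\ forall x, V x = sfunC2 v1 v2 x,
    v1 = 0 -> v2 <> 0, B1 v1 v2 = @scst R z * v1 & B2 v1 v2 = @scst R z * v2].
Proof.
move=> nz [W [W0 BV]].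
have [|v1 [v2 [Vv b1 b2]]] := bloch_smooth u1E u2E k0 (sg := sg) (z := z) (W1 := 0) (W2 := 0) (V := V).
  move: BV; congr (bloch e w sg u V _); apply: funext => x; rewrite W0.
  by congr (_ + _); rewrite (sfunC2_eq0 0 0).2.
exists v1, v2; split=> //; rewrite ?b1 ?b2 ?addr0 //.
by move=> v10 v20; apply: nz => x; rewrite Vv; exact: (sfunC2_eq0 v1 v2).2.
Qed.

Lemma bloch_lin (b c : C) (v1 v2 w1 w2 : sfun R) :
  B1 (@scst R b * v1 + @scst R c * w1) (@scst R b * v2 + @scst R c * w2)
    = @scst R b * B1 v1 v2 + @scst R c * B1 w1 w2 /\
  B2 (@scst R b * v1 + @scst R c * w1) (@scst R b * v2 + @scst R c * w2)
    = @scst R b * B2 v1 v2 + @scst R c * B2 w1 w2.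
Proof.
have E (f g : sfun R) x : (scst b * f + scst c * g) x = b * f x + c * g x by [].
have eval := bloch_eval e w sg u1 u2.
split; apply: sfun_inj => x.
  have [h1 _] := eval (scst b * v1 + scst c * w1) (scst b * v2 + scst c * w2) x.
  apply: etrans h1 _; transitivity (b * B1 v1 v2 x + c * B1 w1 w2 x); last by [].
  have [-> _] := eval v1 v2 x; have [-> _] := eval w1 w2 x.
  by rewrite !(sderD, sderZ) !E; ring.
have [_ h2] := eval (scst b * v1 + scst c * w1) (scst b * v2 + scst c * w2) x.
apply: etrans h2 _; transitivity (b * B2 v1 v2 x + c * B2 w1 w2 x); last by [].
have [_ ->] := eval v1 v2 x; have [_ ->] := eval w1 w2 x.
by rewrite !(sderD, sderZ) !E; ring.
Qed.

Lemma scst_mul_eq0 (c : C) (f : sfun R) : scst c * f = 0 -> c <> 0 -> f = 0.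
Proof.
move=> h c0; have := congr1 (fun g => scst c^-1 * g) h.
by rewrite /= mulrA -rmorphM mulVf ?rmorph1 ?mul1r ?mulr0 //; exact/eqP.
Qed.

(** For distinct eigenvalues two eigenvectors; for a double one an eigenvector and
    a generalized eigenvector outside its line, which [ker_pow_chain] replaces by
    one that is mapped into that line. *)
Lemma spectral_pair_vectors (d : R) (l1 l2 : C) :
  spectral_pair (bloch e w sg u) d l1 l2 ->
  exists (v1 v2 w1 w2 : sfun R) (m : C), [/\
    B1 v1 v2 = @scst R l1 * v1 /\ B2 v1 v2 = @scst R l1 * v2,
    B1 w1 w2 = @scst R l2 * w1 + @scst R m * v1 /\
    B2 w1 w2 = @scst R l2 * w2 + @scst R m * v2 &
    forall b c : C, @scst R b * v1 + @scst R c * w1 = 0 ->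
      @scst R b * v2 + @scst R c * w2 = 0 -> b = 0 /\ c = 0].
Proof.
move=> [_ mult].
have m1 := mult l1 (mem_head _ _).
have m2 : alg_mult (bloch e w sg u) l2 (count_mem l2 [:: l1; l2]).
  by apply: mult; rewrite !inE eqxx orbT.
have [V Vnz kV] : exists2 V : @C2fun R, ~ (forall x, V x = 0) &
    in_ker_pow (bloch e w sg u) l1 1 V.
  by move: m1; rewrite /= eqxx add1n => /alg_mult_nonzero.
have [v1 [v2 [Vv vnz b1 b2]]] := bloch_eigenvector Vnz kV.
have nz b : scst b * v1 = 0 -> scst b * v2 = 0 -> b = 0.
  move=> h1 h2; apply: contrapT => bn.
  by apply: vnz; [exact: scst_mul_eq0 h1 bn|exact: scst_mul_eq0 h2 bn].
have [l12|l12] := eqVneq l1 l2; last first.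
  have [W Wnz kW] : exists2 V : @C2fun R, ~ (forall x, V x = 0) &
      in_ker_pow (bloch e w sg u) l2 1 V.
    by move: m2; rewrite /= (negPf l12) eqxx => /alg_mult_nonzero.
  have [w1 [w2 [Ww wnz c1 c2]]] := bloch_eigenvector Wnz kW.
  exists v1, v2, w1, w2, 0; rewrite !rmorph0 !mul0r !addr0; split=> // b c h1 h2.
  have b0 : b = 0.
    have [q1 q2] := bloch_lin b c v1 v2 w1 w2; rewrite h1 h2 b1 b2 c1 c2 in q1 q2.
    have z0 : B1 0 0 = 0 /\ B2 0 0 = 0.
      by have [] := bloch_lin 0 0 v1 v2 w1 w2; rewrite !rmorph0 !mul0r !addr0.
    rewrite z0.1 in q1; rewrite z0.2 in q2.
    have bl : (l1 - l2) * b = 0.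
      apply: nz.
        transitivity (scst b * (scst l1 * v1) + scst c * (scst l2 * w1)
          - scst l2 * (scst b * v1 + scst c * w1)).
          by rewrite rmorphM rmorphB /=; ring.
        by rewrite -q1 h1 mulr0 subr0.
      transitivity (scst b * (scst l1 * v2) + scst c * (scst l2 * w2)
          - scst l2 * (scst b * v2 + scst c * w2)).
        by rewrite rmorphM rmorphB /=; ring.
      by rewrite -q2 h2 mulr0 subr0.
    by move/eqP: bl; rewrite mulf_eq0 subr_eq0 (negPf l12) => /eqP.
  split=> //; apply: contrapT => cn; rewrite b0 !rmorph0 !mul0r !add0r in h1 h2.
  by apply: wnz; [exact: scst_mul_eq0 h1 cn|exact: scst_mul_eq0 h2 cn].
have m2' : alg_mult (bloch e w sg u) l2 2 by move: m2; rewrite /= l12 eqxx.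
have [U [n gU] out] := alg_mult2_outside V m2'.
have [W [m [outW BW]]] := ker_pow_chain gU out.
have [|w1 [w2 [Ww c1 c2]]] := bloch_smooth u1E u2E k0 (sg := sg) (z := l2)
  (W1 := scst m * v1) (W2 := scst m * v2) (V := W).
  move: BW; congr (bloch e w sg u W _); apply: funext => x; congr (_ + _).
  by rewrite Vv; apply/matrixP => i j; rewrite !mxE; case: ifP.
exists v1, v2, w1, w2, m; split=> // b c h1 h2.
have c0 : c = 0.
  apply: contrapT => cn; apply: (outW (- (b / c))) => x; rewrite Ww Vv.
  have p1 := congr1 (fun f : sfun R => f x) h1; have p2 := congr1 (fun f : sfun R => f x) h2.
  have q (f g : sfun R) : b * f x + c * g x = 0 -> g x = - (b / c) * f x.
    move=> h; have cn' : c != 0 by exact/eqP.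
    apply: (mulfI cn'); apply/eqP; rewrite -subr_eq0 -[X in _ == X]h; apply/eqP.
    by field.
  by apply/matrixP => i j; rewrite !mxE; case: ifP => _; exact: q.
rewrite c0 !rmorph0 !mul0r !addr0 in h1 h2; split=> //; exact: nz.
Qed.


(** A primitive of the squared modulus is then constant on the period, so the zeros
    of the modulus are dense. *)
Lemma L2norm_eq0 (v1 v2 : sfun R) : L2norm (sfunC2 v1 v2) = 0 -> v1 = 0 /\ v2 = 0.
Proof.
pose h (x : R) : R := \sum_j (ReC (sfunC2 v1 v2) j x ^+ 2 + ImC (sfunC2 v1 v2) j x ^+ 2).
have four : lift ord0 ord0 = 1 :> 'I_2 by apply: val_inj.
have hE : h = (fun x => (complex.Re (v1 x) ^+ 2 + complex.Im (v1 x) ^+ 2)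
    + (complex.Re (v2 x) ^+ 2 + complex.Im (v2 x) ^+ 2)).
  by apply: funext => x; rewrite /h !big_ord_recl big_ord0 addr0 four /ReC /ImC !mxE.
have sq (f : R -> R) : continuous f -> continuous (fun x => f x ^+ 2).
  by move=> cf x; apply: (@continuous_comp _ _ _ f (fun y => y ^+ 2));
    [exact: cf|exact: exprn_continuous].
have ch : continuous h.
  have [c1 c1'] := sfun_continuous v1; have [c2 c2'] := sfun_continuous v2.
  by rewrite hE => x; apply: cvgD; apply: cvgD; apply: sq.
have h0 x : 0 <= h x by apply: sumr_ge0 => j _; rewrite addr_ge0 ?sqr_ge0.
rewrite /L2norm -/h => /eqP; rewrite sqrtr_eq0 => int0.
have p0 := @tpi_gt0 R; have [H dH] := primitive0_ex ch.
have HE : H tpi <= H 0 by move: int0; rewrite (integral_FTC2 (ltW p0) ch dH) subr_le0.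
have incr (a b : R) : 0 <= a -> b <= tpi -> a <= b -> H a <= H b.
  move=> a0 b1 ab; have dH' t : a <= t <= b -> is_derive t 1 H (h t).
    by move=> /andP[at_ tb]; apply: dH; rewrite (le_trans a0 at_) (le_trans tb b1).
  have [t _ e'] := is_derive_MVT ab dH'.
  by rewrite -subr_ge0 e' mulr_ge0 // subr_ge0.
have zero (a b : R) : 0 <= a -> b <= tpi -> a < b -> exists2 t, a <= t <= b & h t = 0.
  move=> a0 b1 ab; have dH' t : a <= t <= b -> is_derive t 1 H (h t).
    by move=> /andP[at_ tb]; apply: dH; rewrite (le_trans a0 at_) (le_trans tb b1).
  have [t abt e'] := is_derive_MVT (ltW ab) dH'; exists t => //.
  have Hab : H b - H a = 0.
    have q1 := incr 0 a (lexx _) (le_trans (ltW ab) b1) a0.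
    have q2 := incr b tpi (le_trans a0 (ltW ab)) (lexx _) b1.
    have q3 := incr a b a0 b1 (ltW ab).
    by apply/eqP; rewrite subr_eq0 eq_le q3 (le_trans q2 (le_trans HE q1)).
  have ba : b - a != 0 by rewrite subr_eq0 gt_eqF.
  by move/eqP: e'; rewrite Hab eq_sym mulf_eq0 (negPf ba) orbF => /eqP.
have hz x : 0 <= x <= tpi -> h x = 0.
  move=> /andP[x0 x1]; apply: contrapT => /eqP hx.
  have := ch x => /cvgrPdist_lt/(_ _ (_ : 0 < `|h x|)); rewrite normr_gt0 => /(_ hx).
  move=> [r /= r0 near].
  have r2 : 0 < r / 2 by rewrite divr_gt0.
  have [|||t /andP[t0 t1] ht] := zero (Num.max 0 (x - r / 2)) (Num.min tpi (x + r / 2)).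
  - by rewrite le_max lexx.
  - by rewrite ge_min lexx.
  - have a1 : 0 < x + r / 2 by rewrite ltr_wpDl.
    have a2 : x - r / 2 < tpi by apply: lt_le_trans x1; rewrite gtrDl oppr_lt0.
    have a3 : x - r / 2 < x + r / 2 by rewrite ltrD2l gtrN.
    by rewrite lt_min !gt_max p0 a1 a2 a3.
  suff xt : `|x - t| < r by have := near t xt; rewrite /= ht subr0 ltxx.
  move: t0 t1; rewrite ge_max le_min => /andP[_ t0] /andP[_ t1].
  apply: (@le_lt_trans _ _ (r / 2)); last by rewrite ltr_pdivrMr // ltr_pMr // ltr1n.
  by rewrite ler_norml; move: (r / 2) t0 t1 => y t0 t1; apply/andP; split; lra.
have zz x : v1 x = 0 /\ v2 x = 0.
  have [t ht et] := periodic_reduce C x.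
  rewrite (et v1 (sfun_periodic v1)) (et v2 (sfun_periodic v2)).
  have := hz t ht; rewrite hE; case: (v1 t) (v2 t) => [a b] [a' b'] /= => /eqP.
  rewrite paddr_eq0 ?addr_ge0 ?sqr_ge0 // => /andP[].
  rewrite !paddr_eq0 ?sqr_ge0 // !sqrf_eq0.
  by move=> /andP[/eqP -> /eqP ->] /andP[/eqP -> /eqP ->].
by split; apply: sfun_inj => x; have [] := zz x.
Qed.

(** An eigenvector violates the bound of a resolvent on the right hand side [0]. *)
Lemma eigenvalue_in_spectrum (z : C) (v1 v2 : sfun R) : (v1 = 0 -> v2 <> 0) ->
  B1 v1 v2 = @scst R z * v1 -> B2 v1 v2 = @scst R z * v2 ->
  in_spectrum (bloch e w sg u) z.
Proof.
move=> nz b1 b2 [_ [c hc]].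
have BV := bloch_of_smooth u1E u2E b1 b2.
pose Z : @C2fun R := sfunC2 0 0.
have Z0 x : Z x = 0 by exact: (sfunC2_eq0 0 0).2.
have nZ : L2norm Z = 0.
  rewrite /L2norm (_ : (fun x => _) = fun=> 0); last first.
    apply: funext => x; rewrite big1 // => j _; rewrite /ReC /ImC Z0 mxE /=.
    by rewrite expr0n addr0.
  by rewrite /Rintegral integral0 sqrtr0.
have LZ : L2_perC2 Z.
  have E (f : C -> R) j : f 0 = 0 -> L2_per (fun x => f (Z x j 0)).
    move=> f0; apply: continuous_L2_per.
    rewrite (_ : (fun x => _) = fun=> 0); first by move=> x; exact: cst_continuous.
    by apply: funext => x; rewrite Z0 mxE.
  by move=> j; split; exact: E.
have := hc (sfunC2 v1 v2) Z LZ; rewrite nZ mulr0 => h.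
have le0 : L2norm (sfunC2 v1 v2) <= 0.
  by apply: h; move: BV; congr (bloch e w sg u _ _); apply: funext => x; rewrite Z0 addr0.
have [] := @L2norm_eq0 v1 v2; last by [].
by apply/eqP; rewrite eq_le le0 sqrtr_ge0.
Qed.

(** Conjugation turns [sg] into [- sg] and the reflection turns it back; the profile
    is real and even. *)
Lemma bloch_conj (z : C) (v1 v2 : sfun R) :
  (forall x, u (- x) = u x) ->
  B1 v1 v2 = @scst R z * v1 -> B2 v1 v2 = @scst R z * v2 ->
  let T f := sconj (sreflect f) in
  B1 (T v1) (T v2) = @scst R z^*%C * T v1 /\ B2 (T v1) (T v2) = @scst R z^*%C * T v2.
Proof.
move=> uev b1 b2 T; have eval := bloch_eval e w sg u1 u2.
have TE f x : T f x = (f (- x))^*%C by [].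
have T1 f : sder (T f) = - T (sder f).
  by rewrite /T sder_conj sder_reflect rmorphN.
have T2 f : sder (sder (T f)) = T (sder (sder f)).
  by rewrite T1 sderN T1 opprK.
have U1 x : u1 x = (u1 (- x))^*%C by rewrite !u1E uev; exact/esym/conjc_real.
have U2 x : u2 x = (u2 (- x))^*%C by rewrite !u2E uev; exact/esym/conjc_real.
have cr (y : R) : (y%:C)^*%C = y%:C :> C by exact: conjc_real.
have ci : ('i : C)^*%C = - 'i by rewrite -complexiE; apply: complexE_eq => /=; rewrite ?oppr0.
have cD (a b : C) : (a + b)^*%C = a^*%C + b^*%C by exact: (rmorphD (@conjc R)).
have cN (a : C) : (- a)^*%C = - a^*%C by exact: (rmorphN (@conjc R)).
have cM (a b : C) : (a * b)^*%C = a^*%C * b^*%C by exact: (rmorphM (@conjc R)).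
have cX (a : C) : (a ^+ 2)^*%C = a^*%C ^+ 2 by exact: (rmorphXn (@conjc R)).
have cn (n : nat) : (n%:R : C)^*%C = n%:R by exact: (rmorph_nat (@conjc R)).
split; apply: sfun_inj => x.
  have [h _] := eval (T v1) (T v2) x; apply: etrans h _.
  transitivity ((B1 v1 v2 (- x))^*%C); last by rewrite b1; exact: (rmorphM (@conjc R)).
  have [-> _] := eval v1 v2 (- x); rewrite T2 T1 sfunN !TE.
  rewrite [u1 x]U1 [u2 x]U2.
  by rewrite !(cr, ci, cn, cX, cN, cD, cM); ring.
have [_ h] := eval (T v1) (T v2) x; apply: etrans h _.
transitivity ((B2 v1 v2 (- x))^*%C); last by rewrite b2; exact: (rmorphM (@conjc R)).
have [_ ->] := eval v1 v2 (- x); rewrite T2 T1 sfunN !TE.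
rewrite [u1 x]U1 [u2 x]U2.
by rewrite !(cr, ci, cn, cX, cN, cD, cM); ring.
Qed.

(** The conjugate is an eigenvalue by [bloch_conj], and its real part keeps it out of
    the far part of the spectrum. *)
Lemma small_eigenvalue_conj (d : R) (l1 l2 z : C) (v1 v2 : sfun R) :
  (forall x, u (- x) = u x) -> spectral_pair (bloch e w sg u) d l1 l2 ->
  (v1 = 0 -> v2 <> 0) ->
  B1 v1 v2 = @scst R z * v1 -> B2 v1 v2 = @scst R z * v2 -> - d <= complex.Re z ->
  z^*%C = l1 \/ z^*%C = l2.
Proof.
move=> uev [spec _] nz b1 b2 dz; have [c1 c2] := bloch_conj uev b1 b2.
have Tz f : sconj (sreflect f) = 0 :> sfun R -> f = 0.
  move=> h; apply: sfun_inj => x; have := congr1 (fun g : sfun R => g (- x)) h.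
  move=> /= ; rewrite opprK => h'; apply: (can_inj (@conjcK R)).
  by apply: etrans h' _; exact/esym/(rmorph0 (@conjc R)).
have spz : in_spectrum (bloch e w sg u) z^*%C.
  by apply: eigenvalue_in_spectrum c1 c2 => /Tz v10 /Tz v20; exact: nz.
have [h|h|h] := spec _ spz; [by left|by right|].
by move: h dz; case: (z) => a b /=; rewrite ltNge => /negP.
Qed.


Lemma small_eigenvector (d : R) (l1 l2 z : C) :
  spectral_pair (bloch e w sg u) d l1 l2 -> z \in [:: l1; l2] ->
  exists v1 v2 : sfun R, [/\ v1 = 0 -> v2 <> 0,
    B1 v1 v2 = @scst R z * v1 & B2 v1 v2 = @scst R z * v2].
Proof.
move=> [_ mult] zl; have := mult z zl; move: zl; rewrite -has_pred1 has_count.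
case: (count_mem z _) => // n _ /alg_mult_nonzero[V nz kV].
by have [v1 [v2 [_ ? ? ?]]] := bloch_eigenvector nz kV; exists v1, v2.
Qed.

End BlochSpectrum.

(** * The two small eigenvalues *)

Section Conclusion.
Context {R : realType}.
Local Notation C := R[i].
Local Notation P := (sfun_calculus R).
Variables (e0 : R) (ut : R -> R -> R -> 'cV[R]_2) (w d : R) (lam1 lam2 : R -> R -> C).
Hypothesis hut : profile_family e0 ut.
Hypothesis hw : - 4^-1 < w < 4^-1.
Hypothesis hlam : small_eigenvalues e0 ut w d lam1 lam2.
Local Notation l1 e s := (lam1 e (2 * e * s)).
Local Notation l2 e s := (lam2 e (2 * e * s)).

Definition near_gl (K e : R) (l : C) (g : R) := cabs (l - (e ^+ 2 * g)%:C) <= K * e ^+ 3.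

(** All smallness conditions hold at once for [e] small, uniformly in [s] in a
    bounded set. *)
Lemma small_data : exists2 K : R, 0 <= K & forall S0 eta : R, 0 <= S0 -> 0 < eta ->
  exists2 e1 : R, 0 < e1 & forall e s, 0 < e < e1 -> `|s| <= S0 ->
  [/\ e < eta /\ e <= 1, cabs (l1 e s) < eta /\ cabs (l2 e s) < eta,
      spectral_pair (bloch e w (2 * e * s) (ut e w)) d (l1 e s) (l2 e s),
      forall x, ut e w (- x) = ut e w x &
      exists W : wave (P := P) w K, [/\ wave_e W = e, wave_k W = detune e w,
        (forall x, (wave_1 W : sfun R) x = (ut e w x 0 0)%:C) &
        (forall x, (wave_2 W : sfun R) x = (ut e w x 1 0)%:C)]].
Proof.
have [K [dK [K0 dK0 hW]]] := profile_wave hut hw.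
have [[rs rs0 hspec] hsmall] := hlam; have e00 := profile_e0 hut.
exists K => // S0 eta S00 eta0; have [rt rt0 ht] := hsmall eta eta0.
have q0 : 0 < 2 * S0 + 1 by rewrite ltr_wpDl ?mulr_ge0.
pose r := Num.min rs rt; have r0 : 0 < r by rewrite lt_min rs0.
exists (Num.min (Num.min dK e0) (Num.min (Num.min eta 1) (r / (2 * S0 + 1)))).
  by rewrite !lt_min dK0 e00 eta0 ltr01 divr_gt0.
move=> e s /andP[ep]; rewrite !lt_min => /and3P[/andP[edK ee0] /andP[eeta e1] er] sS.
have eS : e * (2 * S0 + 1) < r by rewrite -ltr_pdivlMr.
have sr : `|2 * e * s| < r.
  apply: le_lt_trans eS; rewrite normrM ger0_norm ?mulr_ge0 ?(ltW ep) //.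
  have -> : 2 * e * `|s| = e * (2 * `|s|) by ring.
  rewrite ler_wpM2l ?(ltW ep) //; apply: (@le_trans _ _ (2 * S0)); last by rewrite lerDl.
  by rewrite ler_wpM2l.
have er' : e < r.
  by apply: le_lt_trans eS; rewrite ler_peMr ?(ltW ep) // lerDr mulr_ge0.
move: sr er'; rewrite !lt_min => /andP[srs srt] /andP[ers ert].
have e0e : 0 <= e < e0 by rewrite ltW.
have ee : 0 < e < e0 by rewrite ep.
have ws : `|w| < 4^-1 by rewrite ltr_norml.
split.
- by split=> //; exact: ltW.
- by have [] := ht e (2 * e * s) e0e ert srt; rewrite !cabsE !ltcR.
- exact: hspec.
- by have [] := profile_even_positive hut ee ws.
- exact: hW.
Qed.

Lemma small_near_gl (S0 : R) : 0 <= S0 -> exists K : R, 0 <= K /\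
  exists2 e1 : R, 0 < e1 & forall e s, 0 < e < e1 -> `|s| <= S0 ->
  near_gl K e (l1 e s) (gl1 w s) /\ near_gl K e (l2 e s) (gl2 w s) \/
  near_gl K e (l1 e s) (gl2 w s) /\ near_gl K e (l2 e s) (gl1 w s).
Proof.
move=> S00; have [K K0 data] := small_data.
have [L [c [L0 c0 hL]]] := @pair_near_gl R P w K hw K0 S0 S00.
have c30 : 0 < c / 3 by rewrite divr_gt0.
have [e1 e10 he] := data S0 (c / 3) S00 c30.
exists L; split=> //; exists e1 => // e s es ss.
have [[ec e1'] [lc1 lc2] spec _ [W [We Wk W1 W2]]] := he e s es ss.
have kn0 : wavenumber e w != 0.
  by rewrite gt_eqF // wavenumber_gt0 // e1'; have /andP[/ltW -> _] := es.
have [v1 [v2 [x1 [x2 [m [hv hx ind]]]]]] := spectral_pair_vectors W1 W2 kn0 spec.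
subst e; rewrite -Wk in hv hx.
apply: (hL (@FloquetPair R P w K S0 W s v1 v2 x1 x2 _ _ m ss hv hx ind)) => /=.
by move: (cabs _) (cabs _) lc1 lc2 ec => a b; lra.
Qed.

Lemma near_gl_scaled (K e : R) (l : C) (g : R) : 0 < e -> near_gl K e l g ->
  cabs (l / (e ^+ 2)%:C - g%:C) <= K * e.
Proof.
move=> e0' h; have e2 : 0 < e ^+ 2 by rewrite exprn_gt0.
have eC : (e ^+ 2)%:C != 0 :> C by rewrite (inj_eq (@complexI R) _ 0) gt_eqF.
rewrite -(ler_pM2l e2) -{1}(ger0_norm (ltW e2)) -cabsr -cabsM mulrBr mulrCA divff // mulr1.
rewrite -ofrealM; apply: le_trans h _.
by rewrite le_eqVlt; apply/orP; left; apply/eqP; ring.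
Qed.

Lemma small_expansion2 (K0 : R) : 0 <= K0 -> exists L : R, 0 <= L /\
  exists2 r1 : R, 0 < r1 & forall e s, 0 < e < r1 -> `|s| < r1 ->
  forall l, l \in [:: l1 e s; l2 e s] -> near_gl K0 e l (gl2 w s) ->
  cabs (l - (e ^+ 2 * expansion2 w s)%:C)
    <= L * (e ^+ 2 * (`|s| ^+ 3 + e * s ^+ 2)).
Proof.
move=> K00; have [K K0' data] := small_data.
have [L [c [L0 c0 hL]]] := @sharp_expansion R P w K hw K0' K0 K00.
have c30 : 0 < c / 3 by rewrite divr_gt0.
have [e1 e10 he] := data 1 (c / 3) ler01 c30.
exists L; split=> //; exists (Num.min (Num.min 1 (c / 3)) e1).
  by rewrite !lt_min ltr01 c30.
move=> e s /andP[ep]; rewrite !lt_min => /andP[_ ee1] /andP[/andP[s1 sc] _] l hl near.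
have es : 0 < e < e1 by rewrite ep.
have [[ec e1'] [lc1 lc2] spec _ [W [We Wk W1 W2]]] := he e s es (ltW s1).
have kn0 : wavenumber e w != 0 by rewrite gt_eqF // wavenumber_gt0 // e1' ltW.
have [v1 [v2 [nz b1 b2]]] := small_eigenvector W1 W2 kn0 spec hl.
have lc : cabs l < c / 3 by move: hl; rewrite !inE => /orP[/eqP ->|/eqP ->].
subst e; rewrite -Wk in b1 b2.
apply: (hL (@FloquetMode R P w K K0 W s v1 v2 l (conj b1 b2) nz near)) => /=.
by move: (cabs l) (`|s|) lc sc ec => a b; lra.
Qed.

(** The conjugate of each eigenvalue is one of the two, and it cannot be the other
    one, since they are close to real numbers that are apart. *)
Lemma small_real (S0 : R) : 0 < d -> 0 <= S0 -> exists2 e1 : R, 0 < e1 &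
  forall e s, 0 < e < e1 -> `|s| <= S0 ->
  complex.Im (l1 e s) = 0 /\ complex.Im (l2 e s) = 0.
Proof.
move=> d0 S00; have [K K0 data] := small_data.
have [L [L0 [e2 e20 hL]]] := small_near_gl S00.
have [e1 e10 he] := data S0 d S00 d0.
have a0' := gl_amp2_gt0 hw.
have L1 : 0 < 2 * L + 1 by rewrite ltr_wpDl ?mulr_ge0.
have g0 : 0 < 4 / 3 * gl_amp2 w by rewrite !mulr_gt0.
exists (Num.min (Num.min e1 e2) (4 / 3 * gl_amp2 w / (2 * L + 1))).
  by rewrite !lt_min e10 e20 divr_gt0.
move=> e s /andP[ep]; rewrite !lt_min => /andP[/andP[ee1 ee2] eg] sS.
have es1 : 0 < e < e1 by rewrite ep.
have es2 : 0 < e < e2 by rewrite ep.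
have [[ec e1'] [lc1 lc2] spec uev [W [We Wk W1 W2]]] := he e s es1 sS.
have kn0 : wavenumber e w != 0 by rewrite gt_eqF // wavenumber_gt0 // e1' ltW.
have fixed (z : C) : z^*%C = z -> complex.Im z = 0.
  case: z => a b [] h; have h2 : 2 * b = 0 by rewrite mulr2n mulrDl !mul1r -{1}h addNr.
  by move/eqP: h2; rewrite mulf_eq0 pnatr_eq0 => /eqP.
have apart (z z' : C) g g' : near_gl L e z g -> near_gl L e z' g' ->
    4 / 3 * gl_amp2 w <= `|g - g'| -> z^*%C <> z'.
  move=> hz hz' gap zz'.
  have hc : near_gl L e z^*%C g.
    have cjB (y : R) : z^*%C - y%:C = (z - y%:C)^* :> C.
      by case: (z) => p q; apply: complexE_eq => /=; ring.
    by rewrite /near_gl cjB cabsJ.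
  rewrite zz' in hc.
  have e2' : 0 < e ^+ 2 by rewrite exprn_gt0.
  have := cabsB (z' - (e ^+ 2 * g')%:C) (z' - (e ^+ 2 * g)%:C).
  have -> : z' - (e ^+ 2 * g')%:C - (z' - (e ^+ 2 * g)%:C) = (e ^+ 2 * (g - g'))%:C.
    by rewrite !ofrealE; ring.
  rewrite cabsr normrM (ger0_norm (ltW e2')) => h.
  have : e ^+ 2 * (4 / 3 * gl_amp2 w) <= e ^+ 2 * (2 * L * e).
    apply: le_trans (le_trans (ler_wpM2l (ltW e2') gap) h) _.
    apply: le_trans (lerD hz' hc) _.
    by rewrite le_eqVlt; apply/orP; left; apply/eqP; ring.
  rewrite ler_pM2l // leNgt => /negP; apply.
  move: eg; rewrite ltr_pdivlMr // mulrC; apply: le_lt_trans.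
  by apply: ler_wpM2r; [exact: ltW|rewrite lerDl].
have gap := gl_gap hw s.
have gap1 : 4 / 3 * gl_amp2 w <= `|gl2 w s - gl1 w s| by apply: le_trans gap (ler_norm _).
have gap2 : 4 / 3 * gl_amp2 w <= `|gl1 w s - gl2 w s| by rewrite distrC.
have cj z : z \in [:: l1 e s; l2 e s] -> cabs z < d ->
    z^*%C = l1 e s \/ z^*%C = l2 e s.
  move=> hz zd; have [v1 [v2 [nz b1 b2]]] := small_eigenvector W1 W2 kn0 spec hz.
  apply: (small_eigenvalue_conj W1 W2 uev spec nz b1 b2).
  have := le_trans (cabs_Re z) (ltW zd).
  by rewrite ler_norml => /andP[].
have c1 := cj _ (mem_head _ _) lc1.
have c2 : (l2 e s)^*%C = l1 e s \/ (l2 e s)^*%C = l2 e s.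
  by apply: cj lc2; rewrite !inE eqxx orbT.
have [n1 n2] : ((l1 e s)^*%C <> l2 e s) /\ ((l2 e s)^*%C <> l1 e s).
  by have [[p q]|[p q]] := hL e s es2 sS; split;
    [exact: apart p q gap2|exact: apart q p gap1|exact: apart p q gap1|exact: apart q p gap2].
by split; apply: fixed; [case: c1|case: c2].
Qed.

End Conclusion.

Theorem theorem1p5 (R : realType)
    (e0 : R) (ut : R -> R -> R -> 'cV[R]_2) (hut : profile_family e0 ut)
    (w : R) (hw : - 4^-1 < w < 4^-1)
    (d : R) (hd : 0 < d)
    (lam1 lam2 : R -> R -> R[i])
    (hlam : small_eigenvalues e0 ut w d lam1 lam2) :
  [/\
    exists hlam1 hlam2 : R -> R -> R[i], exists C e1 r1 : R,
      [/\ 0 < e1, 0 < r1 &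
        forall e s : R, 0 < e < e1 -> `|s| < r1 ->
          [/\ perm_eq [:: lam1 e (2 * e * s); lam2 e (2 * e * s)]
                      [:: (e ^+ 2)%:C * hlam1 e s; (e ^+ 2)%:C * hlam2 e s],
              `|hlam1 e s - (expansion1 w s)%:C|
                <= (C * (`|s| ^+ 3 + e * (1 + `|s|)))%:C &
              `|hlam2 e s - (expansion2 w s)%:C|
                <= (C * (`|s| ^+ 3 + e * s ^+ 2))%:C]],
    exists hGL1 hGL2 : R -> R[i],
      (forall s : R,
         char_poly (GLmx w s) = ('X - (hGL1 s)%:P) * ('X - (hGL2 s)%:P)) /\
      exists C r1 : R, 0 < r1 /\
        forall s : R, `|s| < r1 ->
          `|hGL1 s - (expansion1 w s)%:C| <= (C * `|s| ^+ 3)%:C /\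
          `|hGL2 s - (expansion2 w s)%:C| <= (C * `|s| ^+ 3)%:C
  & forall C : R, 0 < C ->
      exists2 e1 : R, 0 < e1 &
        forall e s : R, 0 < e < e1 -> `|s| <= C ->
          complex.Im (lam1 e (2 * e * s)) = 0 /\
          complex.Im (lam2 e (2 * e * s)) = 0].
Proof.
have near12 := small_near_gl hut hw hlam ler01.
have [K [K0 [e1 e10 alt]]] := near12.
have [L [L0 [r1 r10 sharp]]] := small_expansion2 hut hw hlam K0.
have [G G0 hG] := gl_expansion hw.
split.
- pose is12 e s := `[< near_gl K e (lam1 e (2 * e * s)) (gl1 w s) /\
    near_gl K e (lam2 e (2 * e * s)) (gl2 w s) >].
  pose h1 e s := (if is12 e s then lam1 e (2 * e * s) else lam2 e (2 * e * s)) / (e ^+ 2)%:C.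
  pose h2 e s := (if is12 e s then lam2 e (2 * e * s) else lam1 e (2 * e * s)) / (e ^+ 2)%:C.
  exists h1, h2, (K + G + L), (Num.min e1 r1), (Num.min 1 r1).
  split; rewrite ?lt_min ?e10 ?ltr01 // => e s /andP[ep].
  rewrite !lt_min => /andP[ee1 er1] /andP[s1 sr1].
  have e2C : (e ^+ 2)%:C != 0 :> R[i].
    by rewrite (inj_eq (@complexI R) _ 0) gt_eqF ?exprn_gt0.
  have es : 0 < e < e1 by rewrite ep.
  have er : 0 < e < r1 by rewrite ep.
  have [G1 G2 _] := hG s (ltW s1).
  have [n1 n2] : near_gl K e ((e ^+ 2)%:C * h1 e s) (gl1 w s) /\
      near_gl K e ((e ^+ 2)%:C * h2 e s) (gl2 w s).
    rewrite /h1 /h2 !(mulrC (e ^+ 2)%:C) !divfK //; rewrite /is12; case: asboolP => // no.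
    by have [|[]] := alt e s es (ltW s1).
  have pe : perm_eq [:: lam1 e (2 * e * s); lam2 e (2 * e * s)]
      [:: (e ^+ 2)%:C * h1 e s; (e ^+ 2)%:C * h2 e s].
    rewrite /h1 /h2 !(mulrC (e ^+ 2)%:C) !divfK //; case: ifP => // _.
    by rewrite -cat1s perm_catC.
  have cancel h : (e ^+ 2)%:C * h / (e ^+ 2)%:C = h :> R[i].
    by rewrite mulrC mulKf.
  have e0' : 0 <= e := ltW ep.
  have q3 : 0 <= `|s| ^+ 3 by rewrite exprn_ge0.
  have q2 : 0 <= s ^+ 2 := sqr_ge0 s.
  have es0 : 0 <= e * `|s| by rewrite mulr_ge0.
  have es2 : 0 <= e * s ^+ 2 by rewrite mulr_ge0.
  split=> //; rewrite cabsE lecR.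
    have := near_gl_scaled ep n1; rewrite cancel => nh.
    have -> : h1 e s - (expansion1 w s)%:C
        = (h1 e s - (gl1 w s)%:C) + (gl1 w s - expansion1 w s)%:C.
      by rewrite !ofrealE; ring.
    apply: le_trans (cabsD _ _) _; rewrite cabsr.
    apply: le_trans (lerD nh G1) _.
    have -> : (K + G + L) * (`|s| ^+ 3 + e * (1 + `|s|)) = K * e + G * `|s| ^+ 3
       + (K * `|s| ^+ 3 + K * (e * `|s|) + G * e + G * (e * `|s|)
          + L * (`|s| ^+ 3 + (e + e * `|s|))) by ring.
    by rewrite lerDl !(addr_ge0, mulr_ge0).
  have hm : (e ^+ 2)%:C * h2 e s \in [:: lam1 e (2 * e * s); lam2 e (2 * e * s)].
    by rewrite (perm_mem pe) !inE eqxx orbT.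
  have := sharp e s er sr1 _ hm n2.
  have -> : (e ^+ 2)%:C * h2 e s - (e ^+ 2 * expansion2 w s)%:C
      = (e ^+ 2)%:C * (h2 e s - (expansion2 w s)%:C).
    by rewrite (ofrealM (e ^+ 2)) mulrBr.
  have ee : 0 < e ^+ 2 by rewrite exprn_gt0.
  rewrite cabsM cabsr (ger0_norm (ltW ee)) mulrCA ler_pM2l // => hs.
  by apply: le_trans hs _; rewrite ler_wpM2r ?addr_ge0 // lerDr addr_ge0.
- exists (fun s => (gl1 w s)%:C), (fun s => (gl2 w s)%:C); split.
    by move=> s; exact: char_poly_GLmx.
  exists G, 1; split=> // s s1; have [G1 G2 _] := hG s (ltW s1).
  by rewrite !cabsE !lecR -!ofrealN -!ofrealD !cabsr.
by move=> S0 S00; exact: (small_real hut hw hlam hd (ltW S00)).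
Qed.
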